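(* Let $0<p\le\infty$, $0<\alpha<\infty$, and let $(\varphi_t)$ be a semigroup of analytic functions with Denjoy–Wolff point $b\in\mathbb{T}$ and infinitesimal generator $G$. Let $E=\{h\in H(p,\infty,\alpha):Gh'\in H(p,\infty,\alpha)\}$. Then the closure $\overline{E}$ of $E$ in $H(p,\infty,\alpha)$ (which equals $[\varphi_t,H(p,\infty,\alpha)]$) contains a closed subspace isomorphic to $\ell_\infty$. Consequently, $[\varphi_t,H(p,\infty,\alpha)]\supsetneq H(p,0,\alpha)$.
   Context: $\mathbb{T}$ is the unit circle, $\mathbb{D}$ the unit disk. A semigroup of analytic functions is a family $\{\varphi_t:t\ge0\}$ of analytic self-maps of $\mathbb{D}$ with $\varphi_0=\mathrm{id}$, $\varphi_{t+s}=\varphi_t\circ\varphi_s$, and $\varphi_t\to\varphi_0$ uniformly on compact sets as $t\to0^+$. Its infinitesimal generator is $G(z)=\lim_{t\to0^+}(\varphi_t(z)-z)/t$, of the form $G(z)=(\bar bz-1)(z-b)P(z)$ with $P$ analytic, $\mathrm{Re}\,P\ge0$, where $b\in\overline{\mathbb{D}}$ is the common Denjoy–Wolff point. $M_p(r,f)=\left(\int_0^{2\pi}|f(re^{i\theta})|^p\frac{d\theta}{2\pi}\right)^{1/p}$ ($p<\infty$), $M_\infty(r,f)=\max_\theta|f(re^{i\theta})|$; $H(p,\infty,\alpha)$: analytic $f$ with norm $\sup_{0\le r<1}(1-r)^\alpha M_p(r,f)<\infty$; $H(p,0,\alpha)$: its subspace where $(1-r)^\alpha M_p(r,f)\to0$.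 $[\varphi_t,X]=\{f\in X:\|f\circ\varphi_t-f\|_X\to0\text{ as }t\to0^+\}$. *)

(* Defs.v *)
From Stdlib Require Import Reals.
From Coquelicot Require Import Coquelicot.
Open Scope R_scope.

Definition inD (z : C) : Prop := Cmod z < 1.

Definition analytic_on_D (f : C -> C) : Prop :=
  forall z, inD z -> @ex_derive C_AbsRing C_NormedModule f z.

(* x^q for x >= 0, q > 0, with the convention 0^q = 0 *)
Definition powp (x q : R) : R := if Req_EM_T x 0 then 0 else Rpower x q.

Definition polar (r theta : R) : C := (r * cos theta, r * sin theta).

Definition Mp (p : Rbar) (r : R) (f : C -> C) : R :=
  match p with
  | Finite q =>
      powp (RInt (fun th => powp (Cmod (f (polar r th))) q) 0 (2 * PI) / (2 * PI))
           (/ q)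
  | _ => real (Lub_Rbar (fun y => exists th, y = Cmod (f (polar r th))))
  end.

Definition wMp (p : Rbar) (alpha r : R) (f : C -> C) : R :=
  Rpower (1 - r) alpha * Mp p r f.

Definition Hnorm (p : Rbar) (alpha : R) (f : C -> C) : Rbar :=
  Lub_Rbar (fun y => exists r, 0 <= r < 1 /\ y = wMp p alpha r f).

Definition in_Hinf (p : Rbar) (alpha : R) (f : C -> C) : Prop :=
  analytic_on_D f /\ is_finite (Hnorm p alpha f).

Definition in_H0 (p : Rbar) (alpha : R) (f : C -> C) : Prop :=
  in_Hinf p alpha f /\
  filterlim (fun r => wMp p alpha r f) (at_left 1) (locally 0).

Definition fsub (f g : C -> C) : C -> C := fun z => (f z - g z)%C.

Definition Hclosure (p : Rbar) (alpha : R) (S : (C -> C) -> Prop) (f : C -> C) : Prop :=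
  in_Hinf p alpha f /\
  forall eps, 0 < eps -> exists h, S h /\ Rbar_lt (Hnorm p alpha (fsub f h)) eps.

Definition is_semigroup (phi : R -> C -> C) : Prop :=
  (forall t, 0 <= t -> analytic_on_D (phi t) /\ forall z, inD z -> inD (phi t z)) /\
  (forall z, inD z -> phi 0 z = z) /\
  (forall t s z, 0 <= t -> 0 <= s -> inD z -> phi (t + s) z = phi t (phi s z)) /\
  (* phi_t -> id uniformly on compact subsets of D as t -> 0+
     (every compact subset of D lies in a closed disk |z| <= r, r < 1) *)
  (forall r eps, 0 <= r < 1 -> 0 < eps -> exists delta, 0 < delta /\
     forall t z, 0 < t < delta -> Cmod z <= r -> Cmod (phi t z - z)%C < eps).

Definition is_generator (phi : R -> C -> C) (G : C -> C) : Prop :=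
  forall z, inD z ->
    filterlim (fun t => ((phi t z - z) / RtoC t)%C) (at_right 0) (locally (G z)).

Definition boundary_DW_point (phi : R -> C -> C) (b : C) : Prop :=
  Cmod b = 1 /\
  forall z, inD z -> filterlim (fun t => phi t z) (Rbar_locally p_infty) (locally b).

Definition setE (p : Rbar) (alpha : R) (G : C -> C) (h : C -> C) : Prop :=
  in_Hinf p alpha h /\
  exists dh : C -> C,
    (forall z, inD z -> @is_derive C_AbsRing C_NormedModule h z (dh z)) /\
    in_Hinf p alpha (fun z => (G z * dh z)%C).

Definition strong_cont (p : Rbar) (alpha : R) (phi : R -> C -> C) (f : C -> C) : Prop :=
  in_Hinf p alpha f /\
  forall eps, 0 < eps -> exists delta, 0 < delta /\
    forall t, 0 < t < delta ->
      Rbar_lt (Hnorm p alpha (fsub (fun z => f (phi t z)) f)) eps.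

Definition bounded_seq (x : nat -> C) : Prop := exists M, forall n, Cmod (x n) <= M.
Definition supnorm (x : nat -> C) : R :=
  real (Lub_Rbar (fun y => exists n, y = Cmod (x n))).

(* S contains a closed subspace isomorphic to l_infty: there is a linear map
   T : l_infty -> H(p,infty,alpha) with values in S, which is an isomorphism
   onto its image (two-sided norm estimates), and whose image is closed. *)
Definition contains_linf_copy (p : Rbar) (alpha : R) (S : (C -> C) -> Prop) : Prop :=
  exists (T : (nat -> C) -> C -> C) (c1 c2 : R), 0 < c1 /\ 0 < c2 /\
    (forall x y (a : C), bounded_seq x -> bounded_seq y ->
       forall z, inD z -> T (fun n => a * x n + y n)%C z = (a * T x z + T y z)%C) /\
    (forall x, bounded_seq x -> S (T x)) /\
    (forall x, bounded_seq x ->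
       Rbar_le (c1 * supnorm x) (Hnorm p alpha (T x)) /\
       Rbar_le (Hnorm p alpha (T x)) (c2 * supnorm x)) /\
    (forall g, in_Hinf p alpha g ->
       (forall eps, 0 < eps -> exists x, bounded_seq x /\
          Rbar_lt (Hnorm p alpha (fsub g (T x))) eps) ->
       exists x, bounded_seq x /\ forall z, inD z -> g z = T x z).

(* Main.v *)
Require Import Defs.
From Stdlib Require Import Reals Lra Lia Psatz Arith ZArith Classical ClassicalEpsilon FunctionalExtensionality.
From Coquelicot Require Import Coquelicot.
Open Scope R_scope.

(** All four claims are reduced to one description of the strongly continuous functions. Write D f(z) = (1-|z|)|f'(z)|, and call z bad at scale t when t |G(z)| is not small against 1-|z|. Then f is strongly continuous iff the H(p,infty,alpha) size of D f restricted to the points bad at scale t tends to 0 with t, iff f lies in the closure of E.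

At a point that is not bad at scale s, f o phi_s - f is O(s/t) times a nearby value of f. The bad set is almost invariant under the flow and D (f o phi_s) <= 2 (D f) o phi_s by Schwarz-Pick, so the bad part of D f controls f o phi_s - f. Conversely, at a bad point z, moving for the time k(1-|z|)/|G(z)| and using that G intertwines the flow, k D f(z) is bounded by increments f o phi_s - f at a whole grid of times s up to an error O(k^2); averaging over the grid makes this usable for every p > 0. For h_t = (1/t) int_0^t f o phi_s ds one has G h_t' = (f o phi_t - f)/t, hence h_t is in E, and h_t -> f.

To treat all 0 < p <= infty at once, p-th means are replaced by domination on the shells 1-|z| ~ h by real parts of analytic functions with positive real part: such majorants are stable under composition with self-maps (Harnack at the origin), under passing to nearby points, under quasi-sums and under averages, and the class they define is exactly H(p,infty,alpha).

The generator satisfies |G(z)|(1-|z|) <= C |b-z|^2 (Berkson-Porta form, obtained from Julia's lemma), so on the set bad at scale t the ratio (1-|z|)/|b-z| is O(sqrt t). Lacunary sums of the kernels h_n^(M-beta) (1 - (1-h_n) conj(b) z)^(-M), beta = alpha + 1/p, are bounded by |b-z|^(-beta), which has finite norm, and their D f is smaller by the factor (1-|z|)/|b-z|; evaluating at (1-h_n) b recovers the coefficients. *)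

(** * Complex derivatives *)

(** The obstacle is that 0 < p < 1 is allowed: without an integral Minkowski inequality neither a
    time average nor a supremum over times can be estimated by integrating norms. Estimates are
    therefore pointwise with a witness. A supremum over a disk, a segment or a time interval is
    replaced by one point at which at least half of it is attained, and Harnack's inequality lets
    the majorants absorb the unknown position of that point. When a time depends on z it may only
    range over a finite grid, which is why times get rounded. Passing from f to D f makes everything
    local at the scale 1-|z|; D f controls f again because alpha > 0 makes radial telescoping sums
    geometric. The bad set is, roughly, where the flow moves a point by a definite hyperbolic
    distance within time t; Schwarz-Pick makes this stable along orbits. The bounds on G are
    inequalities for difference quotients of the flow, written in the half-plane that has b at
    infinity. There Julia's lemma gives a nonnegative real part, and the inequalities pass to the
    pointwise limit. *)

Definition cderiv (f : C -> C) (z l : C) : Prop :=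
  forall eps, 0 < eps -> exists d, 0 < d /\
    forall w, Cmod (w - z)%C < d ->
      Cmod (f w - f z - l * (w - z))%C <= eps * Cmod (w - z)%C.

Lemma is_derive_cderiv (f : C -> C) (z l : C) :
  @is_derive C_AbsRing C_NormedModule f z l <-> cderiv f z l.
Proof.
  split.
  - intros [_ H] eps He.
    specialize (H z (fun P HP => HP) (mkposreal eps He)).
    destruct H as [d Hd]. exists d. split; [apply cond_pos|].
    intros w Hw. specialize (Hd w Hw).
    change (Cmod (f w - f z - (w - z) * l)%C <= eps * Cmod (w - z)%C) in Hd.
    rewrite (Cmult_comm l). exact Hd.
  - intros H. split.
    + apply is_linear_scal_l.
    + intros x Hx.
      apply (@is_filter_lim_locally_unique _ (AbsRing_NormedModule C_AbsRing)) in Hx.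
      subst x. intros eps. destruct (H eps (cond_pos eps)) as [d [Hd0 Hd]].
      exists (mkposreal d Hd0). intros w Hw.
      change (Cmod (f w - f z - (w - z) * l)%C <= eps * Cmod (w - z)%C).
      rewrite (Cmult_comm _ l). apply Hd. exact Hw.
Qed.

Lemma Cmod_minus_sym (a b : C) : Cmod (a - b)%C = Cmod (b - a)%C.
Proof. rewrite <- Cmod_opp. f_equal. ring. Qed.

Lemma Cmod_tri_sub (a b c : C) : Cmod (a - c)%C <= Cmod (a - b)%C + Cmod (b - c)%C.
Proof. replace (a - c)%C with ((a - b) + (b - c))%C by ring. apply Cmod_triangle. Qed.

Lemma Cmod_sub_le (a b : C) : Cmod (a - b)%C <= Cmod a + Cmod b.
Proof.
  unfold Cminus. rewrite <- (Cmod_opp b). apply Cmod_triangle.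
Qed.

Lemma Cmod_rev_tri (a b : C) : Cmod a - Cmod b <= Cmod (a - b)%C.
Proof.
  assert (H := Cmod_triangle (a - b)%C b).
  replace (a - b + b)%C with a in H by ring. lra.
Qed.

Lemma Cmod_le_plus (a b : C) : Cmod a <= Cmod b + Cmod (a - b)%C.
Proof. assert (H := Cmod_rev_tri a b). lra. Qed.

Lemma cderiv_local (f g : C -> C) (z l : C) (r : R) : 0 < r ->
  (forall w, Cmod (w - z)%C < r -> f w = g w) -> cderiv f z l -> cderiv g z l.
Proof.
  intros Hr He H eps Heps. destruct (H eps Heps) as [d [Hd0 Hd]].
  exists (Rmin d r). split; [apply Rmin_glb_lt; assumption|].
  intros w Hw. rewrite <- (He w), <- (He z).
  - apply Hd. eapply Rlt_le_trans; [exact Hw|apply Rmin_l].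
  - replace (z - z)%C with (RtoC 0) by (ring). rewrite Cmod_0. exact Hr.
  - eapply Rlt_le_trans; [exact Hw|apply Rmin_r].
Qed.

Lemma cderiv_ext (f g : C -> C) (z l : C) :
  (forall w, f w = g w) -> cderiv f z l -> cderiv g z l.
Proof. intros H. apply (cderiv_local f g z l 1); auto; lra. Qed.

Lemma cderiv_const (c z : C) : cderiv (fun _ => c) z 0.
Proof.
  intros eps He. exists 1. split; [lra|]. intros w _.
  replace (c - c - 0 * (w - z))%C with (RtoC 0) by (ring).
  rewrite Cmod_0. apply Rmult_le_pos; [lra|apply Cmod_ge_0].
Qed.

Lemma cderiv_id (z : C) : cderiv (fun w => w) z 1.
Proof.
  intros eps He. exists 1. split; [lra|]. intros w _.
  replace (w - z - 1 * (w - z))%C with (RtoC 0) by (ring).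
  rewrite Cmod_0. apply Rmult_le_pos; [lra|apply Cmod_ge_0].
Qed.

Lemma cderiv_plus (f g : C -> C) (z a b : C) :
  cderiv f z a -> cderiv g z b -> cderiv (fun w => f w + g w)%C z (a + b)%C.
Proof.
  intros Hf Hg eps He.
  destruct (Hf (eps / 2)) as [d1 [D1 H1]]; [lra|].
  destruct (Hg (eps / 2)) as [d2 [D2 H2]]; [lra|].
  exists (Rmin d1 d2). split; [apply Rmin_glb_lt; assumption|]. intros w Hw.
  assert (A1 := H1 w (Rlt_le_trans _ _ _ Hw (Rmin_l _ _))).
  assert (A2 := H2 w (Rlt_le_trans _ _ _ Hw (Rmin_r _ _))).
  replace (f w + g w - (f z + g z) - (a + b) * (w - z))%C
    with ((f w - f z - a * (w - z)) + (g w - g z - b * (w - z)))%C by ring.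
  eapply Rle_trans; [apply Cmod_triangle|]. lra.
Qed.

Lemma cderiv_lip (f : C -> C) (z l : C) : cderiv f z l ->
  exists d, 0 < d /\ forall w, Cmod (w - z)%C < d ->
    Cmod (f w - f z)%C <= (Cmod l + 1) * Cmod (w - z)%C.
Proof.
  intros H. destruct (H 1) as [d [D Hd]]; [lra|]. exists d. split; [exact D|].
  intros w Hw. specialize (Hd w Hw).
  assert (T := Cmod_triangle (f w - f z - l * (w - z))%C (l * (w - z))%C).
  replace (f w - f z - l * (w - z) + l * (w - z))%C with (f w - f z)%C in T by ring.
  rewrite Cmod_mult in T. lra.
Qed.

Lemma cderiv_continuous (f : C -> C) (z l : C) : cderiv f z l ->
  forall eps, 0 < eps -> exists d, 0 < d /\
    forall w, Cmod (w - z)%C < d -> Cmod (f w - f z)%C < eps.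
Proof.
  intros H eps He. destruct (cderiv_lip f z l H) as [d [D Hd]].
  assert (P : 0 < Cmod l + 1) by (assert (Q := Cmod_ge_0 l); lra).
  exists (Rmin d (eps / (Cmod l + 1))). split.
  - apply Rmin_glb_lt; [exact D|]. apply Rdiv_lt_0_compat; assumption.
  - intros w Hw. eapply Rle_lt_trans; [apply Hd; eapply Rlt_le_trans; [exact Hw|apply Rmin_l]|].
    apply Rlt_le_trans with ((Cmod l + 1) * (eps / (Cmod l + 1))).
    + apply Rmult_lt_compat_l; [exact P|]. eapply Rlt_le_trans; [exact Hw|apply Rmin_r].
    + right. field. lra.
Qed.

Lemma cderiv_comp (f g : C -> C) (z a b : C) :
  cderiv g z b -> cderiv f (g z) a -> cderiv (fun w => f (g w)) z (a * b)%C.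
Proof.
  intros Hg Hf eps He.
  assert (Pa := Cmod_ge_0 a). assert (Pb := Cmod_ge_0 b).
  destruct (cderiv_lip g z b Hg) as [d0 [D0 H0]].
  destruct (Hg (eps / 2 / (Cmod a + 1))) as [d1 [D1 H1]].
  { apply Rdiv_lt_0_compat; lra. }
  destruct (Hf (eps / 2 / (Cmod b + 1))) as [d2 [D2 H2]].
  { apply Rdiv_lt_0_compat; lra. }
  exists (Rmin (Rmin d0 d1) (d2 / (Cmod b + 1))). split.
  { repeat apply Rmin_glb_lt; try assumption. apply Rdiv_lt_0_compat; lra. }
  intros w Hw.
  assert (W0 : Cmod (w - z)%C < d0).
  { eapply Rlt_le_trans; [exact Hw|]. eapply Rle_trans; [apply Rmin_l|apply Rmin_l]. }
  assert (W1 : Cmod (w - z)%C < d1).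
  { eapply Rlt_le_trans; [exact Hw|]. eapply Rle_trans; [apply Rmin_l|apply Rmin_r]. }
  assert (W2 : (Cmod b + 1) * Cmod (w - z)%C < d2).
  { replace d2 with ((Cmod b + 1) * (d2 / (Cmod b + 1))) by (field; lra).
    apply Rmult_lt_compat_l; [lra|]. eapply Rlt_le_trans; [exact Hw|apply Rmin_r]. }
  specialize (H0 w W0). specialize (H1 w W1).
  specialize (H2 (g w) (Rle_lt_trans _ _ _ H0 W2)).
  replace (f (g w) - f (g z) - a * b * (w - z))%C with
    ((f (g w) - f (g z) - a * (g w - g z)) + a * (g w - g z - b * (w - z)))%C by ring.
  eapply Rle_trans; [apply Cmod_triangle|]. rewrite Cmod_mult.
  apply Rle_trans with (eps / 2 / (Cmod b + 1) * ((Cmod b + 1) * Cmod (w - z)%C)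
     + (Cmod a + 1) * (eps / 2 / (Cmod a + 1) * Cmod (w - z)%C)).
  - apply Rplus_le_compat.
    + eapply Rle_trans; [exact H2|]. apply Rmult_le_compat_l; [|exact H0].
      apply Rlt_le, Rdiv_lt_0_compat; lra.
    + apply Rmult_le_compat; try apply Cmod_ge_0; [lra|exact H1].
  - right. field. lra.
Qed.

Lemma cderiv_scal (c : C) (f : C -> C) (z a : C) :
  cderiv f z a -> cderiv (fun w => c * f w)%C z (c * a)%C.
Proof.
  intros H eps He. assert (P := Cmod_ge_0 c).
  destruct (H (eps / (Cmod c + 1))) as [d [D Hd]].
  { apply Rdiv_lt_0_compat; lra. }
  exists d. split; [exact D|]. intros w Hw. specialize (Hd w Hw).
  replace (c * f w - c * f z - c * a * (w - z))%C with (c * (f w - f z - a * (w - z)))%C by ring.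
  rewrite Cmod_mult.
  apply Rle_trans with ((Cmod c + 1) * (eps / (Cmod c + 1) * Cmod (w - z)%C)).
  - apply Rmult_le_compat; try apply Cmod_ge_0; lra.
  - right. field. lra.
Qed.

Lemma cderiv_opp (f : C -> C) (z a : C) :
  cderiv f z a -> cderiv (fun w => - f w)%C z (- a)%C.
Proof.
  intros H. apply (cderiv_scal (-1)%C) in H.
  replace (- a)%C with ((-1) * a)%C by ring.
  eapply cderiv_ext; [|exact H]. intros w; simpl. ring.
Qed.

Lemma cderiv_minus (f g : C -> C) (z a b : C) :
  cderiv f z a -> cderiv g z b -> cderiv (fun w => f w - g w)%C z (a - b)%C.
Proof. intros Hf Hg. apply cderiv_plus; [exact Hf|]. apply cderiv_opp, Hg. Qed.

Lemma cderiv_square (z : C) : cderiv (fun w => w * w)%C z (2 * z)%C.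
Proof.
  intros eps He. exists eps. split; [exact He|]. intros w Hw.
  replace (w * w - z * z - 2 * z * (w - z))%C with ((w - z) * (w - z))%C by ring.
  rewrite Cmod_mult. apply Rmult_le_compat_r; [apply Cmod_ge_0|lra].
Qed.

Lemma cderiv_mult (f g : C -> C) (z a b : C) :
  cderiv f z a -> cderiv g z b ->
  cderiv (fun w => f w * g w)%C z (a * g z + f z * b)%C.
Proof.
  intros Hf Hg.
  (* polarisation: 4 f g = (f+g)^2 - (f-g)^2 *)
  assert (A := cderiv_comp _ _ _ _ _ (cderiv_plus _ _ _ _ _ Hf Hg) (cderiv_square _)).
  assert (B := cderiv_comp _ _ _ _ _ (cderiv_minus _ _ _ _ _ Hf Hg) (cderiv_square _)).
  assert (D := cderiv_scal (/ 4)%C _ _ _ (cderiv_minus _ _ _ _ _ A B)).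
  simpl in D.
  replace (a * g z + f z * b)%C with
    (/ 4 * (2 * (f z + g z) * (a + b) - 2 * (f z - g z) * (a - b)))%C.
  - eapply cderiv_ext; [|exact D]. intros w; simpl. field.
  - field.
Qed.

Lemma cderiv_inv0 (z : C) : z <> 0%C -> cderiv (fun w => / w)%C z (- / (z * z))%C.
Proof.
  intros Hz eps He. assert (P : 0 < Cmod z) by (apply Cmod_gt_0; exact Hz).
  set (m := Cmod z) in *.
  assert (Q : 0 < eps * (m * m * m) / 2) by (apply Rdiv_lt_0_compat; [|lra]; repeat apply Rmult_lt_0_compat; lra).
  exists (Rmin (m / 2) (eps * (m * m * m) / 2)). split.
  { apply Rmin_glb_lt; lra. }
  intros w Hw.
  assert (W1 : Cmod (w - z)%C < m / 2) by (eapply Rlt_le_trans; [exact Hw|apply Rmin_l]).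
  assert (W2 : Cmod (w - z)%C < eps * (m * m * m) / 2) by (eapply Rlt_le_trans; [exact Hw|apply Rmin_r]).
  assert (Wm : m / 2 < Cmod w).
  { assert (T := Cmod_rev_tri z w). rewrite Cmod_minus_sym in T. fold m in T. lra. }
  assert (Hw0 : w <> 0%C) by (apply Cmod_gt_0; lra).
  replace (/ w - / z - - / (z * z) * (w - z))%C with ((w - z) * (w - z) / (z * z * w))%C
    by (field; split; assumption).
  rewrite Cmod_div by (repeat apply Cmult_neq_0; assumption).
  rewrite !Cmod_mult. fold m.
  assert (X := Cmod_ge_0 (w - z)%C). set (x := Cmod (w - z)%C) in *.
  apply Rle_div_l. { repeat apply Rmult_lt_0_compat; lra. }
  apply Rle_trans with (x * (eps * (m * m * (m / 2)))).
  - apply Rmult_le_compat_l; [exact X|]. lra.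
  - replace (eps * x * (m * m * Cmod w)) with (x * (eps * (m * m * Cmod w))) by ring.
    apply Rmult_le_compat_l; [exact X|].
    apply Rmult_le_compat_l; [lra|]. apply Rmult_le_compat_l; [|lra].
    apply Rmult_le_pos; lra.
Qed.

Lemma cderiv_inv (f : C -> C) (z a : C) : cderiv f z a -> f z <> 0%C ->
  cderiv (fun w => / f w)%C z (- a / (f z * f z))%C.
Proof.
  intros H N. assert (A := cderiv_comp _ _ _ _ _ H (cderiv_inv0 _ N)).
  replace (- a / (f z * f z))%C with (- / (f z * f z) * a)%C by (field; exact N).
  exact A.
Qed.

Lemma cderiv_div (f g : C -> C) (z a b : C) : cderiv f z a -> cderiv g z b -> g z <> 0%C ->
  cderiv (fun w => f w / g w)%C z ((a * g z - f z * b) / (g z * g z))%C.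
Proof.
  intros Hf Hg N.
  assert (A := cderiv_mult _ _ _ _ _ Hf (cderiv_inv _ _ _ Hg N)). simpl in A.
  replace ((a * g z - f z * b) / (g z * g z))%C with
    (a * / g z + f z * (- b / (g z * g z)))%C by (field; exact N).
  exact A.
Qed.

Lemma cderiv_unique (f : C -> C) (z a b : C) : cderiv f z a -> cderiv f z b -> a = b.
Proof.
  intros Ha Hb.
  destruct (Ceq_dec a b) as [E|N]; [exact E|exfalso].
  assert (P : 0 < Cmod (a - b)%C).
  { apply Cmod_gt_0. intro E. apply N. rewrite <- (Cplus_0_r b), <- E. ring. }
  set (m := Cmod (a - b)%C) in *.
  destruct (Ha (m / 4)) as [d1 [D1 H1]]; [lra|].
  destruct (Hb (m / 4)) as [d2 [D2 H2]]; [lra|].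
  set (d := Rmin d1 d2 / 2).
  assert (D : 0 < d). { unfold d. assert (0 < Rmin d1 d2) by (apply Rmin_glb_lt; lra). lra. }
  assert (L1 := Rmin_l d1 d2). assert (L2 := Rmin_r d1 d2).
  assert (E : (z + d - z)%C = d) by ring.
  assert (M : Cmod (z + d - z)%C = d) by (rewrite E, Cmod_R, Rabs_right; lra).
  specialize (H1 (z + d)%C). specialize (H2 (z + d)%C).
  rewrite M in H1, H2. unfold d in H1 at 1, H2 at 1.
  specialize (H1 ltac:(lra)). specialize (H2 ltac:(lra)).
  rewrite E in H1, H2.
  assert (T := Cmod_sub_le (f (z + d) - f z - b * d)%C (f (z + d) - f z - a * d)%C).
  replace ((f (z + d) - f z - b * d) - (f (z + d) - f z - a * d))%C with ((a - b) * d)%C in T by ring.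
  rewrite Cmod_mult, Cmod_R, Rabs_right in T by lra. fold m in T. nra.
Qed.

(** A total derivative by choice, so that it can be composed and integrated without carrying proofs;
    its value is arbitrary where no derivative exists. *)
Definition cD (f : C -> C) (z : C) : C := epsilon (inhabits (RtoC 0)) (cderiv f z).

Lemma cD_spec (f : C -> C) (z : C) : (exists l, cderiv f z l) -> cderiv f z (cD f z).
Proof. intros H. exact (epsilon_spec (inhabits (RtoC 0)) (cderiv f z) H). Qed.

Lemma cD_eq (f : C -> C) (z l : C) : cderiv f z l -> cD f z = l.
Proof.
  intros H. apply (cderiv_unique f z); [|exact H]. apply cD_spec. exists l; exact H.
Qed.

Lemma analytic_iff (f : C -> C) :
  analytic_on_D f <-> forall z, inD z -> exists l, cderiv f z l.
Proof.
  split; intros H z Hz; destruct (H z Hz) as [l Hl]; exists l; apply is_derive_cderiv; exact Hl.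
Qed.

Lemma analytic_cD (f : C -> C) (z : C) : analytic_on_D f -> inD z -> cderiv f z (cD f z).
Proof. intros H Hz. apply cD_spec. apply analytic_iff; assumption. Qed.

Lemma analytic_of (f d : C -> C) : (forall z, inD z -> cderiv f z (d z)) -> analytic_on_D f.
Proof. intros H. apply analytic_iff. intros z Hz. exists (d z). auto. Qed.

Lemma cderiv_eq (f : C -> C) (z a b : C) : cderiv f z a -> a = b -> cderiv f z b.
Proof. intros H <-. exact H. Qed.

(** * Integrals of complex-valued functions *)

Definition Ccont (g : R -> C) (t : R) : Prop :=
  forall eps, 0 < eps -> exists d, 0 < d /\
    forall s, Rabs (s - t) < d -> Cmod (g s - g t)%C < eps.

Definition rderiv (F : R -> C) (t : R) (l : C) : Prop :=
  forall eps, 0 < eps -> exists d, 0 < d /\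
    forall s, Rabs (s - t) < d ->
      Cmod (F s - F t - l * RtoC (s - t))%C <= eps * Rabs (s - t).

Lemma continuous_eps (f : R -> R) (x : R) :
  continuous f x <-> forall eps, 0 < eps -> exists d, 0 < d /\
    forall y, Rabs (y - x) < d -> Rabs (f y - f x) < eps.
Proof.
  split.
  - intros H eps He.
    destruct (proj1 (filterlim_locally f (f x)) H (mkposreal eps He)) as [d Hd].
    exists d. split; [apply cond_pos|]. intros y Hy. exact (Hd y Hy).
  - intros H. apply filterlim_locally. intros eps.
    destruct (H eps (cond_pos eps)) as [d [D Hd]].
    exists (mkposreal d D). intros y Hy. exact (Hd y Hy).
Qed.

Lemma im_le_Cmod (c : C) : Rabs (Im c) <= Cmod c.
Proof. eapply Rle_trans; [|apply Rmax_Cmod]. apply Rmax_r. Qed.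

Lemma Re_minus (a b : C) : Re (a - b)%C = Re a - Re b.
Proof. reflexivity. Qed.
Lemma Im_minus (a b : C) : Im (a - b)%C = Im a - Im b.
Proof. reflexivity. Qed.

Lemma Ccont_Re (g : R -> C) (t : R) : Ccont g t -> continuous (fun s => Re (g s)) t.
Proof.
  intros H. apply continuous_eps. intros eps He. destruct (H eps He) as [d [D Hd]].
  exists d. split; [exact D|]. intros y Hy. eapply Rle_lt_trans; [|apply (Hd y Hy)].
  rewrite <- Re_minus. apply re_le_Cmod.
Qed.

Lemma Ccont_Im (g : R -> C) (t : R) : Ccont g t -> continuous (fun s => Im (g s)) t.
Proof.
  intros H. apply continuous_eps. intros eps He. destruct (H eps He) as [d [D Hd]].
  exists d. split; [exact D|]. intros y Hy. eapply Rle_lt_trans; [|apply (Hd y Hy)].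
  rewrite <- Im_minus. apply im_le_Cmod.
Qed.

Lemma Cmod_le_sum (c : C) : Cmod c <= Rabs (Re c) + Rabs (Im c).
Proof.
  destruct c as [x y]. simpl.
  replace (x, y) with (RtoC x + Ci * RtoC y)%C by (unfold RtoC, Ci, Cplus, Cmult; simpl; f_equal; ring).
  eapply Rle_trans; [apply Cmod_triangle|]. rewrite Cmod_mult, Cmod_Ci, !Cmod_R. lra.
Qed.

Lemma Ccont_parts (g : R -> C) (t : R) :
  continuous (fun s => Re (g s)) t -> continuous (fun s => Im (g s)) t -> Ccont g t.
Proof.
  intros H1 H2 eps He.
  destruct (proj1 (continuous_eps _ _) H1 (eps / 2)) as [d1 [D1 E1]]; [lra|].
  destruct (proj1 (continuous_eps _ _) H2 (eps / 2)) as [d2 [D2 E2]]; [lra|].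
  exists (Rmin d1 d2). split; [apply Rmin_glb_lt; assumption|]. intros s Hs.
  specialize (E1 s (Rlt_le_trans _ _ _ Hs (Rmin_l _ _))).
  specialize (E2 s (Rlt_le_trans _ _ _ Hs (Rmin_r _ _))).
  eapply Rle_lt_trans; [apply Cmod_le_sum|]. rewrite Re_minus, Im_minus. lra.
Qed.

Lemma Ccont_const (c : C) (t : R) : Ccont (fun _ => c) t.
Proof.
  intros eps He. exists 1. split; [lra|]. intros s _.
  replace (c - c)%C with (RtoC 0) by ring. rewrite Cmod_0. exact He.
Qed.

Lemma Ccont_RtoC (f : R -> R) (t : R) : continuous f t -> Ccont (fun s => RtoC (f s)) t.
Proof.
  intros H. apply Ccont_parts; simpl; [exact H|apply continuous_const].
Qed.

Lemma Ccont_plus (f g : R -> C) (t : R) :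
  Ccont f t -> Ccont g t -> Ccont (fun s => f s + g s)%C t.
Proof.
  intros Hf Hg. apply Ccont_parts; simpl.
  - apply (continuous_plus (fun s => Re (f s)) (fun s => Re (g s))); apply Ccont_Re; assumption.
  - apply (continuous_plus (fun s => Im (f s)) (fun s => Im (g s))); apply Ccont_Im; assumption.
Qed.

Lemma Ccont_mult (f g : R -> C) (t : R) :
  Ccont f t -> Ccont g t -> Ccont (fun s => f s * g s)%C t.
Proof.
  intros Hf Hg. apply Ccont_parts; simpl.
  - apply (continuous_minus (fun s => Re (f s) * Re (g s)) (fun s => Im (f s) * Im (g s)));
    apply (continuous_mult (K := R_AbsRing)); try (apply Ccont_Re; assumption); apply Ccont_Im; assumption.
  - apply (continuous_plus (fun s => Re (f s) * Im (g s)) (fun s => Im (f s) * Re (g s)));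
    apply (continuous_mult (K := R_AbsRing)); try (apply Ccont_Re; assumption); apply Ccont_Im; assumption.
Qed.

Lemma Ccont_opp (f : R -> C) (t : R) : Ccont f t -> Ccont (fun s => - f s)%C t.
Proof.
  intros H eps He. destruct (H eps He) as [d [D Hd]]. exists d. split; [exact D|].
  intros s Hs. replace (- f s - - f t)%C with (- (f s - f t))%C by ring.
  rewrite Cmod_opp. auto.
Qed.

Lemma Ccont_minus (f g : R -> C) (t : R) :
  Ccont f t -> Ccont g t -> Ccont (fun s => f s - g s)%C t.
Proof. intros Hf Hg. apply Ccont_plus; [exact Hf|apply Ccont_opp, Hg]. Qed.

Lemma Ccont_conj (f : R -> C) (t : R) : Ccont f t -> Ccont (fun s => Cconj (f s)) t.
Proof.
  intros H eps He. destruct (H eps He) as [d [D Hd]]. exists d. split; [exact D|].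
  intros s Hs. rewrite <- Cminus_conj, Cmod_conj. auto.
Qed.

Lemma Cmod_continuous (f : R -> C) (t : R) : Ccont f t -> continuous (fun s => Cmod (f s)) t.
Proof.
  intros H. apply continuous_eps. intros eps He. destruct (H eps He) as [d [D Hd]].
  exists d. split; [exact D|]. intros y Hy. specialize (Hd y Hy).
  assert (A := Cmod_rev_tri (f y) (f t)). assert (B := Cmod_rev_tri (f t) (f y)).
  rewrite Cmod_minus_sym in B. apply Rabs_def1; lra.
Qed.

Lemma Ccont_comp (f : C -> C) (g : R -> C) (t : R) (l : C) :
  cderiv f (g t) l -> Ccont g t -> Ccont (fun s => f (g s)) t.
Proof.
  intros Hf Hg eps He. destruct (cderiv_continuous _ _ _ Hf eps He) as [d [D Hd]].
  destruct (Hg d D) as [d' [D' Hd']]. exists d'. split; [exact D'|]. auto.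
Qed.

Lemma Ccont_ext (f g : R -> C) (t : R) : (forall s, f s = g s) -> Ccont f t -> Ccont g t.
Proof.
  intros E H eps He. destruct (H eps He) as [d [D Hd]]. exists d. split; [exact D|].
  intros s Hs. rewrite <- !E. auto.
Qed.

Definition CI (g : R -> C) (a b : R) : C :=
  (RInt (fun t => Re (g t)) a b, RInt (fun t => Im (g t)) a b).

Definition ccon (g : R -> C) (a b : R) : Prop :=
  forall t, Rmin a b <= t <= Rmax a b -> Ccont g t.

Lemma ccon_exRe g a b : ccon g a b -> ex_RInt (fun t => Re (g t)) a b.
Proof. intros H. apply (ex_RInt_continuous (V := R_CompleteNormedModule)). intros t Ht. apply Ccont_Re. auto. Qed.
Lemma ccon_exIm g a b : ccon g a b -> ex_RInt (fun t => Im (g t)) a b.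
Proof. intros H. apply (ex_RInt_continuous (V := R_CompleteNormedModule)). intros t Ht. apply Ccont_Im. auto. Qed.

Lemma CI_ext f g a b : (forall t, Rmin a b <= t <= Rmax a b -> f t = g t) -> CI f a b = CI g a b.
Proof.
  intros H. unfold CI. f_equal; apply (RInt_ext (V := R_CompleteNormedModule)); intros t Ht; rewrite H; auto; lra.
Qed.

Lemma CI_plus f g a b : ccon f a b -> ccon g a b ->
  CI (fun t => f t + g t)%C a b = (CI f a b + CI g a b)%C.
Proof.
  intros Hf Hg. unfold CI, Cplus; simpl. f_equal.
  - apply (RInt_plus (V := R_CompleteNormedModule) (fun t => Re (f t)) (fun t => Re (g t))); apply ccon_exRe; assumption.
  - apply (RInt_plus (V := R_CompleteNormedModule) (fun t => Im (f t)) (fun t => Im (g t))); apply ccon_exIm; assumption.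
Qed.

Lemma CI_scal c f a b : ccon f a b -> CI (fun t => c * f t)%C a b = (c * CI f a b)%C.
Proof.
  intros Hf. assert (HR := ccon_exRe _ _ _ Hf). assert (HI := ccon_exIm _ _ _ Hf).
  apply (RInt_correct (V := R_CompleteNormedModule)) in HR.
  apply (RInt_correct (V := R_CompleteNormedModule)) in HI.
  unfold CI, Cmult; simpl. destruct c as [u v]; simpl.
  f_equal; apply (is_RInt_unique (V := R_CompleteNormedModule)).
  - exact (is_RInt_minus (V := R_NormedModule) _ _ _ _ _ _
      (is_RInt_scal (V := R_NormedModule) _ _ _ u _ HR) (is_RInt_scal (V := R_NormedModule) _ _ _ v _ HI)).
  - exact (is_RInt_plus (V := R_NormedModule) _ _ _ _ _ _
      (is_RInt_scal (V := R_NormedModule) _ _ _ u _ HI) (is_RInt_scal (V := R_NormedModule) _ _ _ v _ HR)).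
Qed.

Lemma CI_minus f g a b : ccon f a b -> ccon g a b ->
  CI (fun t => f t - g t)%C a b = (CI f a b - CI g a b)%C.
Proof.
  intros Hf Hg.
  rewrite (CI_ext _ (fun t => f t + (-1) * g t)%C) by (intros; ring).
  assert (Hg' : ccon (fun t => (-1) * g t)%C a b) by (intros t Ht; apply Ccont_mult; [apply Ccont_const|auto]).
  rewrite CI_plus, CI_scal by assumption. ring.
Qed.

Lemma CI_const c a b : CI (fun _ => c) a b = (c * RtoC (b - a))%C.
Proof.
  unfold CI. rewrite !RInt_const. destruct c as [u v].
  unfold Cmult, RtoC; simpl. unfold scal; simpl; unfold mult; simpl. f_equal; ring.
Qed.

Lemma CI_Chasles f a b c : ccon f a b -> ccon f b c ->
  (CI f a b + CI f b c)%C = CI f a c.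
Proof.
  intros H1 H2. unfold CI, Cplus; simpl. f_equal.
  - apply (RInt_Chasles (V := R_CompleteNormedModule)); apply ccon_exRe; assumption.
  - apply (RInt_Chasles (V := R_CompleteNormedModule)); apply ccon_exIm; assumption.
Qed.

Lemma CI_point f a : CI f a a = 0%C.
Proof. unfold CI. rewrite !RInt_point. reflexivity. Qed.

Lemma CI_swap f a b : ccon f a b -> CI f b a = (- CI f a b)%C.
Proof.
  intros H. assert (E := CI_Chasles f b a b).
  rewrite CI_point in E.
  assert (H' : ccon f b a) by (intros t Ht; apply H; rewrite Rmin_comm, Rmax_comm; exact Ht).
  specialize (E H' H).
  replace (CI f b a) with (CI f b a + CI f a b - CI f a b)%C by ring. rewrite E. ring.
Qed.

Lemma Re_scal_unit_le (c w : C) : Cmod c <= 1 -> Re (c * w)%C <= Cmod w.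
Proof.
  intros H. eapply Rle_trans; [apply Rle_abs|]. eapply Rle_trans; [apply re_le_Cmod|].
  rewrite Cmod_mult. assert (P := Cmod_ge_0 w). nra.
Qed.

(** Turns a modulus into a real part. Norms of integrals, distances to the unit circle and
    Schwarz-type bounds are all reduced to real-part inequalities in this way. *)
Lemma unit_rot (w : C) : exists c, Cmod c = 1 /\ (c * w)%C = RtoC (Cmod w).
Proof.
  destruct (Ceq_dec w 0) as [->|N].
  - exists 1%C. rewrite Cmod_1, Cmod_0. split; [reflexivity|ring].
  - assert (P : 0 < Cmod w) by (apply Cmod_gt_0; exact N).
    assert (Q : RtoC (Cmod w) <> 0%C) by (intro E; apply (f_equal fst) in E; simpl in E; lra).
    exists (Cconj w / RtoC (Cmod w))%C. split.
    + rewrite Cmod_div, Cmod_conj, Cmod_R, Rabs_right by (try assumption; lra). field. lra.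
    + replace (Cconj w / Cmod w * w)%C with (w * Cconj w / Cmod w)%C by (field; exact Q).
      rewrite <- Cmod2_conj. field_simplify; [|exact Q]. 
      replace (RtoC (Cmod w ^ 2)) with (RtoC (Cmod w) * RtoC (Cmod w))%C by (rewrite <- RtoC_mult; f_equal; ring).
      field. exact Q.
Qed.

(** The rotation that makes the integral real and nonnegative can be moved inside, so only a real
    part has to be compared with [h]. *)
Lemma CI_norm g h a b : a <= b -> ccon g a b -> ex_RInt h a b ->
  (forall t, a <= t <= b -> Cmod (g t) <= h t) -> Cmod (CI g a b) <= RInt h a b.
Proof.
  intros Hab Hg Hh Hle. destruct (unit_rot (CI g a b)) as [c [Hc Ec]].
  rewrite <- CI_scal in Ec by exact Hg.
  apply (f_equal Re) in Ec. simpl in Ec. rewrite <- Ec.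
  apply RInt_le; try assumption.
  - assert (Hcg : ccon (fun t => c * g t)%C a b) by (intros t Ht; apply Ccont_mult; [apply Ccont_const|auto]).
    exact (ccon_exRe _ _ _ Hcg).
  - intros t Ht. eapply Rle_trans; [|apply Hle; lra]. apply (Re_scal_unit_le c); lra.
Qed.

Lemma CI_bound g a b M : ccon g a b ->
  (forall t, Rmin a b <= t <= Rmax a b -> Cmod (g t) <= M) -> Cmod (CI g a b) <= M * Rabs (b - a).
Proof.
  intros Hg HM. destruct (Rle_dec a b) as [L|L].
  - rewrite Rmin_left, Rmax_right in HM by lra.
    eapply Rle_trans; [apply (CI_norm g (fun _ => M)); auto|].
    + apply (ex_RInt_const (V := R_NormedModule)).
    + rewrite RInt_const, Rabs_right by lra. unfold scal; simpl; unfold mult; simpl. lra.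
  - rewrite Rmin_right, Rmax_left in HM by lra.
    assert (Hg' : ccon g b a) by (intros t Ht; apply Hg; rewrite Rmin_comm, Rmax_comm; exact Ht).
    rewrite (CI_swap g b a Hg'), Cmod_opp.
    eapply Rle_trans; [apply (CI_norm g (fun _ => M)); auto; try lra|].
    + apply (ex_RInt_const (V := R_NormedModule)).
    + rewrite RInt_const, Rabs_left by lra. unfold scal; simpl; unfold mult; simpl. lra.
Qed.

Lemma is_derive_eps (f : R -> R) (x l : R) :
  (forall eps, 0 < eps -> exists d, 0 < d /\ forall s, Rabs (s - x) < d ->
     Rabs (f s - f x - l * (s - x)) <= eps * Rabs (s - x)) -> is_derive f x l.
Proof.
  intros H. split; [apply is_linear_scal_l|].
  intros y Hy. apply (@is_filter_lim_locally_unique _ R_NormedModule) in Hy. subst y.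
  intros eps. destruct (H eps (cond_pos eps)) as [d [D Hd]].
  exists (mkposreal d D). intros s Hs. specialize (Hd s Hs).
  change (Rabs (f s - f x - (s - x) * l) <= eps * Rabs (s - x)).
  rewrite (Rmult_comm _ l). exact Hd.
Qed.

Lemma rderiv_Re F t l : rderiv F t l -> is_derive (fun s => Re (F s)) t (Re l).
Proof.
  intros H. apply is_derive_eps. intros eps He. destruct (H eps He) as [d [D Hd]].
  exists d. split; [exact D|]. intros s Hs. eapply Rle_trans; [|apply (Hd s Hs)].
  eapply Rle_trans; [|apply re_le_Cmod]. right. f_equal. destruct l as [u v]. unfold Re, Im; simpl. ring.
Qed.

Lemma rderiv_Im F t l : rderiv F t l -> is_derive (fun s => Im (F s)) t (Im l).
Proof.
  intros H. apply is_derive_eps. intros eps He. destruct (H eps He) as [d [D Hd]].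
  exists d. split; [exact D|]. intros s Hs. eapply Rle_trans; [|apply (Hd s Hs)].
  eapply Rle_trans; [|apply im_le_Cmod]. right. f_equal. destruct l as [u v]. unfold Re, Im; simpl. ring.
Qed.

Lemma CI_FTC F g a b : (forall t, Rmin a b <= t <= Rmax a b -> rderiv F t (g t)) ->
  ccon g a b -> CI g a b = (F b - F a)%C.
Proof.
  intros HF Hg. unfold CI.
  rewrite (is_RInt_unique (V := R_CompleteNormedModule) (fun t => Re (g t)) a b (Re (F b) - Re (F a))).
  rewrite (is_RInt_unique (V := R_CompleteNormedModule) (fun t => Im (g t)) a b (Im (F b) - Im (F a))).
  - reflexivity.
  - apply (is_RInt_derive (V := R_CompleteNormedModule) (fun t => Im (F t))).
    + intros t Ht. apply rderiv_Im. auto.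
    + intros t Ht. apply Ccont_Im. auto.
  - apply (is_RInt_derive (V := R_CompleteNormedModule) (fun t => Re (F t))).
    + intros t Ht. apply rderiv_Re. auto.
    + intros t Ht. apply Ccont_Re. auto.
Qed.

(** Only bounds to the right of each point are assumed, because an orbit of a semigroup is at first
    differentiable only from the right. The set of times up to which the bound with slope [M + eps]
    holds is closed by continuity and can always be prolonged to the right. *)
Lemma mvt_right (y : R -> C) (a b M : R) : a <= b ->
  (forall t, a <= t <= b -> Ccont y t) ->
  (forall u, a <= u < b -> forall eps, 0 < eps -> exists d, 0 < d /\
     forall s, u < s < u + d -> Cmod (y s - y u)%C <= (M + eps) * (s - u)) ->
  Cmod (y b - y a)%C <= M * (b - a).
Proof.
  intros Hab Hc Hd. destruct (Req_dec a b) as [->|Nab].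
  { replace (y b - y b)%C with (RtoC 0) by ring. rewrite Cmod_0. lra. }
  assert (K : forall eps, 0 < eps -> Cmod (y b - y a)%C <= (M + eps) * (b - a)).
  2:{ apply Rnot_lt_le. intros L.
      set (m := Cmod (y b - y a)%C - M * (b - a)) in *. assert (m > 0) by (unfold m; lra).
      specialize (K (m / 2 / (b - a))). 
      assert (P : 0 < m / 2 / (b - a)) by (apply Rdiv_lt_0_compat; lra).
      specialize (K P). rewrite Rmult_plus_distr_r in K.
      replace (m / 2 / (b - a) * (b - a)) with (m / 2) in K by (field; lra). unfold m in *; lra. }
  intros eps He. set (S := fun u => a <= u <= b /\ forall v, a <= v <= u -> Cmod (y v - y a)%C <= (M + eps) * (v - a)).
  destruct (completeness S) as [c [Hub Hlub]].
  { exists b. intros u [Hu _]. lra. }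
  { exists a. split; [lra|]. intros v Hv. replace v with a by lra.
    replace (y a - y a)%C with (RtoC 0) by ring. rewrite Cmod_0. lra. }
  assert (Hac : a <= c).
  { apply Hub. split; [lra|]. intros v Hv. replace v with a by lra.
    replace (y a - y a)%C with (RtoC 0) by ring. rewrite Cmod_0. lra. }
  assert (Hcb : c <= b) by (apply Hlub; intros u [Hu _]; lra).
  assert (Hlt : forall v, a <= v < c -> Cmod (y v - y a)%C <= (M + eps) * (v - a)).
  { intros v Hv. apply NNPP. intros N. apply (Rlt_not_le c v); [lra|]. apply Hlub.
    intros u [Hu1 Hu2]. apply Rnot_lt_le. intros Hvu. apply N. apply Hu2. lra. }
  assert (Hcc : Cmod (y c - y a)%C <= (M + eps) * (c - a)).
  { destruct (Req_dec a c) as [<-|Nac].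
    { replace (y a - y a)%C with (RtoC 0) by ring. rewrite Cmod_0. lra. }
    apply Rnot_lt_le. intros L. set (m := Cmod (y c - y a)%C - (M + eps) * (c - a)) in *.
    assert (Pm : 0 < m) by (unfold m; lra).
    destruct (Hc c ltac:(lra) (m / 2) ltac:(lra)) as [d [D Hdd]].
    assert (PM : 0 < Rabs (M + eps) + 1) by (assert (Q := Rabs_pos (M + eps)); lra).
    (* The bound is known to the left of [c]. Going back by [e] costs at most [m / 2] through
       continuity and at most [m / 2] through the slope, which contradicts an excess [m] at [c]. *)
    set (e := Rmin (d / 2) (Rmin (c - a) (m / 2 / (Rabs (M + eps) + 1)))).
    assert (Pe : 0 < e). { unfold e. repeat apply Rmin_glb_lt; try lra. apply Rdiv_lt_0_compat; lra. }
    assert (e1 : e <= d / 2) by apply Rmin_l.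
    assert (e2 : e <= c - a) by (unfold e; eapply Rle_trans; [apply Rmin_r|apply Rmin_l]).
    assert (e3 : (Rabs (M + eps) + 1) * e <= m / 2).
    { replace (m / 2) with ((Rabs (M + eps) + 1) * (m / 2 / (Rabs (M + eps) + 1))) by (field; lra).
      apply Rmult_le_compat_l; [lra|]. unfold e. eapply Rle_trans; [apply Rmin_r|apply Rmin_r]. }
    assert (A := Hlt (c - e) ltac:(lra)).
    assert (B := Hdd (c - e) ltac:(rewrite Rabs_left; lra)).
    assert (T := Cmod_tri_sub (y c) (y (c - e)) (y a)).
    rewrite (Cmod_minus_sym (y c) (y (c - e))) in T.
    assert (Q := Rle_abs (- (M + eps))). rewrite Rabs_Ropp in Q.
    assert (Q' : - (M + eps) * e <= Rabs (M + eps) * e) by (apply Rmult_le_compat_r; lra).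
    unfold m in *. nra. }
  destruct (Req_dec c b) as [->|Ncb]; [exact Hcc|exfalso].
  destruct (Hd c ltac:(lra) eps He) as [d [D Hdd]].
  assert (In : S (c + Rmin (d / 2) (b - c))).
  { assert (m1 := Rmin_l (d / 2) (b - c)). assert (m2 := Rmin_r (d / 2) (b - c)).
    assert (m3 : 0 < Rmin (d / 2) (b - c)) by (apply Rmin_glb_lt; lra).
    split; [lra|]. intros v Hv. destruct (Rlt_le_dec v c) as [L|L]; [apply Hlt; lra|].
    destruct (Req_dec v c) as [->|N]; [exact Hcc|].
    assert (B := Hdd v ltac:(lra)). assert (T := Cmod_tri_sub (y v) (y c) (y a)). lra. }
  assert (m3 : 0 < Rmin (d / 2) (b - c)) by (apply Rmin_glb_lt; lra).
  specialize (Hub _ In). lra.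
Qed.

Lemma rderiv_lip (F : R -> C) (t : R) (l : C) : rderiv F t l ->
  exists d, 0 < d /\ forall s, Rabs (s - t) < d -> Cmod (F s - F t)%C <= (Cmod l + 1) * Rabs (s - t).
Proof.
  intros H. destruct (H 1) as [d [D Hd]]; [lra|]. exists d. split; [exact D|].
  intros s Hs. specialize (Hd s Hs).
  assert (T := Cmod_triangle (F s - F t - l * RtoC (s - t))%C (l * RtoC (s - t))%C).
  replace (F s - F t - l * RtoC (s - t) + l * RtoC (s - t))%C with (F s - F t)%C in T by ring.
  rewrite Cmod_mult, Cmod_R in T. lra.
Qed.

Lemma rderiv_Ccont (F : R -> C) (t : R) (l : C) : rderiv F t l -> Ccont F t.
Proof.
  intros H eps He. destruct (rderiv_lip F t l H) as [d [D Hd]].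
  assert (P : 0 < Cmod l + 1) by (assert (Q := Cmod_ge_0 l); lra).
  exists (Rmin d (eps / (Cmod l + 1))). split.
  - apply Rmin_glb_lt; [exact D|]. apply Rdiv_lt_0_compat; assumption.
  - intros w Hw. eapply Rle_lt_trans; [apply Hd; eapply Rlt_le_trans; [exact Hw|apply Rmin_l]|].
    apply Rlt_le_trans with ((Cmod l + 1) * (eps / (Cmod l + 1))).
    + apply Rmult_lt_compat_l; [exact P|]. eapply Rlt_le_trans; [exact Hw|apply Rmin_r].
    + right. field. lra.
Qed.

Lemma rderiv_comp (f : C -> C) (g : R -> C) (t : R) (a b : C) :
  rderiv g t b -> cderiv f (g t) a -> rderiv (fun s => f (g s)) t (a * b)%C.
Proof.
  intros Hg Hf eps He.
  assert (Pa := Cmod_ge_0 a). assert (Pb := Cmod_ge_0 b).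
  destruct (rderiv_lip g t b Hg) as [d0 [D0 H0]].
  destruct (Hg (eps / 2 / (Cmod a + 1))) as [d1 [D1 H1]].
  { apply Rdiv_lt_0_compat; lra. }
  destruct (Hf (eps / 2 / (Cmod b + 1))) as [d2 [D2 H2]].
  { apply Rdiv_lt_0_compat; lra. }
  exists (Rmin (Rmin d0 d1) (d2 / (Cmod b + 1))). split.
  { repeat apply Rmin_glb_lt; try assumption. apply Rdiv_lt_0_compat; lra. }
  intros w Hw.
  assert (W0 : Rabs (w - t) < d0).
  { eapply Rlt_le_trans; [exact Hw|]. eapply Rle_trans; [apply Rmin_l|apply Rmin_l]. }
  assert (W1 : Rabs (w - t) < d1).
  { eapply Rlt_le_trans; [exact Hw|]. eapply Rle_trans; [apply Rmin_l|apply Rmin_r]. }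
  assert (W2 : (Cmod b + 1) * Rabs (w - t) < d2).
  { replace d2 with ((Cmod b + 1) * (d2 / (Cmod b + 1))) by (field; lra).
    apply Rmult_lt_compat_l; [lra|]. eapply Rlt_le_trans; [exact Hw|apply Rmin_r]. }
  specialize (H0 w W0). specialize (H1 w W1).
  specialize (H2 (g w) (Rle_lt_trans _ _ _ H0 W2)).
  replace (f (g w) - f (g t) - a * b * RtoC (w - t))%C with
    ((f (g w) - f (g t) - a * (g w - g t)) + a * (g w - g t - b * RtoC (w - t)))%C by ring.
  eapply Rle_trans; [apply Cmod_triangle|]. rewrite Cmod_mult.
  apply Rle_trans with (eps / 2 / (Cmod b + 1) * ((Cmod b + 1) * Rabs (w - t))
     + (Cmod a + 1) * (eps / 2 / (Cmod a + 1) * Rabs (w - t))).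
  - apply Rplus_le_compat.
    + eapply Rle_trans; [exact H2|]. apply Rmult_le_compat_l; [|exact H0].
      apply Rlt_le, Rdiv_lt_0_compat; lra.
    + apply Rmult_le_compat; try apply Cmod_ge_0; [lra|exact H1].
  - right. field. lra.
Qed.

Lemma rderiv_affine (g : R -> C) (t : R) (v : C) :
  (forall s, (g s - g t)%C = (v * RtoC (s - t))%C) -> rderiv g t v.
Proof.
  intros H eps He. exists 1. split; [lra|]. intros s _. rewrite H.
  replace (v * RtoC (s - t) - v * RtoC (s - t))%C with (RtoC 0) by ring.
  rewrite Cmod_0. apply Rmult_le_pos; [lra|apply Rabs_pos].
Qed.

(** * Cauchy theory on the disk *)

Definition pt (x y : R) : C := (x, y).

Lemma pt_h x x' y : (pt x y - pt x' y)%C = RtoC (x - x').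
Proof. unfold pt, Cminus, Cplus, Copp, RtoC; simpl. f_equal; ring. Qed.
Lemma pt_v x y y' : (pt x y - pt x y')%C = (Ci * RtoC (y - y'))%C.
Proof. unfold pt, Cminus, Cplus, Copp, Cmult, Ci, RtoC; simpl. f_equal; ring. Qed.

Lemma rderiv_pt_h y t : rderiv (fun s => pt s y) t 1%C.
Proof. apply rderiv_affine. intros s. rewrite pt_h. ring. Qed.
Lemma rderiv_pt_v x t : rderiv (fun s => pt x s) t Ci.
Proof. apply rderiv_affine. intros s. apply pt_v. Qed.

Definition rectI (f : C -> C) (x1 x2 y1 y2 : R) : C :=
  (CI (fun s => f (pt s y1)) x1 x2 - CI (fun s => f (pt s y2)) x1 x2
   + Ci * (CI (fun t => f (pt x2 t)) y1 y2 - CI (fun t => f (pt x1 t)) y1 y2))%C.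

Definition diffR (f : C -> C) (x1 x2 y1 y2 : R) : Prop :=
  forall x y, x1 <= x <= x2 -> y1 <= y <= y2 -> exists l, cderiv f (pt x y) l.

Lemma diffR_h f x1 x2 y1 y2 a b y : diffR f x1 x2 y1 y2 -> x1 <= a <= x2 -> x1 <= b <= x2 ->
  y1 <= y <= y2 -> ccon (fun s => f (pt s y)) a b.
Proof.
  intros H Ha Hb Hy t Ht. destruct (H t y) as [l Hl]; [|exact Hy|].
  - unfold Rmin, Rmax in Ht. destruct Rle_dec; lra.
  - eapply (Ccont_comp f (fun s => pt s y)); [exact Hl|]. eapply rderiv_Ccont, rderiv_pt_h.
Qed.

Lemma diffR_v f x1 x2 y1 y2 a b x : diffR f x1 x2 y1 y2 -> y1 <= a <= y2 -> y1 <= b <= y2 ->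
  x1 <= x <= x2 -> ccon (fun s => f (pt x s)) a b.
Proof.
  intros H Ha Hb Hy t Ht. destruct (H x t) as [l Hl]; [exact Hy| |].
  - unfold Rmin, Rmax in Ht. destruct Rle_dec; lra.
  - eapply (Ccont_comp f (fun s => pt x s)); [exact Hl|]. eapply rderiv_Ccont, rderiv_pt_v.
Qed.

Lemma rectI_split f x1 x2 y1 y2 : x1 <= x2 -> y1 <= y2 -> diffR f x1 x2 y1 y2 ->
  let xm := (x1 + x2) / 2 in let ym := (y1 + y2) / 2 in
  rectI f x1 x2 y1 y2 = (rectI f x1 xm y1 ym + rectI f xm x2 y1 ym
     + rectI f x1 xm ym y2 + rectI f xm x2 ym y2)%C.
Proof.
  intros Hx Hy H xm ym. unfold rectI.
  assert (X : x1 <= xm <= x2) by (unfold xm; lra). assert (Y : y1 <= ym <= y2) by (unfold ym; lra).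
  rewrite <- (CI_Chasles (fun s => f (pt s y1)) x1 xm x2) by (apply (diffR_h f x1 x2 y1 y2); auto; lra).
  rewrite <- (CI_Chasles (fun s => f (pt s y2)) x1 xm x2) by (apply (diffR_h f x1 x2 y1 y2); auto; lra).
  rewrite <- (CI_Chasles (fun s => f (pt x2 s)) y1 ym y2) by (apply (diffR_v f x1 x2 y1 y2); auto; lra).
  rewrite <- (CI_Chasles (fun s => f (pt x1 s)) y1 ym y2) by (apply (diffR_v f x1 x2 y1 y2); auto; lra).
  ring.
Qed.

Lemma rectI_primitive (P g : C -> C) x1 x2 y1 y2 : (forall z, cderiv P z (g z)) ->
  (forall z, exists l, cderiv g z l) -> rectI g x1 x2 y1 y2 = 0%C.
Proof.
  intros HP Hg. unfold rectI.
  assert (A : forall y, CI (fun s => g (pt s y)) x1 x2 = (P (pt x2 y) - P (pt x1 y))%C).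
  { intros y. apply (CI_FTC (fun s => P (pt s y))).
    - intros t _. replace (g (pt t y)) with (g (pt t y) * 1)%C by ring.
      apply (rderiv_comp P (fun s => pt s y)); [apply rderiv_pt_h|apply HP].
    - intros t _. destruct (Hg (pt t y)) as [l Hl].
      eapply (Ccont_comp g (fun s => pt s y)); [exact Hl|]. eapply rderiv_Ccont, rderiv_pt_h. }
  assert (B : forall x, (Ci * CI (fun s => g (pt x s)) y1 y2)%C = (P (pt x y2) - P (pt x y1))%C).
  { intros x.
    assert (Q : ccon (fun s => g (pt x s)) y1 y2).
    { intros t _. destruct (Hg (pt x t)) as [l Hl].
      eapply (Ccont_comp g (fun s => pt x s)); [exact Hl|]. eapply rderiv_Ccont, rderiv_pt_v. }
    rewrite <- CI_scal by exact Q.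
    apply (CI_FTC (fun s => P (pt x s))).
    - intros t _. rewrite Cmult_comm.
      apply (rderiv_comp P (fun s => pt x s)); [apply rderiv_pt_v|apply HP].
    - intros t Ht. apply Ccont_mult; [apply Ccont_const|apply Q, Ht]. }
  replace (Ci * (CI (fun t : R => g (pt x2 t)) y1 y2 - CI (fun t : R => g (pt x1 t)) y1 y2))%C
    with (Ci * CI (fun t : R => g (pt x2 t)) y1 y2 - Ci * CI (fun t : R => g (pt x1 t)) y1 y2)%C by ring.
  rewrite !A, !B. ring.
Qed.

Lemma Cmod_pt_sub x y x' y' : Cmod (pt x y - pt x' y')%C <= Rabs (x - x') + Rabs (y - y').
Proof.
  eapply Rle_trans; [apply Cmod_le_sum|]. unfold pt, Re, Im, Rminus; simpl. lra.
Qed.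

(** The affine part of f at the point has a primitive and contributes nothing. What is left is at
    most eps times the half perimeter on each side, and the sides have total length twice the half
    perimeter. *)
Lemma rectI_small f x1 x2 y1 y2 px py l eps : x1 <= x2 -> y1 <= y2 -> diffR f x1 x2 y1 y2 ->
  x1 <= px <= x2 -> y1 <= py <= y2 -> 0 < eps ->
  (forall x y, x1 <= x <= x2 -> y1 <= y <= y2 ->
     Cmod (f (pt x y) - f (pt px py) - l * (pt x y - pt px py))%C <= eps * Cmod (pt x y - pt px py)%C) ->
  Cmod (rectI f x1 x2 y1 y2) <= 2 * eps * ((x2 - x1) + (y2 - y1)) * ((x2 - x1) + (y2 - y1)).
Proof.
  intros Hx Hy H Hpx Hpy He Hs. set (p := pt px py) in *.
  set (g := fun z => (f p + l * (z - p))%C).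
  assert (Hg : forall z, cderiv g z l).
  { intros z. unfold g. eapply cderiv_eq.
    - apply cderiv_plus; [apply cderiv_const|]. apply cderiv_scal.
      apply cderiv_minus; [apply cderiv_id|apply cderiv_const].
    - ring. }
  assert (Z : rectI g x1 x2 y1 y2 = 0%C).
  { apply (rectI_primitive (fun z => f p * z + l * / 2 * ((z - p) * (z - p)))%C).
    - intros z. unfold g.
      eapply cderiv_eq.
      + apply cderiv_plus; [apply cderiv_scal, cderiv_id|]. apply cderiv_scal.
        apply (cderiv_comp (fun w => w * w)%C (fun z => z - p)%C); [|apply cderiv_square].
        apply cderiv_minus; [apply cderiv_id|apply cderiv_const].
      + simpl. field.
    - intros z. exists l. apply Hg. }
  set (e := fun z => (f z - g z)%C).
  assert (De : diffR e x1 x2 y1 y2).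
  { intros x y X Y. destruct (H x y X Y) as [m Hm]. exists (m - l)%C. apply cderiv_minus; [exact Hm|apply Hg]. }
  assert (Dg : diffR g x1 x2 y1 y2) by (intros x y _ _; exists l; apply Hg).
  assert (E : rectI f x1 x2 y1 y2 = rectI e x1 x2 y1 y2).
  { replace (rectI f x1 x2 y1 y2) with (rectI f x1 x2 y1 y2 - rectI g x1 x2 y1 y2)%C by (rewrite Z; ring).
    unfold rectI, e.
    rewrite (CI_minus (fun s => f (pt s y1)) (fun s => g (pt s y1)) x1 x2) by (first [apply (diffR_h f x1 x2 y1 y2) | apply (diffR_h g x1 x2 y1 y2)]; auto; lra).
    rewrite (CI_minus (fun s => f (pt s y2)) (fun s => g (pt s y2)) x1 x2) by (first [apply (diffR_h f x1 x2 y1 y2) | apply (diffR_h g x1 x2 y1 y2)]; auto; lra).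
    rewrite (CI_minus (fun s => f (pt x1 s)) (fun s => g (pt x1 s)) y1 y2) by (first [apply (diffR_v f x1 x2 y1 y2) | apply (diffR_v g x1 x2 y1 y2)]; auto; lra).
    rewrite (CI_minus (fun s => f (pt x2 s)) (fun s => g (pt x2 s)) y1 y2) by (first [apply (diffR_v f x1 x2 y1 y2) | apply (diffR_v g x1 x2 y1 y2)]; auto; lra).
    ring. }
  rewrite E. set (d := (x2 - x1) + (y2 - y1)).
  assert (B : forall x y, x1 <= x <= x2 -> y1 <= y <= y2 -> Cmod (e (pt x y)) <= eps * d).
  { intros x y X Y. unfold e, g.
    replace (f (pt x y) - (f p + l * (pt x y - p)))%C with (f (pt x y) - f p - l * (pt x y - p))%C by ring.
    eapply Rle_trans; [apply Hs; assumption|]. apply Rmult_le_compat_l; [lra|].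
    eapply Rle_trans; [apply Cmod_pt_sub|]. unfold d.
    apply Rplus_le_compat; apply Rabs_le; lra. }
  assert (Bh : forall y, y1 <= y <= y2 -> Cmod (CI (fun s => e (pt s y)) x1 x2) <= eps * d * (x2 - x1)).
  { intros y Y. rewrite <- (Rabs_right (x2 - x1)) by lra. apply CI_bound; [apply (diffR_h e x1 x2 y1 y2); auto; lra|].
    rewrite Rmin_left, Rmax_right by lra. intros; apply B; assumption. }
  assert (Bv : forall x, x1 <= x <= x2 -> Cmod (CI (fun s => e (pt x s)) y1 y2) <= eps * d * (y2 - y1)).
  { intros x X. rewrite <- (Rabs_right (y2 - y1)) by lra. apply CI_bound; [apply (diffR_v e x1 x2 y1 y2); auto; lra|].
    rewrite Rmin_left, Rmax_right by lra. intros; apply B; assumption. }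
  unfold rectI. eapply Rle_trans; [apply Cmod_triangle|]. rewrite Cmod_mult, Cmod_Ci.
  assert (T1 := Cmod_sub_le (CI (fun s : R => e (pt s y1)) x1 x2) (CI (fun s : R => e (pt s y2)) x1 x2)).
  assert (T2 := Cmod_sub_le (CI (fun s : R => e (pt x2 s)) y1 y2) (CI (fun s : R => e (pt x1 s)) y1 y2)).
  assert (A1 := Bh y1 ltac:(lra)). assert (A2 := Bh y2 ltac:(lra)).
  assert (A3 := Bv x1 ltac:(lra)). assert (A4 := Bv x2 ltac:(lra)).
  replace (2 * eps * d * d) with (2 * (eps * d * (x2 - x1)) + 2 * (eps * d * (y2 - y1))) by (unfold d; ring).
  lra.
Qed.

Definition rect4 : Type := ((R * R) * (R * R))%type.
Definition rI (f : C -> C) (r : rect4) : C := rectI f (fst (fst r)) (snd (fst r)) (fst (snd r)) (snd (snd r)).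
(** The fourth quarter is a default without a test: if the first three carry less than a quarter of
    the modulus, [rectI_split] forces the fourth to carry it. *)
Definition quarter (f : C -> C) (r : rect4) : rect4 :=
  let x1 := fst (fst r) in let x2 := snd (fst r) in let y1 := fst (snd r) in let y2 := snd (snd r) in
  let xm := (x1 + x2) / 2 in let ym := (y1 + y2) / 2 in
  let q1 := ((x1, xm), (y1, ym)) in let q2 := ((xm, x2), (y1, ym)) in
  let q3 := ((x1, xm), (ym, y2)) in let q4 := ((xm, x2), (ym, y2)) in
  let m := Cmod (rI f r) / 4 in
  if Rle_dec m (Cmod (rI f q1)) then q1 else
  if Rle_dec m (Cmod (rI f q2)) then q2 else
  if Rle_dec m (Cmod (rI f q3)) then q3 else q4.

Definition okr (f : C -> C) (r : rect4) : Prop :=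
  fst (fst r) <= snd (fst r) /\ fst (snd r) <= snd (snd r) /\
  diffR f (fst (fst r)) (snd (fst r)) (fst (snd r)) (snd (snd r)).

Lemma quarter_spec f r : okr f r -> let q := quarter f r in
  okr f q /\ Cmod (rI f r) / 4 <= Cmod (rI f q) /\
  fst (fst r) <= fst (fst q) /\ snd (fst q) <= snd (fst r) /\
  fst (snd r) <= fst (snd q) /\ snd (snd q) <= snd (snd r) /\
  snd (fst q) - fst (fst q) = (snd (fst r) - fst (fst r)) / 2 /\
  snd (snd q) - fst (snd q) = (snd (snd r) - fst (snd r)) / 2.
Proof.
  destruct r as [[x1 x2] [y1 y2]]. unfold okr; simpl. intros [Hx [Hy H]].
  assert (S := rectI_split f x1 x2 y1 y2 Hx Hy H). simpl in S.
  assert (D : forall a b c d, x1 <= a -> b <= x2 -> y1 <= c -> d <= y2 -> diffR f a b c d).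
  { intros a b c d A B C' D' x y X Y. apply H; lra. }
  unfold quarter; simpl.
  destruct Rle_dec as [L1|L1]; simpl.
  { repeat split; try lra. apply D; lra. }
  destruct Rle_dec as [L2|L2]; simpl.
  { repeat split; try lra. apply D; lra. }
  destruct Rle_dec as [L3|L3]; simpl.
  { repeat split; try lra. apply D; lra. }
  repeat split; try lra. { apply D; lra. }
  unfold rI in *; simpl in *.
  assert (T : Cmod (rectI f x1 x2 y1 y2) <= Cmod (rectI f x1 ((x1 + x2) / 2) y1 ((y1 + y2) / 2))
    + Cmod (rectI f ((x1 + x2) / 2) x2 y1 ((y1 + y2) / 2))
    + Cmod (rectI f x1 ((x1 + x2) / 2) ((y1 + y2) / 2) y2)
    + Cmod (rectI f ((x1 + x2) / 2) x2 ((y1 + y2) / 2) y2)).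
  { rewrite S. eapply Rle_trans; [apply Cmod_triangle|]. apply Rplus_le_compat_r.
    eapply Rle_trans; [apply Cmod_triangle|]. apply Rplus_le_compat_r. apply Cmod_triangle. }
  lra.
Qed.

Lemma INR_lt_pow2 (n : nat) : INR n < 2 ^ n.
Proof.
  induction n; [simpl; lra|]. rewrite S_INR. simpl.
  assert (1 <= 2 ^ n) by (apply pow_R1_Rle; lra). lra.
Qed.

(** Bisection: the chosen rectangles shrink to a point, obtained from the suprema of their left and
    lower ends. The contour integrals decay at most like 4^(-n), whereas differentiability at the
    point makes them smaller than any fixed multiple of 4^(-n). *)
Lemma goursat f x1 x2 y1 y2 : x1 <= x2 -> y1 <= y2 -> diffR f x1 x2 y1 y2 ->
  rectI f x1 x2 y1 y2 = 0%C.
Proof.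
  intros Hx Hy H. apply Cmod_eq_0.
  set (r := fix r n := match n with O => ((x1, x2), (y1, y2)) : rect4 | S m => quarter f (r m) end).
  assert (Ok : forall n, okr f (r n)).
  { induction n; [repeat split; simpl; assumption|]. exact (proj1 (quarter_spec f (r n) IHn)). }
  assert (Sz : forall n, snd (fst (r n)) - fst (fst (r n)) = (x2 - x1) / 2 ^ n /\
                         snd (snd (r n)) - fst (snd (r n)) = (y2 - y1) / 2 ^ n /\
                         Cmod (rI f (r O)) / 4 ^ n <= Cmod (rI f (r n))).
  { induction n; [simpl; repeat split; lra|].
    destruct (quarter_spec f (r n) (Ok n)) as [_ [Q1 [_ [_ [_ [_ [Q2 Q3]]]]]]].
    destruct IHn as [I1 [I2 I3]].
    assert (P2 : 0 < 2 ^ n) by (apply pow_lt; lra). assert (P4 : 0 < 4 ^ n) by (apply pow_lt; lra).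
    change (r (S n)) with (quarter f (r n)). rewrite Q2, Q3, I1, I2. repeat split.
    - simpl; field; lra.
    - simpl; field; lra.
    - eapply Rle_trans; [|exact Q1].
      replace (Cmod (rI f (r 0%nat)) / 4 ^ S n) with (Cmod (rI f (r 0%nat)) / 4 ^ n / 4) by (simpl; field; lra).
      lra. }
  assert (Mono : forall n k, fst (fst (r n)) <= fst (fst (r (n + k)%nat)) /\ snd (fst (r (n + k)%nat)) <= snd (fst (r n)) /\
     fst (snd (r n)) <= fst (snd (r (n + k)%nat)) /\ snd (snd (r (n + k)%nat)) <= snd (snd (r n))).
  { intros n k. induction k; [rewrite Nat.add_0_r; repeat split; lra|].
    rewrite Nat.add_succ_r.
    destruct (quarter_spec f (r (n + k)%nat) (Ok _)) as [_ [_ [M1 [M2 [M3 [M4 _]]]]]].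
    change (r (S (n + k))) with (quarter f (r (n + k)%nat)). repeat split; lra. }
  assert (Cross : forall n m, fst (fst (r n)) <= snd (fst (r m)) /\ fst (snd (r n)) <= snd (snd (r m))).
  { intros n m. destruct (Mono n m) as [A1 [_ [A3 _]]]. destruct (Mono m n) as [_ [B2 [_ B4]]].
    rewrite (Nat.add_comm m n) in B2, B4. destruct (Ok (n + m)%nat) as [C1 [C2 _]]. split; lra. }
  destruct (completeness (fun x => exists n, x = fst (fst (r n)))) as [px [Ux Lx]].
  { exists x2. intros x [n ->]. exact (proj1 (Cross n O)). }
  { exists x1, O. reflexivity. }
  destruct (completeness (fun x => exists n, x = fst (snd (r n)))) as [py [Uy Ly]].
  { exists y2. intros x [n ->]. exact (proj2 (Cross n O)). }
  { exists y1, O. reflexivity. }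
  assert (Px : forall n, fst (fst (r n)) <= px <= snd (fst (r n))).
  { intros n. split; [apply Ux; exists n; reflexivity|]. apply Lx. intros x [m ->]. apply Cross. }
  assert (Py : forall n, fst (snd (r n)) <= py <= snd (snd (r n))).
  { intros n. split; [apply Uy; exists n; reflexivity|]. apply Ly. intros x [m ->]. apply Cross. }
  destruct (H px py (Px O) (Py O)) as [l Hl].
  set (d := (x2 - x1) + (y2 - y1)).
  assert (Pd : 0 <= d) by (unfold d; lra).
  apply Rle_antisym; [|apply Cmod_ge_0]. apply Rnot_lt_le. intros Pos.
  set (J := Cmod (rectI f x1 x2 y1 y2)) in *.
  (* Makes 2 * eps * d^2 smaller than J; the added 1 keeps the quotient meaningful when the
     rectangle degenerates. *)
  set (eps := J / (4 * (d * d) + 1)).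
  assert (Pe : 0 < eps) by (apply Rdiv_lt_0_compat; nra).
  destruct (Hl eps Pe) as [dl [Dl Hdl]].
  (* Since n + 1 < 2^(n+1), the rectangle of rank n + 1 has half perimeter below [dl] and lies where
     differentiability gives the bound. *)
  destruct (nfloor_ex (d / dl)) as [n [_ Hn]]. { apply Rdiv_le_0_compat; lra. }
  destruct (Sz (S n)) as [S1 [S2 S3]].
  assert (P2 : d / 2 ^ S n < dl).
  { assert (Q : INR (S n) < 2 ^ S n).
    { apply INR_lt_pow2. }
    assert (Q2 : 0 < 2 ^ S n) by (apply pow_lt; lra).
    apply Rlt_div_l; [exact Q2|]. rewrite S_INR in Q.
    apply Rlt_div_l in Hn; [|exact Dl]. nra. }
  assert (P4 : 4 ^ S n = 2 ^ S n * 2 ^ S n) by (rewrite <- Rpow_mult_distr; f_equal; lra).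
  assert (Q2 : 0 < 2 ^ S n) by (apply pow_lt; lra).
  destruct (Ok (S n)) as [O1 [O2 O3]].
  assert (B := rectI_small f _ _ _ _ px py l eps O1 O2 O3 (Px (S n)) (Py (S n)) Pe).
  fold (rI f (r (S n))) in B. rewrite S1, S2 in B.
  assert (B' : Cmod (rI f (r (S n))) <= 2 * eps * ((x2 - x1) / 2 ^ S n + (y2 - y1) / 2 ^ S n) * ((x2 - x1) / 2 ^ S n + (y2 - y1) / 2 ^ S n)).
  { apply B. intros x y X Y. apply Hdl. eapply Rle_lt_trans; [apply Cmod_pt_sub|].
    eapply Rle_lt_trans; [|exact P2]. unfold d.
    replace ((x2 - x1 + (y2 - y1)) / 2 ^ S n) with ((x2 - x1) / 2 ^ S n + (y2 - y1) / 2 ^ S n) by (field; lra).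
    assert (Px' := Px (S n)). assert (Py' := Py (S n)).
    apply Rplus_le_compat; apply Rabs_le; lra. }
  change (rI f (r 0%nat)) with (rectI f x1 x2 y1 y2) in S3. fold J in S3.
  assert (F : J / 4 ^ S n <= 2 * eps * (d * d) / 4 ^ S n).
  { eapply Rle_trans; [exact S3|]. eapply Rle_trans; [exact B'|]. right. rewrite P4. unfold d. field. lra. }
  assert (P44 : 0 < 4 ^ S n) by (apply pow_lt; lra).
  apply Rmult_le_compat_r with (r := 4 ^ S n) in F; [|lra].
  replace (J / 4 ^ S n * 4 ^ S n) with J in F by (field; lra).
  replace (2 * eps * (d * d) / 4 ^ S n * 4 ^ S n) with (2 * eps * (d * d)) in F by (field; lra).
  assert (E : eps * (4 * (d * d) + 1) = J) by (unfold eps; field; nra).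
  assert (0 <= eps * (d * d)) by nra. nra.
Qed.

(** The corners of the rectangles used for the primitive come in any order; exchanging two of them
    only changes the sign of the contour integral. *)
Lemma goursat_signed f x1 x2 y1 y2 :
  diffR f (Rmin x1 x2) (Rmax x1 x2) (Rmin y1 y2) (Rmax y1 y2) -> rectI f x1 x2 y1 y2 = 0%C.
Proof.
  intros H.
  assert (Hh : forall y, Rmin y1 y2 <= y <= Rmax y1 y2 -> ccon (fun s => f (pt s y)) x1 x2).
  { intros y Y t T. destruct (H t y T Y) as [l Hl].
    eapply (Ccont_comp f (fun s => pt s y)); [exact Hl|]. eapply rderiv_Ccont, rderiv_pt_h. }
  assert (Hv : forall x, Rmin x1 x2 <= x <= Rmax x1 x2 -> ccon (fun s => f (pt x s)) y1 y2).
  { intros x X t T. destruct (H x t X T) as [l Hl].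
    eapply (Ccont_comp f (fun s => pt x s)); [exact Hl|]. eapply rderiv_Ccont, rderiv_pt_v. }
  assert (Ix := conj (Rmin_l x1 x2) (Rmax_l x1 x2)). assert (Ix' := conj (Rmin_r x1 x2) (Rmax_r x1 x2)).
  assert (Iy := conj (Rmin_l y1 y2) (Rmax_l y1 y2)). assert (Iy' := conj (Rmin_r y1 y2) (Rmax_r y1 y2)).
  assert (Sx : rectI f x2 x1 y1 y2 = (- rectI f x1 x2 y1 y2)%C).
  { unfold rectI. rewrite (CI_swap _ x1 x2) by auto. rewrite (CI_swap (fun s => f (pt s y2)) x1 x2) by auto. ring. }
  assert (Sy : rectI f x1 x2 y2 y1 = (- rectI f x1 x2 y1 y2)%C).
  { unfold rectI. rewrite (CI_swap _ y1 y2) by auto. rewrite (CI_swap (fun s => f (pt x1 s)) y1 y2) by auto. ring. }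
  assert (Sxy : rectI f x2 x1 y2 y1 = rectI f x1 x2 y1 y2).
  { unfold rectI. rewrite (CI_swap _ y1 y2) by auto. rewrite (CI_swap (fun s => f (pt x2 s)) y1 y2) by auto.
    rewrite (CI_swap _ x1 x2) by auto. rewrite (CI_swap (fun s => f (pt s y1)) x1 x2) by auto. ring. }
  assert (Opp : forall c, (- c)%C = 0%C -> c = 0%C).
  { intros c Hc. replace c with (- - c)%C by ring. rewrite Hc. ring. }
  destruct (Rle_dec x1 x2) as [Lx|Lx]; destruct (Rle_dec y1 y2) as [Ly|Ly].
  - rewrite Rmin_left, Rmax_right, (Rmin_left y1), (Rmax_right y1) in H by lra. apply goursat; assumption.
  - rewrite Rmin_left, Rmax_right, (Rmin_right y1), (Rmax_left y1) in H by lra.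
    apply Opp. rewrite <- Sy. apply goursat; try assumption; lra.
  - rewrite Rmin_right, Rmax_left, (Rmin_left y1), (Rmax_right y1) in H by lra.
    apply Opp. rewrite <- Sx. apply goursat; try assumption; lra.
  - rewrite Rmin_right, Rmax_left, (Rmin_right y1), (Rmax_left y1) in H by lra.
    rewrite <- Sxy. apply goursat; try assumption; lra.
Qed.

Lemma Cmod_pt_sqr a b : Cmod (pt a b) = sqrt (a ^ 2 + b ^ 2).
Proof. reflexivity. Qed.

Lemma Cmod_pt_mono a b a' b' : Rabs a <= Rabs a' -> Rabs b <= Rabs b' ->
  Cmod (pt a b) <= Cmod (pt a' b').
Proof.
  intros Ha Hb. rewrite !Cmod_pt_sqr. apply sqrt_le_1_alt.
  rewrite <- (pow2_abs a), <- (pow2_abs b), <- (pow2_abs a'), <- (pow2_abs b').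
  assert (P := Rabs_pos a). assert (Q := Rabs_pos b). nra.
Qed.

(** Integration along the real axis and then vertically: such a path stays in the disk and needs
    only rectangles for comparison. *)
Definition primi (f : C -> C) (z : C) : C :=
  (CI (fun s => f (pt s 0)) 0 (Re z) + Ci * CI (fun t => f (pt (Re z) t)) 0 (Im z))%C.

Lemma between_abs a t : Rmin 0 a <= t <= Rmax 0 a -> Rabs t <= Rabs a.
Proof.
  unfold Rmin, Rmax, Rabs. destruct Rle_dec; destruct (Rcase_abs t); destruct (Rcase_abs a); lra.
Qed.

Lemma between_abs2 a b t : Rmin a b <= t <= Rmax a b -> Rabs (t - a) <= Rabs (b - a).
Proof.
  unfold Rmin, Rmax, Rabs. destruct Rle_dec; destruct (Rcase_abs (t - a)); destruct (Rcase_abs (b - a)); lra.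
Qed.

Lemma Ccont_h f x y : (exists l, cderiv f (pt x y) l) -> Ccont (fun s => f (pt s y)) x.
Proof.
  intros [l Hl]. eapply (Ccont_comp f (fun s => pt s y)); [exact Hl|]. eapply rderiv_Ccont, rderiv_pt_h.
Qed.
Lemma Ccont_v f x y : (exists l, cderiv f (pt x y) l) -> Ccont (fun s => f (pt x s)) y.
Proof.
  intros [l Hl]. eapply (Ccont_comp f (fun s => pt x s)); [exact Hl|]. eapply rderiv_Ccont, rderiv_pt_v.
Qed.

Lemma Copp_inj_0 (a b : C) : (a - b)%C = 0%C -> a = b.
Proof. intros H. replace a with (a - b + b)%C by ring. rewrite H. ring. Qed.

Lemma primi_deriv f z : analytic_on_D f -> inD z -> cderiv (primi f) z (f z).
Proof.
  intros Hf Hz eps He.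
  assert (Hf' := proj1 (analytic_iff f) Hf).
  destruct (cderiv_continuous f z _ (analytic_cD f z Hf Hz) (eps / 2) ltac:(lra)) as [d [D Hd]].
  unfold inD in Hz.
  exists (Rmin (d / 2) ((1 - Cmod z) / 2)). split; [apply Rmin_glb_lt; lra|].
  intros w Hw.
  assert (W1 : Cmod (w - z)%C < d / 2) by (eapply Rlt_le_trans; [exact Hw|apply Rmin_l]).
  assert (W2 : Cmod (w - z)%C < (1 - Cmod z) / 2) by (eapply Rlt_le_trans; [exact Hw|apply Rmin_r]).
  set (x := Re z). set (y := Im z). set (x' := Re w). set (y' := Im w).
  assert (Ez : z = pt x y) by (destruct z; reflexivity).
  assert (Ew : w = pt x' y') by (destruct w; reflexivity).
  assert (Dx : Rabs (x' - x) <= Cmod (w - z)%C) by (unfold x, x'; rewrite <- Re_minus; apply re_le_Cmod).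
  assert (Dy : Rabs (y' - y) <= Cmod (w - z)%C) by (unfold y, y'; rewrite <- Im_minus; apply im_le_Cmod).
  assert (In0 : forall u v, Rabs (u - x) <= Rabs (x' - x) -> Rabs (v - y) <= Rabs (y' - y) -> Cmod (pt u v - z)%C < d /\ inD (pt u v)).
  { intros u v U V. assert (T := Cmod_pt_sub u v x y). rewrite <- Ez in T.
    assert (T2 := Cmod_le_plus (pt u v) z). unfold inD. split; lra. }
  assert (Inw : inD w). { unfold inD. assert (T2 := Cmod_le_plus w z). lra. }
  assert (Inm : inD (pt x' y)). { apply In0; [lra|]. rewrite Rminus_eq_0, Rabs_R0. apply Rabs_pos. }
  (* The disk is stable under shrinking the absolute values of the coordinates, which keeps all the
     paths and rectangles below inside it. *)
  assert (InL : forall p, inD p -> forall u v, Rabs u <= Rabs (Re p) -> Rabs v <= Rabs (Im p) -> inD (pt u v)).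
  { intros p Hp u v U V. unfold inD in *. eapply Rle_lt_trans; [|exact Hp].
    destruct p as [p1 p2]. apply (Cmod_pt_mono u v p1 p2); assumption. }
  assert (Hz' : inD z) by exact Hz.
  assert (K0 : ccon (fun s => f (pt s 0)) 0 x).
  { intros t T. apply Ccont_h, Hf'. apply (InL z Hz'); [apply between_abs, T|rewrite Rabs_R0; apply Rabs_pos]. }
  assert (K0' : ccon (fun s => f (pt s 0)) 0 x').
  { intros t T. apply Ccont_h, Hf'. apply (InL w Inw); [apply between_abs, T|rewrite Rabs_R0; apply Rabs_pos]. }
  assert (K1 : ccon (fun s => f (pt s 0)) x x').
  { intros t T. apply Ccont_h, Hf'.
    destruct (Rle_dec (Rabs t) (Rabs x)) as [L|L].
    - apply (InL z Hz'); [exact L|rewrite Rabs_R0; apply Rabs_pos].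
    - apply (InL w Inw); [|rewrite Rabs_R0; apply Rabs_pos].
      change (Re w) with x'. revert T L. clear. unfold Rmin, Rmax, Rabs.
      destruct Rle_dec; destruct (Rcase_abs t); destruct (Rcase_abs x); destruct (Rcase_abs x'); lra. }
  assert (K2 : ccon (fun t => f (pt x' t)) 0 y).
  { intros t T. apply Ccont_v, Hf'. apply (InL _ Inm); simpl; [lra|apply between_abs, T]. }
  assert (K3 : ccon (fun t => f (pt x' t)) y y').
  { intros t T. apply Ccont_v, Hf', In0; [lra|apply between_abs2, T]. }
  assert (K4 : ccon (fun s => f (pt s y)) x x').
  { intros t T. apply Ccont_h, Hf', In0; [apply between_abs2, T|]. rewrite Rminus_eq_0, Rabs_R0. apply Rabs_pos. }
  (* The paths leading to z and to w differ by this rectangle; once its contour integral vanishes,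
     the increment is an integral over two short segments near z. *)
  assert (Gr : rectI f x x' 0 y = 0%C).
  { apply goursat_signed. intros u v U V. apply Hf'.
    apply between_abs in V.
    destruct (Rle_dec (Rabs u) (Rabs x)) as [L|L].
    - apply (InL z Hz'); assumption.
    - apply (InL _ Inm); [|exact V]. simpl. revert U L. clear. unfold Rmin, Rmax, Rabs.
      destruct Rle_dec; destruct (Rcase_abs u); destruct (Rcase_abs x); destruct (Rcase_abs x'); lra. }
  assert (Inc : (primi f w - primi f z)%C = (CI (fun s => f (pt s y)) x x' + Ci * CI (fun t => f (pt x' t)) y y')%C).
  { unfold primi. fold x y x' y'. unfold rectI in Gr.
    rewrite <- (CI_Chasles (fun s => f (pt s 0)) 0 x x') by assumption.
    rewrite <- (CI_Chasles (fun s => f (pt x' s)) 0 y y') by assumption.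
    apply Copp_inj_0. rewrite <- Gr. ring. }
  rewrite Inc.
  replace (CI (fun s => f (pt s y)) x x' + Ci * CI (fun t => f (pt x' t)) y y' - f z * (w - z))%C
    with (CI (fun s => f (pt s y) - f z)%C x x' + Ci * CI (fun t => f (pt x' t) - f z)%C y y')%C.
  2:{ rewrite !CI_minus by (try assumption; intros t T; apply Ccont_const).
      rewrite !CI_const.
      replace (w - z)%C with (RtoC (x' - x) + Ci * RtoC (y' - y))%C.
      2:{ clearbody x y x' y'. rewrite Ez, Ew. apply injective_projections; simpl; ring. }
      ring. }
  eapply Rle_trans; [apply Cmod_triangle|]. rewrite Cmod_mult, Cmod_Ci.
  assert (B1 : Cmod (CI (fun s => f (pt s y) - f z)%C x x') <= eps / 2 * Rabs (x' - x)).
  { apply CI_bound. { intros t T. apply Ccont_minus; [apply K4, T|apply Ccont_const]. }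
    intros t T. left. apply Hd, In0; [apply between_abs2, T|]. rewrite Rminus_eq_0, Rabs_R0. apply Rabs_pos. }
  assert (B2 : Cmod (CI (fun t => f (pt x' t) - f z)%C y y') <= eps / 2 * Rabs (y' - y)).
  { apply CI_bound. { intros t T. apply Ccont_minus; [apply K3, T|apply Ccont_const]. }
    intros t T. left. apply Hd, In0; [lra|apply between_abs2, T]. }
  nra.
Qed.

Lemma mvt_seg (g : C -> C) (a b : C) (M : R) :
  (forall u, 0 <= u <= 1 -> exists l, cderiv g (a + RtoC u * (b - a))%C l /\ Cmod l <= M) ->
  Cmod (g b - g a)%C <= M * Cmod (b - a)%C.
Proof.
  intros H. set (y := fun u => g (a + RtoC u * (b - a))%C).
  assert (Hr : forall u, 0 <= u <= 1 -> exists l, rderiv y u (l * (b - a))%C /\ Cmod l <= M).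
  { intros u Hu. destruct (H u Hu) as [l [Hl B]]. exists l. split; [|exact B].
    apply (rderiv_comp g (fun u => a + RtoC u * (b - a))%C); [|exact Hl].
    apply rderiv_affine. intros s. rewrite RtoC_minus. ring. }
  assert (A := mvt_right y 0 1 (M * Cmod (b - a)%C)).
  assert (Y1 : y 1 = g b) by (unfold y; f_equal; ring).
  assert (Y0 : y 0 = g a) by (unfold y; f_equal; ring).
  rewrite Y1, Y0 in A.
  rewrite Rminus_0_r, Rmult_1_r in A. apply A; [lra| |].
  - intros t Ht. destruct (Hr t Ht) as [l [Hl _]]. eapply rderiv_Ccont, Hl.
  - intros u Hu eps He. destruct (Hr u ltac:(lra)) as [l [Hl B]].
    destruct (Hl eps He) as [d [D Hd]]. exists d. split; [exact D|]. intros s Hs.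
    assert (E : Rabs (s - u) = s - u) by (apply Rabs_right; lra).
    specialize (Hd s). rewrite E in Hd. specialize (Hd ltac:(lra)).
    assert (T := Cmod_triangle (y s - y u - l * (b - a) * RtoC (s - u))%C (l * (b - a) * RtoC (s - u))%C).
    replace (y s - y u - l * (b - a) * RtoC (s - u) + l * (b - a) * RtoC (s - u))%C with (y s - y u)%C in T by ring.
    rewrite !Cmod_mult, Cmod_R, E in T.
    assert (Cmod l * Cmod (b - a)%C <= M * Cmod (b - a)%C) by (apply Rmult_le_compat_r; [apply Cmod_ge_0|exact B]).
    nra.
Qed.

Definition E (t : R) : C := (cos t, sin t).

Lemma E_mod t : Cmod (E t) = 1.
Proof.
  unfold Cmod, E; simpl. rewrite !Rmult_1_r. assert (H := sin2_cos2 t). unfold Rsqr in H.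
  replace (cos t * cos t + sin t * sin t) with 1 by lra. apply sqrt_1.
Qed.

Lemma E_conj t : (Cconj (E t) * E t)%C = 1%C.
Proof.
  rewrite Cmult_comm. rewrite <- Cmod2_conj, E_mod. f_equal. ring.
Qed.

Lemma E_period t : E (t + 2 * PI) = E t.
Proof. unfold E. rewrite cos_plus, sin_plus, cos_2PI, sin_2PI. f_equal; ring. Qed.

Lemma E_2PI : E (2 * PI) = 1%C.
Proof. unfold E. rewrite cos_2PI, sin_2PI. reflexivity. Qed.
Lemma E_0 : E 0 = 1%C.
Proof. unfold E. rewrite cos_0, sin_0. reflexivity. Qed.

Lemma E_plus s t : E (s + t) = (E s * E t)%C.
Proof. unfold E, Cmult; simpl. rewrite cos_plus, sin_plus. f_equal; ring. Qed.

Lemma polar_E r t : polar r t = (RtoC r * E t)%C.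
Proof. unfold polar, E, RtoC, Cmult; simpl. f_equal; ring. Qed.

Lemma rderiv_parts (F : R -> C) (t : R) (l : C) :
  is_derive (fun s => Re (F s)) t (Re l) -> is_derive (fun s => Im (F s)) t (Im l) -> rderiv F t l.
Proof.
  intros H1 H2 eps He.
  assert (K : forall (f : R -> R) m, is_derive f t m -> exists d, 0 < d /\ forall s, Rabs (s - t) < d ->
     Rabs (f s - f t - m * (s - t)) <= eps / 2 * Rabs (s - t)).
  { intros f m [_ H]. specialize (H t (fun P HP => HP)).
    assert (He2 : 0 < eps / 2) by lra.
    destruct (H (mkposreal _ He2)) as [d Hd]. exists d. split; [apply cond_pos|].
    intros s Hs. specialize (Hd s Hs).
    change (Rabs (f s - f t - (s - t) * m) <= eps / 2 * Rabs (s - t)) in Hd.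
    rewrite (Rmult_comm m). exact Hd. }
  destruct (K _ _ H1) as [d1 [D1 E1]]. destruct (K _ _ H2) as [d2 [D2 E2]].
  exists (Rmin d1 d2). split; [apply Rmin_glb_lt; assumption|]. intros s Hs.
  specialize (E1 s (Rlt_le_trans _ _ _ Hs (Rmin_l _ _))).
  specialize (E2 s (Rlt_le_trans _ _ _ Hs (Rmin_r _ _))).
  eapply Rle_trans; [apply Cmod_le_sum|].
  replace (Re (F s - F t - l * RtoC (s - t))%C) with (Re (F s) - Re (F t) - Re l * (s - t))
    by (unfold Re; simpl; ring).
  replace (Im (F s - F t - l * RtoC (s - t))%C) with (Im (F s) - Im (F t) - Im l * (s - t))
    by (unfold Re, Im; simpl; ring).
  lra.
Qed.

Lemma rderiv_E t : rderiv E t (Ci * E t)%C.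
Proof.
  apply rderiv_parts; unfold E; simpl.
  - replace (0 * cos t - 1 * sin t) with (- sin t) by ring. apply is_derive_cos.
  - replace (0 * sin t + 1 * cos t) with (cos t) by ring. apply is_derive_sin.
Qed.

Lemma Ccont_E t : Ccont E t.
Proof. eapply rderiv_Ccont, rderiv_E. Qed.

Lemma rderiv_eq (f : R -> C) t a b : rderiv f t a -> a = b -> rderiv f t b.
Proof. intros H <-. exact H. Qed.

Lemma rderiv_plus (f g : R -> C) t a b : rderiv f t a -> rderiv g t b ->
  rderiv (fun s => f s + g s)%C t (a + b)%C.
Proof.
  intros Hf Hg. apply rderiv_parts; simpl.
  - apply (is_derive_plus (V := R_NormedModule) (fun s => Re (f s)) (fun s => Re (g s))); apply rderiv_Re; assumption.
  - apply (is_derive_plus (V := R_NormedModule) (fun s => Im (f s)) (fun s => Im (g s))); apply rderiv_Im; assumption.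
Qed.

Lemma rderiv_scal c (f : R -> C) t a : rderiv f t a -> rderiv (fun s => c * f s)%C t (c * a)%C.
Proof.
  intros H. assert (K := cderiv_scal c _ (f t) _ (cderiv_id _)).
  assert (L := rderiv_comp _ _ _ _ _ H K). simpl in L. eapply rderiv_eq; [exact L|ring].
Qed.

Lemma rderiv_ext (f g : R -> C) t a : (forall s, f s = g s) -> rderiv f t a -> rderiv g t a.
Proof.
  intros Hq H eps He. destruct (H eps He) as [d [D Hd]]. exists d. split; [exact D|].
  intros s Hs. rewrite <- !Hq. auto.
Qed.

Lemma rderiv_mult (f g : R -> C) t a b : rderiv f t a -> rderiv g t b ->
  rderiv (fun s => f s * g s)%C t (a * g t + f t * b)%C.
Proof.
  intros Hf Hg.
  assert (A := rderiv_comp _ _ _ _ _ (rderiv_plus _ _ _ _ _ Hf Hg) (cderiv_square _)).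
  assert (B := rderiv_comp _ _ _ _ _ (rderiv_plus _ _ _ _ _ Hf (rderiv_scal (-1)%C _ _ _ Hg)) (cderiv_square _)).
  assert (D := rderiv_scal (/ 4)%C _ _ _ (rderiv_plus _ _ _ _ _ A (rderiv_scal (-1)%C _ _ _ B))).
  simpl in D. eapply rderiv_eq.
  - eapply rderiv_ext; [|exact D]. intros s; simpl. field.
  - field.
Qed.

Lemma rderiv_RtoC (f : R -> R) t l : is_derive f t l -> rderiv (fun s => RtoC (f s)) t (RtoC l).
Proof.
  intros H. apply rderiv_parts; simpl; [exact H|]. apply (is_derive_const (V := R_NormedModule)).
Qed.

(** Compactness of the parameter interval makes the local radii uniform. The bound eps / 2 is used
    locally because two values are compared through the centre of a common cell. *)
Lemma unif_curve (f : C -> C) (p : R -> C) (a b : R) :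
  (forall t, a <= t <= b -> Ccont p t) ->
  (forall t, a <= t <= b -> forall eps, 0 < eps -> exists d, 0 < d /\ forall w, Cmod (w - p t)%C < d -> Cmod (f w - f (p t))%C < eps) ->
  (forall t, a <= t <= b -> inD (p t)) ->
  forall eps, 0 < eps -> exists d, 0 < d /\ forall t w, a <= t <= b -> Cmod (w - p t)%C < d ->
     inD w /\ Cmod (f w - f (p t))%C < eps.
Proof.
  intros Hp Hf Hin eps He.
  assert (X : forall t, exists dd : posreal, a <= t <= b -> forall s w, Rabs (s - t) < dd -> Cmod (w - p s)%C < dd ->
     inD w /\ Cmod (f w - f (p t))%C < eps / 2).
  { intros t. destruct (classic (a <= t <= b)) as [T|T].
    2:{ exists (mkposreal 1 Rlt_0_1). intros; contradiction. }
    destruct (Hf t T (eps / 2) ltac:(lra)) as [d [D Hd]].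
    assert (I := Hin t T). unfold inD in I.
    set (m := Rmin (d / 2) ((1 - Cmod (p t)) / 2)).
    assert (Pm : 0 < m) by (apply Rmin_glb_lt; lra).
    assert (m1 : m <= d / 2) by apply Rmin_l. assert (m2 : m <= (1 - Cmod (p t)) / 2) by apply Rmin_r.
    destruct (Hp t T m Pm) as [d' [D' Hd']].
    assert (P : 0 < Rmin m d') by (apply Rmin_glb_lt; lra).
    exists (mkposreal _ P). simpl. intros _ s w Hs Hw.
    assert (A := Hd' s (Rlt_le_trans _ _ _ Hs (Rmin_r _ _))).
    assert (B := Rlt_le_trans _ _ _ Hw (Rmin_l _ _)).
    assert (T1 := Cmod_tri_sub w (p s) (p t)). split.
    - unfold inD. assert (T2 := Cmod_le_plus w (p t)). lra.
    - apply Hd. lra. }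
  apply choice in X. destruct X as [dl Hdl].
  destruct (compactness_value_1d a b dl) as [d Hd].
  exists d. split; [apply cond_pos|]. intros t w T Hw.
  apply NNPP. intros N. apply (Hd t T). intros [s [S1 [S2 S3]]]. apply N.
  destruct (Hdl s S1 t w S2 ltac:(lra)) as [A B]. split; [exact A|].
  assert (Z : Cmod (p t - p t)%C < dl s).
  { replace (p t - p t)%C with (RtoC 0) by ring. rewrite Cmod_0. apply cond_pos. }
  destruct (Hdl s S1 t (p t) S2 Z) as [_ B'].
  assert (T1 := Cmod_tri_sub (f w) (f (p s)) (f (p t))). rewrite (Cmod_minus_sym (f (p s))) in T1. lra.
Qed.

Lemma PI2_pos : 0 < 2 * PI.
Proof. assert (H := PI_RGT_0). lra. Qed.

Lemma CI_bound' g M : ccon g 0 (2 * PI) ->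
  (forall t, 0 <= t <= 2 * PI -> Cmod (g t) <= M) -> Cmod (CI g 0 (2 * PI)) <= M * (2 * PI).
Proof.
  intros H HM. assert (P := PI2_pos).
  replace (M * (2 * PI)) with (M * Rabs (2 * PI - 0)) by (rewrite Rabs_right; lra).
  apply CI_bound; [exact H|]. rewrite Rmin_left, Rmax_right by lra. exact HM.
Qed.

(** Differentiation under the integral sign in the direction [v]. It is used with [v = E], for the
    radial derivative of a circle mean, and with [v = 1], for moving the centre. *)
Lemma dui (F f : C -> C) (c p v : R -> C) :
  (forall z, inD z -> cderiv F z (f z)) -> analytic_on_D f ->
  (forall t, Ccont p t) -> (forall t, Ccont c t) -> (forall t, Ccont v t) ->
  (forall t, inD (p t)) -> (forall t, Cmod (c t) <= 1) -> (forall t, Cmod (v t) <= 1) ->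
  forall eps, 0 < eps -> exists d, 0 < d /\ forall h : C, Cmod h < d ->
    Cmod (CI (fun t => c t * F (p t + h * v t))%C 0 (2 * PI) - CI (fun t => c t * F (p t))%C 0 (2 * PI)
          - h * CI (fun t => c t * (f (p t) * v t))%C 0 (2 * PI))%C <= eps * Cmod h.
Proof.
  intros HF Hf Hp Hc Hv Hin C1 V1 eps He. assert (PP := PI2_pos).
  destruct (unif_curve f p 0 (2 * PI)) with (eps := eps / (2 * PI)) as [d [D Hd]].
  { intros; apply Hp. }
  { intros t _. apply (cderiv_continuous f (p t) (cD f (p t))). apply analytic_cD; auto. }
  { auto. }
  { apply Rdiv_lt_0_compat; lra. }
  exists d. split; [exact D|]. intros h Hh.
  assert (Near : forall t u, 0 <= u <= 1 -> Cmod (p t + RtoC u * (h * v t) - p t)%C <= Cmod h).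
  { intros t u Hu. replace (p t + RtoC u * (h * v t) - p t)%C with (RtoC u * (h * v t))%C by ring.
    rewrite !Cmod_mult, Cmod_R, Rabs_right by lra.
    assert (A := Cmod_ge_0 h). assert (B := Cmod_ge_0 (v t)). specialize (V1 t).
    assert (Cmod h * Cmod (v t) <= Cmod h) by nra. assert (0 <= Cmod h * Cmod (v t)) by nra. nra. }
  assert (CF : forall t, 0 <= t <= 2 * PI -> Ccont (fun t => F (p t + h * v t))%C t).
  { intros t Ht. eapply (Ccont_comp F (fun t => p t + h * v t)%C).
    - apply HF. replace (p t + h * v t)%C with (p t + RtoC 1 * (h * v t))%C by ring.
      apply (Hd t); [exact Ht|]. eapply Rle_lt_trans; [apply Near; lra|exact Hh].
    - apply Ccont_plus; [apply Hp|]. apply Ccont_mult; [apply Ccont_const|apply Hv]. }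
  assert (CF0 : forall t, Ccont (fun t => F (p t)) t).
  { intros t. eapply Ccont_comp; [apply HF, Hin|apply Hp]. }
  assert (Cf0 : forall t, Ccont (fun t => f (p t)) t).
  { intros t. eapply Ccont_comp; [apply analytic_cD; auto|apply Hp]. }
  assert (K1 : ccon (fun t => c t * F (p t + h * v t))%C 0 (2 * PI)).
  { intros t Ht. rewrite Rmin_left, Rmax_right in Ht by lra. apply Ccont_mult; auto. }
  assert (K2 : ccon (fun t => c t * F (p t))%C 0 (2 * PI)) by (intros t Ht; apply Ccont_mult; auto).
  assert (K3 : ccon (fun t => c t * (f (p t) * v t))%C 0 (2 * PI)).
  { intros t Ht. apply Ccont_mult; [auto|]. apply Ccont_mult; auto. }
  assert (K12 : ccon (fun t => c t * F (p t + h * v t) - c t * F (p t))%C 0 (2 * PI)).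
  { intros t Ht. apply Ccont_minus; auto. }
  assert (K3' : ccon (fun t => h * (c t * (f (p t) * v t)))%C 0 (2 * PI)).
  { intros t Ht. apply Ccont_mult; [apply Ccont_const|auto]. }
  rewrite <- CI_scal by exact K3. rewrite <- CI_minus by assumption. rewrite <- CI_minus by assumption.
  replace (eps * Cmod h) with (eps / (2 * PI) * Cmod h * (2 * PI)) by (field; lra).
  apply CI_bound'. { intros t Ht. apply Ccont_minus; auto. }
  intros t Ht.
  replace (c t * F (p t + h * v t) - c t * F (p t) - h * (c t * (f (p t) * v t)))%C
    with (c t * ((F (p t + h * v t) - f (p t) * (p t + h * v t)) - (F (p t) - f (p t) * p t)))%C by ring.
  rewrite Cmod_mult.
  assert (M := mvt_seg (fun w => F w - f (p t) * w)%C (p t) (p t + h * v t)%C (eps / (2 * PI))).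
  replace (p t + h * v t - p t)%C with (h * v t)%C in M by ring.
  assert (M' : Cmod (F (p t + h * v t) - f (p t) * (p t + h * v t) - (F (p t) - f (p t) * p t))%C <= eps / (2 * PI) * Cmod (h * v t)%C).
  { apply M. intros u Hu.
    destruct (Hd t (p t + RtoC u * (h * v t))%C Ht) as [I B].
    { eapply Rle_lt_trans; [apply Near; exact Hu|exact Hh]. }
    exists (f (p t + RtoC u * (h * v t)) - f (p t))%C. split; [|lra].
    eapply cderiv_eq.
    - apply cderiv_minus; [apply HF, I|]. apply cderiv_scal, cderiv_id.
    - ring. }
  rewrite Cmod_mult in M'.
  assert (A := Cmod_ge_0 h). assert (B := Cmod_ge_0 (v t)). specialize (V1 t). specialize (C1 t).
  assert (G := Cmod_ge_0 (F (p t + h * v t) - f (p t) * (p t + h * v t) - (F (p t) - f (p t) * p t))%C).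
  assert (Q : 0 < eps / (2 * PI)) by (apply Rdiv_lt_0_compat; lra).
  assert (Cmod h * Cmod (v t) <= Cmod h) by nra.
  assert (eps / (2 * PI) * (Cmod h * Cmod (v t)) <= eps / (2 * PI) * Cmod h) by (apply Rmult_le_compat_l; lra).
  assert (H00 := Cmod_ge_0 (c t)). nra.
Qed.

Definition Ec (t : R) : C := Cconj (E t).
Lemma Ec_mod t : Cmod (Ec t) = 1.
Proof. unfold Ec. rewrite Cmod_conj. apply E_mod. Qed.
Lemma Ccont_Ec t : Ccont Ec t.
Proof. apply Ccont_conj, Ccont_E. Qed.
Lemma Ec_E t : (Ec t * E t)%C = 1%C.
Proof. apply E_conj. Qed.

Lemma rderiv_Ec t : rderiv Ec t (- Ci * Ec t)%C.
Proof.
  apply rderiv_parts; unfold Ec, E; simpl.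
  - replace (- 0 * cos t - - (1) * - sin t) with (- sin t) by ring. apply is_derive_cos.
  - replace (- 0 * - sin t + - (1) * cos t) with (- cos t) by ring.
    apply (is_derive_opp (V := R_NormedModule)), is_derive_sin.
Qed.

(** * Circle means, Cauchy's formula and the Cauchy estimates *)

Section Means.
Variables (f : C -> C) (z : C).
Hypothesis Hf : analytic_on_D f.
Hypothesis Hz : inD z.
Let F := primi f.

Lemma circ_in s t : 0 <= s < 1 - Cmod z -> inD (z + RtoC s * E t)%C.
Proof.
  intros Hs. unfold inD. eapply Rle_lt_trans; [apply Cmod_triangle|].
  rewrite Cmod_mult, Cmod_R, E_mod, Rabs_right; lra.
Qed.

Lemma circ_cont s t : Ccont (fun t => z + RtoC s * E t)%C t.
Proof. apply Ccont_plus; [apply Ccont_const|]. apply Ccont_mult; [apply Ccont_const|apply Ccont_E]. Qed.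

Lemma fcirc_cont s t : 0 <= s < 1 - Cmod z -> Ccont (fun t => f (z + RtoC s * E t)%C) t.
Proof.
  intros Hs. eapply (Ccont_comp f); [|apply circ_cont].
  apply analytic_cD; [exact Hf|]. apply circ_in, Hs.
Qed.

(** The two relations M = s N and M' = N force M / s, that is N, to have derivative zero; this is
    the mean value property before s tends to 0. *)
Let M (s : R) : C := CI (fun t => Ec t * F (z + RtoC s * E t))%C 0 (2 * PI).
Let N (s : R) : C := CI (fun t => f (z + RtoC s * E t))%C 0 (2 * PI).

(** The t-derivative of e^(-it) F(z + s e^(it)) is i s f(z + s e^(it)) - i e^(-it) F(z + s e^(it)),
    and it integrates to zero over a period. *)
Lemma circ_M_N s : 0 <= s < 1 - Cmod z -> M s = (RtoC s * N s)%C.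
Proof.
  intros Hs. unfold M, N.
  assert (CF : forall t, Ccont (fun t => F (z + RtoC s * E t)%C) t).
  { intros t. eapply (Ccont_comp F); [|apply circ_cont]. apply primi_deriv; [exact Hf|apply circ_in, Hs]. }
  assert (Cf : forall t, Ccont (fun t => f (z + RtoC s * E t)%C) t) by (intros; apply fcirc_cont, Hs).
  set (P := fun t => (Ec t * F (z + RtoC s * E t))%C).
  assert (D : forall t, rderiv P t (Ci * (RtoC s * f (z + RtoC s * E t)) - Ci * (Ec t * F (z + RtoC s * E t)))%C).
  { intros t. unfold P. eapply rderiv_eq.
    - apply rderiv_mult; [apply rderiv_Ec|].
      apply (rderiv_comp F (fun t => z + RtoC s * E t)%C).
      + apply (rderiv_plus (fun _ => z) (fun t => RtoC s * E t)%C t 0%C).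
        * apply rderiv_affine. intros; ring.
        * apply rderiv_scal, rderiv_E.
      + apply primi_deriv; [exact Hf|apply circ_in, Hs].
    - replace (Ec t * (f (z + RtoC s * E t) * (0 + RtoC s * (Ci * E t))))%C
        with (RtoC s * f (z + RtoC s * E t) * Ci * (Ec t * E t))%C by ring.
      rewrite Ec_E. ring. }
  assert (K1 : ccon (fun t => RtoC s * f (z + RtoC s * E t))%C 0 (2 * PI)).
  { intros t _. apply Ccont_mult; [apply Ccont_const|apply Cf]. }
  assert (K2 : ccon (fun t => Ec t * F (z + RtoC s * E t))%C 0 (2 * PI)).
  { intros t _. apply Ccont_mult; [apply Ccont_Ec|apply CF]. }
  assert (I := CI_FTC P _ 0 (2 * PI) (fun t _ => D t)).
  assert (K1' : ccon (fun t => Ci * (RtoC s * f (z + RtoC s * E t)))%C 0 (2 * PI)).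
  { intros t T. apply Ccont_mult; [apply Ccont_const|apply K1, T]. }
  assert (K2' : ccon (fun t => Ci * (Ec t * F (z + RtoC s * E t)))%C 0 (2 * PI)).
  { intros t T. apply Ccont_mult; [apply Ccont_const|apply K2, T]. }
  rewrite CI_minus in I by assumption. rewrite !CI_scal in I; try assumption.
  2:{ intros t _. apply Cf. }
  assert (P0 : (P (2 * PI)%R - P 0%R)%C = 0%C).
  { unfold P, Ec. rewrite E_2PI, E_0. ring. }
  rewrite P0 in I. specialize (I ltac:(intros t T; apply Ccont_minus; auto)).
  set (X := CI (fun t => f (z + RtoC s * E t)%C) 0 (2 * PI)) in *.
  set (Y := CI (fun t => Ec t * F (z + RtoC s * E t))%C 0 (2 * PI)) in *.
  assert (CC : (Ci * Ci)%C = (-1)%C) by (apply injective_projections; simpl; ring).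
  symmetry. apply Copp_inj_0. change (CI P 0 (2 * PI)) with Y.
  replace (RtoC s * X - Y)%C with (- Ci * (Ci * (RtoC s * X) - Ci * Y) + (1 + Ci * Ci) * (RtoC s * X - Y))%C by ring.
  rewrite I, CC. ring.
Qed.

Lemma circ_M_deriv s : 0 <= s < 1 - Cmod z -> rderiv M s (N s).
Proof.
  intros Hs eps He.
  destruct (dui F f Ec (fun t => z + RtoC s * E t)%C E) with (eps := eps) as [d [D Hd]]; try assumption.
  - intros w Hw. apply primi_deriv; assumption.
  - intros; apply circ_cont.
  - apply Ccont_Ec.
  - apply Ccont_E.
  - intros; apply circ_in, Hs.
  - intros t. rewrite Ec_mod. lra.
  - intros t. rewrite E_mod. lra.
  - exists d. split; [exact D|]. intros u Hu. specialize (Hd (RtoC (u - s))).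
    rewrite Cmod_R in Hd. specialize (Hd Hu).
    rewrite (CI_ext (fun t : R => Ec t * (f (z + s * E t) * E t))%C (fun t => f (z + s * E t)%C)) in Hd.
    2:{ intros t _. replace (Ec t * (f (z + s * E t) * E t))%C with (f (z + s * E t) * (Ec t * E t))%C by ring.
        rewrite Ec_E. ring. }
    rewrite (CI_ext (fun t : R => Ec t * F (z + s * E t + (u - s)%R * E t))%C (fun t => Ec t * F (z + u * E t))%C) in Hd.
    2:{ intros t _. f_equal. f_equal. rewrite RtoC_minus. ring. }
    fold (N s) in Hd. fold (M s) in Hd. fold (M u) in Hd.
    rewrite (Cmult_comm (N s)). exact Hd.
Qed.

Lemma circ_N_const s0 s : 0 < s0 <= s -> s < 1 - Cmod z -> N s = N s0.
Proof.
  intros H0 Hs.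
  set (y := fun u => (RtoC (/ u) * M u)%C).
  assert (Y : forall u, s0 <= u <= s -> y u = N u).
  { intros u Hu. unfold y. rewrite circ_M_N by lra. rewrite RtoC_inv by lra. field.
    intro Q. apply (f_equal fst) in Q. simpl in Q. lra. }
  rewrite <- (Y s), <- (Y s0) by lra.
  assert (D : forall u, s0 <= u <= s -> rderiv y u 0%C).
  { intros u Hu. unfold y. eapply rderiv_eq.
    - apply rderiv_mult; [|apply circ_M_deriv; lra].
      apply rderiv_RtoC. apply (is_derive_inv (fun x => x) u 1); [apply (is_derive_id (K := R_AbsRing))|lra].
    - rewrite circ_M_N by lra. rewrite RtoC_div, RtoC_opp, RtoC_inv, RtoC_pow by (try lra; apply pow_nonzero; lra).
      field. intro Q. apply (f_equal fst) in Q. simpl in Q. lra. }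
  apply Copp_inj_0, Cmod_eq_0, Rle_antisym; [|apply Cmod_ge_0].
  replace 0 with (0 * (s - s0)) by ring.
  apply mvt_right; [lra| |].
  - intros t Ht. eapply rderiv_Ccont, D, Ht.
  - intros u Hu eps He. destruct (D u ltac:(lra) eps He) as [d [Dd Hd]]. exists d. split; [exact Dd|].
    intros t Ht. specialize (Hd t). rewrite Rabs_right in Hd by lra. specialize (Hd ltac:(lra)).
    replace (y t - y u - 0 * RtoC (t - u))%C with (y t - y u)%C in Hd by ring. lra.
Qed.

Lemma mean_value s : 0 <= s < 1 - Cmod z ->
  CI (fun t => f (z + RtoC s * E t))%C 0 (2 * PI) = (RtoC (2 * PI) * f z)%C.
Proof.
  intros Hs. assert (PP := PI2_pos).
  destruct (Req_dec s 0) as [->|Ns].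
  { rewrite (CI_ext _ (fun _ => f z)) by (intros t _; f_equal; ring). rewrite CI_const, Rminus_0_r. ring. }
  apply Copp_inj_0, Cmod_eq_0, Rle_antisym; [|apply Cmod_ge_0].
  apply Rnot_lt_le. intros Pos. fold (N s) in *.
  set (m := Cmod (N s - (2 * PI)%R * f z)%C) in *.
  destruct (cderiv_continuous f z _ (analytic_cD f z Hf Hz) (m / 2 / (2 * PI))) as [d [D Hd]].
  { apply Rdiv_lt_0_compat; lra. }
  (* The mean is unchanged on a small circle, where continuity of f compares it with f z. *)
  set (s0 := Rmin s (d / 2)).
  assert (P0 : 0 < s0) by (apply Rmin_glb_lt; lra).
  assert (A := Rmin_l s (d / 2)). assert (B := Rmin_r s (d / 2)). fold s0 in A, B.
  assert (Bd : Cmod (N s - (2 * PI)%R * f z)%C <= m / 2 / (2 * PI) * (2 * PI)).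
  { rewrite (circ_N_const s0 s) by lra. unfold N.
    replace ((2 * PI)%R * f z)%C with (CI (fun _ => f z) 0 (2 * PI)) by (rewrite CI_const, Rminus_0_r; ring).
    rewrite <- CI_minus.
    - apply CI_bound'.
      + intros t _. apply Ccont_minus; [apply fcirc_cont; lra|apply Ccont_const].
      + intros t _. left. apply Hd. replace (z + s0 * E t - z)%C with (s0 * E t)%C by ring.
        rewrite Cmod_mult, E_mod, Cmod_R, Rabs_right; lra.
    - intros t _. apply fcirc_cont; lra.
    - intros t _. apply Ccont_const. }
  fold m in Bd. replace (m / 2 / (2 * PI) * (2 * PI)) with (m / 2) in Bd by (field; assert (Q := PI_RGT_0); lra).
  lra.
Qed.

End Means.

(** As a function of the centre w, the integral of e^(-it) F(w + s e^(it)) equals 2 pi s f(w) near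
    z. Differentiating both expressions at z gives the formula. *)
Lemma cauchy_deriv (f : C -> C) (z : C) (s : R) : analytic_on_D f -> inD z -> 0 < s < 1 - Cmod z ->
  CI (fun t => Ec t * f (z + RtoC s * E t))%C 0 (2 * PI) = (RtoC (2 * PI) * RtoC s * cD f z)%C.
Proof.
  intros Hf Hz Hs.
  set (F := primi f).
  assert (A : cderiv (fun w => RtoC (2 * PI) * RtoC s * f w)%C z (RtoC (2 * PI) * RtoC s * cD f z)%C).
  { apply cderiv_scal, analytic_cD; assumption. }
  assert (B : cderiv (fun w => CI (fun t => Ec t * F (w + RtoC s * E t))%C 0 (2 * PI)) z
     (CI (fun t => Ec t * f (z + RtoC s * E t))%C 0 (2 * PI))).
  { intros eps He.
    destruct (dui F f Ec (fun t => z + RtoC s * E t)%C (fun _ => 1%C)) with (eps := eps) as [d [D Hd]]; try assumption.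
    - intros w Hw. apply primi_deriv; assumption.
    - intros; apply circ_cont.
    - apply Ccont_Ec.
    - intros; apply Ccont_const.
    - intros; apply circ_in; lra.
    - intros t. rewrite Ec_mod. lra.
    - intros t. rewrite Cmod_1. lra.
    - exists d. split; [exact D|]. intros w Hw. specialize (Hd (w - z)%C Hw).
      rewrite (CI_ext (fun t : R => Ec t * (f (z + s * E t) * 1))%C (fun t => Ec t * f (z + s * E t))%C) in Hd
        by (intros t _; ring).
      rewrite (CI_ext (fun t : R => Ec t * F (z + s * E t + (w - z) * 1))%C (fun t => Ec t * F (w + s * E t))%C) in Hd.
      2:{ intros t _. f_equal. f_equal. ring. }
      rewrite (Cmult_comm (CI (fun t : R => Ec t * f (z + s * E t))%C 0 (2 * PI))). exact Hd. }
  apply (cderiv_unique _ _ _ _ B).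
  apply (cderiv_local (fun w => RtoC (2 * PI) * RtoC s * f w)%C _ z _ (1 - Cmod z - s)); [lra| |exact A].
  intros w Hw. assert (T := Cmod_le_plus w z).
  assert (Hw' : inD w) by (unfold inD; lra).
  assert (X := circ_M_N f w Hf s). unfold F in *. rewrite X by lra.
  rewrite (mean_value f w Hf Hw' s) by lra. ring.
Qed.

Lemma cauchy_est (f : C -> C) (z : C) (s B : R) : analytic_on_D f -> 0 < s < 1 - Cmod z ->
  (forall w, Cmod (w - z)%C <= s -> Cmod (f w) <= B) -> Cmod (cD f z) <= B / s.
Proof.
  intros Hf Hs HB. assert (PP := PI2_pos).
  assert (Hz : inD z) by (unfold inD; lra).
  assert (X := cauchy_deriv f z s Hf Hz Hs).
  assert (Y : Cmod (CI (fun t => Ec t * f (z + RtoC s * E t))%C 0 (2 * PI)) <= B * (2 * PI)).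
  { apply CI_bound'.
    - intros t _. apply Ccont_mult; [apply Ccont_Ec|apply fcirc_cont; auto; lra].
    - intros t _. rewrite Cmod_mult, Ec_mod, Rmult_1_l. apply HB.
      replace (z + s * E t - z)%C with (s * E t)%C by ring.
      rewrite Cmod_mult, E_mod, Cmod_R, Rabs_right; lra. }
  rewrite X, !Cmod_mult, !Cmod_R, !Rabs_right in Y by lra.
  apply Rle_div_r; [lra|]. apply Rmult_le_reg_l with (2 * PI); lra.
Qed.

Lemma cauchy_lip (f : C -> C) (z w : C) (s B : R) : analytic_on_D f -> 0 < s -> s < 1 - Cmod z ->
  (forall u, Cmod (u - z)%C <= s -> Cmod (f u) <= B) -> Cmod (w - z)%C <= s / 2 ->
  Cmod (f w - f z)%C <= 2 * B / s * Cmod (w - z)%C.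
Proof.
  intros Hf Hs0 Hs HB Hw. apply mvt_seg. intros u Hu.
  set (p := (z + RtoC u * (w - z))%C).
  assert (Np : Cmod (p - z)%C <= s / 2).
  { unfold p. replace (z + RtoC u * (w - z) - z)%C with (RtoC u * (w - z))%C by ring.
    rewrite Cmod_mult, Cmod_R, Rabs_right by lra. assert (Q := Cmod_ge_0 (w - z)%C). nra. }
  assert (T := Cmod_le_plus p z).
  exists (cD f p). split; [apply analytic_cD; [exact Hf|unfold inD; lra]|].
  replace (2 * B / s) with (B / (s / 2)) by (field; lra).
  apply cauchy_est; [exact Hf|lra|]. intros v Hv. apply HB.
  assert (T2 := Cmod_tri_sub v p z). lra.
Qed.

(** The two derivatives are written by Cauchy's formula on circles of the same radius s / 2, so that
    f is only compared at points differing by w - z. *)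
Lemma cauchy_lip_deriv (f : C -> C) (z w : C) (s B : R) : analytic_on_D f -> 0 < s -> s < 1 - Cmod z ->
  (forall u, Cmod (u - z)%C <= s -> Cmod (f u) <= B) -> Cmod (w - z)%C <= s / 4 ->
  Cmod (cD f w - cD f z)%C <= 8 * B / (s * s) * Cmod (w - z)%C.
Proof.
  intros Hf Hs0 Hs HB Hw. assert (PP := PI2_pos).
  assert (Tw := Cmod_le_plus w z).
  assert (Iz : inD z) by (unfold inD; lra). assert (Iw : inD w) by (unfold inD; lra).
  assert (Xz := cauchy_deriv f z (s / 2) Hf Iz ltac:(lra)).
  assert (Xw := cauchy_deriv f w (s / 2) Hf Iw ltac:(lra)).
  assert (Cz : ccon (fun t => Ec t * f (z + RtoC (s / 2) * E t))%C 0 (2 * PI)).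
  { intros t _. apply Ccont_mult; [apply Ccont_Ec|apply fcirc_cont; auto; lra]. }
  assert (Cw : ccon (fun t => Ec t * f (w + RtoC (s / 2) * E t))%C 0 (2 * PI)).
  { intros t _. apply Ccont_mult; [apply Ccont_Ec|apply fcirc_cont; auto; lra]. }
  assert (Y : Cmod (CI (fun t => Ec t * f (w + RtoC (s / 2) * E t) - Ec t * f (z + RtoC (s / 2) * E t))%C 0 (2 * PI))
     <= 4 * B / s * Cmod (w - z)%C * (2 * PI)).
  { apply CI_bound'; [intros t T; apply Ccont_minus; auto|]. intros t _.
    replace (Ec t * f (w + RtoC (s / 2) * E t) - Ec t * f (z + RtoC (s / 2) * E t))%C
      with (Ec t * (f (w + RtoC (s / 2) * E t) - f (z + RtoC (s / 2) * E t)))%C by ring.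
    rewrite Cmod_mult, Ec_mod, Rmult_1_l.
    replace (w - z)%C with ((w + RtoC (s / 2) * E t) - (z + RtoC (s / 2) * E t))%C by ring.
    apply mvt_seg. intros u Hu.
    set (p := (z + (s / 2)%R * E t + u * (w + (s / 2)%R * E t - (z + (s / 2)%R * E t)))%C).
    assert (Np : Cmod (p - z)%C <= 3 * s / 4).
    { unfold p. replace (z + (s / 2)%R * E t + u * (w + (s / 2)%R * E t - (z + (s / 2)%R * E t)) - z)%C
        with ((s / 2)%R * E t + u * (w - z))%C by ring.
      eapply Rle_trans; [apply Cmod_triangle|]. rewrite !Cmod_mult, !Cmod_R, E_mod, !Rabs_right by lra.
      assert (Q := Cmod_ge_0 (w - z)%C). nra. }
    assert (T := Cmod_le_plus p z).
    exists (cD f p). split; [apply analytic_cD; [exact Hf|unfold inD; lra]|].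
    replace (4 * B / s) with (B / (s / 4)) by (field; lra).
    apply cauchy_est; [exact Hf|lra|]. intros v Hv. apply HB.
    assert (T2 := Cmod_tri_sub v p z). lra. }
  rewrite CI_minus, Xz, Xw in Y by assumption.
  replace ((2 * PI)%R * (s / 2)%R * cD f w - (2 * PI)%R * (s / 2)%R * cD f z)%C
    with ((2 * PI)%R * (s / 2)%R * (cD f w - cD f z))%C in Y by ring.
  rewrite !Cmod_mult, !Cmod_R, !Rabs_right in Y by lra.
  apply Rmult_le_reg_l with (2 * PI * (s / 2)); [nra|]. eapply Rle_trans; [exact Y|].
  right. field. lra.
Qed.

Lemma cauchy_second (f : C -> C) (z w : C) (s B : R) : analytic_on_D f -> 0 < s -> s < 1 - Cmod z ->
  (forall u, Cmod (u - z)%C <= s -> Cmod (f u) <= B) -> Cmod (w - z)%C <= s / 4 ->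
  Cmod (f w - f z - cD f z * (w - z))%C <= 8 * B / (s * s) * (Cmod (w - z)%C * Cmod (w - z)%C).
Proof.
  intros Hf Hs0 Hs HB Hw.
  assert (PB : 0 <= B).
  { eapply Rle_trans; [apply (Cmod_ge_0 (f z))|apply HB].
    replace (z - z)%C with (RtoC 0) by ring. rewrite Cmod_0. lra. }
  assert (M := mvt_seg (fun x => f x - cD f z * x)%C z w (8 * B / (s * s) * Cmod (w - z)%C)).
  replace (f w - f z - cD f z * (w - z))%C with (f w - cD f z * w - (f z - cD f z * z))%C by ring.
  rewrite <- Rmult_assoc. apply M. intros u Hu.
  set (p := (z + RtoC u * (w - z))%C).
  assert (Np : Cmod (p - z)%C <= Cmod (w - z)%C).
  { unfold p. replace (z + RtoC u * (w - z) - z)%C with (RtoC u * (w - z))%C by ring.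
    rewrite Cmod_mult, Cmod_R, Rabs_right by lra. assert (Q := Cmod_ge_0 (w - z)%C). nra. }
  assert (T := Cmod_le_plus p z).
  exists (cD f p - cD f z)%C. split.
  - eapply cderiv_eq.
    + apply cderiv_minus; [apply analytic_cD; [exact Hf|unfold inD; lra]|]. apply cderiv_scal, cderiv_id.
    + ring.
  - eapply Rle_trans; [apply (cauchy_lip_deriv f z p s B); auto; lra|].
    apply Rmult_le_compat_l; [|exact Np]. apply Rdiv_le_0_compat; nra.
Qed.

(** * Positive real part and self-maps of the disk *)

Definition posr (K : C -> C) : Prop :=
  analytic_on_D K /\ forall z, inD z -> 0 <= Re (K z).

Lemma inD_0 : inD 0%C.
Proof. unfold inD. rewrite Cmod_0. lra. Qed.

Lemma Cmod_sq (c : C) : Cmod c * Cmod c = Re c * Re c + Im c * Im c.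
Proof. assert (H := Cmod2_alt c). simpl in H. lra. Qed.

Lemma CI_conj g a b : ccon g a b -> CI (fun t => Cconj (g t)) a b = Cconj (CI g a b).
Proof.
  intros H. unfold CI, Cconj; simpl. f_equal.
  apply (is_RInt_unique (V := R_CompleteNormedModule)).
  apply (is_RInt_opp (V := R_NormedModule) (fun t => Im (g t))).
  apply (RInt_correct (V := R_CompleteNormedModule)), ccon_exIm, H.
Qed.

Lemma le_scale_limit a b : (forall s, 0 < s < 1 -> s * a <= b) -> a <= b.
Proof.
  intros H. apply Rnot_lt_le. intros L.
  destruct (Rle_dec a 0) as [N|P].
  - specialize (H (1 / 2) ltac:(lra)). assert (G := H). nra.
  - assert (Pa : 0 < a) by lra.
    destruct (Rle_dec b 0) as [Nb|Pb].
    + specialize (H (1 / 2) ltac:(lra)). lra.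
    + specialize (H ((1 + b / a) / 2)).
      assert (Q : 0 < b / a < 1). { split; [apply Rdiv_lt_0_compat; lra|]. apply Rlt_div_l; lra. }
      specialize (H ltac:(lra)).
      replace ((1 + b / a) / 2 * a) with ((a + b) / 2) in H by (field; lra). lra.
Qed.

Lemma analytic_mult f g : analytic_on_D f -> analytic_on_D g -> analytic_on_D (fun z => f z * g z)%C.
Proof.
  intros Hf Hg. eapply analytic_of. intros z Hz.
  exact (cderiv_mult f g z _ _ (analytic_cD f z Hf Hz) (analytic_cD g z Hg Hz)).
Qed.

Lemma analytic_plus f g : analytic_on_D f -> analytic_on_D g -> analytic_on_D (fun z => f z + g z)%C.
Proof.
  intros Hf Hg. eapply analytic_of. intros z Hz.
  exact (cderiv_plus f g z _ _ (analytic_cD f z Hf Hz) (analytic_cD g z Hg Hz)).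
Qed.

Lemma analytic_minus f g : analytic_on_D f -> analytic_on_D g -> analytic_on_D (fun z => f z - g z)%C.
Proof.
  intros Hf Hg. eapply analytic_of. intros z Hz.
  exact (cderiv_minus f g z _ _ (analytic_cD f z Hf Hz) (analytic_cD g z Hg Hz)).
Qed.

Lemma analytic_scal c f : analytic_on_D f -> analytic_on_D (fun z => c * f z)%C.
Proof.
  intros Hf. eapply analytic_of. intros z Hz. exact (cderiv_scal c f z _ (analytic_cD f z Hf Hz)).
Qed.

Lemma analytic_const c : analytic_on_D (fun _ => c).
Proof. eapply analytic_of. intros z Hz. apply cderiv_const. Qed.

Lemma analytic_id : analytic_on_D (fun z => z).
Proof. eapply analytic_of. intros z Hz. apply cderiv_id. Qed.

Lemma analytic_div f g : analytic_on_D f -> analytic_on_D g -> (forall z, inD z -> g z <> 0%C) ->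
  analytic_on_D (fun z => f z / g z)%C.
Proof.
  intros Hf Hg N. eapply analytic_of. intros z Hz.
  exact (cderiv_div f g z _ _ (analytic_cD f z Hf Hz) (analytic_cD g z Hg Hz) (N z Hz)).
Qed.

Lemma analytic_comp f g : analytic_on_D f -> analytic_on_D g -> (forall z, inD z -> inD (g z)) ->
  analytic_on_D (fun z => f (g z)).
Proof.
  intros Hf Hg N. eapply analytic_of. intros z Hz.
  exact (cderiv_comp f g z _ _ (analytic_cD g z Hg Hz) (analytic_cD f _ Hf (N z Hz))).
Qed.

(** The mean of e^(it) K vanishes. Adding its conjugate to Cauchy's formula for K'(0) replaces K by
    2 Re K, whose modulus has a computable mean because it is nonnegative. *)
Lemma pos_deriv0 K : posr K -> Cmod (cD K 0) <= 2 * Re (K 0%C).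
Proof.
  intros [HK Hp]. assert (PP := PI2_pos). apply le_scale_limit. intros s Hs.
  assert (H0 := inD_0).
  assert (S1 : 0 <= s < 1 - Cmod 0) by (rewrite Cmod_0; lra).
  assert (Kc : forall t, Ccont (fun t => K (0 + RtoC s * E t)%C) t) by (intros t; apply fcirc_cont; assumption).
  assert (A := cauchy_deriv K 0%C s HK H0 ltac:(rewrite Cmod_0; lra)).
  assert (B := mean_value (fun w => w * K w)%C 0%C (analytic_mult _ _ analytic_id HK) H0 s S1).
  simpl in B.
  rewrite (CI_ext _ (fun t => RtoC s * (E t * K (0 + RtoC s * E t)))%C) in B by (intros t _; ring).
  assert (KE : ccon (fun t => E t * K (0 + RtoC s * E t))%C 0 (2 * PI)).
  { intros t _. apply Ccont_mult; [apply Ccont_E|apply Kc]. }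
  rewrite CI_scal in B by exact KE.
  assert (B' : CI (fun t => E t * K (0 + RtoC s * E t))%C 0 (2 * PI) = 0%C).
  { assert (Ns : RtoC s <> 0%C) by (intro Q; apply (f_equal fst) in Q; simpl in Q; lra).
    replace (CI (fun t => E t * K (0 + RtoC s * E t))%C 0 (2 * PI))
      with (/ RtoC s * (RtoC s * CI (fun t => E t * K (0 + RtoC s * E t))%C 0 (2 * PI)))%C by (field; exact Ns).
    rewrite B. ring. }
  assert (B2 := CI_conj _ _ _ KE). rewrite B' in B2.
  assert (KEc : ccon (fun t => Ec t * K (0 + RtoC s * E t))%C 0 (2 * PI)).
  { intros t _. apply Ccont_mult; [apply Ccont_Ec|apply Kc]. }
  assert (KEc2 : ccon (fun t => Cconj (E t * K (0 + RtoC s * E t))%C) 0 (2 * PI)).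
  { intros t T. apply Ccont_conj, KE, T. }
  assert (Sm : (RtoC (2 * PI) * RtoC s * cD K 0)%C =
     CI (fun t => Ec t * K (0 + RtoC s * E t) + Cconj (E t * K (0 + RtoC s * E t)))%C 0 (2 * PI)).
  { rewrite CI_plus by assumption. rewrite A, B2.
    replace (Cconj 0) with (RtoC 0) by (apply injective_projections; simpl; ring). ring. }
  assert (Kcon : ccon (fun t => K (0 + RtoC s * E t)%C) 0 (2 * PI)) by (intros t _; apply Kc).
  assert (MV := mean_value K 0%C HK H0 s S1).
  assert (Nm : Cmod (RtoC (2 * PI) * RtoC s * cD K 0)%C <= RInt (fun t => 2 * Re (K (0 + RtoC s * E t)%C)) 0 (2 * PI)).
  { rewrite Sm. apply CI_norm; [lra| | |].
    - intros t T. apply Ccont_plus; auto.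
    - apply (ex_RInt_scal (V := R_NormedModule) (fun t => Re (K (0 + RtoC s * E t)%C)) 0 (2 * PI) 2).
      apply (ccon_exRe _ _ _ Kcon).
    - intros t _. rewrite Cmult_conj. fold (Ec t).
      replace (Ec t * K (0 + RtoC s * E t) + Ec t * Cconj (K (0 + RtoC s * E t)))%C
        with (Ec t * RtoC (2 * Re (K (0 + RtoC s * E t)%C)))%C.
      2:{ set (k := K (0 + RtoC s * E t)%C). destruct k as [x y].
          apply injective_projections; simpl; ring. }
      rewrite Cmod_mult, Ec_mod, Cmod_R, Rmult_1_l, Rabs_right; [lra|].
      assert (Q := Hp (0 + RtoC s * E t)%C (circ_in 0%C s t S1)). lra. }
  assert (RI : RInt (fun t => 2 * Re (K (0 + RtoC s * E t)%C)) 0 (2 * PI) = 2 * (2 * PI * Re (K 0%C))).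
  { assert (Q := RInt_scal (V := R_CompleteNormedModule) (fun t => Re (K (0 + RtoC s * E t)%C)) 0 (2 * PI) 2 (ccon_exRe _ _ _ Kcon)).
    transitivity (2 * RInt (fun t => Re (K (0 + RtoC s * E t)%C)) 0 (2 * PI)); [exact Q|].
    apply (f_equal Re) in MV. simpl in MV. rewrite MV. unfold Re. simpl. ring. }
  rewrite RI, !Cmod_mult, !Cmod_R, !Rabs_right in Nm by lra.
  apply Rmult_le_reg_l with (2 * PI); lra.
Qed.

(** The disk automorphism taking 0 to z; it transports estimates at the origin to z. *)
Definition tau (z w : C) : C := ((w + z) / (1 + Cconj z * w))%C.

Lemma tau_id2 z w : Cmod (1 + Cconj z * w)%C * Cmod (1 + Cconj z * w)%C - Cmod (w + z)%C * Cmod (w + z)%C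
  = (1 - Cmod z * Cmod z) * (1 - Cmod w * Cmod w).
Proof.
  rewrite !Cmod_sq. destruct z as [a b], w as [c d]. unfold Re, Im; simpl. ring.
Qed.

Lemma inD_sq z : inD z -> 0 < 1 - Cmod z * Cmod z.
Proof. unfold inD. intros H. assert (P := Cmod_ge_0 z). nra. Qed.

Lemma tau_den z w : inD z -> inD w -> 0 < Cmod (1 + Cconj z * w)%C.
Proof.
  intros Hz Hw. assert (I := tau_id2 z w). assert (A := inD_sq z Hz). assert (B := inD_sq w Hw).
  assert (P := Cmod_ge_0 (1 + Cconj z * w)%C). assert (Q := Cmod_ge_0 (w + z)%C).
  assert (0 < (1 - Cmod z * Cmod z) * (1 - Cmod w * Cmod w)) by (apply Rmult_lt_0_compat; assumption).
  destruct P as [P|P]; [exact P|]. rewrite <- P in I. nra.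
Qed.

Lemma tau_mod z w : inD z -> inD w -> 1 - Cmod (tau z w) * Cmod (tau z w) =
  (1 - Cmod z * Cmod z) * (1 - Cmod w * Cmod w) / (Cmod (1 + Cconj z * w)%C * Cmod (1 + Cconj z * w)%C).
Proof.
  intros Hz Hw. assert (D := tau_den z w Hz Hw). rewrite <- tau_id2. unfold tau.
  rewrite Cmod_div by (apply Cmod_gt_0, D). field. lra.
Qed.

Lemma tau_inD z w : inD z -> inD w -> inD (tau z w).
Proof.
  intros Hz Hw. assert (M := tau_mod z w Hz Hw). assert (D := tau_den z w Hz Hw).
  assert (A := inD_sq z Hz). assert (B := inD_sq w Hw).
  assert (0 < (1 - Cmod z * Cmod z) * (1 - Cmod w * Cmod w) / (Cmod (1 + Cconj z * w)%C * Cmod (1 + Cconj z * w)%C)).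
  { apply Rdiv_lt_0_compat; apply Rmult_lt_0_compat; assumption. }
  unfold inD. assert (P := Cmod_ge_0 (tau z w)). nra.
Qed.

Lemma tau_deriv z w : inD z -> inD w -> exists l, cderiv (tau z) w l.
Proof.
  intros Hz Hw. eexists. unfold tau. apply cderiv_div.
  - apply cderiv_plus; [apply cderiv_id|apply cderiv_const].
  - apply cderiv_plus; [apply cderiv_const|apply cderiv_scal, cderiv_id].
  - apply Cmod_gt_0, tau_den; assumption.
Qed.

Lemma tau_analytic z : inD z -> analytic_on_D (tau z).
Proof. intros Hz. apply analytic_iff. intros w Hw. apply tau_deriv; assumption. Qed.

Lemma tau_0 z : tau z 0 = z.
Proof. unfold tau. field. Qed.

Lemma tau_deriv0 z : cderiv (tau z) 0 (RtoC (1 - Cmod z * Cmod z)).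
Proof.
  unfold tau. eapply cderiv_eq.
  - apply cderiv_div.
    + apply cderiv_plus; [apply cderiv_id|apply cderiv_const].
    + apply cderiv_plus; [apply cderiv_const|apply cderiv_scal, cderiv_id].
    + replace (1 + Cconj z * 0)%C with (RtoC 1) by ring. apply C1_nz.
  - replace (RtoC (1 - Cmod z * Cmod z)) with (1 - z * Cconj z)%C.
    + field.
    + rewrite <- Cmod2_conj, RtoC_minus. f_equal. f_equal. f_equal. ring.
Qed.

Lemma pos_comp K g : posr K -> analytic_on_D g -> (forall z, inD z -> inD (g z)) -> posr (fun z => K (g z)).
Proof.
  intros [HK Hp] Hg Hi. split; [apply analytic_comp; assumption|]. intros z Hz. apply Hp, Hi, Hz.
Qed.

Lemma pos_deriv K z : posr K -> inD z -> Cmod (cD K z) * (1 - Cmod z * Cmod z) <= 2 * Re (K z).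
Proof.
  intros HK Hz.
  assert (P := pos_comp K (tau z) HK (tau_analytic z Hz) (fun w Hw => tau_inD z w Hz Hw)).
  assert (A := pos_deriv0 _ P). simpl in A. rewrite tau_0 in A.
  assert (D : cderiv (fun w => K (tau z w)) 0 (cD K z * RtoC (1 - Cmod z * Cmod z))%C).
  { apply cderiv_comp; [apply tau_deriv0|]. rewrite tau_0. apply analytic_cD; [apply HK|exact Hz]. }
  rewrite (cD_eq _ _ _ D), Cmod_mult, Cmod_R, Rabs_right in A; [exact A|].
  assert (Q := inD_sq z Hz). lra.
Qed.

Lemma decr_of_deriv (f df : R -> R) a b : a <= b ->
  (forall x, a <= x <= b -> is_derive f x (df x)) -> (forall x, a <= x <= b -> df x <= 0) -> f b <= f a.
Proof.
  intros Hab Hd Hn.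
  destruct (MVT_gen f a b df) as [c [Hc E]].
  - rewrite Rmin_left, Rmax_right by lra. intros x Hx. apply Hd; lra.
  - rewrite Rmin_left, Rmax_right by lra. intros x Hx. apply derivable_continuous_pt.
    exists (df x). apply is_derive_Reals, Hd, Hx.
  - rewrite Rmin_left, Rmax_right in Hc by lra. specialize (Hn c Hc). nra.
Qed.

Lemma line_deriv K z v u : analytic_on_D K -> inD (z + RtoC u * v)%C ->
  rderiv (fun u => K (z + RtoC u * v)%C) u (cD K (z + RtoC u * v)%C * v)%C.
Proof.
  intros HK Hi. apply (rderiv_comp K (fun u => z + RtoC u * v)%C); [|apply analytic_cD; assumption].
  apply rderiv_affine. intros s. rewrite RtoC_minus. ring.
Qed.

Lemma abs_Re_mult a v : Rabs (Re (a * v)%C) <= Cmod a * Cmod v.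
Proof. rewrite <- Cmod_mult. apply re_le_Cmod. Qed.

(** Along the segment the logarithmic derivative of Re K is at most 2, because |w - z| is at most
    1-|p| at each point p of it. Hence Re K grows at most by e^2, and 9 bounds e^2. *)
Lemma harnack_near K z w : posr K -> inD z -> Cmod (w - z)%C <= (1 - Cmod z) / 2 ->
  Re (K w) <= 9 * Re (K z).
Proof.
  intros HK Hz Hw. unfold inD in Hz.
  set (v := (w - z)%C). set (y := fun u => Re (K (z + RtoC u * v)%C)).
  assert (In : forall u, 0 <= u <= 1 -> Cmod (z + RtoC u * v)%C <= Cmod z + (1 - Cmod z) / 2).
  { intros u Hu. eapply Rle_trans; [apply Cmod_triangle|]. rewrite Cmod_mult, Cmod_R, Rabs_right by lra.
    assert (Q := Cmod_ge_0 v). unfold v in *. nra. }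
  assert (InD : forall u, 0 <= u <= 1 -> inD (z + RtoC u * v)%C).
  { intros u Hu. unfold inD. specialize (In u Hu). lra. }
  assert (Dy : forall u, 0 <= u <= 1 -> is_derive y u (Re (cD K (z + RtoC u * v)%C * v)%C)).
  { intros u Hu. apply (rderiv_Re (fun u => K (z + RtoC u * v)%C)). apply line_deriv; [apply HK|apply InD, Hu]. }
  assert (By : forall u, 0 <= u <= 1 -> Re (cD K (z + RtoC u * v)%C * v)%C <= 2 * y u).
  { intros u Hu. specialize (In u Hu). specialize (InD u Hu).
    set (p := (z + RtoC u * v)%C) in *.
    assert (A := pos_deriv K p HK InD). assert (Pp := Cmod_ge_0 p).
    eapply Rle_trans; [apply Rle_abs|]. eapply Rle_trans; [apply abs_Re_mult|].
    assert (Yp : 0 <= y u) by (apply HK; exact InD). unfold y in *. fold p in Yp |- *.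
    assert (C0 := Cmod_ge_0 (cD K p)). fold v in Hw. assert (V0 := Cmod_ge_0 v).
    apply Rle_trans with (Cmod (cD K p) * (1 - Cmod p * Cmod p)); [|exact A].
    apply Rmult_le_compat_l; [exact C0|]. nra. }
  assert (D := decr_of_deriv (fun u => y u * exp (- 2 * u)) (fun u => Re (cD K (z + RtoC u * v)%C * v)%C * exp (- 2 * u) + y u * (- 2 * exp (- 2 * u))) 0 1).
  assert (X : y 1 * exp (-2 * 1) <= y 0 * exp (-2 * 0)).
  { apply D; [lra| |].
    - intros u Hu. apply (is_derive_mult (K := R_AbsRing) y (fun u => exp (- 2 * u))).
      + apply Dy, Hu.
      + auto_derive; [exact I|ring].
      + intros; apply Rmult_comm.
    - intros u Hu. specialize (By u Hu). assert (P := exp_pos (-2 * u)). nra. }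
  replace (exp (-2 * 0)) with 1 in X by (rewrite Rmult_0_r, exp_0; reflexivity).
  replace (exp (-2 * 1)) with (/ (exp 1 * exp 1)) in X
    by (rewrite <- exp_plus, <- exp_Ropp; f_equal; ring).
  assert (Y1 : y 1 = Re (K w)) by (unfold y, v; do 2 f_equal; ring).
  assert (Y0 : y 0 = Re (K z)) by (unfold y, v; do 2 f_equal; ring).
  rewrite Y1, Y0 in X.
  assert (E3 := exp_le_3). assert (E0 := exp_pos 1).
  assert (Z : 0 <= Re (K z)) by (apply HK; exact Hz).
  apply Rmult_le_compat_r with (r := exp 1 * exp 1) in X; [|nra].
  replace (Re (K w) * / (exp 1 * exp 1) * (exp 1 * exp 1)) with (Re (K w)) in X by (field; lra).
  eapply Rle_trans; [exact X|]. rewrite Rmult_1_r, (Rmult_comm 9). apply Rmult_le_compat_l; [exact Z|nra].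
Qed.

(** 36 = 2 * 9 * 2: the invariant derivative bound, [harnack_near], and the halving of 1-|.| along
    the segment. *)
Lemma pos_lip K z w : posr K -> inD z -> Cmod (w - z)%C <= (1 - Cmod z) / 2 ->
  Cmod (K w - K z)%C <= 36 * Re (K z) / (1 - Cmod z) * Cmod (w - z)%C.
Proof.
  intros HK Hz Hw. apply mvt_seg. intros u Hu.
  set (p := (z + RtoC u * (w - z))%C). unfold inD in Hz.
  assert (Np : Cmod (p - z)%C <= (1 - Cmod z) / 2).
  { unfold p. replace (z + RtoC u * (w - z) - z)%C with (RtoC u * (w - z))%C by ring.
    rewrite Cmod_mult, Cmod_R, Rabs_right by lra. assert (Q := Cmod_ge_0 (w - z)%C). nra. }
  assert (T := Cmod_le_plus p z). assert (Hp : inD p) by (unfold inD; lra).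
  exists (cD K p). split; [apply analytic_cD; [apply HK|exact Hp]|].
  assert (A := pos_deriv K p HK Hp). assert (B := harnack_near K z p HK Hz Np).
  assert (P0 := Cmod_ge_0 p). assert (C0 := Cmod_ge_0 (cD K p)).
  apply Rle_div_r; [lra|]. 
  apply Rle_trans with (Cmod (cD K p) * (2 * (1 - Cmod p * Cmod p))); [|nra].
  apply Rmult_le_compat_l; [exact C0|]. nra.
Qed.

Lemma scaled_inD z u : inD z -> 0 <= u <= 1 -> inD (0 + RtoC u * z)%C.
Proof.
  unfold inD. intros Hz Hu. rewrite Cplus_0_l, Cmod_mult, Cmod_R, Rabs_right by lra.
  assert (P := Cmod_ge_0 z). nra.
Qed.

Lemma mul_unit_bd u r : 0 <= u <= 1 -> 0 <= r < 1 -> 0 <= u * r < 1.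
Proof. intros Hu Hr. split; [apply Rmult_le_pos; lra|]. nra. Qed.

Lemma mul_unit_sq u r : 0 <= u <= 1 -> 0 <= r < 1 -> 0 <= 1 - u * r * (u * r).
Proof. intros Hu Hr. assert (H := mul_unit_bd u r Hu Hr). nra. Qed.

(** With y(u) = Re K(u z) one has |y'| (1 - u^2 r^2) <= 2 r y; the factor (1 - u r) / (1 + u r) and
    its inverse are the integrating factors giving the two bounds. *)
Lemma harnack_radial K z : posr K -> inD z ->
  Re (K z) * (1 - Cmod z) <= Re (K 0%C) * (1 + Cmod z) /\
  Re (K 0%C) * (1 - Cmod z) <= Re (K z) * (1 + Cmod z).
Proof.
  intros HK Hz. set (r := Cmod z). assert (P := Cmod_ge_0 z). fold r in P.
  assert (Hr : r < 1) by exact Hz.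
  set (y := fun u => Re (K (0 + RtoC u * z)%C)).
  set (dy := fun u => Re (cD K (0 + RtoC u * z)%C * z)%C).
  assert (Dy : forall u, 0 <= u <= 1 -> is_derive y u (dy u)).
  { intros u Hu. apply (rderiv_Re (fun u => K (0 + RtoC u * z)%C)). apply line_deriv; [apply HK|apply scaled_inD; assumption]. }
  assert (Yp : forall u, 0 <= u <= 1 -> 0 <= y u) by (intros u Hu; apply HK, scaled_inD; assumption).
  assert (By : forall u, 0 <= u <= 1 -> Rabs (dy u) * (1 - u * r * (u * r)) <= 2 * r * y u).
  { intros u Hu. assert (I := scaled_inD z u Hz Hu).
    assert (A := pos_deriv K _ HK I).
    assert (M : Cmod (0 + RtoC u * z)%C = u * r).
    { rewrite Cplus_0_l, Cmod_mult, Cmod_R, Rabs_right by lra. reflexivity. }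
    rewrite M in A. assert (B := abs_Re_mult (cD K (0 + RtoC u * z)%C) z). fold r in B. fold (dy u) in B. fold (y u) in A.
    assert (Q := mul_unit_sq u r Hu (conj P Hr)).
    eapply Rle_trans; [apply Rmult_le_compat_r; [exact Q|exact B]|].
    replace (Cmod (cD K (0 + u * z)%C) * r * (1 - u * r * (u * r))) with (r * (Cmod (cD K (0 + u * z)%C) * (1 - u * r * (u * r)))) by ring.
    apply Rle_trans with (r * (2 * y u)); [apply Rmult_le_compat_l; assumption|lra]. }
  assert (Y1 : y 1 = Re (K z)) by (unfold y; do 2 f_equal; ring).
  assert (Y0 : y 0 = Re (K 0%C)) by (unfold y; do 2 f_equal; ring).
  split.
  - assert (X : y 1 * ((1 - 1 * r) / (1 + 1 * r)) <= y 0 * ((1 - 0 * r) / (1 + 0 * r))).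
    { apply (decr_of_deriv (fun u => y u * ((1 - u * r) / (1 + u * r)))
        (fun u => dy u * ((1 - u * r) / (1 + u * r)) + y u * (- 2 * r / ((1 + u * r) * (1 + u * r))))); [lra| |].
      - intros u Hu. apply (is_derive_mult (K := R_AbsRing) y (fun u => (1 - u * r) / (1 + u * r))).
        + apply Dy, Hu.
        + assert (Q := mul_unit_bd u r Hu (conj P Hr)). auto_derive; [lra|]. field. lra.
        + intros; apply Rmult_comm.
      - intros u Hu. specialize (By u Hu). specialize (Yp u Hu).
        assert (Q := mul_unit_bd u r Hu (conj P Hr)). assert (D := Rle_abs (dy u)).
        replace (dy u * ((1 - u * r) / (1 + u * r)) + y u * (-2 * r / ((1 + u * r) * (1 + u * r))))
          with ((dy u * (1 - u * r * (u * r)) - 2 * r * y u) / ((1 + u * r) * (1 + u * r))) by (field; lra).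
        apply Rle_div_l; [nra|]. rewrite Rmult_0_l.
        apply Rmult_le_compat_r with (r := 1 - u * r * (u * r)) in D; [lra|apply mul_unit_sq; lra]. }
    rewrite Y1, Y0 in X.
    replace (Re (K z) * ((1 - 1 * r) / (1 + 1 * r))) with (Re (K z) * (1 - r) / (1 + r)) in X by (field; lra).
    replace (Re (K 0%C) * ((1 - 0 * r) / (1 + 0 * r))) with (Re (K 0%C)) in X by field.
    apply Rle_div_l in X; lra.
  - assert (X : - (y 1) * ((1 + 1 * r) / (1 - 1 * r)) <= - (y 0) * ((1 + 0 * r) / (1 - 0 * r))).
    { apply (decr_of_deriv (fun u => - (y u) * ((1 + u * r) / (1 - u * r)))
        (fun u => - (dy u) * ((1 + u * r) / (1 - u * r)) + - (y u) * (2 * r / ((1 - u * r) * (1 - u * r))))); [lra| |].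
      - intros u Hu. assert (Q := mul_unit_bd u r Hu (conj P Hr)).
        apply (is_derive_mult (K := R_AbsRing) (fun u => - (y u)) (fun u => (1 + u * r) / (1 - u * r))).
        + apply (is_derive_opp (V := R_NormedModule)), Dy, Hu.
        + auto_derive; [lra|]. field. lra.
        + intros; apply Rmult_comm.
      - intros u Hu. specialize (By u Hu). specialize (Yp u Hu).
        assert (Q := mul_unit_bd u r Hu (conj P Hr)). assert (D := Rle_abs (- dy u)). rewrite Rabs_Ropp in D.
        replace (- dy u * ((1 + u * r) / (1 - u * r)) + - y u * (2 * r / ((1 - u * r) * (1 - u * r))))
          with ((- dy u * (1 - u * r * (u * r)) - 2 * r * y u) / ((1 - u * r) * (1 - u * r))) by (field; lra).
        apply Rle_div_l; [nra|]. rewrite Rmult_0_l.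
        apply Rmult_le_compat_r with (r := 1 - u * r * (u * r)) in D; [lra|apply mul_unit_sq; lra]. }
    rewrite Y1, Y0 in X.
    replace (- Re (K z) * ((1 + 1 * r) / (1 - 1 * r))) with (- (Re (K z) * (1 + r) / (1 - r))) in X by (field; lra).
    replace (- Re (K 0%C) * ((1 + 0 * r) / (1 - 0 * r))) with (- Re (K 0%C)) in X by field.
    assert (X' : Re (K 0%C) <= Re (K z) * (1 + r) / (1 - r)) by lra.
    apply Rle_div_r in X'; lra.
Qed.

(** Same integrating factor as for the real part, applied to |K|^2, since |K'| is controlled by Re K
    <= |K|. The growth of the generator requires a bound on the modulus. *)
Lemma pos_mod_bound K z : posr K -> inD z -> Cmod (K z) * (1 - Cmod z) <= Cmod (K 0%C) * (1 + Cmod z).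
Proof.
  intros HK Hz. set (r := Cmod z). assert (P := Cmod_ge_0 z). fold r in P.
  assert (Hr : r < 1) by exact Hz.
  set (k := fun u => K (0 + RtoC u * z)%C).
  set (dk := fun u => (cD K (0 + RtoC u * z)%C * z)%C).
  assert (Dk : forall u, 0 <= u <= 1 -> rderiv k u (dk u)).
  { intros u Hu. apply line_deriv; [apply HK|apply scaled_inD; assumption]. }
  set (N := fun u => Re (k u) * Re (k u) + Im (k u) * Im (k u)).
  set (dN := fun u => (Re (dk u) * Re (k u) + Re (k u) * Re (dk u)) + (Im (dk u) * Im (k u) + Im (k u) * Im (dk u))).
  assert (DN : forall u, 0 <= u <= 1 -> is_derive N u (dN u)).
  { intros u Hu. apply (is_derive_plus (V := R_NormedModule) (fun u => Re (k u) * Re (k u)) (fun u => Im (k u) * Im (k u))).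
    - apply (is_derive_mult (K := R_AbsRing) (fun u => Re (k u)) (fun u => Re (k u))); try apply rderiv_Re, Dk, Hu.
      intros; apply Rmult_comm.
    - apply (is_derive_mult (K := R_AbsRing) (fun u => Im (k u)) (fun u => Im (k u))); try apply rderiv_Im, Dk, Hu.
      intros; apply Rmult_comm. }
  assert (BN : forall u, 0 <= u <= 1 -> dN u * (1 - u * r * (u * r)) <= 4 * r * N u).
  { intros u Hu. assert (I := scaled_inD z u Hz Hu).
    assert (A := pos_deriv K _ HK I).
    assert (M : Cmod (0 + RtoC u * z)%C = u * r).
    { rewrite Cplus_0_l, Cmod_mult, Cmod_R, Rabs_right by lra. reflexivity. }
    rewrite M in A. fold (k u) in A.
    assert (cseries : dN u <= 2 * (Cmod (k u) * Cmod (dk u))).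
    { assert (S := Re_scal_unit_le 1%C (Cconj (k u) * dk u)%C ltac:(rewrite Cmod_1; lra)).
      rewrite Cmod_mult, Cmod_conj in S. unfold dN.
      replace (Re (1 * (Cconj (k u) * dk u))%C) with (Re (k u) * Re (dk u) + Im (k u) * Im (dk u)) in S.
      - lra.
      - generalize (k u) (dk u). intros [a b] [c d]. unfold Re, Im; simpl. ring. }
    unfold dk at 1 in cseries. rewrite Cmod_mult in cseries. fold r in cseries.
    assert (RK : Re (k u) <= Cmod (k u)) by (eapply Rle_trans; [apply Rle_abs|apply re_le_Cmod]).
    assert (NK : N u = Cmod (k u) * Cmod (k u)) by (unfold N; rewrite Cmod_sq; reflexivity).
    rewrite NK. assert (K0 := Cmod_ge_0 (k u)). assert (D0 := Cmod_ge_0 (cD K (0 + u * z)%C)).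
    assert (Q := mul_unit_sq u r Hu (conj P Hr)).
    apply Rle_trans with (2 * (Cmod (k u) * (Cmod (cD K (0 + u * z)%C) * r)) * (1 - u * r * (u * r))).
    { apply Rmult_le_compat_r; assumption. }
    replace (2 * (Cmod (k u) * (Cmod (cD K (0 + u * z)%C) * r)) * (1 - u * r * (u * r)))
      with (2 * r * Cmod (k u) * (Cmod (cD K (0 + u * z)%C) * (1 - u * r * (u * r)))) by ring.
    apply Rle_trans with (2 * r * Cmod (k u) * (2 * Cmod (k u))); [|lra].
    apply Rmult_le_compat_l; [nra|lra]. }
  assert (X : N 1 * ((1 - 1 * r) * (1 - 1 * r) / ((1 + 1 * r) * (1 + 1 * r))) <= N 0 * ((1 - 0 * r) * (1 - 0 * r) / ((1 + 0 * r) * (1 + 0 * r)))).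
  { apply (decr_of_deriv (fun u => N u * ((1 - u * r) * (1 - u * r) / ((1 + u * r) * (1 + u * r))))
      (fun u => dN u * ((1 - u * r) * (1 - u * r) / ((1 + u * r) * (1 + u * r))) + N u * (- 4 * r * (1 - u * r) / ((1 + u * r) * (1 + u * r) * (1 + u * r))))); [lra| |].
    - intros u Hu. assert (Q := mul_unit_bd u r Hu (conj P Hr)).
      apply (is_derive_mult (K := R_AbsRing) N (fun u => (1 - u * r) * (1 - u * r) / ((1 + u * r) * (1 + u * r)))).
      + apply DN, Hu.
      + auto_derive; [nra|]. field. lra.
      + intros; apply Rmult_comm.
    - intros u Hu. specialize (BN u Hu). assert (Q := mul_unit_bd u r Hu (conj P Hr)).
      replace (dN u * ((1 - u * r) * (1 - u * r) / ((1 + u * r) * (1 + u * r))) + N u * (-4 * r * (1 - u * r) / ((1 + u * r) * (1 + u * r) * (1 + u * r))))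
        with ((dN u * (1 - u * r * (u * r)) - 4 * r * N u) * (1 - u * r) / ((1 + u * r) * (1 + u * r) * (1 + u * r))) by (field; lra).
      apply Rle_div_l; [repeat apply Rmult_lt_0_compat; lra|]. rewrite Rmult_0_l. nra. }
  assert (N1 : N 1 = Cmod (K z) * Cmod (K z)).
  { unfold N. rewrite <- Cmod_sq. unfold k. replace (0 + RtoC 1 * z)%C with z by ring. reflexivity. }
  assert (N0 : N 0 = Cmod (K 0%C) * Cmod (K 0%C)).
  { unfold N. rewrite <- Cmod_sq. unfold k. replace (0 + RtoC 0 * z)%C with (RtoC 0) by ring. reflexivity. }
  rewrite N1, N0 in X.
  replace (Cmod (K z) * Cmod (K z) * ((1 - 1 * r) * (1 - 1 * r) / ((1 + 1 * r) * (1 + 1 * r))))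
    with ((Cmod (K z) * (1 - r)) * (Cmod (K z) * (1 - r)) / ((1 + r) * (1 + r))) in X by (field; lra).
  replace (Cmod (K 0%C) * Cmod (K 0%C) * ((1 - 0 * r) * (1 - 0 * r) / ((1 + 0 * r) * (1 + 0 * r))))
    with (Cmod (K 0%C) * Cmod (K 0%C)) in X by field.
  apply (Rle_div_l _ _ ((1 + r) * (1 + r))) in X; [|apply Rmult_lt_0_compat; lra].
  apply Rsqr_incr_0; unfold Rsqr; [lra| |].
  - apply Rmult_le_pos; [apply Cmod_ge_0|lra].
  - apply Rmult_le_pos; [apply Cmod_ge_0|lra].
Qed.

(** * Self-maps of the disk: Schwarz-Pick and two-point estimates *)

Definition selfmap (g : C -> C) : Prop := analytic_on_D g /\ forall z, inD z -> inD (g z).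

Lemma cayley_Re (a : C) : Cmod a < 1 ->
  Re ((1 + a) / (1 - a))%C = (1 - Cmod a * Cmod a) / (Cmod (1 - a)%C * Cmod (1 - a)%C).
Proof.
  intros H. assert (N : 0 < Cmod (1 - a)%C).
  { assert (T := Cmod_rev_tri 1%C a). rewrite Cmod_1 in T. lra. }
  assert (S := Cmod_sq (1 - a)%C). rewrite S. rewrite Cmod_sq.
  destruct a as [x y]. unfold Re, Im in *; simpl in *. field.
  intro Q. assert (Z : Cmod (1 - (x, y))%C * Cmod (1 - (x, y))%C = 0) by (rewrite S; nra). nra.
Qed.

Lemma one_minus_nz a : Cmod a < 1 -> (1 - a)%C <> 0%C.
Proof.
  intros H. apply Cmod_gt_0. assert (T := Cmod_rev_tri 1%C a). rewrite Cmod_1 in T. lra.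
Qed.

Lemma cayley_pos g w : selfmap g -> Cmod w <= 1 -> posr (fun z => (1 + w * g z) / (1 - w * g z))%C.
Proof.
  intros [Hg Hi] Hw.
  assert (M : forall z, inD z -> Cmod (w * g z)%C < 1).
  { intros z Hz. specialize (Hi z Hz). unfold inD in Hi. rewrite Cmod_mult.
    assert (P := Cmod_ge_0 w). assert (Q := Cmod_ge_0 (g z)). nra. }
  split.
  - apply analytic_div.
    + apply analytic_plus; [apply analytic_const|apply analytic_scal, Hg].
    + apply analytic_minus; [apply analytic_const|apply analytic_scal, Hg].
    + intros z Hz. apply one_minus_nz, M, Hz.
  - intros z Hz. specialize (M z Hz). rewrite cayley_Re by exact M.
    assert (P := Cmod_ge_0 (w * g z)%C). assert (N := one_minus_nz _ M). apply Cmod_gt_0 in N.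
    apply Rdiv_le_0_compat; nra.
Qed.

(** The invariant derivative bound [pos_deriv] for (1 + g) / (1 - g), whose derivative is 2 g' / (1
    - g)^2 and whose real part is (1 - |g|^2) / |1 - g|^2. *)
Lemma schwarz_pick g z : selfmap g -> inD z ->
  Cmod (cD g z) * (1 - Cmod z * Cmod z) <= 1 - Cmod (g z) * Cmod (g z).
Proof.
  intros Hg Hz. assert (PK := cayley_pos g 1%C Hg ltac:(rewrite Cmod_1; lra)).
  assert (A := pos_deriv _ z PK Hz). cbv beta in A.
  assert (M : Cmod (1 * g z)%C < 1) by (rewrite Cmult_1_l; apply Hg, Hz).
  rewrite cayley_Re in A by exact M. rewrite Cmult_1_l in A.
  assert (N : (1 - 1 * g z)%C <> 0%C) by (apply one_minus_nz, M).
  assert (D := analytic_cD g z (proj1 Hg) Hz).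
  assert (DK : cderiv (fun z => (1 + 1 * g z) / (1 - 1 * g z))%C z (2 * cD g z / ((1 - g z) * (1 - g z)))%C).
  { eapply cderiv_eq.
    - apply cderiv_div.
      + apply cderiv_plus; [apply cderiv_const|apply cderiv_scal, D].
      + apply cderiv_minus; [apply cderiv_const|apply cderiv_scal, D].
      + exact N.
    - rewrite !Cmult_1_l in *. field. exact N. }
  rewrite (cD_eq _ _ _ DK) in A. rewrite Cmult_1_l in N.
  rewrite Cmod_div, !Cmod_mult, Cmod_R, Rabs_right in A by (try lra; apply Cmult_neq_0; exact N).
  assert (NP := proj1 (Cmod_gt_0 _) N).
  set (q := Cmod (1 - g z)%C) in *.
  replace (2 * Cmod (cD g z) / (q * q) * (1 - Cmod z * Cmod z)) with (2 * (Cmod (cD g z) * (1 - Cmod z * Cmod z)) / (q * q)) in A by (field; lra).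
  replace (2 * ((1 - Cmod (g z) * Cmod (g z)) / (q * q))) with (2 * (1 - Cmod (g z) * Cmod (g z)) / (q * q)) in A by (field; lra).
  apply Rmult_le_compat_r with (r := q * q) in A; [|nra].
  replace (2 * (Cmod (cD g z) * (1 - Cmod z * Cmod z)) / (q * q) * (q * q)) with (2 * (Cmod (cD g z) * (1 - Cmod z * Cmod z))) in A by (field; lra).
  replace (2 * (1 - Cmod (g z) * Cmod (g z)) / (q * q) * (q * q)) with (2 * (1 - Cmod (g z) * Cmod (g z))) in A by (field; lra).
  lra.
Qed.

(** With c rotating g z to the positive axis, Re (1 - c g) is positive harmonic, at least 1/2 at 0
    and equal to 1 - |g z| at z; the lower Harnack bound concludes. *)
Lemma selfmap_dist g z : selfmap g -> Cmod (g 0%C) <= 1 / 2 -> inD z -> (1 - Cmod z) / 4 <= 1 - Cmod (g z).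
Proof.
  intros Hg H0 Hz. destruct (unit_rot (g z)) as [c [Hc Ec']].
  assert (PK : posr (fun w => 1 - c * g w)%C).
  { split; [apply analytic_minus; [apply analytic_const|apply analytic_scal, Hg]|].
    intros w Hw. rewrite Re_minus. simpl (Re 1).
    assert (S := Re_scal_unit_le c (g w) ltac:(lra)). assert (I := proj2 Hg w Hw). unfold inD in I. lra. }
  destruct (harnack_radial _ z PK Hz) as [_ A]. rewrite Ec' in A.
  replace (Re (1 - RtoC (Cmod (g z)))%C) with (1 - Cmod (g z)) in A by (unfold Re; simpl; ring).
  rewrite Re_minus in A. simpl (Re 1) in A.
  assert (S := Re_scal_unit_le c (g 0%C) ltac:(lra)).
  assert (P := Cmod_ge_0 z). unfold inD in Hz. assert (Q := proj2 Hg z Hz). unfold inD in Q. nra.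
Qed.

(** Harnack's inequality moved by [tau w], so that the centre becomes w. It is kept in a form
    without quotients of distances to the circle, because w will be sent to the boundary in Julia's
    lemma. *)
Lemma pos_two_points k z w : posr k -> inD z -> inD w ->
  Re (k w) * ((1 - Cmod z * Cmod z) * (1 - Cmod w * Cmod w)) <=
  4 * (Cmod (1 - Cconj w * z)%C * Cmod (1 - Cconj w * z)%C) * Re (k z).
Proof.
  intros Hk Hz Hw.
  assert (Hw' : inD (- w)%C) by (unfold inD; rewrite Cmod_opp; exact Hw).
  set (x := tau (- w) z).
  assert (Ix : inD x) by (apply tau_inD; assumption).
  assert (D := tau_den (- w)%C z Hw' Hz). rewrite Copp_conj in D.
  assert (Dn : (1 + - Cconj w * z)%C <> 0%C) by (apply Cmod_gt_0; exact D).
  assert (D2 := tau_den w x Hw Ix).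
  assert (Ez : tau w x = z).
  { unfold x, tau in *. rewrite !Copp_conj in *.
    assert (W : (1 - w * Cconj w)%C <> 0%C).
    { rewrite <- Cmod2_conj. intro Q. rewrite <- RtoC_minus in Q. apply (f_equal fst) in Q. simpl in Q.
      assert (Q2 := inD_sq w Hw). lra. }
    field. split; [exact Dn|]. 
    intro Q. apply W. rewrite <- Q. ring. }
  assert (PK := pos_comp k (tau w) Hk (tau_analytic w Hw) (fun u Hu => tau_inD w u Hw Hu)).
  destruct (harnack_radial _ x PK Ix) as [_ A]. rewrite tau_0, Ez in A.
  assert (M := tau_mod (- w)%C z Hw' Hz). fold x in M. rewrite Cmod_opp, Copp_conj in M.
  replace (1 - Cconj w * z)%C with (1 + - Cconj w * z)%C by ring.
  set (q := Cmod (1 + - Cconj w * z)%C) in *.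
  assert (P1 := proj2 Hk z Hz). assert (P2 := proj2 Hk w Hw). assert (Px := Cmod_ge_0 x). unfold inD in Ix.
  replace ((1 - Cmod z * Cmod z) * (1 - Cmod w * Cmod w)) with ((1 - Cmod x * Cmod x) * (q * q)) by (rewrite M; field; lra).
  replace (4 * (q * q) * Re (k z)) with (4 * Re (k z) * (q * q)) by ring.
  rewrite <- Rmult_assoc. apply Rmult_le_compat_r; [nra|].
  apply Rle_trans with (Re (k z) * (1 + Cmod x) * (1 + Cmod x)); [|rewrite Rmult_assoc, (Rmult_comm 4); apply Rmult_le_compat_l; [exact P1|nra]].
  replace (Re (k w) * (1 - Cmod x * Cmod x)) with (Re (k w) * (1 - Cmod x) * (1 + Cmod x)) by ring.
  apply Rmult_le_compat_r; lra.
Qed.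

(** * Real powers with 0^q = 0 *)

Lemma powp_pos_eq x q : 0 < x -> powp x q = Rpower x q.
Proof. intros H. unfold powp. destruct Req_EM_T; [lra|reflexivity]. Qed.
Lemma powp_0 q : powp 0 q = 0.
Proof. unfold powp. destruct Req_EM_T; [reflexivity|lra]. Qed.
Lemma Rpower_pos x q : 0 < Rpower x q.
Proof. apply exp_pos. Qed.
Lemma powp_ge_0 x q : 0 <= powp x q.
Proof. unfold powp. destruct Req_EM_T; [lra|]. left; apply Rpower_pos. Qed.
Lemma powp_mono x y q : 0 < q -> 0 <= x <= y -> powp x q <= powp y q.
Proof.
  intros Hq [H0 H]. destruct (Req_dec x 0) as [->|N]; [rewrite powp_0; apply powp_ge_0|].
  rewrite !powp_pos_eq by lra. apply Rle_Rpower_l; lra.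
Qed.
Lemma powp_mult x y q : 0 <= x -> 0 <= y -> powp (x * y) q = powp x q * powp y q.
Proof.
  intros Hx Hy. destruct (Req_dec x 0) as [->|Nx]; [rewrite Rmult_0_l, !powp_0; ring|].
  destruct (Req_dec y 0) as [->|Ny]; [rewrite Rmult_0_r, !powp_0; ring|].
  rewrite !powp_pos_eq by nra. symmetry. apply Rpower_mult_distr; lra.
Qed.
Lemma powp_powp x q : 0 <= x -> 0 < q -> powp (powp x q) (/ q) = x.
Proof.
  intros Hx Hq. destruct (Req_dec x 0) as [->|N]; [rewrite !powp_0; reflexivity|].
  rewrite !powp_pos_eq by (try lra; rewrite powp_pos_eq by lra; apply Rpower_pos).
  rewrite Rpower_mult, Rinv_r by lra. apply Rpower_1; lra.
Qed.
Lemma powp_powp' x q : 0 <= x -> 0 < q -> powp (powp x (/ q)) q = x.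
Proof.
  intros Hx Hq. rewrite <- (Rinv_inv q) at 2. apply powp_powp; [exact Hx|]. apply Rinv_0_lt_compat, Hq.
Qed.
Lemma powp_inv_mono x y q : 0 < q -> 0 <= x -> 0 <= y -> powp x q <= powp y q -> x <= y.
Proof.
  intros Hq Hx Hy H. rewrite <- (powp_powp x q), <- (powp_powp y q) by assumption.
  apply powp_mono; [apply Rinv_0_lt_compat, Hq|]. split; [apply powp_ge_0|exact H].
Qed.

Lemma powp_continuous (g : R -> R) q t : 0 < q -> (forall s, 0 <= g s) -> continuous g t ->
  continuous (fun s => powp (g s) q) t.
Proof.
  intros Hq Hg Hc. destruct (Req_dec (g t) 0) as [Z|N].
  - apply continuous_eps. intros eps He. rewrite Z, powp_0.
    set (d := Rpower eps (/ q)). assert (Pd : 0 < d) by apply Rpower_pos.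
    destruct (proj1 (continuous_eps _ _) Hc d Pd) as [r [Pr Hr]].
    exists r. split; [exact Pr|]. intros y Hy. specialize (Hr y Hy). rewrite Z, Rminus_0_r in Hr.
    rewrite Rminus_0_r, Rabs_right by (apply Rle_ge, powp_ge_0).
    rewrite Rabs_right in Hr by (apply Rle_ge, Hg).
    destruct (Req_dec (g y) 0) as [Zy|Ny]; [rewrite Zy, powp_0; exact He|].
    assert (Gy := Hg y). rewrite powp_pos_eq by lra.
    replace eps with (Rpower d q).
    + unfold Rpower. apply exp_increasing. apply Rmult_lt_compat_l; [exact Hq|]. apply ln_increasing; lra.
    + unfold d. rewrite Rpower_mult, Rinv_l by lra. apply Rpower_1, He.
  - assert (Gt := Hg t).
    apply continuous_ext_loc with (fun s => exp (q * ln (g s))).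
    + destruct (proj1 (continuous_eps _ _) Hc (g t)) as [r [Pr Hr]]; [lra|].
      exists (mkposreal r Pr). intros y Hy. specialize (Hr y Hy).
      assert (0 < g y) by (apply Rabs_def2 in Hr; lra). rewrite powp_pos_eq by lra. reflexivity.
    + apply (continuous_comp (fun s => q * ln (g s)) exp).
      * apply (continuous_mult (K := R_AbsRing) (fun _ => q) (fun s => ln (g s))); [apply continuous_const|].
        apply (continuous_comp g ln); [exact Hc|]. apply continuous_ln. lra.
      * apply continuous_exp.
Qed.

(** * Harmonic majorants of |f|^q *)

Fixpoint rprod (f : nat -> R) (n : nat) : R := match n with O => 1 | S m => rprod f m * f m end.
Fixpoint rsum (f : nat -> R) (n : nat) : R := match n with O => 0 | S m => rsum f m + f m end.
Fixpoint cprod (f : nat -> C) (n : nat) : C := match n with O => 1%C | S m => (cprod f m * f m)%C end.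

Lemma cprod_mod f n : Cmod (cprod f n) = rprod (fun k => Cmod (f k)) n.
Proof. induction n; simpl; [apply Cmod_1|]. rewrite Cmod_mult, IHn. reflexivity. Qed.

Lemma rprod_ge_0 f n : (forall k, 0 <= f k) -> 0 <= rprod f n.
Proof. intros H. induction n; simpl; [lra|]. apply Rmult_le_pos; auto. Qed.

Lemma rprod_powp f n q : (forall k, 0 <= f k) -> powp (rprod f n) q = rprod (fun k => powp (f k) q) n.
Proof.
  intros H. induction n; simpl.
  - rewrite powp_pos_eq by lra. unfold Rpower. rewrite ln_1, Rmult_0_r, exp_0. reflexivity.
  - rewrite powp_mult, IHn; auto. apply rprod_ge_0, H.
Qed.

(** Multiply the inequalities f_k / A <= exp (f_k / A - 1); the exponents add up to something
    nonpositive. *)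
Lemma amgm f n A : (forall k, 0 <= f k) -> 0 < A -> rsum f n <= INR n * A -> rprod f n <= A ^ n.
Proof.
  intros Hf HA HS.
  assert (K : rprod f n <= A ^ n * exp (rsum f n / A - INR n)).
  { clear HS. induction n; [simpl; unfold Rdiv; rewrite Rmult_0_l, Rminus_0_r, exp_0; lra|].
    rewrite S_INR. simpl.
    replace ((rsum f n + f n) / A - (INR n + 1)) with ((rsum f n / A - INR n) + (f n / A - 1)) by (field; lra).
    rewrite exp_plus.
    assert (P := rprod_ge_0 f n Hf). assert (F := Hf n).
    assert (X : f n <= A * exp (f n / A - 1)).
    { assert (Q := exp_ineq1_le (f n / A - 1)).
      replace (f n) with (A * (f n / A)) at 1 by (field; lra).
      apply Rmult_le_compat_l; lra. }
    assert (Y := exp_pos (rsum f n / A - INR n)). assert (Z := pow_lt A n HA).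
    apply Rle_trans with ((A ^ n * exp (rsum f n / A - INR n)) * (A * exp (f n / A - 1))).
    - apply Rmult_le_compat; assumption.
    - right. ring. }
  eapply Rle_trans; [exact K|]. assert (Z := pow_lt A n HA).
  rewrite <- (Rmult_1_r (A ^ n)) at 2. apply Rmult_le_compat_l; [lra|].
  rewrite <- exp_0. destruct (Req_dec (rsum f n / A - INR n) 0) as [->|N]; [lra|].
  left. apply exp_increasing. assert (rsum f n / A <= INR n) by (apply Rle_div_l; lra). lra.
Qed.

Lemma exR_cont (W : R -> R) a b : (forall t, continuous W t) -> ex_RInt W a b.
Proof. intros H. apply (ex_RInt_continuous (V := R_CompleteNormedModule)). auto. Qed.

Lemma RInt_shift (W : R -> R) a b c : (forall t, continuous W t) ->
  RInt (fun t => W (t + c)) a b = RInt W (a + c) (b + c).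
Proof.
  intros H. assert (K := RInt_comp_lin (V := R_CompleteNormedModule) W 1 c a b).
  rewrite !Rmult_1_l in K. rewrite <- K by (apply exR_cont, H).
  apply RInt_ext. intros t _. unfold scal; simpl; unfold mult; simpl. rewrite !Rmult_1_l. reflexivity.
Qed.

Lemma RInt_periodic (W : R -> R) c : (forall t, continuous W t) -> (forall t, W (t + 2 * PI) = W t) ->
  RInt W c (c + 2 * PI) = RInt W 0 (2 * PI).
Proof.
  intros H Hp.
  assert (A := RInt_Chasles (V := R_CompleteNormedModule) W c 0 (2 * PI) (exR_cont _ _ _ H) (exR_cont _ _ _ H)).
  assert (B := RInt_Chasles (V := R_CompleteNormedModule) W c (2 * PI) (c + 2 * PI) (exR_cont _ _ _ H) (exR_cont _ _ _ H)).
  assert (D := RInt_shift W 0 c (2 * PI) H). rewrite Rplus_0_l in D.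
  rewrite (RInt_ext _ W) in D by (intros; apply Hp).
  assert (F := RInt_Chasles (V := R_CompleteNormedModule) W c 0 c (exR_cont _ _ _ H) (exR_cont _ _ _ H)).
  rewrite RInt_point in F.
  unfold plus, zero in *; simpl in *. lra.
Qed.

Lemma shifted_mean (W : R -> R) c : (forall t, continuous W t) -> (forall t, W (t + 2 * PI) = W t) ->
  RInt (fun t => W (t + c)) 0 (2 * PI) = RInt W 0 (2 * PI).
Proof.
  intros H Hp. rewrite RInt_shift by exact H. rewrite Rplus_0_l, (Rplus_comm _ c). apply RInt_periodic; assumption.
Qed.

(** The same n must serve every offset [th], because the product over rotations in [submean] is
    bounded on a whole circle at once. *)
Lemma riemann_sum (W : R -> R) eps : (forall t, continuous W t) -> (forall t, W (t + 2 * PI) = W t) -> 0 < eps ->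
  exists n, (0 < n)%nat /\ forall th, 0 <= th <= 2 * PI ->
   rsum (fun k => W (th + INR k * (2 * PI / INR n))) n <= INR n * (RInt W 0 (2 * PI) / (2 * PI) + eps).
Proof.
  intros H Hp He. assert (PP := PI2_pos).
  (* Offset and sample points together reach 4 PI; the larger interval only leaves room for uniform
     continuity. *)
  assert (Hc : forall x, 0 <= x <= 6 * PI -> continuity_pt W x).
  { intros x _. apply continuity_pt_filterlim. apply H. }
  destruct (Heine_cor2 Hc (mkposreal eps He)) as [d Hd].
  destruct (nfloor_ex (2 * PI / d)) as [m [_ Hm]].
  { apply Rdiv_le_0_compat; [lra|apply cond_pos]. }
  exists (S m). split; [lia|]. intros th Hth. set (n := S m). set (h := 2 * PI / INR n).
  assert (Pn : 0 < INR n) by (apply lt_0_INR; unfold n; lia).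
  assert (Ph : 0 < h) by (apply Rdiv_lt_0_compat; lra).
  assert (Hh : h < d).
  { unfold h. apply Rlt_div_l; [lra|]. apply Rlt_div_l in Hm; [|apply cond_pos].
    unfold n. rewrite S_INR. lra. }
  assert (Nh : INR n * h = 2 * PI) by (unfold h; field; lra).
  assert (K : forall j, (j <= n)%nat -> h * rsum (fun k => W (th + INR k * h)) j - INR j * h * eps <= RInt W th (th + INR j * h)).
  { induction j; intros Hj.
    - simpl. rewrite !Rmult_0_l, Rplus_0_r, RInt_point, Rmult_0_r. unfold zero; simpl. lra.
    - specialize (IHj ltac:(lia)). rewrite S_INR. simpl.
      assert (A := RInt_Chasles (V := R_CompleteNormedModule) W th (th + INR j * h) (th + (INR j + 1) * h) (exR_cont _ _ _ H) (exR_cont _ _ _ H)).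
      rewrite <- A. unfold plus; simpl.
      assert (B : h * (W (th + INR j * h) - eps) <= RInt W (th + INR j * h) (th + (INR j + 1) * h)).
      { assert (Q := RInt_const (V := R_CompleteNormedModule) (th + INR j * h) (th + (INR j + 1) * h) (W (th + INR j * h) - eps)).
        unfold scal in Q; simpl in Q; unfold mult in Q; simpl in Q.
        replace (h * (W (th + INR j * h) - eps)) with ((th + (INR j + 1) * h - (th + INR j * h)) * (W (th + INR j * h) - eps)) by ring.
        rewrite <- Q. apply RInt_le; [lra| | |].
        - apply (ex_RInt_const (V := R_NormedModule)).
        - apply exR_cont, H.
        - intros x Hx. assert (J : INR j + 1 <= INR n) by (rewrite <- S_INR; apply le_INR; exact Hj).
          assert (J0 := pos_INR j).
          assert (J1 : 0 <= INR j * h) by (apply Rmult_le_pos; lra).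
          assert (J2 : (INR j + 1) * h <= 2 * PI) by (rewrite <- Nh; apply Rmult_le_compat_r; lra).
          assert (P0 := PI_RGT_0).
          assert (X := Hd (th + INR j * h) x ltac:(lra) ltac:(lra) ltac:(apply Rabs_def1; lra)).
          simpl in X. apply Rabs_def2 in X. lra. }
      lra. }
  specialize (K n ltac:(lia)). rewrite Nh in K.
  rewrite RInt_periodic in K by assumption.
  apply Rmult_le_reg_l with h; [exact Ph|].
  set (I0 := RInt W 0 (2 * PI) : R) in *.
  replace (h * (INR n * (I0 / (2 * PI) + eps))) with (INR n * h * (I0 / (2 * PI) + eps)) by ring.
  rewrite Nh. rewrite Rmult_plus_distr_l.
  replace (2 * PI * (I0 / (2 * PI))) with I0 by (field; assert (P0 := PI_RGT_0); lra).
  fold h in K |- *. lra.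
Qed.

Lemma cprod_analytic (f : nat -> C -> C) n : (forall k, analytic_on_D (f k)) ->
  analytic_on_D (fun z => cprod (fun k => f k z) n).
Proof.
  intros H. induction n; simpl; [apply analytic_const|]. apply analytic_mult; auto.
Qed.

Lemma pow_le_inv x y n : (0 < n)%nat -> 0 <= x -> 0 < y -> x ^ n <= y ^ n -> x <= y.
Proof.
  intros Hn Hx Hy H. apply Rnot_lt_le. intros L.
  assert (y ^ n < x ^ n); [|lra]. clear H.
  destruct n; [lia|]. clear Hn. induction n; [simpl; lra|].
  change (y * y ^ S n < x * x ^ S n). apply Rmult_gt_0_lt_compat; try lra.
  apply pow_lt; exact Hy.
Qed.

Definition circW (g : C -> C) (s q t : R) : R := powp (Cmod (g (RtoC s * E t)%C)) q.

Lemma circW_cont g s q t : analytic_on_D g -> 0 <= s < 1 -> 0 < q -> continuous (circW g s q) t.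
Proof.
  intros Hg Hs Hq. apply powp_continuous; [exact Hq|intros; apply Cmod_ge_0|].
  apply Cmod_continuous. apply Ccont_ext with (fun t => g (0 + RtoC s * E t)%C).
  - intros u. f_equal. ring.
  - apply fcirc_cont; [exact Hg|]. rewrite Cmod_0. lra.
Qed.

Lemma circW_period g s q t : circW g s q (t + 2 * PI) = circW g s q t.
Proof. unfold circW. rewrite E_period. reflexivity. Qed.

(* With H(z) the product of g over n rotations of z, |g 0|^n = |H 0| is at most the maximum of |H|
   on the circle, and the AM-GM inequality turns that product into a Riemann sum of |g|^q. *)
Lemma submean g s q : analytic_on_D g -> 0 <= s < 1 -> 0 < q ->
  powp (Cmod (g 0%C)) q <= RInt (circW g s q) 0 (2 * PI) / (2 * PI).
Proof.
  intros Hg Hs Hq. assert (PP := PI2_pos).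
  assert (Wc := fun t => circW_cont g s q t Hg Hs Hq).
  set (I := RInt (circW g s q) 0 (2 * PI) / (2 * PI)).
  assert (PI0 : 0 <= I).
  { apply Rdiv_le_0_compat; [|lra]. apply RInt_ge_0; [lra|apply exR_cont, Wc|]. intros; apply powp_ge_0. }
  apply Rnot_lt_le. intros L. set (eps := (powp (Cmod (g 0%C)) q - I) / 2).
  assert (Pe : 0 < eps) by (unfold eps; lra).
  destruct (riemann_sum (circW g s q) eps Wc (circW_period g s q) Pe) as [n [Hn HR]].
  fold I in HR. set (A := I + eps) in *. assert (PA : 0 < A) by (unfold A; lra).
  set (h := 2 * PI / INR n) in *.
  set (H := fun z => cprod (fun k => g (E (INR k * h) * z)%C) n).
  assert (rotI : forall k z, inD z -> inD (E (INR k * h) * z)%C).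
  { intros k z Hz. unfold inD in *. rewrite Cmod_mult, E_mod. lra. }
  assert (HA : analytic_on_D H).
  { apply (cprod_analytic (fun k z => g (E (INR k * h) * z)%C)). intros k.
    apply (analytic_comp g (fun z => E (INR k * h) * z)%C); [exact Hg| |apply rotI].
    apply analytic_scal, analytic_id. }
  assert (B : forall t, 0 <= t <= 2 * PI -> Cmod (H (0 + RtoC s * E t)%C) <= powp (A ^ n) (/ q)).
  { intros t Ht. unfold H. rewrite cprod_mod.
    assert (P : forall k, 0 <= Cmod (g (E (INR k * h) * (0 + RtoC s * E t))%C)) by (intros; apply Cmod_ge_0).
    rewrite <- (powp_powp (rprod _ n) q) by (try exact Hq; apply rprod_ge_0; exact P).
    apply powp_mono; [apply Rinv_0_lt_compat, Hq|]. split; [apply powp_ge_0|].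
    rewrite rprod_powp by exact P.
    apply amgm; [intros; apply powp_ge_0|exact PA|].
    eapply Rle_trans; [|apply (HR t Ht)]. right.
    apply (f_equal (fun f => rsum f n)).
    apply FunctionalExtensionality.functional_extensionality. intros k.
    unfold circW. rewrite (Rplus_comm t), E_plus. do 3 f_equal. ring. }
  assert (H0 : Cmod (H 0%C) = Cmod (g 0%C) ^ n).
  { assert (Z : forall m, rprod (fun k => Cmod (g (E (INR k * h) * 0)%C)) m = Cmod (g 0%C) ^ m).
    { induction m; [reflexivity|]. simpl. rewrite IHm.
      replace (E (INR m * h) * 0)%C with (RtoC 0) by ring. ring. }
    unfold H. rewrite cprod_mod. apply Z. }
  assert (M : Cmod (H 0%C) <= powp (A ^ n) (/ q)).
  { assert (MV := mean_value H 0%C HA inD_0 s ltac:(rewrite Cmod_0; lra)).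
    assert (Bd := CI_bound' (fun t => H (0 + RtoC s * E t)%C) _ ltac:(intros t _; apply fcirc_cont; [exact HA|rewrite Cmod_0; lra]) B).
    rewrite MV, Cmod_mult, Cmod_R, Rabs_right in Bd by lra. apply Rmult_le_reg_l with (2 * PI); lra. }
  rewrite H0 in M.
  assert (X : powp (Cmod (g 0%C)) q ^ n <= A ^ n).
  { assert (Pw : forall x m, 0 <= x -> powp (x ^ m) q = powp x q ^ m).
    { intros x m Hx. induction m; simpl.
      - rewrite powp_pos_eq by lra. unfold Rpower. rewrite ln_1, Rmult_0_r, exp_0. reflexivity.
      - rewrite powp_mult, IHm; auto. apply pow_le, Hx. }
    rewrite <- Pw by apply Cmod_ge_0.
    rewrite <- (powp_powp' (A ^ n) q) by (try exact Hq; left; apply pow_lt, PA).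
    apply powp_mono; [exact Hq|]. split; [apply pow_le, Cmod_ge_0|exact M]. }
  apply pow_le_inv in X; [|exact Hn|apply powp_ge_0|exact PA].
  unfold A, eps in X. lra.
Qed.

Lemma unit_angle c : Cmod c = 1 -> exists th, c = E th.
Proof.
  intros H. assert (S := Cmod_sq c). rewrite H in S. destruct c as [x y]. unfold Re, Im in S; simpl in S.
  assert (X : -1 <= x <= 1) by nra.
  assert (Y : sqrt (1 - x * x) = Rabs y).
  { replace (1 - x * x) with (Rsqr y) by (unfold Rsqr; lra). apply sqrt_Rsqr_abs. }
  destruct (Rle_dec 0 y) as [P|N].
  - exists (acos x). unfold E. rewrite cos_acos, sin_acos by exact X. unfold Rsqr. rewrite Y, Rabs_right by lra. reflexivity.
  - exists (- acos x). unfold E. rewrite cos_neg, sin_neg, cos_acos, sin_acos by exact X. unfold Rsqr.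
    rewrite Y, Rabs_left by lra. f_equal. ring.
Qed.

Lemma rderiv_comp_real (F : R -> C) (g : R -> R) t l m :
  rderiv F (g t) l -> is_derive g t m -> rderiv (fun s => F (g s)) t (RtoC m * l)%C.
Proof.
  intros HF Hg. apply rderiv_parts.
  - replace (Re (RtoC m * l)%C) with (scal m (Re l)) by (unfold Re, scal; simpl; unfold mult; simpl; ring).
    apply (is_derive_comp (fun s => Re (F s)) g); [apply rderiv_Re, HF|exact Hg].
  - replace (Im (RtoC m * l)%C) with (scal m (Im l)) by (unfold Re, Im, scal; simpl; unfold mult; simpl; ring).
    apply (is_derive_comp (fun s => Im (F s)) g); [apply rderiv_Im, HF|exact Hg].
Qed.

(** * Change of variable by a Moebius map of the circle *)

Section Moebius.
Variable a : R.
Hypothesis Ha : 0 <= a < 1.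

Lemma den_mod t : Cmod (RtoC a * E t)%C = a.
Proof. rewrite Cmod_mult, Cmod_R, E_mod, Rabs_right; lra. Qed.

Lemma den_pos t : 0 < Cmod (1 + RtoC a * E t)%C.
Proof.
  assert (T := Cmod_rev_tri 1%C (- (RtoC a * E t))%C). rewrite Cmod_opp, den_mod, Cmod_1 in T.
  replace (1 - - (RtoC a * E t))%C with (1 + RtoC a * E t)%C in T by ring. lra.
Qed.

(** Writing a as sqrt a * sqrt a realises the Poisson kernel of parameter a on the circle of radius
    sqrt a, strictly inside the disk, where [mean_value] computes its integral. *)
Let sa := sqrt a.
Let k := fun z : C => ((1 + - RtoC sa * z) / (1 - - RtoC sa * z))%C.

Lemma sa_bd : 0 <= sa < 1.
Proof. unfold sa. split; [apply sqrt_pos|]. rewrite <- sqrt_1. apply sqrt_lt_1; lra. Qed.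
Lemma sa_sq : sa * sa = a.
Proof. unfold sa. apply sqrt_sqrt; lra. Qed.

Lemma k_pos : posr k.
Proof.
  apply (cayley_pos (fun z => z)); [split; [apply analytic_id|auto]|].
  rewrite Cmod_opp, Cmod_R, Rabs_right; assert (B := sa_bd); lra.
Qed.

Definition pk (t : R) : R := Re (k (0 + RtoC sa * E t)%C).

Lemma pk_cont t : continuous pk t.
Proof.
  apply (Ccont_Re (fun t => k (0 + RtoC sa * E t)%C)). apply fcirc_cont; [apply k_pos|].
  rewrite Cmod_0. assert (B := sa_bd). lra.
Qed.

Lemma pk_eq t : pk t = (1 - a * a) / (Cmod (1 + RtoC a * E t)%C * Cmod (1 + RtoC a * E t)%C).
Proof.
  unfold pk, k.
  assert (Q : (- RtoC sa * (0 + RtoC sa * E t))%C = (- (RtoC a * E t))%C).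
  { rewrite <- sa_sq, RtoC_mult. ring. }
  rewrite Q, cayley_Re by (rewrite Cmod_opp, den_mod; lra).
  rewrite Cmod_opp, den_mod. replace (1 - - (RtoC a * E t))%C with (1 + RtoC a * E t)%C by ring. reflexivity.
Qed.

Lemma pk_int : RInt pk 0 (2 * PI) = 2 * PI.
Proof.
  assert (M := mean_value k 0%C (proj1 k_pos) inD_0 sa ltac:(rewrite Cmod_0; assert (B := sa_bd); lra)).
  apply (f_equal Re) in M. change (RInt pk 0 (2 * PI) = Re (RtoC (2 * PI) * k 0%C)%C) in M. rewrite M.
  assert (K0 : k 0%C = 1%C) by (unfold k; field). rewrite K0. unfold Re; simpl. ring.
Qed.

(** The lifted argument of the Moebius image of e^(it), obtained by integrating its angular speed
    [pk]; this avoids choosing a branch of the argument. *)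
Definition psi (t : R) : R := RInt pk 0 t.

Lemma psi_deriv t : is_derive psi t (pk t).
Proof.
  apply (is_derive_RInt (V := R_NormedModule) pk psi 0 t).
  - exists (mkposreal 1 Rlt_0_1). intros y _. apply (RInt_correct (V := R_CompleteNormedModule)). apply exR_cont, pk_cont.
  - apply pk_cont.
Qed.

Definition moeb_circle (t : R) : C := ((E t + RtoC a) / (1 + RtoC a * E t))%C.

Lemma pk_C t : (RtoC (pk t) * (1 + RtoC a * E t) * (1 + RtoC a * Ec t))%C = (1 - RtoC a * RtoC a)%C.
Proof.
  assert (D := den_pos t).
  assert (X : ((1 + RtoC a * E t) * (1 + RtoC a * Ec t))%C = RtoC (Cmod (1 + RtoC a * E t)%C * Cmod (1 + RtoC a * E t)%C)).
  { assert (Y := Cmod2_conj (1 + RtoC a * E t)%C). rewrite Cplus_conj, Cmult_conj in Y.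
    replace (Cconj 1) with (RtoC 1) in Y by (apply injective_projections; simpl; ring).
    replace (Cconj (RtoC a)) with (RtoC a) in Y by (apply injective_projections; simpl; ring).
    unfold Ec. rewrite <- Y. f_equal. ring. }
  rewrite <- Cmult_assoc, X, pk_eq, <- !RtoC_mult, <- RtoC_minus. f_equal. field. lra.
Qed.

Lemma moeb_circle_deriv t : rderiv moeb_circle t (Ci * RtoC (pk t) * moeb_circle t)%C.
Proof.
  assert (D := den_pos t). apply Cmod_gt_0 in D.
  eapply rderiv_eq.
  - apply (rderiv_comp (fun w => (w + RtoC a) / (1 + RtoC a * w))%C E); [apply rderiv_E|].
    apply cderiv_div.
    + apply cderiv_plus; [apply cderiv_id|apply cderiv_const].
    + apply cderiv_plus; [apply cderiv_const|apply cderiv_scal, cderiv_id].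
    + exact D.
  - cbv beta. unfold moeb_circle.
    assert (P := pk_C t).
    assert (N2 : (E t + RtoC a)%C = (E t * (1 + RtoC a * Ec t))%C).
    { replace (E t * (1 + RtoC a * Ec t))%C with (E t + RtoC a * (Ec t * E t))%C by ring. rewrite Ec_E. ring. }
    rewrite N2 at 2.
    replace (Ci * pk t * (E t * (1 + a * Ec t) / (1 + a * E t)))%C
      with (Ci * E t * (RtoC (pk t) * (1 + RtoC a * E t) * (1 + RtoC a * Ec t)) / ((1 + a * E t) * (1 + a * E t)))%C by (field; exact D).
    rewrite P. field. exact D.
Qed.

(** Both curves rotate with angular speed [pk], so their quotient has derivative zero; it equals 1
    at t = 0. *)
Lemma moeb_circle_psi t : 0 <= t -> moeb_circle t = E (psi t).
Proof.
  intros Ht. set (X := fun t => (moeb_circle t * Ec (psi t))%C).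
  assert (DX : forall t, rderiv X t 0%C).
  { intros u. eapply rderiv_eq.
    - apply (rderiv_mult moeb_circle (fun t => Ec (psi t))); [apply moeb_circle_deriv|].
      apply (rderiv_comp_real Ec psi); [apply rderiv_Ec|apply psi_deriv].
    - ring. }
  assert (X0 : X 0 = 1%C).
  { unfold X, moeb_circle, psi. rewrite RInt_point. unfold zero; simpl. unfold Ec. rewrite E_0.
    replace (Cconj 1) with (RtoC 1) by (apply injective_projections; simpl; ring).
    field. replace (RtoC 1 + RtoC a)%C with (RtoC (1 + a)) by (rewrite RtoC_plus; reflexivity).
    intro Q. apply (f_equal fst) in Q. simpl in Q. lra. }
  assert (XC : X t = 1%C).
  { rewrite <- X0. apply Copp_inj_0, Cmod_eq_0, Rle_antisym; [|apply Cmod_ge_0].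
    replace 0 with (0 * (t - 0)) at 2 by ring. apply mvt_right; [exact Ht| |].
    - intros u _. eapply rderiv_Ccont, DX.
    - intros u Hu eps He. destruct (DX u eps He) as [d [Dd Hd]]. exists d. split; [exact Dd|].
      intros s Hs. specialize (Hd s). rewrite Rabs_right in Hd by lra. specialize (Hd ltac:(lra)).
      replace (X s - X u - 0 * RtoC (s - u))%C with (X s - X u)%C in Hd by ring. lra. }
  replace (moeb_circle t) with (X t * E (psi t))%C; [rewrite XC; ring|].
  unfold X. replace (moeb_circle t * Ec (psi t) * E (psi t))%C with (moeb_circle t * (Ec (psi t) * E (psi t)))%C by ring.
  rewrite Ec_E. ring.
Qed.

Definition Pa (x : R) : R := (1 - a * a) / (Cmod (E x - RtoC a)%C * Cmod (E x - RtoC a)%C).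

Lemma Ea_pos x : 0 < Cmod (E x - RtoC a)%C.
Proof. assert (T := Cmod_rev_tri (E x) (RtoC a)). rewrite E_mod, Cmod_R, Rabs_right in T by lra. lra. Qed.

Lemma Pa_cont x : continuous Pa x.
Proof.
  unfold Pa. apply (continuous_mult (K := R_AbsRing) (fun _ => 1 - a * a)); [apply continuous_const|].
  apply (continuous_comp (fun x => Cmod (E x - RtoC a)%C * Cmod (E x - RtoC a)%C) Rinv).
  - assert (Q : continuous (fun x => Cmod (E x - RtoC a)%C) x).
    { apply Cmod_continuous, Ccont_minus; [apply Ccont_E|apply Ccont_const]. }
    apply (continuous_mult (K := R_AbsRing)); exact Q.
  - apply continuous_Rinv. assert (D := Ea_pos x). apply Rgt_not_eq. nra.
Qed.

Lemma Pa_psi t : 0 <= t -> pk t * Pa (psi t) = 1.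
Proof.
  intros Ht. assert (D := den_pos t). unfold Pa. rewrite <- moeb_circle_psi by exact Ht. unfold moeb_circle.
  replace ((E t + a) / (1 + a * E t) - a)%C with ((1 - RtoC a * RtoC a) * E t / (1 + RtoC a * E t))%C
    by (field; apply Cmod_gt_0, D).
  rewrite Cmod_div by (apply Cmod_gt_0, D).
  rewrite Cmod_mult, E_mod, <- RtoC_mult, <- RtoC_minus, Cmod_R, Rabs_right by nra. rewrite pk_eq.
  assert (0 < 1 - a * a) by nra. field. lra.
Qed.

(** Substitution x = psi t. By [Pa_psi] the Jacobian [pk] is the reciprocal of the Poisson kernel at
    the image point, and psi maps a full period onto a full period. *)
Lemma moebius_subst (W : R -> R) : (forall t, continuous W t) ->
  RInt (fun t => W (psi t)) 0 (2 * PI) = RInt (fun x => W x * Pa x) 0 (2 * PI).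
Proof.
  intros HW. assert (PP := PI2_pos).
  assert (S := RInt_comp (V := R_CompleteNormedModule) (fun x => W x * Pa x) psi pk 0 (2 * PI)).
  assert (P0 : psi 0 = 0) by (unfold psi; rewrite RInt_point; reflexivity).
  assert (P1 : psi (2 * PI) = 2 * PI) by apply pk_int.
  rewrite P0, P1 in S. rewrite <- S.
  - apply RInt_ext. intros t Ht. rewrite Rmin_left, Rmax_right in Ht by lra.
    unfold scal; simpl; unfold mult; simpl.
    replace (pk t * (W (psi t) * Pa (psi t))) with (W (psi t) * (pk t * Pa (psi t))) by ring.
    rewrite Pa_psi by lra. ring.
  - intros x _. apply (continuous_mult (K := R_AbsRing)); [apply HW|apply Pa_cont].
  - intros x _. split; [apply psi_deriv|apply pk_cont].
Qed.

End Moebius.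

Definition Prho (rho : R) (z : C) (x : R) : R :=
  (rho * rho - Cmod z * Cmod z) / (Cmod (RtoC rho * E x - z)%C * Cmod (RtoC rho * E x - z)%C).

Lemma Prho_den rho z x : Cmod z < rho -> 0 < Cmod (RtoC rho * E x - z)%C.
Proof.
  intros H. assert (P := Cmod_ge_0 z). assert (T := Cmod_rev_tri (RtoC rho * E x)%C z).
  rewrite Cmod_mult, E_mod, Cmod_R, Rabs_right in T by lra. lra.
Qed.

Lemma Prho_cont rho z x : Cmod z < rho -> continuous (Prho rho z) x.
Proof.
  intros H. apply (continuous_mult (K := R_AbsRing) (fun _ => rho * rho - Cmod z * Cmod z)); [apply continuous_const|].
  apply (continuous_comp (fun x => Cmod (RtoC rho * E x - z)%C * Cmod (RtoC rho * E x - z)%C) Rinv).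
  - assert (Q : continuous (fun x => Cmod (RtoC rho * E x - z)%C) x).
    { apply Cmod_continuous, Ccont_minus; [|apply Ccont_const].
      apply Ccont_mult; [apply Ccont_const|apply Ccont_E]. }
    apply (continuous_mult (K := R_AbsRing)); exact Q.
  - apply continuous_Rinv. assert (D := Prho_den rho z x H). apply Rgt_not_eq. nra.
Qed.

(* |eta + a| rho < |1 + a eta| for |eta| < R0 := (1 + rho a)/(rho + a), which exceeds 1 *)
Lemma moebius_ext a rho eta : 0 <= a < 1 -> 0 < rho < 1 -> (rho + a) * Cmod eta < 1 + rho * a ->
  rho * Cmod (eta + RtoC a)%C < Cmod (1 + RtoC a * eta)%C.
Proof.
  intros Ha Hr H. apply Rsqr_incrst_0; [|apply Rmult_le_pos; [lra|apply Cmod_ge_0]|apply Cmod_ge_0].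
  unfold Rsqr.
  replace (rho * Cmod (eta + RtoC a)%C * (rho * Cmod (eta + RtoC a)%C)) with (rho * rho * (Cmod (eta + RtoC a)%C * Cmod (eta + RtoC a)%C)) by ring.
  rewrite !Cmod_sq.
  assert (M := Cmod_sq eta). assert (P := Cmod_ge_0 eta). assert (R1 := re_le_Cmod eta).
  set (m := Cmod eta) in *.
  assert (X : - m <= Re eta) by (apply Rabs_def2 with (x := Re eta) (a := m + 1) in R1 || idtac; assert (Q := Rle_abs (- Re eta)); rewrite Rabs_Ropp in Q; lra).
  destruct eta as [u v]. unfold Re, Im in *; simpl in *.
  assert (K : 0 < (1 - a * m) * (1 - a * m) - rho * rho * ((m - a) * (m - a))).
  { assert (F1 : 0 < (1 - a * m) - rho * (m - a)) by nra.
    assert (F2 : 0 < (1 - a * m) + rho * (m - a)).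
    { destruct (Rle_dec a m) as [L|L].
      - assert (a * m < 1).
        { apply Rnot_le_lt. intros G. assert (0 <= rho * (m - a)) by (apply Rmult_le_pos; lra). lra. }
        assert (0 <= rho * (m - a)) by (apply Rmult_le_pos; lra). lra.
      - assert (0 <= (1 - rho) * (a - m)) by (apply Rmult_le_pos; lra).
        assert (0 < (1 - a) * (1 + m)) by (apply Rmult_lt_0_compat; lra). nra. }
    assert (0 < ((1 - a * m) - rho * (m - a)) * ((1 - a * m) + rho * (m - a))) by (apply Rmult_lt_0_compat; assumption).
    nra. }
  assert (Y : 0 <= 2 * a * (1 - rho * rho) * (u + m)).
  { apply Rmult_le_pos; [|lra]. apply Rmult_le_pos; [lra|nra]. }
  nra.
Qed.

(** [submean] at the centre, applied to f composed with a Moebius map that takes 0 to z and the unit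
    circle to the circle of radius rho. The substitution rule turns the uniform mean into the
    Poisson mean. *)
Lemma poisson_submean f z rho q : analytic_on_D f -> 0 < rho < 1 -> Cmod z < rho -> 0 < q ->
  powp (Cmod (f z)) q <= RInt (fun x => circW f rho q x * Prho rho z x) 0 (2 * PI) / (2 * PI).
Proof.
  intros Hf Hr Hz Hq. assert (PP := PI2_pos). assert (Pz := Cmod_ge_0 z).
  destruct (unit_rot z) as [c [Hc Ez]].
  assert (Hcc : Cmod (Cconj c) = 1) by (rewrite Cmod_conj; exact Hc).
  destruct (unit_angle _ Hcc) as [th Eth].
  assert (Ez' : z = (RtoC (Cmod z) * E th)%C).
  { rewrite <- Ez, <- Eth. replace (c * z * Cconj c)%C with (z * (c * Cconj c))%C by ring.
    rewrite <- Cmod2_conj, Hc. replace (RtoC (1 ^ 2)) with (RtoC 1) by (f_equal; ring). ring. }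
  set (a := Cmod z / rho).
  assert (Ha : 0 <= a < 1).
  { split; [apply Rdiv_le_0_compat; lra|]. apply Rlt_div_l; lra. }
  assert (Era : rho * a = Cmod z) by (unfold a; field; lra).
  (* By [moebius_ext] the map still takes values in the unit disk for |eta| < R0, and R0 > 1.
     Rescaling by [RR], midway between 1 and R0, defines the composite on the whole unit disk, and
     the former unit circle becomes the circle of radius 1 / RR. *)
  set (R0 := (1 + rho * a) / (rho + a)).
  assert (HR0 : 1 < R0). { unfold R0. apply Rlt_div_r; [lra|]. nra. }
  assert (HR0' : (rho + a) * R0 = 1 + rho * a) by (unfold R0; field; lra).
  set (RR := (1 + R0) / 2).
  assert (HRR : 1 < RR < R0) by (unfold RR; lra).
  set (g := fun xi => f (RtoC rho * E th * ((RtoC RR * xi + RtoC a) / (1 + RtoC a * (RtoC RR * xi))))%C).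
  assert (Bd : forall xi, inD xi -> rho * Cmod (RtoC RR * xi + RtoC a)%C < Cmod (1 + RtoC a * (RtoC RR * xi))%C).
  { intros xi Hxi. apply moebius_ext; [exact Ha|exact Hr|]. rewrite Cmod_mult, Cmod_R, Rabs_right by lra.
    rewrite <- HR0'. apply Rmult_lt_compat_l; [lra|]. unfold inD in Hxi. assert (Q := Cmod_ge_0 xi). nra. }
  assert (Nz : forall xi, inD xi -> (1 + RtoC a * (RtoC RR * xi))%C <> 0%C).
  { intros xi Hxi. apply Cmod_gt_0. specialize (Bd xi Hxi). assert (Q := Cmod_ge_0 (RtoC RR * xi + RtoC a)%C). nra. }
  assert (Hg : analytic_on_D g).
  { apply (analytic_comp f (fun xi => RtoC rho * E th * ((RtoC RR * xi + RtoC a) / (1 + RtoC a * (RtoC RR * xi))))%C); [exact Hf| |].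
    - apply analytic_scal. apply analytic_div.
      + apply analytic_plus; [apply analytic_scal, analytic_id|apply analytic_const].
      + apply analytic_plus; [apply analytic_const|]. apply analytic_scal, analytic_scal, analytic_id.
      + exact Nz.
    - intros xi Hxi. unfold inD. rewrite !Cmod_mult, Cmod_div by (apply Nz, Hxi).
      rewrite Cmod_R, E_mod, Rabs_right, Rmult_1_r by lra.
      assert (N := proj1 (Cmod_gt_0 _) (Nz xi Hxi)). specialize (Bd xi Hxi).
      replace (rho * (Cmod (RR * xi + a) / Cmod (1 + a * (RR * xi)))) with (rho * Cmod (RR * xi + a) / Cmod (1 + a * (RR * xi))) by (field; lra).
      apply Rlt_div_l; lra. }
  assert (Hs : 0 <= / RR < 1).
  { split; [left; apply Rinv_0_lt_compat; lra|]. rewrite <- Rinv_1. apply Rinv_lt_contravar; lra. }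
  assert (S := submean g (/ RR) q Hg Hs Hq).
  replace (g 0%C) with (f z) in S.
  2:{ unfold g. f_equal. rewrite Ez' at 1. rewrite <- Era, RtoC_mult. field. }
  eapply Rle_trans; [exact S|]. right. f_equal.
  set (W := fun x => circW f rho q (x + th)).
  assert (Wf := fun t => circW_cont f rho q t Hf ltac:(lra) Hq).
  assert (Wc : forall t, continuous W t).
  { intros t. apply (continuous_comp (fun x => x + th) (circW f rho q)); [|apply Wf].
    apply (continuous_plus (fun x => x) (fun _ => th)); [apply continuous_id|apply continuous_const]. }
  transitivity (RInt (fun t => W (psi a t)) 0 (2 * PI)).
  { apply RInt_ext. intros t Ht. rewrite Rmin_left, Rmax_right in Ht by lra.
    unfold W, circW, g. do 3 f_equal. rewrite E_plus, <- (moeb_circle_psi a Ha t) by lra. unfold moeb_circle.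
    replace (RtoC RR * (RtoC (/ RR) * E t))%C with (E t).
    - ring.
    - rewrite RtoC_inv by lra. field. intro Q. apply (f_equal fst) in Q. simpl in Q. lra. }
  rewrite (moebius_subst a Ha W Wc).
  set (V := fun x => circW f rho q x * Prho rho z x).
  rewrite <- (shifted_mean V th).
  - apply RInt_ext. intros x _. unfold V, W. f_equal. unfold Pa, Prho.
    assert (A1 : Cmod (RtoC rho * E (x + th) - z)%C = rho * Cmod (E x - RtoC a)%C).
    { rewrite Ez', E_plus, <- Era, RtoC_mult.
      replace (rho * (E x * E th) - rho * a * E th)%C with (RtoC rho * (E x - RtoC a) * E th)%C by ring.
      rewrite !Cmod_mult, E_mod, Cmod_R, Rabs_right by lra. ring. }
    rewrite A1, <- Era. assert (D := Ea_pos a Ha x). field. lra.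
  - intros t. apply (continuous_mult (K := R_AbsRing)); [apply Wf|apply Prho_cont, Hz].
  - intros t. unfold V, Prho. rewrite circW_period, E_period. reflexivity.
Qed.

(** A quadratic remainder uniform in the parameter is enough to differentiate under the integral. It
    serves the Herglotz integral and the time means of the flow. *)
Lemma param_cderiv (k : R -> C -> C) (dk : R -> C) (a b : R) (z : C) (B r : R) : a <= b -> 0 < r ->
  (forall w, Cmod (w - z)%C < r -> ccon (fun t => k t w) a b) -> ccon dk a b -> 0 <= B ->
  (forall t w, a <= t <= b -> Cmod (w - z)%C < r ->
     Cmod (k t w - k t z - dk t * (w - z))%C <= B * (Cmod (w - z)%C * Cmod (w - z)%C)) ->
  cderiv (fun w => CI (fun t => k t w) a b) z (CI dk a b).
Proof.
  intros Hab Hr Hk Hdk HB H eps He.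
  set (M := B * (b - a) + 1).
  assert (PM : 0 < M) by (unfold M; assert (0 <= B * (b - a)) by (apply Rmult_le_pos; lra); lra).
  exists (Rmin r (eps / M)). split; [apply Rmin_glb_lt; [exact Hr|apply Rdiv_lt_0_compat; assumption]|].
  intros w Hw.
  assert (W1 := Rlt_le_trans _ _ _ Hw (Rmin_l _ _)). assert (W2 := Rlt_le_trans _ _ _ Hw (Rmin_r _ _)).
  assert (Z0 : Cmod (z - z)%C < r) by (replace (z - z)%C with (RtoC 0) by ring; rewrite Cmod_0; exact Hr).
  rewrite (Cmult_comm (CI dk a b)). rewrite <- CI_scal by exact Hdk.
  assert (K1 := Hk w W1). assert (K2 := Hk z Z0).
  assert (K3 : ccon (fun t => (w - z) * dk t)%C a b) by (intros t T; apply Ccont_mult; [apply Ccont_const|auto]).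
  rewrite <- CI_minus by assumption.
  assert (K4 : ccon (fun t => k t w - k t z)%C a b) by (intros t T; apply Ccont_minus; auto).
  rewrite <- CI_minus by assumption.
  set (m := Cmod (w - z)%C) in *. assert (Pm : 0 <= m) by apply Cmod_ge_0.
  eapply Rle_trans; [apply (CI_bound _ a b (B * (m * m)))|].
  - intros t T. apply Ccont_minus; auto.
  - rewrite Rmin_left, Rmax_right by lra. intros t T.
    rewrite (Cmult_comm (w - z)%C). apply H; assumption.
  - rewrite Rabs_right by lra.
    assert (E1 : M * m <= eps).
    { replace eps with (M * (eps / M)) by (field; lra). apply Rmult_le_compat_l; lra. }
    assert (E2 : B * (b - a) * m <= M * m) by (unfold M; nra).
    replace (B * (m * m) * (b - a)) with (B * (b - a) * m * m) by ring.
    apply Rmult_le_compat_r; lra.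
Qed.

Lemma cont_bounded (W : R -> R) a b : (forall t, continuous W t) -> exists M, 0 <= M /\ forall t, a <= t <= b -> W t <= M.
Proof.
  intros H. destruct (Rle_dec a b) as [L|L].
  - destruct (continuity_ab_maj W a b L) as [x [Hx _]].
    { intros c _. apply continuity_pt_filterlim, H. }
    exists (Rmax 0 (W x)). split; [apply Rmax_l|]. intros t T. eapply Rle_trans; [apply Hx, T|apply Rmax_r].
  - exists 0. split; [lra|]. intros t T. lra.
Qed.

Definition herglotz (W : R -> R) (z : C) : C :=
  CI (fun x => RtoC (W x) * ((E x + z) / (E x - z)))%C 0 (2 * PI).

Lemma Ez_den z x : inD z -> 1 - Cmod z <= Cmod (E x - z)%C.
Proof. intros H. assert (T := Cmod_rev_tri (E x) z). rewrite E_mod in T. exact T. Qed.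

Lemma Ez_nz z x : inD z -> (E x - z)%C <> 0%C.
Proof. intros H. apply Cmod_gt_0. assert (D := Ez_den z x H). unfold inD in H. lra. Qed.

Lemma herg_cont W z x : (forall t, continuous W t) -> inD z ->
  Ccont (fun x => RtoC (W x) * ((E x + z) / (E x - z)))%C x.
Proof.
  intros HW Hz. apply Ccont_mult; [apply Ccont_RtoC, HW|].
  apply Ccont_mult; [apply Ccont_plus; [apply Ccont_E|apply Ccont_const]|].
  apply (Ccont_comp (fun w => / w)%C (fun x => E x - z)%C x (- / ((E x - z) * (E x - z)))%C).
  - apply cderiv_inv0, Ez_nz, Hz.
  - apply Ccont_minus; [apply Ccont_E|apply Ccont_const].
Qed.

Lemma herg_kernel_analytic x : analytic_on_D (fun z => (E x + z) / (E x - z))%C.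
Proof.
  apply analytic_div.
  - apply analytic_plus; [apply analytic_const|apply analytic_id].
  - apply analytic_minus; [apply analytic_const|apply analytic_id].
  - intros z Hz. apply Ez_nz, Hz.
Qed.

Lemma herg_kernel_deriv x z : inD z ->
  cD (fun z => (E x + z) / (E x - z))%C z = (2 * E x / ((E x - z) * (E x - z)))%C.
Proof.
  intros Hz. assert (N := Ez_nz z x Hz). apply cD_eq. eapply cderiv_eq.
  - apply cderiv_div; [apply cderiv_plus; [apply cderiv_const|apply cderiv_id]|apply cderiv_minus; [apply cderiv_const|apply cderiv_id]|exact N].
  - field. exact N.
Qed.

Lemma herglotz_analytic W : (forall t, continuous W t) -> (forall t, 0 <= W t) -> analytic_on_D (herglotz W).
Proof.
  intros HW WP. apply analytic_iff. intros z Hz. assert (PP := PI2_pos).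
  destruct (cont_bounded W 0 (2 * PI) HW) as [M [M0 HM]].
  set (s := (1 - Cmod z) / 2). assert (Ps : 0 < s) by (unfold s; unfold inD in Hz; lra).
  eexists.
  (* On the disk of radius s about z the kernel has numerator at most 2 and denominator at least s,
     hence the constant 2 / s in the second-order Cauchy bound. *)
  apply (param_cderiv (fun x z => RtoC (W x) * ((E x + z) / (E x - z)))%C
    (fun x => RtoC (W x) * (2 * E x / ((E x - z) * (E x - z))))%C 0 (2 * PI) z (M * (8 * (2 / s) / (s * s))) (s / 4)); [lra|lra| | | |].
  - intros w Hw t _. apply herg_cont; [exact HW|]. unfold inD. assert (T := Cmod_le_plus w z). unfold s in *. lra.
  - intros t _. apply Ccont_mult; [apply Ccont_RtoC, HW|].
    apply Ccont_mult; [apply Ccont_mult; [apply Ccont_const|apply Ccont_E]|].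
    apply (Ccont_comp (fun w => / w)%C (fun x => (E x - z) * (E x - z))%C t (- / (((E t - z) * (E t - z)) * ((E t - z) * (E t - z))))%C).
    + apply cderiv_inv0, Cmult_neq_0; apply Ez_nz, Hz.
    + apply Ccont_mult; apply Ccont_minus; try apply Ccont_E; apply Ccont_const.
  - apply Rmult_le_pos; [exact M0|]. apply Rdiv_le_0_compat; [|nra].
    assert (0 < 2 / s) by (apply Rdiv_lt_0_compat; lra). lra.
  - intros t w Ht Hw. rewrite <- herg_kernel_deriv by exact Hz.
    replace (W t * ((E t + w) / (E t - w)) - W t * ((E t + z) / (E t - z)) - W t * cD (fun z0 : C => (E t + z0) / (E t - z0)) z * (w - z))%C
      with (RtoC (W t) * ((E t + w) / (E t - w) - (E t + z) / (E t - z) - cD (fun z0 : C => (E t + z0) / (E t - z0))%C z * (w - z)))%C by ring.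
    rewrite Cmod_mult, Cmod_R, Rabs_right by (apply Rle_ge, WP). rewrite Rmult_assoc.
    apply Rmult_le_compat; [apply WP|apply Cmod_ge_0|apply HM, Ht|].
    apply (cauchy_second (fun z => (E t + z) / (E t - z))%C z w s (2 / s)).
    + apply herg_kernel_analytic.
    + exact Ps.
    + unfold s. unfold inD in Hz. lra.
    + intros u Hu. assert (T := Cmod_le_plus u z).
      assert (Iu : inD u) by (unfold inD, s in *; lra).
      rewrite Cmod_div by (apply Ez_nz, Iu). assert (D := Ez_den u t Iu).
      assert (D' : s <= Cmod (E t - u)%C) by (unfold s in *; lra).
      assert (N : Cmod (E t + u)%C <= 2).
      { eapply Rle_trans; [apply Cmod_triangle|]. rewrite E_mod. unfold inD in Iu. lra. }
      apply Rle_trans with (2 / Cmod (E t - u)%C).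
      * apply Rmult_le_compat_r; [|exact N]. left. apply Rinv_0_lt_compat. lra.
      * apply Rmult_le_compat_l; [lra|]. apply Rinv_le_contravar; lra.
    + lra.
Qed.

Lemma herg_Re W z x : inD z -> Re (RtoC (W x) * ((E x + z) / (E x - z)))%C = W x * Prho 1 z x.
Proof.
  intros Hz. assert (N := Ez_nz z x Hz).
  assert (M1 : Cmod (Ec x * z)%C < 1) by (rewrite Cmod_mult, Ec_mod, Rmult_1_l; exact Hz).
  assert (F : ((E x + z) / (E x - z))%C = ((1 + Ec x * z) / (1 - Ec x * z))%C).
  { assert (Q : (E x * (1 + Ec x * z))%C = (E x + z)%C).
    { replace (E x * (1 + Ec x * z))%C with (E x + (Ec x * E x) * z)%C by ring. rewrite Ec_E. ring. }
    assert (Q' : (E x * (1 - Ec x * z))%C = (E x - z)%C).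
    { replace (E x * (1 - Ec x * z))%C with (E x - (Ec x * E x) * z)%C by ring. rewrite Ec_E. ring. }
    rewrite <- Q, <- Q'. field. split; [apply one_minus_nz, M1|].
    apply Cmod_gt_0. rewrite E_mod. lra. }
  replace (Re (RtoC (W x) * ((E x + z) / (E x - z)))%C) with (W x * Re ((E x + z) / (E x - z))%C)
    by (generalize ((E x + z) / (E x - z))%C; intros [u v]; unfold Re; simpl; ring).
  f_equal. rewrite F, cayley_Re by exact M1. unfold Prho.
  rewrite Cmod_mult, Ec_mod, Rmult_1_l.
  replace (Cmod (RtoC 1 * E x - z)%C) with (Cmod (1 - Ec x * z)%C).
  - f_equal. ring.
  - replace (RtoC 1 * E x - z)%C with (E x * (1 - Ec x * z))%C.
    + rewrite Cmod_mult, E_mod, Rmult_1_l. reflexivity.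
    + replace (E x * (1 - Ec x * z))%C with (E x - (Ec x * E x) * z)%C by ring. rewrite Ec_E. ring.
Qed.

Lemma herglotz_Re W z : inD z -> Re (herglotz W z) = RInt (fun x => W x * Prho 1 z x) 0 (2 * PI).
Proof.
  intros Hz. unfold herglotz, CI. simpl. apply RInt_ext. intros x _. apply herg_Re, Hz.
Qed.

Lemma Prho_ge_0 rho z x : 0 <= Cmod z < rho -> 0 <= Prho rho z x.
Proof.
  intros H. unfold Prho. assert (D := Prho_den rho z x ltac:(lra)).
  apply Rdiv_le_0_compat; nra.
Qed.

Lemma herglotz_pos W : (forall t, continuous W t) -> (forall t, 0 <= W t) -> posr (herglotz W).
Proof.
  intros HW WP. split; [apply herglotz_analytic; assumption|]. intros z Hz. assert (PP := PI2_pos).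
  rewrite herglotz_Re by exact Hz. apply RInt_ge_0; [lra| |].
  - apply exR_cont. intros t. apply (continuous_mult (K := R_AbsRing)); [apply HW|apply Prho_cont, Hz].
  - intros x _. apply Rmult_le_pos; [apply WP|]. apply Prho_ge_0. split; [apply Cmod_ge_0|exact Hz].
Qed.

Lemma herglotz_0 W : Re (herglotz W 0%C) = RInt W 0 (2 * PI).
Proof.
  rewrite herglotz_Re by apply inD_0. apply RInt_ext. intros x _. unfold Prho.
  replace (RtoC 1 * E x - 0)%C with (E x) by ring. rewrite Cmod_0, E_mod.
  transitivity (W x * 1); [|apply Rmult_1_r]. apply (f_equal (Rmult (W x))). field.
Qed.

(** The hypothesis makes 1 - rho at most |rho e^(ix) - z|, so passing from radius rho to radius 1 at
    most doubles the distance; 4 is the square of that factor. *)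
Lemma Prho_compare rho z x : rho < 1 -> 0 <= Cmod z -> 1 - rho <= rho - Cmod z -> Prho rho z x <= 4 * Prho 1 z x.
Proof.
  intros Hr Hz H. unfold Prho.
  assert (D := Prho_den rho z x ltac:(lra)). assert (D1 := Prho_den 1 z x ltac:(lra)).
  set (d := Cmod (RtoC rho * E x - z)%C) in *. set (d1 := Cmod (RtoC 1 * E x - z)%C) in *.
  assert (T : d1 <= 2 * d).
  { assert (T := Cmod_triangle (RtoC rho * E x - z)%C (RtoC (1 - rho) * E x)%C).
    replace (rho * E x - z + (1 - rho)%R * E x)%C with (RtoC 1 * E x - z)%C in T by (rewrite RtoC_minus; ring).
    rewrite Cmod_mult, E_mod, Cmod_R, Rabs_right in T by lra. fold d d1 in T.
    assert (T2 := Cmod_rev_tri (RtoC rho * E x)%C z). rewrite Cmod_mult, E_mod, Cmod_R, Rabs_right in T2 by lra.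
    fold d in T2. lra. }
  apply Rle_trans with ((1 * 1 - Cmod z * Cmod z) / (d * d)).
  - apply Rmult_le_compat_r; [left; apply Rinv_0_lt_compat; nra|nra].
  - replace (4 * ((1 * 1 - Cmod z * Cmod z) / (d1 * d1))) with ((1 * 1 - Cmod z * Cmod z) * (/ (d1 * d1 / 4))) by (field; lra).
    apply Rmult_le_compat_l; [nra|]. apply Rinv_le_contravar; nra.
Qed.

Lemma pos_scal c K : 0 <= c -> posr K -> posr (fun z => RtoC c * K z)%C.
Proof.
  intros Hc [HK HP]. split; [apply analytic_scal, HK|]. intros z Hz. specialize (HP z Hz).
  replace (Re (RtoC c * K z)%C) with (c * Re (K z)) by (unfold Re; simpl; ring). apply Rmult_le_pos; assumption.
Qed.

(** The Poisson integral over the circle of radius 1 - h/4 lives only inside that circle. For |z| <=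
    1 - h/2 its kernel is comparable to that of the unit circle, which gives a majorant on the whole
    disk. *)
Lemma submean_majorant f h q : analytic_on_D f -> 0 < h <= 1 -> 0 < q ->
  exists K, posr K /\ Re (K 0%C) = 4 * (RInt (circW f (1 - h / 4) q) 0 (2 * PI) / (2 * PI)) /\
   forall z, Cmod z <= 1 - h / 2 -> powp (Cmod (f z)) q <= Re (K z).
Proof.
  intros Hf Hh Hq. assert (PP := PI2_pos). set (rho := 1 - h / 4).
  assert (Wc := fun t => circW_cont f rho q t Hf ltac:(unfold rho; lra) Hq).
  assert (WP : forall t, 0 <= circW f rho q t) by (intros; apply powp_ge_0).
  exists (fun z => RtoC (4 / (2 * PI)) * herglotz (circW f rho q) z)%C. split; [|split].
  - apply pos_scal; [apply Rdiv_le_0_compat; lra|]. apply herglotz_pos; assumption.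
  - replace (Re (RtoC (4 / (2 * PI)) * herglotz (circW f rho q) 0)%C) with (4 / (2 * PI) * Re (herglotz (circW f rho q) 0%C))
      by (unfold Re; simpl; ring).
    rewrite herglotz_0. set (I := RInt (circW f rho q) 0 (2 * PI) : R). field. assert (P0 := PI_RGT_0); lra.
  - intros z Hz. assert (Pz := Cmod_ge_0 z). assert (Iz : inD z) by (unfold inD; lra).
    replace (Re (RtoC (4 / (2 * PI)) * herglotz (circW f rho q) z)%C) with (4 / (2 * PI) * Re (herglotz (circW f rho q) z))
      by (unfold Re; simpl; ring).
    rewrite herglotz_Re by exact Iz.
    eapply Rle_trans; [apply (poisson_submean f z rho q); auto; unfold rho; lra|].
    replace (4 / (2 * PI) * RInt (fun x => circW f rho q x * Prho 1 z x) 0 (2 * PI))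
      with (4 * RInt (fun x => circW f rho q x * Prho 1 z x) 0 (2 * PI) / (2 * PI)) by (unfold Rdiv; ring).
    apply Rmult_le_compat_r; [left; apply Rinv_0_lt_compat, PP|].
    assert (Ex : ex_RInt (fun x => circW f rho q x * Prho 1 z x) 0 (2 * PI)).
    { apply exR_cont. intros t. apply (continuous_mult (K := R_AbsRing)); [apply Wc|apply Prho_cont, Iz]. }
    assert (Sc := RInt_scal (V := R_CompleteNormedModule) (fun x => circW f rho q x * Prho 1 z x) 0 (2 * PI) 4 Ex).
    unfold scal in Sc; simpl in Sc; unfold mult in Sc; simpl in Sc. rewrite <- Sc.
    apply RInt_le; [lra| | |].
    + apply exR_cont. intros t. apply (continuous_mult (K := R_AbsRing)); [apply Wc|apply Prho_cont; unfold rho; lra].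
    + apply (ex_RInt_scal (V := R_NormedModule)). exact Ex.
    + intros x _. replace (4 * (circW f rho q x * Prho 1 z x)) with (circW f rho q x * (4 * Prho 1 z x)) by ring.
      apply Rmult_le_compat_l; [apply WP|]. apply Prho_compare; unfold rho; lra.
Qed.

Lemma Rpower_anti x y a : 0 <= a -> 0 < x <= y -> Rpower y (- a) <= Rpower x (- a).
Proof.
  intros Ha [Hx Hy]. rewrite !Rpower_Ropp. apply Rinv_le_contravar; [apply Rpower_pos|]. apply Rle_Rpower_l; lra.
Qed.
Lemma Rpower_incr x y a : 0 < a -> 0 < x <= y -> Rpower x a <= Rpower y a.
Proof. intros. apply Rle_Rpower_l; lra. Qed.
Lemma Rpower_root x q : 0 < x -> 0 < q -> Rpower (Rpower x (/ q)) q = x.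
Proof. intros Hx Hq. rewrite Rpower_mult, Rinv_l by lra. apply Rpower_1, Hx. Qed.
Lemma Rpower_lt_1 x a : 0 < x < 1 -> 0 < a -> Rpower x a < 1.
Proof.
  intros Hx Ha. unfold Rpower. rewrite <- exp_0. apply exp_increasing.
  assert (ln x < 0) by (rewrite <- ln_1; apply ln_increasing; lra). nra.
Qed.
Lemma Rpower_pow_comm x a n : 0 < x -> Rpower (x ^ n) a = Rpower x a ^ n.
Proof.
  intros Hx. rewrite <- !Rpower_pow by (try exact Hx; apply Rpower_pos).
  rewrite !Rpower_mult. f_equal. ring.
Qed.

Lemma rsum_le f g n : (forall i, (i < n)%nat -> f i <= g i) -> rsum f n <= rsum g n.
Proof.
  induction n; intros H; simpl; [lra|]. assert (H1 := H n ltac:(lia)).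
  assert (rsum f n <= rsum g n) by (apply IHn; intros; apply H; lia). lra.
Qed.
Lemma rsum_lt f g n : (0 < n)%nat -> (forall i, (i < n)%nat -> f i < g i) -> rsum f n < rsum g n.
Proof.
  intros Hn H. destruct n; [lia|]. simpl. assert (H1 := H n ltac:(lia)).
  assert (rsum f n <= rsum g n) by (apply rsum_le; intros; left; apply H; lia). lra.
Qed.
Lemma rsum_scal c f n : rsum (fun i => c * f i) n = c * rsum f n.
Proof. induction n; simpl; [ring|]. rewrite IHn. ring. Qed.
Lemma rsum_plus f g n : rsum (fun i => f i + g i) n = rsum f n + rsum g n.
Proof. induction n; simpl; [ring|]. rewrite IHn. ring. Qed.
Lemma rsum_const c n : rsum (fun _ => c) n = INR n * c.
Proof. induction n; [simpl; ring|]. rewrite S_INR. simpl. rewrite IHn. ring. Qed.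
Lemma rsum_ge_0 f n : (forall i, (i < n)%nat -> 0 <= f i) -> 0 <= rsum f n.
Proof.
  intros H. replace 0 with (rsum (fun _ => 0) n) by (rewrite rsum_const; ring). apply rsum_le. exact H.
Qed.
Lemma rsum_elem f n i : (forall i, (i < n)%nat -> 0 <= f i) -> (i < n)%nat -> f i <= rsum f n.
Proof.
  induction n; intros H Hi; [lia|]. simpl.
  destruct (Nat.eq_dec i n) as [->|N].
  - assert (0 <= rsum f n) by (apply rsum_ge_0; intros; apply H; lia). lra.
  - assert (f i <= rsum f n) by (apply IHn; [intros; apply H; lia|lia]). assert (Q := H n ltac:(lia)). lra.
Qed.
Lemma rsum_geo k n : 0 <= k < 1 -> rsum (fun i => k ^ i) n <= / (1 - k).
Proof.
  intros Hk. assert (X : rsum (fun i => k ^ i) n = (1 - k ^ n) / (1 - k)).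
  { induction n; simpl; [field; lra|]. rewrite IHn. field. lra. }
  rewrite X. unfold Rdiv. rewrite <- (Rmult_1_l (/ (1 - k))) at 2.
  apply Rmult_le_compat_r; [left; apply Rinv_0_lt_compat; lra|]. assert (0 <= k ^ n) by (apply pow_le; lra). lra.
Qed.
Lemma rsum_split f n m : rsum f (n + m) = rsum f n + rsum (fun i => f (n + i)%nat) m.
Proof.
  induction m; simpl; [rewrite Nat.add_0_r; ring|]. rewrite Nat.add_succ_r. simpl. rewrite IHm. ring.
Qed.
Lemma rsum_ext f g n : (forall i, (i < n)%nat -> f i = g i) -> rsum f n = rsum g n.
Proof.
  induction n; intros H; simpl; [reflexivity|]. rewrite IHn by (intros; apply H; lia). rewrite H by lia. reflexivity.
Qed.

(** If the inequality failed for every i, summing the reversed inequalities would be contradictory.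
    It lets one weighted summand dominate a whole sum, whatever the exponent. *)
Lemma pigeon x c n : (0 < n)%nat -> (forall i, 0 <= x i) -> (forall i, 0 < c i) ->
  exists i, (i < n)%nat /\ rsum x n * c i <= rsum c n * x i.
Proof.
  intros Hn Hx Hc. apply NNPP. intros N.
  assert (H : forall i, (i < n)%nat -> rsum c n * x i < rsum x n * c i).
  { intros i Hi. apply Rnot_le_lt. intros L. apply N. exists i. split; assumption. }
  assert (K := rsum_lt _ _ n Hn H). rewrite !rsum_scal in K. lra.
Qed.

Fixpoint ksum (w : nat -> R) (K : nat -> C -> C) (n : nat) (z : C) : C :=
  match n with O => 0%C | S m => (ksum w K m z + RtoC (w m) * K m z)%C end.

Lemma ksum_Re w K n z : Re (ksum w K n z) = rsum (fun i => w i * Re (K i z)) n.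
Proof.
  induction n; simpl; [reflexivity|]. rewrite <- IHn. unfold Re; simpl. ring.
Qed.

Lemma ksum_pos w K n : (forall i, 0 <= w i) -> (forall i, (i < n)%nat -> posr (K i)) -> posr (ksum w K n).
Proof.
  intros Hw HK. split.
  - induction n; [apply analytic_const|]. simpl. apply analytic_plus; [apply IHn; intros; apply HK; lia|].
    apply analytic_scal, HK. lia.
  - intros z Hz. rewrite ksum_Re. apply rsum_ge_0. intros i Hi. apply Rmult_le_pos; [apply Hw|]. apply HK; assumption.
Qed.

Lemma level_exists lam b : 1 < lam -> 0 < b <= 1 -> exists N, 1 <= lam ^ N * b < lam.
Proof.
  intros Hl Hb.
  destruct (Pow_x_infinity lam ltac:(rewrite Rabs_right; lra) (/ b)) as [M HM].
  specialize (HM M (le_n _)). rewrite Rabs_right in HM by (apply Rle_ge, pow_le; lra).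
  assert (H : 1 <= lam ^ M * b).
  { replace 1 with (/ b * b) by (field; lra). apply Rmult_le_compat_r; lra. }
  clear HM. induction M.
  - exists O. simpl in *. lra.
  - destruct (Rle_dec 1 (lam ^ M * b)) as [L|L]; [apply IHM, L|].
    exists (S M). split; [exact H|]. simpl. rewrite Rmult_assoc.
    apply Rlt_le_trans with (lam * 1); [apply Rmult_lt_compat_l; lra|lra].
Qed.

Lemma level_find b x N : 0 < b <= x -> x <= 2 ^ N * b -> exists i, (i <= N)%nat /\ x <= 2 ^ i * b <= 2 * x.
Proof.
  intros Hb. induction N; intros H.
  - exists O. simpl in *. split; [lia|]. lra.
  - destruct (Rle_dec x (2 ^ N * b)) as [L|L].
    + destruct (IHN L) as [i [Hi H']]. exists i. split; [lia|exact H'].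
    + exists (S N). split; [lia|]. simpl in *. lra.
Qed.

Lemma pow_le_level lam b i N : 1 < lam -> 0 < b -> (i <= N)%nat -> lam ^ i * b <= lam ^ N * b.
Proof.
  intros Hl Hb Hi. apply Rmult_le_compat_r; [lra|]. apply Rle_pow; [lra|exact Hi].
Qed.

(** * Domination on shells *)

(** A thickness by the factor 2 lets dyadic values of h cover the disk without gaps. *)
Definition shell (h : R) (z : C) : Prop := h / 2 <= 1 - Cmod z <= h.

Lemma shell_inD h z : 0 < h -> shell h z -> inD z.
Proof. unfold shell, inD. lra. Qed.

Section Norm.
Variables (p : Rbar) (alpha : R).
Hypothesis Hp : Rbar_lt 0 p.
Hypothesis Ha : 0 < alpha.

(* For p < infty, Re (K 0) is the mean of the majorant Re K of u^p over any circle, so [harm_dom h u A] says that the p-th mean of u over the shell is at most A. *)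
Definition harm_dom (h : R) (u : C -> R) (A : R) : Prop :=
  match p with
  | Finite q => exists K, posr K /\ Re (K 0%C) <= Rpower A q /\ forall z, shell h z -> powp (u z) q <= Re (K z)
  | _ => forall z, shell h z -> u z <= A
  end.

Definition bnd (u : C -> R) (A : R) : Prop :=
  forall h, 0 < h <= 1 -> harm_dom h u (A * Rpower h (- alpha)).

Lemma dom_mono h u v A B : 0 < A <= B -> (forall z, shell h z -> 0 <= u z <= v z) -> harm_dom h v A -> harm_dom h u B.
Proof.
  intros HA H. unfold harm_dom. destruct p as [q| |]; simpl in Hp.
  - intros [K [HK [K0 Hu]]]. exists K. split; [exact HK|]. split.
    + eapply Rle_trans; [exact K0|]. apply Rpower_incr; assumption.
    + intros z Hz. eapply Rle_trans; [|apply Hu, Hz]. apply powp_mono; auto.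
  - intros Hv z Hz. specialize (H z Hz). specialize (Hv z Hz). lra.
  - contradiction.
Qed.

Lemma dom_scal h u A c : 0 < c -> 0 < A -> (forall z, shell h z -> 0 <= u z) -> harm_dom h u A -> harm_dom h (fun z => c * u z) (c * A).
Proof.
  intros Hc HA H. unfold harm_dom. destruct p as [q| |]; simpl in Hp.
  - intros [K [HK [K0 Hu]]]. exists (fun z => RtoC (powp c q) * K z)%C.
    split; [apply pos_scal; [apply powp_ge_0|exact HK]|].
    assert (RM : forall w, Re (RtoC (powp c q) * w)%C = powp c q * Re w) by (intros w; unfold Re; simpl; ring).
    split.
    + rewrite RM, <- Rpower_mult_distr, powp_pos_eq by lra. apply Rmult_le_compat_l; [left; apply Rpower_pos|exact K0].
    + intros z Hz. rewrite RM, powp_mult by (try lra; apply H, Hz).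
      apply Rmult_le_compat_l; [apply powp_ge_0|apply Hu, Hz].
  - intros Hv z Hz. specialize (Hv z Hz). apply Rmult_le_compat_l; lra.
  - contradiction.
Qed.

(** Replaces the triangle inequality for every q at once. With s = sqrt k, [pigeon] with weights s^i
    bounds [U z] by [S / s^i * u i z] for some i depending on z. The remaining decay s^i makes the
    q-th powers summable, so the constant does not depend on the number of summands. *)
Lemma dom_geo k : 0 < k < 1 -> exists C0, 0 < C0 /\ forall h A n (u : nat -> C -> R) U, 0 < A ->
  (forall i z, 0 <= u i z) -> (forall i, (i < n)%nat -> harm_dom h (u i) (A * k ^ i)) ->
  (forall z, shell h z -> 0 <= U z <= rsum (fun i => u i z) n) -> harm_dom h U (C0 * A).
Proof.
  intros Hk. unfold harm_dom. destruct p as [q| |]; simpl in Hp; [| |contradiction].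
  - set (s := sqrt k). assert (Hs : 0 < s < 1).
    { unfold s. split; [apply sqrt_lt_R0; lra|]. rewrite <- sqrt_1. apply sqrt_lt_1; lra. }
    assert (Ss : s * s = k) by (apply sqrt_sqrt; lra).
    set (S := / (1 - s)). assert (PS : 0 < S) by (apply Rinv_0_lt_compat; lra).
    set (s' := Rpower s q). assert (Hs' : 0 < s' < 1) by (split; [apply Rpower_pos|apply Rpower_lt_1; assumption]).
    set (D := / (1 - s')). assert (PD : 0 < D) by (apply Rinv_0_lt_compat; lra).
    exists (S * Rpower D (/ q)). split; [apply Rmult_lt_0_compat; [exact PS|apply Rpower_pos]|].
    intros h A n u U HA Hu0 Hu HU.
    assert (X : forall i, exists K, (i < n)%nat -> posr K /\ Re (K 0%C) <= Rpower (A * k ^ i) q /\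
        forall z, shell h z -> powp (u i z) q <= Re (K z)).
    { intros i. destruct (le_lt_dec n i) as [L|L].
      - exists (fun _ => 0%C). lia.
      - destruct (Hu i L) as [K HK]. exists K. auto. }
    apply choice in X. destruct X as [K HK].
    set (w := fun i => powp (S / s ^ i) q).
    assert (Psi : forall i, 0 < s ^ i) by (intros; apply pow_lt; lra).
    exists (ksum w K n). split; [|split].
    + apply ksum_pos; [intros; apply powp_ge_0|]. intros i Hi. apply HK, Hi.
    + rewrite ksum_Re.
      apply Rle_trans with (rsum (fun i => Rpower (S * A) q * s' ^ i) n).
      * apply rsum_le. intros i Hi. destruct (HK i Hi) as [_ [K0 _]].
        unfold w. rewrite powp_pos_eq by (apply Rdiv_lt_0_compat; auto).
        apply Rle_trans with (Rpower (S / s ^ i) q * Rpower (A * k ^ i) q).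
        { apply Rmult_le_compat_l; [left; apply Rpower_pos|exact K0]. }
        right. assert (Pk : 0 < k ^ i) by (apply pow_lt; lra).
        rewrite Rpower_mult_distr; [|apply Rdiv_lt_0_compat; auto|apply Rmult_lt_0_compat; lra].
        unfold s'. rewrite <- Rpower_pow_comm by lra.
        rewrite Rpower_mult_distr; [|apply Rmult_lt_0_compat; lra|auto].
        f_equal. rewrite <- Ss, Rpow_mult_distr. field. specialize (Psi i); lra.
      * rewrite rsum_scal. rewrite <- Rpower_mult_distr with (x := S * Rpower D (/ q));
          [|apply Rmult_lt_0_compat; [lra|apply Rpower_pos]|lra].
        rewrite <- !Rpower_mult_distr; try lra; try apply Rpower_pos.
        rewrite Rpower_root by lra.
        assert (G := rsum_geo s' n ltac:(lra)). fold D in G.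
        assert (P1 := Rpower_pos S q). assert (P2 := Rpower_pos A q).
        replace (Rpower S q * D * Rpower A q) with (Rpower S q * Rpower A q * D) by ring.
        apply Rmult_le_compat_l; [|exact G]. apply Rmult_le_pos; lra.
    + intros z Hz. rewrite ksum_Re.
      assert (Nn : forall i, (i < n)%nat -> 0 <= w i * Re (K i z)).
      { intros i Hi. apply Rmult_le_pos; [apply powp_ge_0|].
        eapply Rle_trans; [apply powp_ge_0|apply (HK i Hi), Hz]. }
      destruct n as [|m].
      { specialize (HU z Hz). simpl in *. replace (U z) with 0 by lra. rewrite powp_0. lra. }
      destruct (pigeon (fun i => u i z) (fun i => s ^ i) (Datatypes.S m)) as [i [Hi Hpi]]; [lia|auto|auto|].
      eapply Rle_trans; [|apply (rsum_elem _ _ i Nn Hi)]. cbv beta in *.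
      destruct (HK i Hi) as [_ [_ Hz']]. specialize (Hz' z Hz). specialize (HU z Hz).
      assert (G := rsum_geo s (Datatypes.S m) ltac:(lra)). fold S in G.
      unfold w. eapply Rle_trans; [|apply Rmult_le_compat_l; [apply powp_ge_0|exact Hz']].
      rewrite <- powp_mult; [|apply Rlt_le, Rdiv_lt_0_compat; auto|apply Hu0].
      apply powp_mono; [exact Hp|]. split; [lra|].
      eapply Rle_trans; [exact (proj2 HU)|].
      replace (S / s ^ i * u i z) with (S * u i z / s ^ i) by (field; specialize (Psi i); lra).
      apply (Rle_div_r _ _ (s ^ i)); [apply Psi|]. eapply Rle_trans; [exact Hpi|]. apply Rmult_le_compat_r; [apply Hu0|exact G].
  - exists (/ (1 - k)). split; [apply Rinv_0_lt_compat; lra|].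
    intros h A n u U HA Hu0 Hu HU z Hz. eapply Rle_trans; [apply HU, Hz|].
    apply Rle_trans with (rsum (fun i => A * k ^ i) n).
    + apply rsum_le. intros i Hi. apply Hu; assumption.
    + rewrite rsum_scal, Rmult_comm. apply Rmult_le_compat_r; [lra|]. apply rsum_geo. lra.
Qed.

Lemma dom_plus : exists C0, 0 < C0 /\ forall h A B u v U, 0 < A -> 0 < B ->
  (forall z, 0 <= u z) -> (forall z, 0 <= v z) -> harm_dom h u A -> harm_dom h v B ->
  (forall z, shell h z -> 0 <= U z <= u z + v z) -> harm_dom h U (C0 * (A + B)).
Proof.
  destruct (dom_geo (1 / 2)) as [C0 [P H]]; [lra|]. exists (C0 * 2). split; [lra|].
  intros h A B u v U HA HB Hu Hv Du Dv HU. rewrite Rmult_assoc.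
  (* The level 2 (A + B) still leaves A + B for the second summand after one factor k = 1/2. *)
  apply (H h (2 * (A + B)) 2%nat (fun i => match i with O => u | _ => v end)); [lra| | |].
  - intros [|i] z; auto.
  - intros i Hi. destruct i as [|[|i]]; [| |lia]; simpl.
    + apply dom_mono with u A; [lra| |exact Du]. intros z _. specialize (Hu z). lra.
    + apply dom_mono with v B; [lra| |exact Dv]. intros z _. specialize (Hv z). lra.
  - intros z Hz. simpl. specialize (HU z Hz). lra.
Qed.

Lemma bnd_mono u v A B : 0 < A <= B -> (forall z, inD z -> 0 <= u z <= v z) -> bnd v A -> bnd u B.
Proof.
  intros HA H Hb h Hh. assert (P := Rpower_pos h (- alpha)).
  apply dom_mono with v (A * Rpower h (- alpha)).
  - split; [apply Rmult_lt_0_compat; lra|]. apply Rmult_le_compat_r; lra.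
  - intros z Hz. apply H. apply (shell_inD h); [lra|exact Hz].
  - apply Hb, Hh.
Qed.

Lemma bnd_scal u A c : 0 < c -> 0 < A -> (forall z, inD z -> 0 <= u z) -> bnd u A -> bnd (fun z => c * u z) (c * A).
Proof.
  intros Hc HA H Hb h Hh. rewrite Rmult_assoc. apply dom_scal; [exact Hc| | |apply Hb, Hh].
  - apply Rmult_lt_0_compat; [exact HA|apply Rpower_pos].
  - intros z Hz. apply H. apply (shell_inD h); [lra|exact Hz].
Qed.

Lemma bnd_plus : exists C0, 0 < C0 /\ forall A B u v U, 0 < A -> 0 < B ->
  (forall z, 0 <= u z) -> (forall z, 0 <= v z) -> bnd u A -> bnd v B ->
  (forall z, inD z -> 0 <= U z <= u z + v z) -> bnd U (C0 * (A + B)).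
Proof.
  destruct dom_plus as [C0 [P H]]. exists C0. split; [exact P|].
  intros A B u v U HA HB Hu Hv Bu Bv HU h Hh. assert (Q := Rpower_pos h (- alpha)).
  replace (C0 * (A + B) * Rpower h (- alpha)) with (C0 * (A * Rpower h (- alpha) + B * Rpower h (- alpha))) by ring.
  apply (H h _ _ u v); auto; try (apply Rmult_lt_0_compat; lra).
  intros z Hz. apply HU. apply (shell_inD h); [lra|exact Hz].
Qed.

(** Constant 27 = 9 * 3 on q-th powers: [harnack_near] between w and [kap z], then Harnack between
    [kap 0] and 0. The alternative [u z = 0] admits functions cut off outside a set. *)
Lemma dom_move : exists C0, 0 < C0 /\ forall h g' kap u v A, 0 < h -> 0 < A -> 0 < g' -> selfmap kap -> Cmod (kap 0%C) <= 1 / 2 ->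
  harm_dom g' v A -> (forall z, 0 <= v z) ->
  (forall z, shell h z -> 0 <= u z /\ (u z = 0 \/ exists w, Cmod (w - kap z)%C <= (1 - Cmod (kap z)) / 2 /\ shell g' w /\ u z <= v w)) ->
  harm_dom h u (C0 * A).
Proof.
  unfold harm_dom. destruct p as [q| |]; simpl in Hp; [| |contradiction].
  - exists (Rpower 27 (/ q)). split; [apply Rpower_pos|].
    intros h g' kap u v A Hh HA Hg' Hk Hk0 [K [HK [K0 Hv]]] Hv0 Hu.
    assert (PK := pos_comp K kap HK (proj1 Hk) (proj2 Hk)).
    assert (RM : forall w, Re (RtoC 9 * w)%C = 9 * Re w) by (intros w; unfold Re; simpl; ring).
    exists (fun z => RtoC 9 * K (kap z))%C. split; [apply pos_scal; [lra|exact PK]|]. split.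
    + rewrite RM, <- Rpower_mult_distr, Rpower_root by (try lra; apply Rpower_pos).
      assert (I0 := proj2 Hk _ inD_0). destruct (harnack_radial K (kap 0%C) HK I0) as [B _].
      assert (N0 := proj2 HK _ I0). assert (N1 := proj2 HK _ inD_0). assert (Q := Cmod_ge_0 (kap 0%C)).
      assert (Re (K (kap 0%C)) <= 3 * Re (K 0%C)) by nra. lra.
    + intros z Hz. rewrite RM. assert (Iz := shell_inD h z Hh Hz). assert (Ik := proj2 Hk z Iz).
      destruct (Hu z Hz) as [U0 [Uz|[w [W1 [W2 W3]]]]].
      * rewrite Uz, powp_0. assert (N := proj2 HK _ Ik). lra.
      * eapply Rle_trans; [apply powp_mono; [exact Hp|]; split; [exact U0|exact W3]|].
        eapply Rle_trans; [apply Hv, W2|]. apply harnack_near; assumption.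
  - exists 1. split; [lra|]. intros h g' kap u v A Hh HA Hg' Hk Hk0 Hv Hv0 Hu z Hz. rewrite Rmult_1_l.
    destruct (Hu z Hz) as [U0 [Uz|[w [W1 [W2 W3]]]]]; [lra|]. specialize (Hv w W2). lra.
Qed.

(* Covers composition with self-maps, passage to nearby points and radial contractions at once. *)
Lemma dom_transfer : exists C0, 0 < C0 /\ forall h g kap u v A, 0 < h <= 1 -> 0 < g <= 1 -> 0 < A ->
  selfmap kap -> Cmod (kap 0%C) <= 1 / 2 -> (forall z, shell h z -> g <= 1 - Cmod (kap z)) ->
  bnd v A -> (forall z, 0 <= v z) ->
  (forall z, shell h z -> 0 <= u z /\ exists w, Cmod (w - kap z)%C <= (1 - Cmod (kap z)) / 2 /\ u z <= v w) ->
  harm_dom h u (C0 * (A * Rpower g (- alpha))).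
Proof.
  destruct dom_move as [C1 [P1 H1]].
  set (k := Rpower 2 (- alpha)).
  assert (Hk : 0 < k < 1).
  { unfold k. split; [apply Rpower_pos|]. rewrite Rpower_Ropp. rewrite <- Rinv_1. apply Rinv_lt_contravar.
    - rewrite Rmult_1_l. apply Rpower_pos.
    - replace 1 with (Rpower 2 0) by (apply Rpower_O; lra). apply Rpower_lt; lra. }
  destruct (dom_geo k Hk) as [C2 [P2 H2]].
  exists (C2 * (C1 * Rpower (1 / 4) (- alpha))). split.
  { repeat apply Rmult_lt_0_compat; try assumption. apply Rpower_pos. }
  intros h g kap u v A Hh Hg HA Hs Hs0 Hgk Hv Hv0 Hu.
  (* A witness satisfies 1-|w| >= (1-|kap z|) / 2 >= g / 2, so the shells of sizes g/2, g, 2g, ...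
     up to 1 catch all witnesses. *)
  set (b := g / 2). assert (Hb : 0 < b <= 1) by (unfold b; lra).
  destruct (level_exists 2 b ltac:(lra) Hb) as [N [N1 N2]].
  set (lv := fun i => Rmin 1 (2 ^ i * b)).
  assert (Plv : forall i, 0 < lv i <= 1).
  { intros i. unfold lv. split; [|apply Rmin_l]. apply Rmin_glb_lt; [lra|]. apply Rmult_lt_0_compat; [apply pow_lt; lra|lra]. }
  set (P := fun i z => exists w, Cmod (w - kap z)%C <= (1 - Cmod (kap z)) / 2 /\ shell (lv i) w /\ u z <= v w).
  (* [u] is cut according to the shell in which a witness lies. Larger shells carry smaller weights,
     so the pieces decay like k^i and [dom_geo] sums them. *)
  set (ui := fun i z => if excluded_middle_informative (shell h z /\ P i z) then u z else 0).
  assert (Q := Rpower_pos g (- alpha)). assert (Q4 := Rpower_pos (1 / 4) (- alpha)).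
  replace (C2 * (C1 * Rpower (1 / 4) (- alpha)) * (A * Rpower g (- alpha)))
    with (C2 * (C1 * Rpower (1 / 4) (- alpha) * (A * Rpower g (- alpha)))) by ring.
  apply (H2 h _ (S N) ui).
  - repeat apply Rmult_lt_0_compat; assumption.
  - intros i z. unfold ui. destruct excluded_middle_informative as [[Sz _]|]; [apply Hu, Sz|lra].
  - intros i Hi.
    assert (Lb : 2 ^ i * (g / 4) <= lv i).
    { assert (PL := pow_le_level 2 b i N ltac:(lra) ltac:(lra) ltac:(lia)).
      assert (Q0 : 0 < 2 ^ i * b) by (apply Rmult_lt_0_compat; [apply pow_lt; lra|lra]).
      unfold lv. replace (2 ^ i * (g / 4)) with (2 ^ i * b / 2) by (unfold b; field). apply Rmin_glb; lra. }
    assert (Pi : 0 < 2 ^ i) by (apply pow_lt; lra).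
    assert (Le : Rpower (lv i) (- alpha) <= Rpower (1 / 4) (- alpha) * Rpower g (- alpha) * k ^ i).
    { eapply Rle_trans; [apply (Rpower_anti (2 ^ i * (g / 4))); [lra|split; [|exact Lb]]|].
      - apply Rmult_lt_0_compat; lra.
      - right. unfold k. rewrite <- Rpower_pow_comm by lra.
        rewrite !Rpower_mult_distr; try lra. f_equal. field. }
    assert (Dm : harm_dom h (ui i) (C1 * (A * Rpower (lv i) (- alpha)))).
    { apply (H1 h (lv i) kap (ui i) v); auto; try lra.
      - apply Rmult_lt_0_compat; [exact HA|apply Rpower_pos].
      - apply Plv.
      - intros z Hz. unfold ui. destruct excluded_middle_informative as [[_ Pz]|]; [|lra].
        split; [apply Hu, Hz|]. right. exact Pz. }
    apply dom_mono with (ui i) (C1 * (A * Rpower (lv i) (- alpha))); [split| |exact Dm].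
    + repeat apply Rmult_lt_0_compat; try assumption. apply Rpower_pos.
    + replace (C1 * Rpower (1 / 4) (- alpha) * (A * Rpower g (- alpha)) * k ^ i)
        with (C1 * (A * (Rpower (1 / 4) (- alpha) * Rpower g (- alpha) * k ^ i))) by ring.
      apply Rmult_le_compat_l; [lra|]. apply Rmult_le_compat_l; [lra|exact Le].
    + intros z Hz. unfold ui. destruct excluded_middle_informative; [|lra]. split; [apply Hu, Hz|lra].
  - intros z Hz. destruct (Hu z Hz) as [U0 [w [W1 W2]]]. split; [exact U0|].
    assert (T := Cmod_le_plus w (kap z)). assert (Gz := Hgk z Hz). assert (Wp := Cmod_ge_0 w).
    destruct (level_find b (1 - Cmod w) N) as [i [Hi Hx]]; [unfold b; lra|lra|].
    assert (Sw : shell (lv i) w).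
    { unfold shell, lv. split; [eapply Rle_trans; [apply Rmult_le_compat_r; [lra|apply Rmin_r]|]; lra|].
      apply Rmin_glb; lra. }
    assert (Ui : u z = ui i z).
    { unfold ui. destruct excluded_middle_informative as [|NN]; [reflexivity|]. exfalso. apply NN.
      split; [exact Hz|]. exists w. auto. }
    rewrite Ui. apply (rsum_elem (fun i => ui i z)); [|lia].
    intros j _. unfold ui. destruct excluded_middle_informative as [[Sz _]|]; [apply Hu, Sz|lra].
Qed.

Lemma selfmap_id : selfmap (fun z => z).
Proof. split; [apply analytic_id|auto]. Qed.

(** What allows a Cauchy estimate inside a norm bound: the supremum over a disk becomes a value at a
    witness, and the witness may vary with z without any measurability. *)
Lemma bnd_near : exists C0, 0 < C0 /\ forall u v A, 0 < A -> bnd v A -> (forall z, 0 <= v z) ->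
  (forall z, inD z -> 0 <= u z /\ exists w, Cmod (w - z)%C <= (1 - Cmod z) / 2 /\ u z <= v w) -> bnd u (C0 * A).
Proof.
  destruct dom_transfer as [C1 [P1 H1]]. exists (C1 * Rpower (1 / 2) (- alpha)).
  split; [apply Rmult_lt_0_compat; [exact P1|apply Rpower_pos]|].
  intros u v A HA Hv Hv0 Hu h Hh.
  replace (C1 * Rpower (1 / 2) (- alpha) * A * Rpower h (- alpha)) with (C1 * (A * Rpower (h / 2) (- alpha))).
  2:{ replace (h / 2) with (1 / 2 * h) by field. rewrite <- Rpower_mult_distr by lra. ring. }
  apply (H1 h (h / 2) (fun z => z) u v A); auto; try lra.
  - apply selfmap_id.
  - rewrite Cmod_0. lra.
  - intros z [Hz _]. exact Hz.
  - intros z Hz. apply Hu. apply (shell_inD h); [lra|exact Hz].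
Qed.

(** Littlewood subordination in terms of majorants. By [selfmap_dist] a point of the shell of size h
    is mapped to distance at least h / 8 from the circle, hence a constant independent of the
    map. *)
Lemma bnd_comp : exists C0, 0 < C0 /\ forall kap u v A, 0 < A -> selfmap kap -> Cmod (kap 0%C) <= 1 / 2 ->
  bnd v A -> (forall z, 0 <= v z) ->
  (forall z, inD z -> 0 <= u z /\ exists w, Cmod (w - kap z)%C <= (1 - Cmod (kap z)) / 2 /\ u z <= v w) -> bnd u (C0 * A).
Proof.
  destruct dom_transfer as [C1 [P1 H1]]. exists (C1 * Rpower (1 / 8) (- alpha)).
  split; [apply Rmult_lt_0_compat; [exact P1|apply Rpower_pos]|].
  intros kap u v A HA Hk Hk0 Hv Hv0 Hu h Hh.
  replace (C1 * Rpower (1 / 8) (- alpha) * A * Rpower h (- alpha)) with (C1 * (A * Rpower (h / 8) (- alpha))).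
  2:{ replace (h / 8) with (1 / 8 * h) by field. rewrite <- Rpower_mult_distr by lra. ring. }
  apply (H1 h (h / 8) kap u v A); auto; try lra.
  - intros z Hz. assert (Iz := shell_inD h z ltac:(lra) Hz). assert (S := selfmap_dist kap z Hk Hk0 Iz).
    destruct Hz as [Hz _]. lra.
  - intros z Hz. apply Hu. apply (shell_inD h); [lra|exact Hz].
Qed.

(* For a fixed z the summands in the bound of U z may come from a z-dependent shift j; summing over i absorbs both families into the same 2n functions. *)
Lemma dom_avg : exists C0, 0 < C0 /\ forall h A n (u : nat -> C -> R) U, 0 < A -> (0 < n)%nat ->
  (forall i z, 0 <= u i z) -> (forall i, (i < 2 * n)%nat -> harm_dom h (u i) A) ->
  (forall z, shell h z -> 0 <= U z /\ exists j, (j <= n)%nat /\ forall i, (i < n)%nat -> U z <= u i z + u (i + j)%nat z) ->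
  harm_dom h U (C0 * A).
Proof.
  unfold harm_dom. destruct p as [q| |]; simpl in Hp; [| |contradiction].
  - exists (2 * Rpower 4 (/ q)). split; [apply Rmult_lt_0_compat; [lra|apply Rpower_pos]|].
    intros h A n u U HA Hn Hu0 Hu HU.
    assert (X : forall i, exists K, (i < 2 * n)%nat -> posr K /\ Re (K 0%C) <= Rpower A q /\
        forall z, shell h z -> powp (u i z) q <= Re (K z)).
    { intros i. destruct (le_lt_dec (2 * n) i) as [L|L].
      - exists (fun _ => 0%C). lia.
      - destruct (Hu i L) as [K HK]. exists K. auto. }
    apply choice in X. destruct X as [K HK].
    assert (Pn : 0 < INR n) by (apply lt_0_INR; lia).
    set (c := 2 * Rpower 2 q / INR n). assert (P2 := Rpower_pos 2 q).
    assert (Pc : 0 < c) by (apply Rdiv_lt_0_compat; lra).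
    exists (ksum (fun _ => c) K (2 * n)). split; [|split].
    + apply ksum_pos; [intros; lra|]. intros i Hi. apply HK, Hi.
    + rewrite ksum_Re. apply Rle_trans with (rsum (fun _ => c * Rpower A q) (2 * n)).
      * apply rsum_le. intros i Hi. apply Rmult_le_compat_l; [lra|]. apply HK, Hi.
      * rewrite rsum_const, mult_INR. simpl (INR 2).
        rewrite <- !Rpower_mult_distr; try lra; try apply Rpower_pos; try (apply Rmult_lt_0_compat; [lra|apply Rpower_pos]).
        rewrite Rpower_root by lra. unfold c. right. field. lra.
    + intros z Hz. rewrite ksum_Re. destruct (HU z Hz) as [U0 [j [Hj Hij]]].
      assert (B : forall i, (i < n)%nat -> powp (U z) q <= Rpower 2 q * (powp (u i z) q + powp (u (i + j)%nat z) q)).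
      { intros i Hi. specialize (Hij i Hi). assert (A1 := Hu0 i z). assert (A2 := Hu0 (i + j)%nat z).
        assert (Q1 := powp_ge_0 (u i z) q). assert (Q2 := powp_ge_0 (u (i + j)%nat z) q).
        destruct (Rle_dec (u i z) (u (i + j)%nat z)) as [L|L].
        - eapply Rle_trans; [apply (powp_mono _ (2 * u (i + j)%nat z)); [exact Hp|lra]|].
          rewrite powp_mult, (powp_pos_eq 2) by lra. apply Rmult_le_compat_l; lra.
        - eapply Rle_trans; [apply (powp_mono _ (2 * u i z)); [exact Hp|lra]|].
          rewrite powp_mult, (powp_pos_eq 2) by lra. apply Rmult_le_compat_l; lra. }
      assert (S := rsum_le _ _ n B). rewrite rsum_const, rsum_scal, rsum_plus in S.
      set (T := rsum (fun i => powp (u i z) q) (2 * n)).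
      assert (T1 : rsum (fun i => powp (u i z) q) n <= T).
      { unfold T. replace (2 * n)%nat with (n + n)%nat by lia. rewrite rsum_split.
        assert (0 <= rsum (fun i => powp (u (n + i)%nat z) q) n) by (apply rsum_ge_0; intros; apply powp_ge_0). lra. }
      assert (T2 : rsum (fun i => powp (u (i + j)%nat z) q) n <= T).
      { unfold T. replace (2 * n)%nat with (j + (n + (n - j)))%nat by lia. rewrite rsum_split, rsum_split.
        rewrite (rsum_ext (fun i => powp (u (i + j)%nat z) q) (fun i => powp (u (j + i)%nat z) q)) by (intros; rewrite Nat.add_comm; reflexivity).
        assert (0 <= rsum (fun i => powp (u i z) q) j) by (apply rsum_ge_0; intros; apply powp_ge_0).
        assert (0 <= rsum (fun i => powp (u (j + (n + i))%nat z) q) (n - j)) by (apply rsum_ge_0; intros; apply powp_ge_0). lra. }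
      assert (T3 : c * T <= rsum (fun i => c * Re (K i z)) (2 * n)).
      { unfold T. rewrite <- rsum_scal. apply rsum_le. intros i Hi. apply Rmult_le_compat_l; [lra|]. apply HK; assumption. }
      eapply Rle_trans; [|exact T3].
      apply Rmult_le_reg_l with (INR n); [exact Pn|]. eapply Rle_trans; [exact S|].
      replace (INR n * (c * T)) with (Rpower 2 q * (T + T)) by (unfold c; field; lra).
      apply Rmult_le_compat_l; lra.
  - exists 2. split; [lra|]. intros h A n u U HA Hn Hu0 Hu HU z Hz.
    destruct (HU z Hz) as [_ [j [Hj Hij]]]. specialize (Hij O ltac:(lia)). simpl in Hij.
    assert (A1 := Hu O ltac:(lia) z Hz). assert (A2 := Hu j ltac:(lia) z Hz). lra.
Qed.

(* 1/p, with 1/infty = 0. *)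
Definition ip : R := match p with Finite q => / q | _ => 0 end.

(** Harnack from the centre to the shell costs a factor 4 / h on the q-th power, hence h^(-1/q) on
    the value. *)
Lemma dom_point : exists C0, 0 < C0 /\ forall h u A z, 0 < h <= 1 -> 0 < A -> harm_dom h u A -> shell h z -> 0 <= u z ->
  u z <= C0 * A * Rpower h (- ip).
Proof.
  unfold harm_dom, ip. destruct p as [q| |]; simpl in Hp; [| |contradiction].
  - exists (Rpower 4 (/ q)). split; [apply Rpower_pos|]. intros h u A z Hh HA [K [HK [K0 Hu]]] Hz U0.
    assert (Iz := shell_inD h z ltac:(lra) Hz). destruct (harnack_radial K z HK Iz) as [B _].
    specialize (Hu z Hz). assert (N := proj2 HK _ Iz). assert (N0 := proj2 HK _ inD_0). unfold inD in Iz.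
    assert (Pz := Cmod_ge_0 z). destruct Hz as [Hz _].
    assert (X : Re (K z) <= 4 / h * Rpower A q).
    { apply Rmult_le_reg_r with (h / 2); [lra|].
      apply Rle_trans with (Re (K 0%C) * (1 + Cmod z)); [eapply Rle_trans; [|exact B]; apply Rmult_le_compat_l; lra|].
      apply Rle_trans with (Rpower A q * 2); [apply Rmult_le_compat; lra|]. right. field. lra. }
    apply (powp_inv_mono _ _ q Hp U0).
    { repeat apply Rmult_le_pos; try lra; left; apply Rpower_pos. }
    rewrite (powp_pos_eq (_ * _)) by (repeat apply Rmult_lt_0_compat; try lra; apply Rpower_pos).
    rewrite <- !Rpower_mult_distr; try lra; try apply Rpower_pos; try (apply Rmult_lt_0_compat; [apply Rpower_pos|lra]).
    rewrite Rpower_root, Rpower_mult by lra.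
    replace (- / q * q) with (- (1)) by (field; lra). rewrite Rpower_Ropp, Rpower_1 by lra.
    eapply Rle_trans; [exact Hu|]. eapply Rle_trans; [exact X|]. right. unfold Rdiv. ring.
  - exists 1. split; [lra|]. intros h u A z Hh HA Hu Hz _. rewrite Ropp_0, Rpower_O by lra.
    specialize (Hu z Hz). lra.
Qed.

End Norm.

(* The absolute value makes Dfn nonnegative outside the disk as well. *)
Definition Dfn (f : C -> C) (z : C) : R := Rabs (1 - Cmod z) * Cmod (cD f z).

Lemma Dfn_ge_0 f z : 0 <= Dfn f z.
Proof. apply Rmult_le_pos; [apply Rabs_pos|apply Cmod_ge_0]. Qed.
Lemma Dfn_eq f z : inD z -> Dfn f z = (1 - Cmod z) * Cmod (cD f z).
Proof. unfold inD, Dfn. intros H. rewrite Rabs_right by lra. reflexivity. Qed.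

(** A factor 2 is given away so that no maximum has to be attained: if no point reached half of X /
    c, the assumed estimate with bound X / (2 c) would give X <= X / 2. *)
Lemma near_ex (f : C -> C) x rho X c : 0 <= rho -> 0 < c -> 0 <= X ->
  (forall B, 0 <= B -> (forall w, Cmod (w - x)%C <= rho -> Cmod (f w) <= B) -> X <= c * B) ->
  exists w, Cmod (w - x)%C <= rho /\ X <= 2 * c * Cmod (f w).
Proof.
  intros Hr Hc HX H. destruct (Req_dec X 0) as [->|N].
  - exists x. replace (x - x)%C with (RtoC 0) by ring. rewrite Cmod_0. split; [exact Hr|].
    apply Rmult_le_pos; [lra|apply Cmod_ge_0].
  - apply NNPP. intros NN. assert (K : X <= c * (X / (2 * c))).
    { apply H; [apply Rdiv_le_0_compat; lra|]. intros w Hw. apply Rnot_lt_le. intros L. apply NN.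
      exists w. split; [exact Hw|]. apply Rlt_le. replace X with (2 * c * (X / (2 * c))) by (field; lra).
      apply Rmult_lt_compat_l; lra. }
    replace (c * (X / (2 * c))) with (X / 2) in K by (field; lra). lra.
Qed.

(** A mean value inequality with a witness on the segment, obtained by giving away a factor 2 as in
    [near_ex]. *)
Lemma seg_mvt_ex f a b : (forall u, 0 <= u <= 1 -> exists l, cderiv f (a + RtoC u * (b - a))%C l) ->
  exists u, 0 <= u <= 1 /\ Cmod (f b - f a)%C <= 2 * Cmod (b - a)%C * Cmod (cD f (a + RtoC u * (b - a))%C).
Proof.
  intros H. set (X := Cmod (f b - f a)%C). assert (HX : 0 <= X) by apply Cmod_ge_0.
  assert (Pd := Cmod_ge_0 (b - a)%C).
  destruct (Req_dec X 0) as [E0|N].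
  - exists 0. split; [lra|]. rewrite E0. repeat apply Rmult_le_pos; try lra; apply Cmod_ge_0.
  - apply NNPP. intros NN.
    assert (K : X <= X / 2).
    { destruct (Req_dec (Cmod (b - a)%C) 0) as [Z|Nz].
      { exfalso. apply N. unfold X. apply Cmod_eq_0, Copp_inj_0 in Z. subst b. replace (f a - f a)%C with (RtoC 0) by ring. apply Cmod_0. }
      replace (X / 2) with (X / (2 * Cmod (b - a)%C) * Cmod (b - a)%C) by (field; lra).
      apply mvt_seg. intros u Hu. destruct (H u Hu) as [l Hl]. exists l. split; [exact Hl|].
      apply Rnot_lt_le. intros L. apply NN. exists u. split; [exact Hu|].
      rewrite (cD_eq _ _ _ Hl). apply Rlt_le.
      replace X with (2 * Cmod (b - a)%C * (X / (2 * Cmod (b - a)%C))) by (field; lra).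
      apply Rmult_lt_compat_l; lra. }
    lra.
Qed.

Lemma scal_mod s z : 0 <= s -> Cmod (RtoC s * z)%C = s * Cmod z.
Proof. intros H. rewrite Cmod_mult, Cmod_R, Rabs_right by lra. reflexivity. Qed.

Lemma scal_inD s z : 0 <= s <= 1 -> inD z -> inD (RtoC s * z)%C.
Proof.
  unfold inD. intros Hs Hz. rewrite scal_mod by lra. assert (P := Cmod_ge_0 z). nra.
Qed.

Lemma radial_step f z s s' : analytic_on_D f -> inD z -> 0 <= s' <= s -> s <= 1 ->
  exists t, s' <= t <= s /\ Cmod (f (RtoC s * z)%C - f (RtoC s' * z)%C)%C <= 2 * (s - s') * Cmod (cD f (RtoC t * z)%C).
Proof.
  intros Hf Hz Hs Hs1.
  assert (Q : forall u, (RtoC s' * z + RtoC u * (RtoC s * z - RtoC s' * z))%C = (RtoC (s' + u * (s - s')) * z)%C).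
  { intros u. rewrite RtoC_plus, RtoC_mult, RtoC_minus. ring. }
  destruct (seg_mvt_ex f (RtoC s' * z)%C (RtoC s * z)%C) as [u [Hu B]].
  - intros u Hu. rewrite Q. exists (cD f (RtoC (s' + u * (s - s')) * z)%C). apply analytic_cD; [exact Hf|].
    apply scal_inD; [|exact Hz]. nra.
  - rewrite Q in B. exists (s' + u * (s - s')). split; [nra|]. eapply Rle_trans; [exact B|].
    apply Rmult_le_compat_r; [apply Cmod_ge_0|]. apply Rmult_le_compat_l; [lra|].
    replace (RtoC s * z - RtoC s' * z)%C with (RtoC (s - s') * z)%C by (rewrite RtoC_minus; ring).
    rewrite scal_mod by lra. unfold inD in Hz. assert (P := Cmod_ge_0 z). nra.
Qed.

Section Norm2.
Variables (p : Rbar) (alpha : R).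
Hypothesis Hp : Rbar_lt 0 p.
Hypothesis Ha : 0 < alpha.
Local Notation dom := (harm_dom p).
Local Notation bnd := (bnd p alpha).

Lemma dom_const h a A : 0 <= a <= A -> 0 < A -> dom h (fun _ => a) A.
Proof.
  intros Hh HA. unfold harm_dom. destruct p as [q| |]; simpl in Hp; [| |contradiction].
  - exists (fun _ => RtoC (Rpower A q)). split; [split; [apply analytic_const|]|split].
    + intros z _. simpl. left. apply Rpower_pos.
    + simpl. lra.
    + intros z _. simpl. rewrite <- powp_pos_eq by exact HA. apply powp_mono; assumption.
  - intros z _. lra.
Qed.

Lemma bnd_deriv : exists C0, 0 < C0 /\ forall f A, 0 < A -> analytic_on_D f -> bnd (fun z => Cmod (f z)) A -> bnd (Dfn f) (C0 * A).
Proof.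
  destruct (bnd_near p alpha Hp Ha) as [C1 [P1 H1]]. exists (C1 * 6). split; [lra|].
  intros f A HA Hf Hb. rewrite Rmult_assoc.
  apply (H1 (Dfn f) (fun z => 6 * Cmod (f z)) (6 * A)); [lra| | |].
  - apply bnd_scal; auto; try lra. intros z _. apply Cmod_ge_0.
  - intros z. assert (Q := Cmod_ge_0 (f z)). lra.
  - intros z Hz. split; [apply Dfn_ge_0|].
    destruct (near_ex f z ((1 - Cmod z) / 2) (Dfn f z) 3) as [w [W1 W2]]; [unfold inD in Hz; lra|lra|apply Dfn_ge_0| |].
    + intros B HB HH. rewrite Dfn_eq by exact Hz. unfold inD in Hz.
      assert (K := cauchy_est f z ((1 - Cmod z) / 2) B Hf ltac:(lra) HH).
      apply Rmult_le_compat_l with (r := 1 - Cmod z) in K; [|lra].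
      replace ((1 - Cmod z) * (B / ((1 - Cmod z) / 2))) with (2 * B) in K by (field; lra). lra.
    + exists w. split; [exact W1|]. lra.
Qed.

Lemma scal_selfmap s : 0 <= s <= 1 -> selfmap (fun z => RtoC s * z)%C.
Proof.
  intros Hs. split; [apply analytic_scal, analytic_id|]. intros z Hz. apply scal_inD; assumption.
Qed.

(** f is telescoped along z, s_0 z, s_1 z, ..., 0, where 1 - s_i grows by the factor 3/2. Each
    increment is at most a value of D f near the contracted point, and these bounds decay
    geometrically because alpha > 0. The value at 0 is the only part that D f does not see. *)
Lemma bnd_of_deriv : exists C0, 0 < C0 /\ forall f A, 0 < A -> analytic_on_D f -> Cmod (f 0%C) <= A ->
  bnd (Dfn f) A -> bnd (fun z => Cmod (f z)) (C0 * A).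
Proof.
  destruct (dom_transfer p alpha Hp Ha) as [C1 [P1 H1]].
  destruct (dom_plus p Hp) as [C3 [P3 H3]].
  set (k := Rpower (3 / 2) (- alpha)).
  assert (Hk : 0 < k < 1).
  { unfold k. split; [apply Rpower_pos|]. rewrite Rpower_Ropp, <- Rinv_1. apply Rinv_lt_contravar.
    - rewrite Rmult_1_l. apply Rpower_pos.
    - replace 1 with (Rpower (3 / 2) 0) by (apply Rpower_O; lra). apply Rpower_lt; lra. }
  destruct (dom_geo p Hp k Hk) as [C2 [P2 H2]].
  set (c := Rpower (1 / 9) (- alpha)). assert (Pc : 0 < c) by apply Rpower_pos.
  exists (C3 * (C2 * (C1 * c) + 1)). split.
  { apply Rmult_lt_0_compat; [exact P3|]. assert (0 < C2 * (C1 * c)) by (repeat apply Rmult_lt_0_compat; lra). lra. }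
  intros f A HA Hf Hf0 Hb h Hh. assert (Pha := Rpower_pos h (- alpha)).
  (* A first step of size h/4 is at most half of 1-|z| on the shell, and the ratio 3/2 keeps every
     later step within half of the current distance, as [dom_transfer] demands of its witnesses. *)
  set (b := h / 4). assert (Hb4 : 0 < b <= 1) by (unfold b; lra).
  destruct (level_exists (3 / 2) b ltac:(lra) Hb4) as [N [N1 N2]].
  set (g := fun i => Rmin 1 ((3 / 2) ^ i * b)).
  set (s := fun i => 1 - g i).
  assert (Pg : forall i, 0 < g i <= 1).
  { intros i. unfold g. split; [|apply Rmin_l]. apply Rmin_glb_lt; [lra|]. apply Rmult_lt_0_compat; [apply pow_lt; lra|lra]. }
  assert (Gmono : forall i, g i <= g (S i) <= 3 / 2 * g i).
  { intros i. unfold g. simpl. assert (Q : 0 < (3 / 2) ^ i * b) by (apply Rmult_lt_0_compat; [apply pow_lt; lra|lra]).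
    set (x := (3 / 2) ^ i * b) in *. replace (3 / 2 * (3 / 2) ^ i * b) with (3 / 2 * x) by (unfold x; ring).
    unfold Rmin. destruct (Rle_dec 1 x); destruct (Rle_dec 1 (3 / 2 * x)); lra. }
  assert (GN : g N = 1) by (unfold g; apply Rmin_left; lra).
  set (ui := fun i z => match i with
     | O => if Rlt_dec (Cmod z) 1 then Cmod (f z - f (RtoC (s O) * z)%C)%C else 0
     | S j => if Rlt_dec (Cmod z) 1 then Cmod (f (RtoC (s j) * z)%C - f (RtoC (s (S j)) * z)%C)%C else 0 end).
  assert (U0 : forall i z, 0 <= ui i z).
  { intros [|i] z; unfold ui; destruct Rlt_dec; try lra; apply Cmod_ge_0. }
  assert (D1 : dom h (fun z => rsum (fun i => ui i z) (S N)) (C2 * (C1 * c * (A * Rpower h (- alpha))))).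
  { apply (H2 h _ (S N) ui).
    - repeat apply Rmult_lt_0_compat; assumption.
    - exact U0.
    - intros i Hi.
      assert (X : exists gi, 0 < gi <= 1 /\ h / 9 * (3 / 2) ^ i <= gi /\ dom h (ui i) (C1 * (A * Rpower gi (- alpha)))).
      { destruct i as [|j].
        - exists (h / 2). split; [lra|]. split; [simpl; lra|].
          apply (H1 h (h / 2) (fun z => z) (ui O) (Dfn f) A); auto; try lra.
          + apply selfmap_id.
          + rewrite Cmod_0. lra.
          + intros z [Hz _]. exact Hz.
          + apply Dfn_ge_0.
          + intros z Hz. split; [apply U0|]. assert (Iz := shell_inD h z ltac:(lra) Hz). destruct Hz as [Hz1 Hz2].
            assert (Hs0 : 1 - s 0%nat = h / 4). { unfold s, g, b. simpl. rewrite Rmin_right; lra. }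
            destruct (radial_step f z 1 (s 0%nat) Hf Iz ltac:(lra) ltac:(lra)) as [t [Ht B]].
            exists (RtoC t * z)%C. split.
            * replace (RtoC t * z - z)%C with (- (RtoC (1 - t) * z))%C by (rewrite RtoC_minus; ring).
              rewrite Cmod_opp, scal_mod by lra. unfold inD in Iz. assert (P := Cmod_ge_0 z). nra.
            * unfold ui. destruct Rlt_dec as [L|L]; [|exfalso; apply L; exact Iz].
              replace (RtoC 1 * z)%C with z in B by ring. eapply Rle_trans; [exact B|].
              assert (It : inD (RtoC t * z)%C) by (apply scal_inD; [lra|exact Iz]).
              rewrite Dfn_eq by exact It. apply Rmult_le_compat_r; [apply Cmod_ge_0|].
              rewrite scal_mod by lra. assert (P := Cmod_ge_0 z). nra.
        - exists (g j). split; [apply Pg|]. split.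
          + unfold g. apply Rmin_glb.
            * assert (PL := pow_le_level (3 / 2) b j N ltac:(lra) ltac:(lra) ltac:(lia)). simpl. unfold b in *. lra.
            * simpl. unfold b. assert (0 < (3 / 2) ^ j) by (apply pow_lt; lra). nra.
          + assert (Gj := Pg j). assert (Gm := Gmono j).
            apply (H1 h (g j) (fun z => RtoC (s j) * z)%C (ui (S j)) (Dfn f) A); auto; try lra.
            * apply scal_selfmap. unfold s. lra.
            * replace (RtoC (s j) * 0)%C with (RtoC 0) by ring. rewrite Cmod_0. lra.
            * intros z Hz. assert (Iz := shell_inD h z ltac:(lra) Hz). unfold inD in Iz.
              rewrite scal_mod by (unfold s; lra). assert (P := Cmod_ge_0 z). unfold s. nra.
            * apply Dfn_ge_0.
            * intros z Hz. split; [apply U0|]. assert (Iz := shell_inD h z ltac:(lra) Hz).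
              assert (Gs := Pg (S j)).
              destruct (radial_step f z (s j) (s (S j)) Hf Iz ltac:(unfold s; lra) ltac:(unfold s; lra)) as [t [Ht B]].
              assert (Ht' : 0 <= t <= 1) by (unfold s in Ht; lra).
              exists (RtoC t * z)%C. assert (P := Cmod_ge_0 z). assert (Iz' : Cmod z < 1) by exact Iz. split.
              -- replace (RtoC t * z - RtoC (s j) * z)%C with (- (RtoC (s j - t) * z))%C by (rewrite RtoC_minus; ring).
                 rewrite Cmod_opp, !scal_mod by (unfold s in *; lra).
                 assert (s j - t <= g j / 2) by (unfold s in *; lra).
                 assert (s j * Cmod z <= 1 - g j) by (unfold s in *; nra). assert (0 <= s j - t) by lra. nra.
              -- unfold ui. destruct Rlt_dec as [L|L]; [|exfalso; apply L; exact Iz].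
                 eapply Rle_trans; [exact B|].
                 assert (It : inD (RtoC t * z)%C) by (apply scal_inD; assumption).
                 rewrite Dfn_eq by exact It. apply Rmult_le_compat_r; [apply Cmod_ge_0|].
                 rewrite scal_mod by lra. assert (t * Cmod z <= t) by nra. unfold s in *. lra. }
      destruct X as [gi [G1 [G2 G3]]].
      apply (dom_mono p Hp h (ui i) (ui i) (C1 * (A * Rpower gi (- alpha)))); [split| |exact G3].
      + repeat apply Rmult_lt_0_compat; try assumption. apply Rpower_pos.
      + assert (Pi : 0 < (3 / 2) ^ i) by (apply pow_lt; lra).
        assert (Le : Rpower gi (- alpha) <= c * Rpower h (- alpha) * k ^ i).
        { eapply Rle_trans; [apply (Rpower_anti (h / 9 * (3 / 2) ^ i)); [lra|split; [|exact G2]]|].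
          - apply Rmult_lt_0_compat; lra.
          - right. unfold k, c. rewrite <- Rpower_pow_comm by lra.
            rewrite !Rpower_mult_distr; try lra. f_equal. field. }
        replace (C1 * c * (A * Rpower h (- alpha)) * k ^ i) with (C1 * (A * (c * Rpower h (- alpha) * k ^ i))) by ring.
        apply Rmult_le_compat_l; [lra|]. apply Rmult_le_compat_l; [lra|exact Le].
      + intros z _. split; [apply U0|lra].
    - intros z Hz. split; [|lra]. apply rsum_ge_0. intros i _. apply U0. }
  assert (D2 := dom_const h (Cmod (f 0%C)) (A * Rpower h (- alpha))).
  (* The weight is at least 1, so the constant |f 0| fits under the same bound on every shell. *)
  assert (H1h : 1 <= Rpower h (- alpha)).
  { replace 1 with (Rpower 1 (- alpha)) by (unfold Rpower; rewrite ln_1, Rmult_0_r; apply exp_0). apply Rpower_anti; lra. }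
  replace (C3 * (C2 * (C1 * c) + 1) * A * Rpower h (- alpha))
    with (C3 * (C2 * (C1 * c * (A * Rpower h (- alpha))) + A * Rpower h (- alpha))) by ring.
  apply (H3 h _ _ (fun z => rsum (fun i => ui i z) (S N)) (fun _ => Cmod (f 0%C))).
  - repeat apply Rmult_lt_0_compat; assumption.
  - apply Rmult_lt_0_compat; assumption.
  - intros z. apply rsum_ge_0. intros i _. apply U0.
  - intros _. apply Cmod_ge_0.
  - exact D1.
  - apply D2; [|apply Rmult_lt_0_compat; assumption]. split; [apply Cmod_ge_0|]. nra.
  - intros z Hz. split; [apply Cmod_ge_0|]. assert (Iz := shell_inD h z ltac:(lra) Hz).
    assert (Tel : forall n, Cmod (f z - f (RtoC (s n) * z)%C)%C <= rsum (fun i => ui i z) (S n)).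
    { induction n.
      - simpl. unfold ui. destruct Rlt_dec as [L|L]; [lra|exfalso; apply L; exact Iz].
      - change (rsum (fun i => ui i z) (S (S n))) with (rsum (fun i => ui i z) (S n) + ui (S n) z).
        assert (E1 : ui (S n) z = Cmod (f (RtoC (s n) * z)%C - f (RtoC (s (S n)) * z)%C)%C).
        { unfold ui. destruct Rlt_dec as [L|L]; [reflexivity|exfalso; apply L; exact Iz]. }
        rewrite E1. eapply Rle_trans; [apply (Cmod_tri_sub _ (f (RtoC (s n) * z)%C))|]. lra. }
    specialize (Tel N). assert (SN : (RtoC (s N) * z)%C = 0%C).
    { unfold s. rewrite GN. replace (1 - 1) with 0 by ring. ring. }
    rewrite SN in Tel. assert (T := Cmod_le_plus (f z) (f 0%C)). lra.
Qed.

Lemma polar_W f r q t : powp (Cmod (f (polar r t))) q = circW f r q t.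
Proof. unfold circW. rewrite polar_E. reflexivity. Qed.

Lemma angle_range c : Cmod c = 1 -> exists th, - PI <= th <= PI /\ c = E th.
Proof.
  intros H. assert (S := Cmod_sq c). rewrite H in S. destruct c as [x y]. unfold Re, Im in S; simpl in S.
  assert (X : -1 <= x <= 1) by nra.
  assert (Y : sqrt (1 - x * x) = Rabs y).
  { replace (1 - x * x) with (Rsqr y) by (unfold Rsqr; lra). apply sqrt_Rsqr_abs. }
  assert (B := acos_bound x).
  destruct (Rle_dec 0 y) as [P|N].
  - exists (acos x). split; [lra|]. unfold E. rewrite cos_acos, sin_acos by exact X. unfold Rsqr. rewrite Y, Rabs_right by lra. reflexivity.
  - exists (- acos x). split; [lra|]. unfold E. rewrite cos_neg, sin_neg, cos_acos, sin_acos by exact X. unfold Rsqr.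
    rewrite Y, Rabs_left by lra. f_equal. ring.
Qed.

Lemma circle_bounded f r : analytic_on_D f -> 0 <= r < 1 -> exists M, forall t, Cmod (f (polar r t)) <= M.
Proof.
  intros Hf Hr.
  destruct (cont_bounded (fun t => Cmod (f (0 + RtoC r * E t)%C)) (- PI) PI) as [M [_ HM]].
  { intros t. apply Cmod_continuous, fcirc_cont; [exact Hf|]. rewrite Cmod_0. lra. }
  exists M. intros t. destruct (angle_range (E t) (E_mod t)) as [th [H1 H2]].
  rewrite polar_E, H2. replace (RtoC r * E th)%C with (0 + RtoC r * E th)%C by ring. apply HM, H1.
Qed.

Lemma Lub_real_ub (S : R -> Prop) M x : (forall y, S y -> y <= M) -> S x -> x <= real (Lub_Rbar S) /\ real (Lub_Rbar S) <= M.
Proof.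
  intros HM Hx. destruct (Lub_Rbar_correct S) as [U L].
  assert (A := U x Hx). assert (B : Rbar_le (Lub_Rbar S) M) by (apply L; intros y Hy; exact (HM y Hy)).
  destruct (Lub_Rbar S) as [l| |]; simpl in *; try contradiction; lra.
Qed.

(** For finite p only the circle of radius 1 - h/4 enters, through [submean_majorant]; for p
    infinite the circle through the point itself. The assumed range of radii contains both. *)
Lemma dom_of_Mp : exists C0, 0 < C0 /\ forall f h A, analytic_on_D f -> 0 < h <= 1 -> 0 < A ->
  (forall r, 1 - h <= r <= 1 - h / 4 -> Mp p r f <= A) -> dom h (fun z => Cmod (f z)) (C0 * A).
Proof.
  unfold harm_dom, Mp. destruct p as [q| |]; simpl in Hp; [| |contradiction].
  - exists (Rpower 4 (/ q)). split; [apply Rpower_pos|]. intros f h A Hf Hh HA HM.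
    destruct (submean_majorant f h q Hf Hh Hp) as [K [HK [K0 Hz]]].
    exists K. split; [exact HK|]. split.
    + rewrite K0, <- Rpower_mult_distr, Rpower_root by (try lra; apply Rpower_pos).
      apply Rmult_le_compat_l; [lra|]. specialize (HM (1 - h / 4) ltac:(lra)).
      rewrite (RInt_ext _ (circW f (1 - h / 4) q)) in HM by (intros t _; apply polar_W).
      assert (PP := PI2_pos).
      assert (I0 : 0 <= RInt (circW f (1 - h / 4) q) 0 (2 * PI) / (2 * PI)).
      { apply Rdiv_le_0_compat; [|lra]. apply RInt_ge_0; [lra| |intros; apply powp_ge_0].
        apply exR_cont. intros t. apply circW_cont; auto; lra. }
      rewrite <- (powp_powp' _ q I0 Hp), <- (powp_pos_eq A) by exact HA.
      apply powp_mono; [exact Hp|]. split; [apply powp_ge_0|exact HM].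
    + intros z [Hz1 _]. apply Hz. lra.
  - exists 1. split; [lra|]. intros f h A Hf Hh HA HM z [Hz1 Hz2].
    rewrite Rmult_1_l. specialize (HM (Cmod z) ltac:(lra)).
    assert (Pz := Cmod_ge_0 z). destruct (circle_bounded f (Cmod z) Hf ltac:(lra)) as [M HB].
    eapply Rle_trans; [|exact HM].
    apply (Lub_real_ub _ M).
    + intros y [t ->]. apply HB.
    + destruct (unit_rot z) as [c [Hc Ez]].
      destruct (unit_angle (Cconj c)) as [th Eth]; [rewrite Cmod_conj; exact Hc|].
      exists th. rewrite polar_E, <- Eth, <- Ez. do 2 f_equal.
      replace (c * z * Cconj c)%C with (z * (c * Cconj c))%C by ring.
      rewrite <- Cmod2_conj, Hc. replace (RtoC (1 ^ 2)) with (RtoC 1) by (f_equal; ring). ring.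
Qed.

(** The circle of radius r lies on the inner edge of the shell of size 1 - r, and the mean of Re K
    over it is Re K(0). *)
Lemma Mp_of_dom f r A : analytic_on_D f -> 0 <= r < 1 -> 0 < A -> dom (1 - r) (fun z => Cmod (f z)) A -> Mp p r f <= A.
Proof.
  intros Hf Hr HA. unfold harm_dom, Mp.
  assert (Sh : forall t, shell (1 - r) (polar r t)).
  { intros t. unfold shell. rewrite polar_E, scal_mod, E_mod by lra. lra. }
  destruct p as [q| |]; simpl in Hp; [| |contradiction].
  - intros [K [HK [K0 Hz]]]. assert (PP := PI2_pos).
    rewrite (RInt_ext _ (circW f r q)) by (intros t _; apply polar_W).
    apply (powp_inv_mono _ _ q Hp); [apply powp_ge_0|lra|].
    assert (Wc := fun t => circW_cont f r q t Hf Hr Hp).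
    assert (I0 : 0 <= RInt (circW f r q) 0 (2 * PI) / (2 * PI)).
    { apply Rdiv_le_0_compat; [|lra]. apply RInt_ge_0; [lra|apply exR_cont, Wc|intros; apply powp_ge_0]. }
    rewrite powp_powp', powp_pos_eq by assumption. eapply Rle_trans; [|exact K0].
    apply Rle_div_l; [lra|].
    assert (R0 : 0 <= r < 1 - Cmod 0) by (rewrite Cmod_0; lra).
    assert (MV := mean_value K 0%C (proj1 HK) inD_0 r R0).
    apply (f_equal Re) in MV.
    change (RInt (fun t => Re (K (0 + RtoC r * E t)%C)) 0 (2 * PI) = Re (RtoC (2 * PI) * K 0%C)%C) in MV.
    replace (Re (K 0%C) * (2 * PI)) with (Re (RtoC (2 * PI) * K 0%C)%C) by (unfold Re; simpl; ring).
    rewrite <- MV. apply RInt_le; [lra|apply exR_cont, Wc| |].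
    + apply exR_cont. intros t. apply (Ccont_Re (fun t => K (0 + RtoC r * E t)%C)). apply fcirc_cont; [apply HK|exact R0].
    + intros t _. rewrite <- polar_W. eapply Rle_trans; [apply Hz, Sh|]. right. do 2 f_equal. rewrite polar_E. ring.
  - intros H. apply (Lub_real_ub _ A (Cmod (f (polar r 0)))).
    + intros y [t ->]. apply H, Sh.
    + exists 0. reflexivity.
Qed.

Lemma Mp_ge_0 f r : analytic_on_D f -> 0 <= r < 1 -> 0 <= Mp p r f.
Proof.
  intros Hf Hr. unfold Mp. destruct p as [q| |]; simpl in Hp; [| |contradiction].
  - apply powp_ge_0.
  - destruct (circle_bounded f r Hf Hr) as [M HM].
    eapply Rle_trans; [apply (Cmod_ge_0 (f (polar r 0)))|]. apply (Lub_real_ub _ M).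
    + intros y [t ->]. apply HM.
    + exists 0. reflexivity.
Qed.

Lemma Rpower_inv_r x a : Rpower x a * Rpower x (- a) = 1.
Proof. rewrite Rpower_Ropp. apply Rinv_r. apply Rgt_not_eq, Rpower_pos. Qed.

Lemma Hnorm_wMp f (A r : R) : Rbar_le (Hnorm p alpha f) A -> 0 <= r < 1 -> wMp p alpha r f <= A.
Proof.
  intros H Hr. unfold Hnorm in H. destruct (Lub_Rbar_correct (fun y => exists r, 0 <= r < 1 /\ y = wMp p alpha r f)) as [U _].
  assert (Q := U (wMp p alpha r f) (ex_intro _ r (conj Hr eq_refl))).
  exact (Rbar_le_trans (wMp p alpha r f) _ A Q H).
Qed.

Lemma Hnorm_le f (A : R) : (forall r, 0 <= r < 1 -> wMp p alpha r f <= A) -> Rbar_le (Hnorm p alpha f) A.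
Proof.
  intros H. destruct (Lub_Rbar_correct (fun y => exists r, 0 <= r < 1 /\ y = wMp p alpha r f)) as [_ L].
  apply L. intros y [r [Hr ->]]. apply H, Hr.
Qed.

Lemma Hnorm_not_minf f : Hnorm p alpha f <> m_infty.
Proof.
  destruct (Lub_Rbar_correct (fun y => exists r, 0 <= r < 1 /\ y = wMp p alpha r f)) as [U _].
  assert (Q := U (wMp p alpha 0 f) (ex_intro _ 0 (conj (conj (Rle_refl 0) Rlt_0_1) eq_refl))).
  unfold Hnorm. intros E0. rewrite E0 in Q. exact Q.
Qed.

Lemma Hnorm_finite f A : Rbar_le (Hnorm p alpha f) (Finite A) -> is_finite (Hnorm p alpha f).
Proof.
  intros H. assert (N := Hnorm_not_minf f). destruct (Hnorm p alpha f); [reflexivity|contradiction|congruence].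
Qed.

(** Localised: only radii beyond 1 - h are consulted. The same estimate therefore serves the norm
    and the limit condition that defines the little-o space. *)
Lemma dom_of_wMp : exists C0, 0 < C0 /\ forall f h A, analytic_on_D f -> 0 < h <= 1 -> 0 < A ->
  (forall r, 1 - h <= r < 1 -> wMp p alpha r f <= A) -> dom h (fun z => Cmod (f z)) (C0 * A * Rpower h (- alpha)).
Proof.
  destruct dom_of_Mp as [C1 [P1 H1]]. exists (C1 * Rpower (1 / 4) (- alpha)).
  split; [apply Rmult_lt_0_compat; [exact P1|apply Rpower_pos]|]. intros f h A Hf Hh HA Hw.
  assert (Q := Rpower_pos h (- alpha)). assert (Q4 := Rpower_pos (1 / 4) (- alpha)).
  replace (C1 * Rpower (1 / 4) (- alpha) * A * Rpower h (- alpha)) with (C1 * (A * (Rpower (1 / 4) (- alpha) * Rpower h (- alpha)))) by ring.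
  apply H1; auto. { repeat apply Rmult_lt_0_compat; assumption. }
  intros r Hr. specialize (Hw r ltac:(lra)). unfold wMp in Hw.
  assert (M0 := Mp_ge_0 f r Hf ltac:(lra)).
  assert (X : Mp p r f <= A * Rpower (1 - r) (- alpha)).
  { replace (Mp p r f) with (Rpower (1 - r) alpha * Mp p r f * Rpower (1 - r) (- alpha)).
    - apply Rmult_le_compat_r; [left; apply Rpower_pos|exact Hw].
    - replace (Rpower (1 - r) alpha * Mp p r f * Rpower (1 - r) (- alpha)) with (Mp p r f * (Rpower (1 - r) alpha * Rpower (1 - r) (- alpha))) by ring.
      rewrite Rpower_inv_r. ring. }
  eapply Rle_trans; [exact X|]. apply Rmult_le_compat_l; [lra|].
  rewrite Rpower_mult_distr by lra. apply Rpower_anti; lra.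
Qed.

Lemma bnd_of_Hnorm : exists C0, 0 < C0 /\ forall f A, 0 < A -> analytic_on_D f ->
  Rbar_le (Hnorm p alpha f) A -> bnd (fun z => Cmod (f z)) (C0 * A).
Proof.
  destruct dom_of_wMp as [C1 [P1 H1]]. exists C1. split; [exact P1|]. intros f A HA Hf HN h Hh.
  apply H1; auto. intros r Hr. apply Hnorm_wMp; [exact HN|lra].
Qed.

Lemma Hnorm_of_bnd f A : 0 < A -> analytic_on_D f -> bnd (fun z => Cmod (f z)) A -> Rbar_le (Hnorm p alpha f) A.
Proof.
  intros HA Hf Hb. apply Hnorm_le. intros r Hr. unfold wMp.
  assert (Q := Rpower_pos (1 - r) alpha). assert (Q' := Rpower_pos (1 - r) (- alpha)).
  assert (M := Mp_of_dom f r (A * Rpower (1 - r) (- alpha)) Hf Hr ltac:(apply Rmult_lt_0_compat; assumption) (Hb (1 - r) ltac:(lra))).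
  apply Rmult_le_compat_l with (r := Rpower (1 - r) alpha) in M; [|lra].
  replace (Rpower (1 - r) alpha * (A * Rpower (1 - r) (- alpha))) with (A * (Rpower (1 - r) alpha * Rpower (1 - r) (- alpha))) in M by ring.
  rewrite Rpower_inv_r in M. lra.
Qed.

Lemma in_Hinf_bnd f : in_Hinf p alpha f -> exists A, 0 < A /\ bnd (fun z => Cmod (f z)) A.
Proof.
  intros [Hf Hn]. destruct bnd_of_Hnorm as [C1 [P1 H1]].
  unfold is_finite in Hn. set (N := real (Hnorm p alpha f)) in *.
  exists (C1 * (Rabs N + 1)). assert (PN := Rabs_pos N). split; [apply Rmult_lt_0_compat; lra|].
  apply H1; [lra|exact Hf|]. rewrite <- Hn. simpl. assert (Q := Rle_abs N). lra.
Qed.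

Lemma bnd_in_Hinf f A : 0 < A -> analytic_on_D f -> bnd (fun z => Cmod (f z)) A -> in_Hinf p alpha f.
Proof.
  intros HA Hf Hb. split; [exact Hf|]. eapply Hnorm_finite. apply Hnorm_of_bnd; eassumption.
Qed.

End Norm2.

(** * The flow and its generator *)

(** Right derivative at time 0, with the initial value given separately; this is exactly what a
    generator provides. *)
Definition rder (y : R -> C) (y0 L : C) : Prop :=
  forall eps, 0 < eps -> exists d, 0 < d /\ forall t, 0 < t < d ->
    Cmod (y t - y0 - L * RtoC t)%C <= eps * t.

Lemma rder_comp (F : C -> C) (y : R -> C) y0 L l :
  rder y y0 L -> cderiv F y0 l -> rder (fun t => F (y t)) (F y0) (l * L)%C.
Proof.
  intros Hy HF eps He.
  assert (Pa := Cmod_ge_0 l). assert (Pb := Cmod_ge_0 L).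
  destruct (Hy 1 ltac:(lra)) as [d0 [D0 H0]].
  destruct (Hy (eps / 2 / (Cmod l + 1))) as [d1 [D1 H1]]; [apply Rdiv_lt_0_compat; lra|].
  destruct (HF (eps / 2 / (Cmod L + 1))) as [d2 [D2 H2]]; [apply Rdiv_lt_0_compat; lra|].
  exists (Rmin (Rmin d0 d1) (d2 / (Cmod L + 1))). split.
  { repeat apply Rmin_glb_lt; try assumption. apply Rdiv_lt_0_compat; lra. }
  intros t [Ht0 Ht].
  assert (T0 : t < d0) by (eapply Rlt_le_trans; [exact Ht|]; eapply Rle_trans; [apply Rmin_l|apply Rmin_l]).
  assert (T1 : t < d1) by (eapply Rlt_le_trans; [exact Ht|]; eapply Rle_trans; [apply Rmin_l|apply Rmin_r]).
  assert (T2 : (Cmod L + 1) * t < d2).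
  { replace d2 with ((Cmod L + 1) * (d2 / (Cmod L + 1))) by (field; lra).
    apply Rmult_lt_compat_l; [lra|]. eapply Rlt_le_trans; [exact Ht|apply Rmin_r]. }
  specialize (H0 t (conj Ht0 T0)). specialize (H1 t (conj Ht0 T1)).
  assert (B : Cmod (y t - y0)%C <= (Cmod L + 1) * t).
  { assert (Q := Cmod_triangle (y t - y0 - L * RtoC t)%C (L * RtoC t)%C).
    replace (y t - y0 - L * RtoC t + L * RtoC t)%C with (y t - y0)%C in Q by ring.
    rewrite Cmod_mult, Cmod_R, Rabs_right in Q by lra. lra. }
  specialize (H2 (y t) (Rle_lt_trans _ _ _ B T2)).
  replace (F (y t) - F y0 - l * L * RtoC t)%C with
    ((F (y t) - F y0 - l * (y t - y0)) + l * (y t - y0 - L * RtoC t))%C by ring.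
  eapply Rle_trans; [apply Cmod_triangle|]. rewrite Cmod_mult.
  apply Rle_trans with (eps / 2 / (Cmod L + 1) * ((Cmod L + 1) * t) + (Cmod l + 1) * (eps / 2 / (Cmod l + 1) * t)).
  - apply Rplus_le_compat.
    + eapply Rle_trans; [exact H2|]. apply Rmult_le_compat_l; [|exact B]. apply Rlt_le, Rdiv_lt_0_compat; lra.
    + apply Rmult_le_compat; try apply Cmod_ge_0; [lra|exact H1].
  - right. field. lra.
Qed.

Lemma rder_unique y y0 L L' : rder y y0 L -> rder y y0 L' -> L = L'.
Proof.
  intros H H'. apply Copp_inj_0, Cmod_eq_0, Rle_antisym; [|apply Cmod_ge_0]. apply Rnot_lt_le. intros P.
  set (m := Cmod (L - L')%C) in *.
  destruct (H (m / 4) ltac:(lra)) as [d [D Hd]]. destruct (H' (m / 4) ltac:(lra)) as [d' [D' Hd']].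
  set (t := Rmin d d' / 2). assert (Pm : 0 < Rmin d d') by (apply Rmin_glb_lt; lra).
  assert (L1 := Rmin_l d d'). assert (L2 := Rmin_r d d').
  specialize (Hd t ltac:(unfold t; lra)). specialize (Hd' t ltac:(unfold t; lra)).
  assert (T := Cmod_sub_le (y t - y0 - L' * RtoC t)%C (y t - y0 - L * RtoC t)%C).
  replace (y t - y0 - L' * RtoC t - (y t - y0 - L * RtoC t))%C with ((L - L') * RtoC t)%C in T by ring.
  assert (Pt : 0 < t) by (unfold t; lra).
  rewrite Cmod_mult, Cmod_R, Rabs_right in T by lra. fold m in T. nra.
Qed.

Lemma rder_dini y y0 L : rder y y0 L -> forall M, Cmod L <= M -> forall eps, 0 < eps ->
  exists d, 0 < d /\ forall t, 0 < t < d -> Cmod (y t - y0)%C <= (M + eps) * t.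
Proof.
  intros H M HM eps He. destruct (H eps He) as [d [D Hd]]. exists d. split; [exact D|]. intros t Ht.
  specialize (Hd t Ht).
  assert (Q := Cmod_triangle (y t - y0 - L * RtoC t)%C (L * RtoC t)%C).
  replace (y t - y0 - L * RtoC t + L * RtoC t)%C with (y t - y0)%C in Q by ring.
  rewrite Cmod_mult, Cmod_R, Rabs_right in Q by lra.
  assert (Cmod L * t <= M * t) by (apply Rmult_le_compat_r; lra). lra.
Qed.

(** Continuity method: the times up to which the bound r holds form a closed set, and the
    improvement to r / 2 lets it be prolonged. It breaks the circle between staying near a point and
    moving slowly because of staying near it. *)
Lemma bootstrap (d : R -> R) (s r : R) : 0 <= s -> 0 < r -> (forall u, continuous d u) -> d 0 <= r ->
  (forall u, 0 <= u <= s -> (forall v, 0 <= v <= u -> d v <= r) -> d u <= r / 2) ->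
  forall u, 0 <= u <= s -> d u <= r.
Proof.
  intros Hs Hr Hc H0 H.
  set (S := fun u => 0 <= u <= s /\ forall v, 0 <= v <= u -> d v <= r).
  assert (S0 : S 0). { split; [lra|]. intros v Hv. replace v with 0 by lra. exact H0. }
  destruct (completeness S) as [c [Ub Lub]].
  { exists s. intros u [Hu _]. lra. }
  { exists 0. exact S0. }
  assert (C0 : 0 <= c) by (apply Ub, S0).
  assert (Cs : c <= s) by (apply Lub; intros u [Hu _]; lra).
  assert (Lt : forall v, 0 <= v < c -> d v <= r).
  { intros v Hv. apply NNPP. intros N. apply (Rlt_not_le c v); [lra|]. apply Lub.
    intros u [Hu1 Hu2]. apply Rnot_lt_le. intros Hvu. apply N, Hu2. lra. }
  assert (Dc : d c <= r).
  { destruct (Req_dec c 0) as [->|N]; [exact H0|]. apply Rnot_lt_le. intros L.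
    destruct (proj1 (continuous_eps d c) (Hc c) (d c - r) ltac:(lra)) as [e [Pe He]].
    set (v := c - Rmin (e / 2) c). assert (M1 := Rmin_l (e / 2) c). assert (M2 := Rmin_r (e / 2) c).
    assert (M3 : 0 < Rmin (e / 2) c) by (apply Rmin_glb_lt; lra).
    specialize (He v ltac:(unfold v; rewrite Rabs_left; lra)). specialize (Lt v ltac:(unfold v; lra)).
    apply Rabs_def2 in He. lra. }
  assert (Sc : forall v, 0 <= v <= c -> d v <= r).
  { intros v Hv. destruct (Req_dec v c) as [->|N]; [exact Dc|apply Lt; lra]. }
  destruct (Req_dec c s) as [->|N]; [exact Sc|exfalso].
  assert (Dh := H c ltac:(lra) Sc).
  destruct (proj1 (continuous_eps d c) (Hc c) (r / 2) ltac:(lra)) as [e [Pe He]].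
  assert (M1 := Rmin_l (e / 2) (s - c)). assert (M2 := Rmin_r (e / 2) (s - c)).
  assert (M3 : 0 < Rmin (e / 2) (s - c)) by (apply Rmin_glb_lt; lra).
  assert (In : S (c + Rmin (e / 2) (s - c))).
  { split; [lra|]. intros v Hv. destruct (Rle_dec v c) as [L|L]; [apply Sc; lra|].
    specialize (He v ltac:(rewrite Rabs_right; lra)). apply Rabs_def2 in He. lra. }
  specialize (Ub _ In). lra.
Qed.

(** Prolongs orbits by constants beyond the interval [0, m], so that two-sided continuity and
    integration apply up to the end points. *)
Definition clamp (m u : R) : R := Rmax 0 (Rmin u m).
Lemma clamp_id m u : 0 <= u <= m -> clamp m u = u.
Proof. intros H. unfold clamp. rewrite Rmin_left, Rmax_right by lra. reflexivity. Qed.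
Lemma clamp_bd m u : 0 <= m -> 0 <= clamp m u <= m.
Proof. intros H. unfold clamp, Rmin, Rmax. repeat destruct Rle_dec; lra. Qed.
Lemma clamp_lip m u v : Rabs (clamp m u - clamp m v) <= Rabs (u - v).
Proof. unfold clamp, Rmin, Rmax, Rabs. repeat destruct Rle_dec; repeat destruct Rcase_abs; lra. Qed.

Section Flow.
Variables (phi : R -> C -> C) (G : C -> C) (b : C).
Hypothesis Hsg : is_semigroup phi.
Hypothesis HG : is_generator phi G.
Hypothesis HDW : boundary_DW_point phi b.

Lemma phi_self t : 0 <= t -> selfmap (phi t).
Proof. intros Ht. destruct Hsg as [H _]. apply H, Ht. Qed.
Lemma phi_0 z : inD z -> phi 0 z = z.
Proof. apply Hsg. Qed.
Lemma phi_add t s z : 0 <= t -> 0 <= s -> inD z -> phi (t + s) z = phi t (phi s z).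
Proof. apply Hsg. Qed.
Lemma phi_inD t z : 0 <= t -> inD z -> inD (phi t z).
Proof. intros Ht. apply (phi_self t Ht). Qed.

Lemma locally_C_eps (g : R -> C) (F : (R -> Prop) -> Prop) (l : C) : Filter F ->
  filterlim g F (locally l) -> forall eps, 0 < eps -> F (fun t => Cmod (g t - l)%C < eps).
Proof.
  intros FF H eps He. apply (H (fun y => Cmod (y - l)%C < eps)).
  assert (P : 0 < eps / 2) by lra. exists (mkposreal _ P). intros y [H1 H2]. simpl in H1, H2.
  change (Rabs (Re y - Re l) < eps / 2) in H1. change (Rabs (Im y - Im l) < eps / 2) in H2.
  eapply Rle_lt_trans; [apply Cmod_le_sum|]. rewrite Re_minus, Im_minus. lra.
Qed.

Lemma gen_rder z : inD z -> rder (fun t => phi t z) z (G z).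
Proof.
  intros Hz eps He.
  destruct (locally_C_eps _ _ _ _ (HG z Hz) eps He) as [d Hd].
  exists d. split; [apply cond_pos|]. intros t Ht.
  assert (Q : Cmod ((phi t z - z) / RtoC t - G z)%C < eps).
  { apply Hd; [|lra]. change (Rabs (t - 0) < d). rewrite Rabs_right; lra. }
  assert (Nt : RtoC t <> 0%C) by (intro E0; apply (f_equal fst) in E0; simpl in E0; lra).
  replace (phi t z - z - G z * RtoC t)%C with (((phi t z - z) / RtoC t - G z) * RtoC t)%C by (field; exact Nt).
  rewrite Cmod_mult, Cmod_R, Rabs_right by lra. apply Rmult_le_compat_r; lra.
Qed.

Lemma dw_lim z : inD z -> forall eps, 0 < eps -> exists M, forall t, M < t -> Cmod (phi t z - b)%C < eps.
Proof.
  intros Hz eps He. exact (locally_C_eps _ _ _ _ (proj2 HDW z Hz) eps He).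
Qed.

(** Has modulus |b - z| and is the denominator of the Cayley transform at b. *)
Definition bb (z : C) : C := (1 - Cconj b * z)%C.

Lemma Hb1 : Cmod b = 1. Proof. apply HDW. Qed.
Lemma b_conj : (b * Cconj b)%C = 1%C.
Proof. rewrite <- Cmod2_conj, Hb1. f_equal. ring. Qed.
Lemma bb_mod z : Cmod (bb z) = Cmod (b - z)%C.
Proof.
  replace (b - z)%C with (b * bb z)%C.
  - rewrite Cmod_mult, Hb1. ring.
  - unfold bb. replace (b * (1 - Cconj b * z))%C with (b - (b * Cconj b) * z)%C by ring. rewrite b_conj. ring.
Qed.
Lemma bb_ge z : 1 - Cmod z <= Cmod (bb z).
Proof. rewrite bb_mod. assert (T := Cmod_rev_tri b z). rewrite Hb1 in T. exact T. Qed.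
Lemma bb_pos z : inD z -> 0 < Cmod (bb z).
Proof. intros H. assert (T := bb_ge z). unfold inD in H. lra. Qed.
Lemma bb_diff w z : Cmod (bb w - bb z)%C = Cmod (w - z)%C.
Proof.
  unfold bb. replace (1 - Cconj b * w - (1 - Cconj b * z))%C with (- (Cconj b * (w - z)))%C by ring.
  rewrite Cmod_opp, Cmod_mult, Cmod_conj, Hb1. ring.
Qed.
Lemma bz_lt z : inD z -> Cmod (Cconj b * z)%C < 1.
Proof. intros H. rewrite Cmod_mult, Cmod_conj, Hb1, Rmult_1_l. exact H. Qed.

Lemma orbit_lim (t : R) eps : 0 < t -> 0 < eps -> exists N, forall n, (N <= n)%nat -> Cmod (phi (INR n * t) 0%C - b)%C < eps.
Proof.
  intros Ht He. destruct (dw_lim 0%C inD_0 eps He) as [M HM].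
  destruct (nfloor_ex (Rabs M / t)) as [N [_ HN]]; [apply Rdiv_le_0_compat; [apply Rabs_pos|exact Ht]|].
  exists (S N). intros n Hn. apply HM.
  apply Rlt_div_l in HN; [|exact Ht]. apply le_INR in Hn. rewrite S_INR in Hn.
  assert (Q := Rle_abs M). nra.
Qed.

(** The orbit of 0 tends to the circle, so 1-|.| cannot increase at every step. A late step at which
    it does not increase replaces the knowledge that the boundary dilation at b is at most 1. *)
Lemma orbit_decr (t : R) eps : 0 < t -> 0 < eps -> exists w, inD w /\ Cmod (w - b)%C < eps /\ Cmod (phi t w - b)%C < eps /\
  1 - Cmod (phi t w) <= 1 - Cmod w.
Proof.
  intros Ht He. destruct (orbit_lim t eps Ht He) as [N HN].
  assert (Step : forall n, phi (INR (S n) * t) 0%C = phi t (phi (INR n * t) 0%C)).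
  { intros n. rewrite S_INR. replace ((INR n + 1) * t) with (t + INR n * t) by ring.
    apply phi_add; [lra| |apply inD_0]. apply Rmult_le_pos; [apply pos_INR|lra]. }
  assert (InO : forall n, inD (phi (INR n * t) 0%C)).
  { intros n. apply phi_inD; [|apply inD_0]. apply Rmult_le_pos; [apply pos_INR|lra]. }
  assert (X : exists n, (N <= n)%nat /\ 1 - Cmod (phi (INR (S n) * t) 0%C) <= 1 - Cmod (phi (INR n * t) 0%C)).
  { apply NNPP. intros NN.
    assert (Inc : forall k, 1 - Cmod (phi (INR N * t) 0%C) <= 1 - Cmod (phi (INR (N + k) * t) 0%C)).
    { induction k; [rewrite Nat.add_0_r; lra|]. rewrite Nat.add_succ_r. eapply Rle_trans; [exact IHk|].
      apply Rnot_lt_le. intros L. apply NN. exists (N + k)%nat. split; [lia|]. lra. }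
    assert (P := InO N). unfold inD in P.
    destruct (orbit_lim t (1 - Cmod (phi (INR N * t) 0%C)) Ht ltac:(lra)) as [N' HN'].
    specialize (HN' (N + N')%nat ltac:(lia)). specialize (Inc N').
    rewrite Cmod_minus_sym in HN'. assert (T := Cmod_rev_tri b (phi (INR (N + N') * t) 0%C)). rewrite Hb1 in T. lra. }
  destruct X as [n [Hn Hd]]. exists (phi (INR n * t) 0%C). rewrite <- Step.
  repeat split; auto.
Qed.

(** [pos_two_points] for a Cayley transform of phi_t, rotated by [om] so that the image of w lies on
    the positive axis, with w close to b. [orbit_decr] gives 1-|phi_t w| <= 1-|w|; letting w tend to
    b leaves the invariance of horodisks. *)
Lemma julia t z : 0 <= t -> inD z ->
  (1 - Cmod z * Cmod z) * (Cmod (bb (phi t z)) * Cmod (bb (phi t z))) <=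
  (1 - Cmod (phi t z) * Cmod (phi t z)) * (Cmod (bb z) * Cmod (bb z)).
Proof.
  intros Ht Hz. destruct (Req_dec t 0) as [->|Nt]; [rewrite phi_0 by exact Hz; lra|].
  set (f := phi t z). assert (If : inD f) by (apply phi_inD; assumption).
  rewrite !bb_mod.
  set (A := 1 - Cmod z * Cmod z). set (F := 1 - Cmod f * Cmod f).
  set (B := Cmod (b - f)%C). set (D := Cmod (b - z)%C).
  assert (PA : 0 < A) by (apply inD_sq, Hz). assert (PF : 0 < F) by (apply inD_sq, If).
  assert (LA : A <= 1) by (unfold A; assert (Q := Cmod_ge_0 z); nra).
  assert (LF : F <= 1) by (unfold F; assert (Q := Cmod_ge_0 f); nra).
  assert (B0 : 0 <= B) by apply Cmod_ge_0. assert (D0 : 0 <= D) by apply Cmod_ge_0.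
  assert (B2 : B <= 2). { unfold B. eapply Rle_trans; [apply Cmod_sub_le|]. rewrite Hb1. unfold inD in If. lra. }
  assert (D2 : D <= 2). { unfold D. eapply Rle_trans; [apply Cmod_sub_le|]. rewrite Hb1. unfold inD in Hz. lra. }
  (* 68 = 48 + 20 collects the errors of replacing w, its image and the conjugate of [om] by b on
     the two sides, with A, F <= 1 and B, D <= 2. *)
  assert (K : forall eps, 0 < eps < 1 -> 4 * (A * (B * B)) <= 4 * (F * (D * D)) + 68 * eps).
  { intros e He. destruct (orbit_decr t e ltac:(lra) ltac:(lra)) as [w [Iw [W1 [W2 W3]]]].
    set (w' := phi t w) in *. assert (Iw' : inD w') by (apply phi_inD; assumption).
    destruct (unit_rot w') as [om [Hom Eom]].
    assert (PK := cayley_pos (phi t) om (phi_self t Ht) ltac:(lra)).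
    assert (T := pos_two_points _ z w PK Hz Iw). cbv beta in T. fold w' f in T.
    rewrite Eom in T.
    assert (Mw' : Cmod (RtoC (Cmod w')) < 1) by (rewrite Cmod_R, Rabs_right; [exact Iw'|apply Rle_ge, Cmod_ge_0]).
    assert (Mf : Cmod (om * f)%C < 1) by (rewrite Cmod_mult, Hom, Rmult_1_l; exact If).
    rewrite !cayley_Re in T by assumption.
    rewrite <- RtoC_minus, !Cmod_R in T.
    assert (Pw := Cmod_ge_0 w). assert (Pw' := Cmod_ge_0 w'). unfold inD in Iw, Iw'.
    rewrite (Rabs_right (Cmod w')), (Rabs_right (1 - Cmod w')), (Cmod_mult om f), Hom, Rmult_1_l in T by lra.
    fold A F in T.
    assert (Nf : 0 < Cmod (1 - om * f)%C) by (apply Cmod_gt_0, one_minus_nz, Mf).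
    set (y := Cmod (1 - om * f)%C) in *. set (x := Cmod (1 - Cconj w * z)%C) in *.
    assert (T' : (1 + Cmod w') * (1 + Cmod w) * (A * (y * y)) <= 4 * (x * x) * F).
    { assert (E1 : (1 - Cmod w' * Cmod w') / ((1 - Cmod w') * (1 - Cmod w')) = (1 + Cmod w') / (1 - Cmod w')) by (field; lra).
      rewrite E1 in T.
      assert (E2 : (1 + Cmod w') * (1 + Cmod w) * A <= (1 + Cmod w') / (1 - Cmod w') * (A * (1 - Cmod w * Cmod w))).
      { replace ((1 + Cmod w') / (1 - Cmod w') * (A * (1 - Cmod w * Cmod w))) with ((1 + Cmod w') * (1 + Cmod w) * A * ((1 - Cmod w) / (1 - Cmod w'))) by (field; lra).
        rewrite <- (Rmult_1_r ((1 + Cmod w') * (1 + Cmod w) * A)) at 1.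
        apply Rmult_le_compat_l; [repeat apply Rmult_le_pos; lra|]. apply Rle_div_r; lra. }
      assert (E3 := Rle_trans _ _ _ E2 T).
      apply Rmult_le_compat_r with (r := y * y) in E3; [|nra].
      replace (4 * (x * x) * (F / (y * y)) * (y * y)) with (4 * (x * x) * F) in E3 by (field; lra). lra. }
    assert (Yb : B - 2 * e <= y).
    { assert (E1 : y = Cmod (Cconj om - f)%C).
      { unfold y. replace (Cconj om - f)%C with (Cconj om * (1 - om * f))%C.
        - rewrite Cmod_mult, Cmod_conj, Hom. ring.
        - replace (Cconj om * (1 - om * f))%C with (Cconj om - (om * Cconj om) * f)%C by ring.
          rewrite <- Cmod2_conj, Hom. replace (RtoC (1 ^ 2)) with (RtoC 1) by (f_equal; ring). ring. }
      assert (E2 : w' = (Cconj om * RtoC (Cmod w'))%C).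
      { rewrite <- Eom. replace (Cconj om * (om * w'))%C with (om * Cconj om * w')%C by ring.
        rewrite <- Cmod2_conj, Hom. replace (RtoC (1 ^ 2)) with (RtoC 1) by (f_equal; ring). ring. }
      assert (E3 : Cmod (Cconj om - w')%C = 1 - Cmod w').
      { rewrite E2 at 1. replace (Cconj om - Cconj om * RtoC (Cmod w'))%C with (Cconj om * RtoC (1 - Cmod w'))%C by (rewrite RtoC_minus; ring).
        rewrite Cmod_mult, Cmod_conj, Hom, Cmod_R, Rabs_right; lra. }
      assert (E4 := Cmod_rev_tri b w'). rewrite Hb1, Cmod_minus_sym in E4.
      assert (T1 := Cmod_tri_sub b w' f). assert (T2 := Cmod_tri_sub w' (Cconj om) f).
      rewrite (Cmod_minus_sym b w') in T1. rewrite (Cmod_minus_sym w' (Cconj om)) in T2. fold B in T1. lra. }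
    assert (Xd : x <= D + e).
    { unfold x, D. rewrite <- bb_mod. unfold bb.
      replace (1 - Cconj w * z)%C with ((1 - Cconj b * z) + - (Cconj (w - b) * z))%C by (rewrite Cminus_conj; ring).
      eapply Rle_trans; [apply Cmod_triangle|]. rewrite Cmod_opp, Cmod_mult, Cmod_conj.
      unfold inD in Hz. assert (Q := Cmod_ge_0 z). assert (Q2 := Cmod_ge_0 (w - b)%C). nra. }
    assert (X0 : 0 <= x) by apply Cmod_ge_0.
    assert (Lw : 1 - e <= Cmod w). { assert (E4 := Cmod_rev_tri b w). rewrite Hb1, Cmod_minus_sym in E4. lra. }
    assert (Lw' : 1 - e <= Cmod w'). { assert (E4 := Cmod_rev_tri b w'). rewrite Hb1, Cmod_minus_sym in E4. lra. }
    assert (Lprod : (2 - e) * (2 - e) <= (1 + Cmod w') * (1 + Cmod w)) by (apply Rmult_le_compat; lra).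
    assert (Y2 : B * B - 4 * e * B <= y * y).
    { destruct (Rle_dec (B - 2 * e) 0) as [L|L]; [nra|]. assert ((B - 2 * e) * (B - 2 * e) <= y * y) by (apply Rmult_le_compat; lra). nra. }
    assert (X2 : x * x <= D * D + 5 * e).
    { assert (x * x <= (D + e) * (D + e)) by (apply Rmult_le_compat; lra). nra. }
    assert (Left : 4 * (A * (B * B)) - 48 * e <= (1 + Cmod w') * (1 + Cmod w) * (A * (y * y))).
    { assert (S1 : (4 - 4 * e) * (A * (y * y)) <= (1 + Cmod w') * (1 + Cmod w) * (A * (y * y))).
      { apply Rmult_le_compat_r; [|nra]. apply Rmult_le_pos; nra. }
      assert (S2 : A * (B * B) - 8 * e <= A * (y * y)).
      { assert (A * (B * B - 4 * e * B) <= A * (y * y)) by (apply Rmult_le_compat_l; lra).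
        assert (A * (e * B) <= 1 * (e * 2)) by (apply Rmult_le_compat; nra). nra. }
      assert (S3 : (4 - 4 * e) * (A * (B * B) - 8 * e) <= (4 - 4 * e) * (A * (y * y))) by (apply Rmult_le_compat_l; lra).
      assert (S4 : A * (B * B) <= 4) by (assert (B * B <= 4) by nra; nra).
      assert (S5 : 0 <= A * (B * B)) by (apply Rmult_le_pos; nra). nra. }
    assert (Right : 4 * (x * x) * F <= 4 * (F * (D * D)) + 20 * e).
    { assert (x * x * F <= (D * D + 5 * e) * F) by (apply Rmult_le_compat_r; lra). nra. }
    lra. }
  apply Rnot_lt_le. intros L. set (m := A * (B * B) - F * (D * D)) in *. assert (Pm : 0 < m) by (unfold m; lra).
  specialize (K (Rmin (1 / 2) (m / 68))).
  assert (M1 := Rmin_l (1 / 2) (m / 68)). assert (M2 := Rmin_r (1 / 2) (m / 68)).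
  assert (M3 : 0 < Rmin (1 / 2) (m / 68)) by (apply Rmin_glb_lt; lra).
  specialize (K ltac:(lra)). unfold m in *. lra.
Qed.

(** Sends the disk to the right half-plane and b to infinity. *)
Definition Cay (z : C) : C := ((1 + Cconj b * z) / (1 - Cconj b * z))%C.
Definition Qt (t : R) (z : C) : C := (RtoC (/ t) * (Cay (phi t z) - Cay z))%C.
(** Twice the Berkson-Porta factor P: the velocity of the flow in the half-plane, and the pointwise
    limit of [Qt t]. *)
Definition QQ (z : C) : C := (2 * Cconj b / (bb z * bb z) * G z)%C.

Lemma Cay_deriv z : inD z -> cderiv Cay z (2 * Cconj b / (bb z * bb z))%C.
Proof.
  intros Hz. assert (N := one_minus_nz _ (bz_lt z Hz)). eapply cderiv_eq.
  - apply cderiv_div.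
    + apply cderiv_plus; [apply cderiv_const|apply cderiv_scal, cderiv_id].
    + apply cderiv_minus; [apply cderiv_const|apply cderiv_scal, cderiv_id].
    + exact N.
  - unfold bb. cbv beta. field. exact N.
Qed.

Lemma Cay_analytic : analytic_on_D Cay.
Proof. eapply analytic_of. intros z Hz. apply Cay_deriv, Hz. Qed.

(** Re Cay equals (1-|z|^2) / |b-z|^2, which does not decrease along the flow by Julia's lemma. *)
Lemma Qt_pos t : 0 < t -> posr (Qt t).
Proof.
  intros Ht. assert (Hs := phi_self t ltac:(lra)). split.
  - apply analytic_scal, analytic_minus; [|apply Cay_analytic].
    apply analytic_comp; [apply Cay_analytic|apply Hs|apply Hs].
  - intros z Hz. unfold Qt.
    replace (Re (RtoC (/ t) * (Cay (phi t z) - Cay z))%C) with (/ t * (Re (Cay (phi t z)) - Re (Cay z)))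
      by (unfold Re; simpl; ring).
    apply Rmult_le_pos; [left; apply Rinv_0_lt_compat, Ht|].
    assert (If := phi_inD t z ltac:(lra) Hz).
    unfold Cay. rewrite !cayley_Re by (apply bz_lt; assumption). fold (bb z) (bb (phi t z)).
    rewrite !Cmod_mult, Cmod_conj, Hb1, !Rmult_1_l.
    assert (J := julia t z ltac:(lra) Hz). assert (P1 := bb_pos z Hz). assert (P2 := bb_pos _ If).
    set (x := Cmod (bb z)) in *. set (y := Cmod (bb (phi t z))) in *.
    assert (K : (1 - Cmod z * Cmod z) / (x * x) <= (1 - Cmod (phi t z) * Cmod (phi t z)) / (y * y)); [|lra].
    apply Rle_div_l; [nra|]. replace ((1 - Cmod (phi t z) * Cmod (phi t z)) / (y * y) * (x * x)) with ((1 - Cmod (phi t z) * Cmod (phi t z)) * (x * x) / (y * y)) by (field; lra).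
    apply Rle_div_r; [nra|]. exact J.
Qed.

Lemma Qt_lim z : inD z -> forall eps, 0 < eps -> exists d, 0 < d /\ forall t, 0 < t < d -> Cmod (Qt t z - QQ z)%C <= eps.
Proof.
  intros Hz eps He.
  destruct (rder_comp Cay _ _ _ _ (gen_rder z Hz) (Cay_deriv z Hz) eps He) as [d [D Hd]].
  exists d. split; [exact D|]. intros t Ht. specialize (Hd t Ht). fold (QQ z) in Hd.
  assert (Nt : RtoC t <> 0%C) by (intro E0; apply (f_equal fst) in E0; simpl in E0; lra).
  replace (Qt t z - QQ z)%C with (RtoC (/ t) * (Cay (phi t z) - Cay z - QQ z * RtoC t))%C
    by (unfold Qt; rewrite RtoC_inv by lra; field; exact Nt).
  rewrite Cmod_mult, Cmod_R, Rabs_right by (apply Rle_ge; left; apply Rinv_0_lt_compat; lra).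
  apply Rmult_le_reg_l with t; [lra|]. rewrite <- Rmult_assoc, Rinv_r by lra. lra.
Qed.

(** Carries inequalities linear in moduli from the quotients [Qt t], which have nonnegative real
    part, to their pointwise limit [QQ]. *)
Lemma limit_ineq (x y c : R) : 0 <= c ->
  (forall eps, 0 < eps -> exists x' y', Rabs (x' - x) <= eps /\ Rabs (y' - y) <= eps /\ x' <= c * y') -> x <= c * y.
Proof.
  intros Hc H. apply Rnot_lt_le. intros L. set (m := x - c * y) in *. assert (Pm : 0 < m) by (unfold m; lra).
  destruct (H (m / 2 / (c + 1))) as [x' [y' [H1 [H2 H3]]]]; [apply Rdiv_lt_0_compat; lra|].
  apply Rabs_le_between in H1. apply Rabs_le_between in H2.
  set (e := m / 2 / (c + 1)) in *. assert (E1 : e * (c + 1) = m / 2) by (unfold e; field; lra).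
  assert (c * y' <= c * (y + e)) by (apply Rmult_le_compat_l; lra). unfold m in *. nra.
Qed.

Lemma mod_close (a c : C) eps : Cmod (a - c)%C <= eps -> Rabs (Cmod a - Cmod c) <= eps.
Proof.
  intros H. assert (A := Cmod_rev_tri a c). assert (B := Cmod_rev_tri c a). rewrite Cmod_minus_sym in B.
  apply Rabs_le. lra.
Qed.

Lemma QQ_lip z w : inD z -> Cmod (w - z)%C <= (1 - Cmod z) / 2 ->
  Cmod (QQ w - QQ z)%C <= 36 * Cmod (w - z)%C / (1 - Cmod z) * Cmod (QQ z).
Proof.
  intros Hz Hw. unfold inD in Hz. assert (T := Cmod_le_plus w z). assert (Iw : inD w) by (unfold inD; lra).
  apply limit_ineq.
  { apply Rdiv_le_0_compat; [|lra]. assert (Q := Cmod_ge_0 (w - z)%C). lra. }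
  intros eps He.
  destruct (Qt_lim z Hz (eps / 2) ltac:(lra)) as [d1 [D1 H1]]. destruct (Qt_lim w Iw (eps / 2) ltac:(lra)) as [d2 [D2 H2]].
  assert (P := Rmin_glb_lt d1 d2 0 D1 D2). assert (L1 := Rmin_l d1 d2). assert (L2 := Rmin_r d1 d2).
  set (t := Rmin d1 d2 / 2). specialize (H1 t ltac:(unfold t; lra)). specialize (H2 t ltac:(unfold t; lra)).
  exists (Cmod (Qt t w - Qt t z)%C), (Cmod (Qt t z)). split; [|split].
  - apply mod_close. replace (Qt t w - Qt t z - (QQ w - QQ z))%C with ((Qt t w - QQ w) - (Qt t z - QQ z))%C by ring.
    eapply Rle_trans; [apply Cmod_sub_le|]. lra.
  - eapply Rle_trans; [apply mod_close, H1|]. lra.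
  - eapply Rle_trans; [apply (pos_lip (Qt t) z w); [apply Qt_pos; unfold t; lra|exact Hz|exact Hw]|].
    replace (36 * Re (Qt t z) / (1 - Cmod z) * Cmod (w - z)%C) with (36 * Cmod (w - z)%C / (1 - Cmod z) * Re (Qt t z)) by (field; lra).
    apply Rmult_le_compat_l.
    + apply Rdiv_le_0_compat; [|lra]. assert (Q := Cmod_ge_0 (w - z)%C). lra.
    + eapply Rle_trans; [apply Rle_abs|apply re_le_Cmod].
Qed.

Lemma QQ_growth z : inD z -> Cmod (QQ z) * (1 - Cmod z) <= 2 * Cmod (QQ 0%C).
Proof.
  intros Hz. unfold inD in Hz. assert (Pz := Cmod_ge_0 z).
  assert (K : Cmod (QQ z) <= 2 / (1 - Cmod z) * Cmod (QQ 0%C)).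
  { apply limit_ineq; [apply Rdiv_le_0_compat; lra|]. intros eps He.
    destruct (Qt_lim z Hz eps He) as [d1 [D1 H1]]. destruct (Qt_lim 0%C inD_0 eps He) as [d2 [D2 H2]].
    assert (P := Rmin_glb_lt d1 d2 0 D1 D2). assert (L1 := Rmin_l d1 d2). assert (L2 := Rmin_r d1 d2).
    set (t := Rmin d1 d2 / 2). specialize (H1 t ltac:(unfold t; lra)). specialize (H2 t ltac:(unfold t; lra)).
    exists (Cmod (Qt t z)), (Cmod (Qt t 0%C)). split; [apply mod_close, H1|]. split; [apply mod_close, H2|].
    assert (B := pos_mod_bound (Qt t) z (Qt_pos t ltac:(unfold t; lra)) Hz).
    replace (2 / (1 - Cmod z) * Cmod (Qt t 0%C)) with (2 * Cmod (Qt t 0%C) / (1 - Cmod z)) by (field; lra).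
    apply Rle_div_r; [lra|]. assert (Q := Cmod_ge_0 (Qt t 0%C)). nra. }
  apply Rmult_le_compat_r with (r := 1 - Cmod z) in K; [|lra].
  replace (2 / (1 - Cmod z) * Cmod (QQ 0%C) * (1 - Cmod z)) with (2 * Cmod (QQ 0%C)) in K by (field; lra). exact K.
Qed.

Lemma G_QQ z : inD z -> G z = (b / 2 * (bb z * bb z) * QQ z)%C.
Proof.
  intros Hz. unfold QQ. assert (N := bb_pos z Hz). apply Cmod_gt_0 in N.
  replace (b / 2 * (bb z * bb z) * (2 * Cconj b / (bb z * bb z) * G z))%C with ((b * Cconj b) * G z)%C by (field; exact N).
  rewrite b_conj. ring.
Qed.

Lemma G_mod z : inD z -> Cmod (G z) = / 2 * (Cmod (bb z) * Cmod (bb z)) * Cmod (QQ z).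
Proof.
  intros Hz. rewrite (G_QQ z Hz) at 1. rewrite !Cmod_mult.
  unfold Cdiv. rewrite Cmod_mult, Hb1, Cmod_inv, Cmod_R, Rabs_right; [ring|lra|].
  intro E0. apply (f_equal fst) in E0. simpl in E0. lra.
Qed.

(** The error is relative to |G z|, which is what comparisons of speeds along an orbit require. The
    constant 81 = 9/4 * 36 comes from the variation of [QQ], 5/2 from that of the square of [bb],
    and 84 rounds up the sum. *)
Lemma G_lip z w : inD z -> Cmod (w - z)%C <= (1 - Cmod z) / 2 ->
  Cmod (G w - G z)%C <= 84 * Cmod (G z) * Cmod (w - z)%C / (1 - Cmod z).
Proof.
  intros Hz Hw. assert (Hz' := Hz). unfold inD in Hz'. assert (T := Cmod_le_plus w z). assert (Iw : inD w) by (unfold inD; lra).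
  rewrite (G_mod z Hz), (G_QQ w Iw), (G_QQ z Hz).
  assert (L := QQ_lip z w Hz Hw).
  set (q := Cmod (QQ z)) in *. set (d := Cmod (w - z)%C) in *. set (e := 1 - Cmod z) in *.
  assert (Bz := bb_ge z). fold e in Bz. set (B := Cmod (bb z)) in *.
  assert (Bw : Cmod (bb w) <= 3 / 2 * B).
  { assert (T2 := Cmod_le_plus (bb w) (bb z)). rewrite bb_diff in T2. fold d B in T2. lra. }
  replace (b / 2 * (bb w * bb w) * QQ w - b / 2 * (bb z * bb z) * QQ z)%C
    with (b / 2 * ((bb w * bb w) * (QQ w - QQ z) + (bb w - bb z) * (bb w + bb z) * QQ z))%C by ring.
  rewrite Cmod_mult. unfold Cdiv. rewrite Cmod_mult, Hb1, Cmod_inv, Cmod_R, Rabs_right; [|lra|].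
  2:{ intro E0. apply (f_equal fst) in E0. simpl in E0. lra. }
  assert (S : Cmod (bb w * bb w * (QQ w - QQ z) + (bb w - bb z) * (bb w + bb z) * QQ z)%C <= 84 * (B * B) * q * d / e).
  { eapply Rle_trans; [apply Cmod_triangle|]. rewrite !Cmod_mult, bb_diff. fold d q.
    assert (Bp : Cmod (bb w + bb z)%C <= 5 / 2 * B) by (eapply Rle_trans; [apply Cmod_triangle|]; fold B; lra).
    assert (W0 := Cmod_ge_0 (bb w)). assert (Q0 : 0 <= q) by apply Cmod_ge_0. assert (d0 : 0 <= d) by apply Cmod_ge_0.
    assert (e0 : 0 < e) by (unfold e; lra).
    assert (S1 : Cmod (bb w) * Cmod (bb w) * Cmod (QQ w - QQ z)%C <= 9 / 4 * (B * B) * (36 * d / e * q)).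
    { apply Rmult_le_compat; [nra|apply Cmod_ge_0|nra|exact L]. }
    assert (S2 : d * Cmod (bb w + bb z)%C * q <= 5 / 2 * (B * B) * q * d / e).
    { apply (Rle_div_r _ _ e); [exact e0|].
      replace (5 / 2 * (B * B) * q * d) with (d * (5 / 2 * B) * q * B) by ring.
      apply Rmult_le_compat; [| |apply Rmult_le_compat_r; [exact Q0|apply Rmult_le_compat_l; assumption]|exact Bz].
      - apply Rmult_le_pos; [apply Rmult_le_pos; [exact d0|apply Cmod_ge_0]|exact Q0].
      - lra. }
    replace (9 / 4 * (B * B) * (36 * d / e * q)) with (81 * ((B * B) * q * d / e)) in S1 by (field; lra).
    replace (5 / 2 * (B * B) * q * d / e) with (5 / 2 * ((B * B) * q * d / e)) in S2 by (field; lra).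
    replace (84 * (B * B) * q * d / e) with (84 * ((B * B) * q * d / e)) by (field; lra).
    assert (0 <= (B * B) * q * d / e).
    { apply Rdiv_le_0_compat; [|exact e0]. repeat apply Rmult_le_pos; lra. }
    lra. }
  replace (84 * (/ 2 * (B * B) * q) * d / e) with (1 * / 2 * (84 * (B * B) * q * d / e)) by (field; unfold e; lra).
  apply Rmult_le_compat_l; [lra|exact S].
Qed.

Lemma G_near z w : inD z -> Cmod (w - z)%C <= (1 - Cmod z) / 84 -> Cmod (G w) <= 2 * Cmod (G z).
Proof.
  intros Hz Hw. assert (Hz' := Hz). unfold inD in Hz'. assert (L := G_lip z w Hz ltac:(lra)).
  assert (T := Cmod_le_plus (G w) (G z)).
  assert (84 * Cmod (G z) * Cmod (w - z)%C / (1 - Cmod z) <= Cmod (G z)).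
  { apply Rle_div_l; [lra|]. assert (Q := Cmod_ge_0 (G z)). nra. }
  lra.
Qed.

Lemma G_growth : exists CG, 0 < CG /\ forall z, inD z -> Cmod (G z) * (1 - Cmod z) <= CG * (Cmod (bb z) * Cmod (bb z)).
Proof.
  exists (Cmod (QQ 0%C) + 1). assert (Q0 := Cmod_ge_0 (QQ 0%C)). split; [lra|]. intros z Hz.
  rewrite (G_mod z Hz). assert (K := QQ_growth z Hz). assert (B := bb_pos z Hz).
  replace (/ 2 * (Cmod (bb z) * Cmod (bb z)) * Cmod (QQ z) * (1 - Cmod z))
    with (/ 2 * (Cmod (QQ z) * (1 - Cmod z)) * (Cmod (bb z) * Cmod (bb z))) by ring.
  apply Rmult_le_compat_r; [nra|]. lra.
Qed.

(** For times up to ts the maps phi_t keep 0 in the disk of radius 1/2, so the constants of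
    composition estimates do not depend on t. *)
Lemma ts_exists : exists ts, 0 < ts /\ forall t, 0 <= t <= ts -> Cmod (phi t 0%C) <= 1 / 2.
Proof.
  destruct Hsg as [_ [_ [_ U]]]. destruct (U 0 (1 / 2) ltac:(lra) ltac:(lra)) as [d [D Hd]].
  exists (d / 2). split; [lra|]. intros t Ht. destruct (Req_dec t 0) as [->|N].
  - rewrite phi_0 by apply inD_0. rewrite Cmod_0. lra.
  - specialize (Hd t 0%C ltac:(lra) ltac:(rewrite Cmod_0; lra)).
    replace (phi t 0%C - 0)%C with (phi t 0%C) in Hd by ring. lra.
Qed.

End Flow.

Section Flow2.
Variables (phi : R -> C -> C) (G : C -> C) (b : C).
Hypothesis Hsg : is_semigroup phi.
Hypothesis HG : is_generator phi G.
Hypothesis HDW : boundary_DW_point phi b.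
Variable ts : R.
Hypothesis Hts0 : 0 < ts.
Hypothesis Hts : forall t, 0 <= t <= ts -> Cmod (phi t 0%C) <= 1 / 2.

Local Notation phi_self := (phi_self phi Hsg).
Local Notation phi_0 := (phi_0 phi Hsg).
Local Notation phi_add := (phi_add phi Hsg).
Local Notation phi_inD := (phi_inD phi Hsg).
Local Notation gen_rder := (gen_rder phi G HG).
Local Notation G_lip := (G_lip phi G b Hsg HG HDW).
Local Notation G_near := (G_near phi G b Hsg HG HDW).

Lemma flow_dist s z : 0 <= s <= ts -> inD z -> (1 - Cmod z) / 4 <= 1 - Cmod (phi s z).
Proof. intros Hs Hz. apply selfmap_dist; [apply phi_self; lra|apply Hts, Hs|exact Hz]. Qed.

(** Up to time ts the orbit stays in the closed disk of radius 1 - (1-|z|)/4, on which phi_t tends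
    to the identity uniformly; the semigroup law transfers this to any two times. *)
Lemma flow_unif z eps : inD z -> 0 < eps -> exists d, 0 < d /\ forall s s', 0 <= s <= ts -> 0 <= s' <= ts ->
  Rabs (s - s') < d -> Cmod (phi s z - phi s' z)%C < eps.
Proof.
  intros Hz He. assert (Hsg' := Hsg). destruct Hsg' as [_ [_ [_ U]]].
  assert (Hz' := Hz). unfold inD in Hz'. assert (Pz := Cmod_ge_0 z).
  destruct (U (1 - (1 - Cmod z) / 4) eps ltac:(lra) He) as [d [D Hd]].
  exists d. split; [exact D|].
  assert (K : forall s s', 0 <= s <= ts -> 0 <= s' <= ts -> s < s' -> s' - s < d -> Cmod (phi s' z - phi s z)%C < eps).
  { intros s s' Hs Hs' L L'. replace s' with ((s' - s) + s) at 1 by ring. rewrite phi_add by (try lra; exact Hz).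
    apply Hd; [lra|]. assert (Q := flow_dist s z Hs Hz). lra. }
  intros s s' Hs Hs' L. destruct (Rtotal_order s s') as [Q|[Q|Q]].
  - rewrite Cmod_minus_sym. apply K; auto. rewrite Rabs_left in L; lra.
  - subst s'. replace (phi s z - phi s z)%C with (RtoC 0) by ring. rewrite Cmod_0. exact He.
  - apply K; auto. rewrite Rabs_right in L; lra.
Qed.

Definition traj (z : C) (u : R) : C := phi (clamp ts u) z.

Lemma traj_eq z u : 0 <= u <= ts -> traj z u = phi u z.
Proof. intros H. unfold traj. rewrite clamp_id by exact H. reflexivity. Qed.

Lemma traj_inD z u : inD z -> inD (traj z u).
Proof. intros Hz. apply phi_inD; [|exact Hz]. apply clamp_bd. lra. Qed.

Lemma traj_cont z u : inD z -> Ccont (traj z) u.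
Proof.
  intros Hz eps He. destruct (flow_unif z eps Hz He) as [d [D Hd]]. exists d. split; [exact D|].
  intros s Hs. apply Hd; try (apply clamp_bd; lra). eapply Rle_lt_trans; [apply clamp_lip|exact Hs].
Qed.

Lemma traj_rder z v : inD z -> 0 <= v < ts -> rder (fun t => traj z (v + t)) (traj z v) (G (traj z v)).
Proof.
  intros Hz Hv eps He. assert (Iv := traj_inD z v Hz).
  destruct (gen_rder (traj z v) Iv eps He) as [d [D Hd]].
  exists (Rmin d (ts - v)). split; [apply Rmin_glb_lt; lra|]. intros t [Ht0 Ht].
  assert (M1 := Rmin_l d (ts - v)). assert (M2 := Rmin_r d (ts - v)).
  replace (traj z (v + t)) with (phi t (traj z v)); [apply Hd; lra|].
  rewrite !traj_eq by lra. rewrite (Rplus_comm v). symmetry. apply phi_add; [lra|lra|exact Hz].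
Qed.

Lemma traj_speed z u v M : inD z -> 0 <= u <= v -> v <= ts ->
  (forall t, u <= t <= v -> Cmod (G (traj z t)) <= M) -> Cmod (traj z v - traj z u)%C <= M * (v - u).
Proof.
  intros Hz Hu Hv HM. apply mvt_right; [lra| |].
  - intros t _. apply traj_cont, Hz.
  - intros t Ht eps He.
    destruct (rder_dini _ _ _ (traj_rder z t Hz ltac:(lra)) M (HM t ltac:(lra)) eps He) as [d [D Hd]].
    exists d. split; [exact D|]. intros s Hs. specialize (Hd (s - t) ltac:(lra)).
    replace (t + (s - t)) with s in Hd by ring. exact Hd.
Qed.

(* Small against the constant 84 of G_lip: along a piece of orbit with t |G z| <= eta0 (1-|z|) the generator varies by a factor of at most 2. *)
Definition eta0 : R := 1 / 400.

Lemma traj_dist_cont z w u : inD z -> continuous (fun v => Cmod (traj z v - w)%C) u.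
Proof.
  intros Hz. apply Cmod_continuous, Ccont_minus; [apply traj_cont, Hz|apply Ccont_const].
Qed.

(** While the orbit is within (1-|z|)/84 of z its speed is at most 2 |G z|. It then travels at most
    2 * eta0 * (1-|z|) = (1-|z|)/200, less than half of the allowed distance, and [bootstrap] closes
    the argument. *)
Lemma displacement z s : inD z -> 0 <= s <= ts -> s * Cmod (G z) <= eta0 * (1 - Cmod z) ->
  forall u, 0 <= u <= s -> Cmod (phi u z - z)%C <= 2 * u * Cmod (G z).
Proof.
  intros Hz Hs Hsm. assert (Hz' := Hz). unfold inD in Hz'. unfold eta0 in Hsm.
  assert (G0 := Cmod_ge_0 (G z)).
  assert (T0 : traj z 0 = z) by (rewrite traj_eq by lra; apply phi_0, Hz).
  assert (Sp : forall u, 0 <= u <= s -> (forall v, 0 <= v <= u -> Cmod (traj z v - z)%C <= (1 - Cmod z) / 84) ->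
     Cmod (traj z u - z)%C <= 2 * Cmod (G z) * u).
  { intros u Hu HB. rewrite <- T0 at 2. rewrite <- (Rminus_0_r u) at 2. apply traj_speed; [exact Hz|lra|lra|].
    intros t Ht. apply G_near; [exact Hz|]. apply HB. lra. }
  assert (B : forall u, 0 <= u <= s -> Cmod (traj z u - z)%C <= (1 - Cmod z) / 84).
  { apply (bootstrap (fun u => Cmod (traj z u - z)%C)); [lra|lra| | |].
    - intros u. apply traj_dist_cont, Hz.
    - rewrite T0. replace (z - z)%C with (RtoC 0) by ring. rewrite Cmod_0. lra.
    - intros u Hu HB. eapply Rle_trans; [apply Sp; assumption|]. nra. }
  intros u Hu. rewrite <- (traj_eq z u) by lra. replace (2 * u * Cmod (G z)) with (2 * Cmod (G z) * u) by ring.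
  apply Sp; [exact Hu|]. intros v Hv. apply B. lra.
Qed.

(** Subtracting the uniform motion leaves the speed G(phi_u z) - G z; 168 is the Lipschitz constant
    84 times the 2 of [displacement]. *)
Lemma second_displacement z s : inD z -> 0 <= s <= ts -> s * Cmod (G z) <= eta0 * (1 - Cmod z) ->
  Cmod (phi s z - z - RtoC s * G z)%C <= 168 * (s * Cmod (G z)) * (s * Cmod (G z)) / (1 - Cmod z).
Proof.
  intros Hz Hs Hsm. assert (Hz' := Hz). unfold inD in Hz'.
  assert (Dsp := displacement z s Hz Hs Hsm). assert (G0 := Cmod_ge_0 (G z)). unfold eta0 in Hsm.
  set (y := fun u => (traj z u - RtoC u * G z)%C).
  assert (M := mvt_right y 0 s (168 * (s * Cmod (G z)) * Cmod (G z) / (1 - Cmod z)) ltac:(lra)).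
  assert (Y : (y s - y 0)%C = (phi s z - z - RtoC s * G z)%C).
  { unfold y. rewrite !traj_eq by lra. rewrite phi_0 by exact Hz. ring. }
  rewrite Y in M.
  replace (168 * (s * Cmod (G z)) * (s * Cmod (G z)) / (1 - Cmod z)) with (168 * (s * Cmod (G z)) * Cmod (G z) / (1 - Cmod z) * (s - 0)) by (field; lra).
  apply M.
  - intros t _. apply Ccont_minus; [apply traj_cont, Hz|]. apply Ccont_mult; [|apply Ccont_const].
    apply Ccont_RtoC. apply continuous_id.
  - intros u Hu eps He.
    assert (RD : rder (fun t => y (u + t)) (y u) (G (traj z u) - G z)%C).
    { intros e Pe. destruct (traj_rder z u Hz ltac:(lra) e Pe) as [d [D Hd]]. exists d. split; [exact D|].
      intros t Ht. specialize (Hd t Ht). eapply Rle_trans; [|exact Hd]. right. f_equal. unfold y. rewrite RtoC_plus. ring. }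
    assert (Bd : Cmod (G (traj z u) - G z)%C <= 168 * (s * Cmod (G z)) * Cmod (G z) / (1 - Cmod z)).
    { specialize (Dsp u ltac:(lra)). rewrite <- (traj_eq z u) in Dsp by lra.
      assert (Q : u * Cmod (G z) <= s * Cmod (G z)) by (apply Rmult_le_compat_r; lra).
      eapply Rle_trans; [apply G_lip; [exact Hz|lra]|].
      apply Rmult_le_compat_r; [left; apply Rinv_0_lt_compat; lra|].
      replace (168 * (s * Cmod (G z)) * Cmod (G z)) with (84 * Cmod (G z) * (2 * (s * Cmod (G z)))) by ring.
      apply Rmult_le_compat_l; lra. }
    destruct (rder_dini _ _ _ RD _ Bd eps He) as [d [D Hd]].
    exists d. split; [exact D|]. intros t Ht. specialize (Hd (t - u) ltac:(lra)).
    replace (u + (t - u)) with t in Hd by ring. exact Hd.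
Qed.

Definition bad_set (t : R) (z : C) : Prop := eta0 * (1 - Cmod z) <= t * Cmod (G z).

(** Run the orbit backwards from w = phi_s z. If w were not bad at scale 4 t, then s |G w| <=
    (1-|w|)/1600 would keep the whole piece of orbit near w, and [G_near] would make z not bad at
    scale t. The factor 4 pays for the doubling of |G| and the change of 1-|.|. *)
Lemma bad_forward z s t : inD z -> 0 <= s <= ts -> s <= t -> bad_set t z -> bad_set (4 * t) (phi s z).
Proof.
  intros Hz Hs Hst Hb. apply Rnot_lt_le. intros L.
  assert (G0 := Cmod_ge_0 (G z)).
  set (w := phi s z) in *. assert (Iw : inD w) by (apply phi_inD; [lra|exact Hz]). assert (Iw' := Iw). unfold inD in Iw'.
  assert (Gw := Cmod_ge_0 (G w)). unfold bad_set, eta0 in *.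
  assert (Tw : traj z s = w) by (apply traj_eq; lra).
  assert (Sw : s * Cmod (G w) <= 1 / 1600 * (1 - Cmod w)).
  { assert (s * Cmod (G w) <= t * Cmod (G w)) by (apply Rmult_le_compat_r; lra). lra. }
  assert (Sp : forall v, 0 <= v <= s -> (forall v', 0 <= v' <= v -> Cmod (traj z (s - v') - w)%C <= (1 - Cmod w) / 84) ->
     Cmod (traj z (s - v) - w)%C <= 2 * Cmod (G w) * v).
  { intros v Hv HB. rewrite <- Tw at 1. rewrite Cmod_minus_sym.
    replace v with (s - (s - v)) at 2 by ring. apply traj_speed; [exact Hz|lra|lra|].
    intros x Hx. apply G_near; [exact Iw|]. replace x with (s - (s - x)) by ring. apply HB. lra. }
  assert (B : forall v, 0 <= v <= s -> Cmod (traj z (s - v) - w)%C <= (1 - Cmod w) / 84).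
  { apply (bootstrap (fun v => Cmod (traj z (s - v) - w)%C)); [lra|lra| | |].
    - intros v. apply (continuous_comp (fun v => s - v) (fun v => Cmod (traj z v - w)%C)).
      + apply (continuous_minus (fun _ => s) (fun v => v)); [apply continuous_const|apply continuous_id].
      + apply traj_dist_cont, Hz.
    - rewrite Rminus_0_r, Tw. replace (w - w)%C with (RtoC 0) by ring. rewrite Cmod_0. lra.
    - intros v Hv HB. eapply Rle_trans; [apply Sp; assumption|].
      assert (Cmod (G w) * v <= s * Cmod (G w)) by (rewrite (Rmult_comm s); apply Rmult_le_compat_l; lra). lra. }
  assert (Bs := B s ltac:(lra)). rewrite Rminus_eq_0 in Bs.
  rewrite traj_eq, phi_0 in Bs by (try lra; exact Hz).
  assert (GN := G_near w z Iw Bs).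
  assert (T := Cmod_le_plus z w).
  assert (t * Cmod (G z) <= 2 * (t * Cmod (G w))).
  { replace (2 * (t * Cmod (G w))) with (t * (2 * Cmod (G w))) by ring. apply Rmult_le_compat_l; lra. }
  lra.
Qed.

(** Both sides are right derivatives at t = 0 of phi_{t+s} z, read once as phi_t (phi_s z) and once
    as phi_s (phi_t z). *)
Lemma flow_commute s z : 0 <= s -> inD z -> G (phi s z) = (cD (phi s) z * G z)%C.
Proof.
  intros Hs Hz. assert (Ip := phi_inD s z Hs Hz).
  assert (A := gen_rder (phi s z) Ip).
  assert (B := rder_comp (phi s) _ _ _ _ (gen_rder z Hz) (analytic_cD (phi s) z (proj1 (phi_self s Hs)) Hz)).
  apply (rder_unique _ _ _ _ A). intros eps He. destruct (B eps He) as [d [D Hd]]. exists d. split; [exact D|].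
  intros t Ht. specialize (Hd t Ht).
  rewrite <- phi_add in Hd by (try lra; exact Hz). rewrite <- phi_add by (try lra; exact Hz).
  rewrite (Rplus_comm t s). exact Hd.
Qed.

(** Schwarz-Pick applied to the intertwining relation: the hyperbolic length of the vector G does
    not grow along the flow. *)
Lemma flow_contract s z : 0 <= s -> inD z ->
  Cmod (G (phi s z)) * (1 - Cmod z * Cmod z) <= Cmod (G z) * (1 - Cmod (phi s z) * Cmod (phi s z)).
Proof.
  intros Hs Hz. rewrite flow_commute, Cmod_mult by assumption.
  assert (P := schwarz_pick (phi s) z (phi_self s Hs) Hz). assert (G0 := Cmod_ge_0 (G z)).
  replace (Cmod (cD (phi s) z) * Cmod (G z) * (1 - Cmod z * Cmod z)) with (Cmod (G z) * (Cmod (cD (phi s) z) * (1 - Cmod z * Cmod z))) by ring.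
  apply Rmult_le_compat_l; assumption.
Qed.

(** A zero of G would be fixed by phi_ts, by [displacement], hence by all its iterates, whereas
    every orbit converges to a point of the circle. Division by G in the time means rests on
    this. *)
Lemma G_nz z : inD z -> G z <> 0%C.
Proof.
  intros Hz E0. assert (Hz' := Hz). unfold inD in Hz'.
  assert (Fx : phi ts z = z).
  { apply Copp_inj_0, Cmod_eq_0, Rle_antisym; [|apply Cmod_ge_0].
    assert (Q := displacement z ts Hz ltac:(lra)). rewrite E0, Cmod_0 in Q. unfold eta0 in Q.
    specialize (Q ltac:(lra) ts ltac:(lra)). lra. }
  assert (Fn : forall n, phi (INR n * ts) z = z).
  { induction n; [simpl; rewrite Rmult_0_l; apply phi_0, Hz|].
    rewrite S_INR. replace ((INR n + 1) * ts) with (INR n * ts + ts) by ring.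
    rewrite phi_add by (first [exact Hz | apply Rmult_le_pos; [apply pos_INR|lra] | lra]). rewrite Fx. exact IHn. }
  destruct (dw_lim phi b HDW z Hz (1 - Cmod z) ltac:(lra)) as [M HM].
  destruct (nfloor_ex (Rabs M / ts)) as [N [_ HN]]; [apply Rdiv_le_0_compat; [apply Rabs_pos|lra]|].
  specialize (HM (INR (S N) * ts)). rewrite Fn in HM.
  apply Rlt_div_l in HN; [|lra]. rewrite S_INR in HM. assert (Q := Rle_abs M). specialize (HM ltac:(nra)).
  rewrite Cmod_minus_sym in HM. assert (T := Cmod_rev_tri b z). rewrite (proj1 HDW) in T. lra.
Qed.

End Flow2.

(** * Strong continuity and the closure of E *)

Lemma analytic_ext f g : (forall z, inD z -> f z = g z) -> analytic_on_D f -> analytic_on_D g.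
Proof.
  intros H Hf. eapply analytic_of. intros z Hz. assert (Hz' := Hz). unfold inD in Hz'.
  apply (cderiv_local f g z (cD f z) (1 - Cmod z)); [lra| |apply analytic_cD; assumption].
  intros w Hw. apply H. assert (T := Cmod_le_plus w z). unfold inD. lra.
Qed.

Lemma Dfn_tri f g h z : inD z -> analytic_on_D g -> analytic_on_D h -> (forall w, inD w -> f w = (g w + h w)%C) ->
  Dfn f z <= Dfn g z + Dfn h z.
Proof.
  intros Hz Hg Hh E0. rewrite !Dfn_eq by exact Hz. assert (Hz' := Hz). unfold inD in Hz'.
  assert (D : cderiv f z (cD g z + cD h z)%C).
  { apply (cderiv_local (fun w => g w + h w)%C f z _ (1 - Cmod z)); [lra| |].
    - intros w Hw. symmetry. apply E0. assert (T := Cmod_le_plus w z). unfold inD. lra.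
    - apply cderiv_plus; apply analytic_cD; assumption. }
  rewrite (cD_eq _ _ _ D). assert (T := Cmod_triangle (cD g z) (cD h z)). nra.
Qed.

Lemma Dfn_scal f g c z : inD z -> analytic_on_D g -> (forall w, inD w -> f w = (c * g w)%C) ->
  Dfn f z = Cmod c * Dfn g z.
Proof.
  intros Hz Hg E0. rewrite !Dfn_eq by exact Hz. assert (Hz' := Hz). unfold inD in Hz'.
  assert (D : cderiv f z (c * cD g z)%C).
  { apply (cderiv_local (fun w => c * g w)%C f z _ (1 - Cmod z)); [lra| |].
    - intros w Hw. symmetry. apply E0. assert (T := Cmod_le_plus w z). unfold inD. lra.
    - apply cderiv_scal; apply analytic_cD; assumption. }
  rewrite (cD_eq _ _ _ D), Cmod_mult. ring.
Qed.

(** Schwarz-Pick; the factor 2 comes from replacing 1-|.|^2 by 1-|.|. *)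
Lemma Dfn_comp f g z : analytic_on_D f -> selfmap g -> inD z -> Dfn (fun w => f (g w)) z <= 2 * Dfn f (g z).
Proof.
  intros Hf Hg Hz. assert (Ig := proj2 Hg z Hz). rewrite !Dfn_eq by assumption.
  assert (D := cderiv_comp f g z _ _ (analytic_cD g z (proj1 Hg) Hz) (analytic_cD f _ Hf Ig)).
  rewrite (cD_eq _ _ _ D), Cmod_mult.
  assert (S := schwarz_pick g z Hg Hz). assert (F0 := Cmod_ge_0 (cD f (g z))).
  assert (G0 := Cmod_ge_0 (cD g z)). assert (Pg := Cmod_ge_0 (g z)). assert (Pz := Cmod_ge_0 z).
  unfold inD in Hz, Ig.
  assert (K : (1 - Cmod z) * Cmod (cD g z) <= 2 * (1 - Cmod (g z))).
  { apply Rle_trans with (Cmod (cD g z) * (1 - Cmod z * Cmod z)); [rewrite Rmult_comm; apply Rmult_le_compat_l; [exact G0|nra]|].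
    eapply Rle_trans; [exact S|]. nra. }
  replace ((1 - Cmod z) * (Cmod (cD f (g z)) * Cmod (cD g z))) with (Cmod (cD f (g z)) * ((1 - Cmod z) * Cmod (cD g z))) by ring.
  replace (2 * ((1 - Cmod (g z)) * Cmod (cD f (g z)))) with (Cmod (cD f (g z)) * (2 * (1 - Cmod (g z)))) by ring.
  apply Rmult_le_compat_l; assumption.
Qed.

Section Main.
Variables (p : Rbar) (alpha : R) (phi : R -> C -> C) (G : C -> C) (b : C).
Hypothesis Hp : Rbar_lt 0 p.
Hypothesis Ha : 0 < alpha.
Hypothesis Hsg : is_semigroup phi.
Hypothesis HG : is_generator phi G.
Hypothesis HDW : boundary_DW_point phi b.
Variable ts : R.
Hypothesis Hts0 : 0 < ts.
Hypothesis Hts : forall t, 0 <= t <= ts -> Cmod (phi t 0%C) <= 1 / 2.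

Local Notation bnd := (bnd p alpha).
Local Notation phi_self := (phi_self phi Hsg).
Local Notation phi_0 := (phi_0 phi Hsg).
Local Notation phi_inD := (phi_inD phi Hsg).
Local Notation displacement := (displacement phi G b Hsg HG HDW ts Hts0 Hts).
Local Notation second_displacement := (second_displacement phi G b Hsg HG HDW ts Hts0 Hts).
Local Notation bad_forward := (bad_forward phi G b Hsg HG HDW ts Hts0 Hts).
Local Notation Bad := (bad_set G).

Definition flowdiff (f : C -> C) (s : R) : C -> C := fsub (fun z => f (phi s z)) f.

Local Notation ee := flowdiff.

Lemma ee_analytic f s : analytic_on_D f -> 0 <= s -> analytic_on_D (ee f s).
Proof.
  intros Hf Hs. unfold flowdiff, fsub. apply analytic_minus; [|exact Hf].
  apply analytic_comp; [exact Hf|apply phi_self, Hs|apply phi_self, Hs].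
Qed.

Lemma first_order f z s eta : analytic_on_D f -> inD z -> 0 <= s <= ts -> 0 < eta <= eta0 ->
  s * Cmod (G z) <= eta * (1 - Cmod z) ->
  exists w, Cmod (w - z)%C <= (1 - Cmod z) / 4 /\ Cmod (ee f s z) <= 32 * eta * Cmod (f w).
Proof.
  intros Hf Hz Hs He Hsm. assert (Hz' := Hz). unfold inD in Hz'. unfold eta0 in *.
  destruct (near_ex f z ((1 - Cmod z) / 4) (Cmod (ee f s z)) (16 * eta)) as [w [W1 W2]]; [lra|lra|apply Cmod_ge_0| |].
  - intros B HB HH.
    assert (D := displacement z s Hz Hs ltac:(unfold eta0; nra) s ltac:(lra)).
    assert (D' : Cmod (phi s z - z)%C <= 2 * eta * (1 - Cmod z)) by lra.
    assert (L := cauchy_lip f z (phi s z) ((1 - Cmod z) / 4) B Hf ltac:(lra) ltac:(lra) HH ltac:(nra)).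
    unfold flowdiff, fsub. eapply Rle_trans; [exact L|].
    replace (16 * eta * B) with (2 * B / ((1 - Cmod z) / 4) * (2 * eta * (1 - Cmod z))) by (field; lra).
    apply Rmult_le_compat_l; [|exact D']. apply Rdiv_le_0_compat; lra.
  - exists w. split; [exact W1|]. lra.
Qed.

(** Within (1-|z|)/84 of z the speed |G| at most doubles and 1-|.| at most halves, so [first_order]
    applies with 4 eta; Cauchy's estimate there yields 21504 = 168 * 128. *)
Lemma first_order_deriv f z s eta : analytic_on_D f -> inD z -> 0 <= s <= ts -> 0 < eta -> 4 * eta <= eta0 ->
  s * Cmod (G z) <= eta * (1 - Cmod z) ->
  exists w, Cmod (w - z)%C <= (1 - Cmod z) / 2 /\ Dfn (ee f s) z <= 21504 * eta * Cmod (f w).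
Proof.
  intros Hf Hz Hs He He4 Hsm. assert (Hz' := Hz). unfold inD in Hz'. unfold eta0 in *.
  destruct (near_ex (ee f s) z ((1 - Cmod z) / 84) (Dfn (ee f s) z) 84) as [x [X1 X2]]; [lra|lra|apply Dfn_ge_0| |].
  - intros B HB HH. rewrite Dfn_eq by exact Hz.
    assert (K := cauchy_est (ee f s) z ((1 - Cmod z) / 84) B (ee_analytic f s Hf ltac:(lra)) ltac:(lra) HH).
    apply Rmult_le_compat_l with (r := 1 - Cmod z) in K; [|lra].
    replace ((1 - Cmod z) * (B / ((1 - Cmod z) / 84))) with (84 * B) in K by (field; lra). exact K.
  - assert (T := Cmod_le_plus x z). assert (T' := Cmod_le_plus z x). rewrite Cmod_minus_sym in T'.
    assert (Ix : inD x) by (unfold inD; lra).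
    assert (GN := G_near phi G b Hsg HG HDW z x Hz X1).
    destruct (first_order f x s (4 * eta) Hf Ix Hs ltac:(unfold eta0; lra)) as [w [W1 W2]].
    { assert (s * Cmod (G x) <= s * (2 * Cmod (G z))) by (apply Rmult_le_compat_l; lra).
      assert (eta * (1 - Cmod z) <= eta * (2 * (1 - Cmod x))) by (apply Rmult_le_compat_l; lra). lra. }
    exists w. split.
    + assert (T2 := Cmod_tri_sub w x z). lra.
    + assert (Q := Cmod_ge_0 (f w)). lra.
Qed.

(** The error is the Taylor remainder of f over the displacement plus f' times the deviation of the
    orbit from uniform motion. They give 128 + 336 = 464, doubled by [near_ex]. *)
Lemma second_order f x s eta : analytic_on_D f -> inD x -> 0 <= s <= ts -> 0 < eta <= eta0 ->
  s * Cmod (G x) <= eta * (1 - Cmod x) ->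
  exists y, Cmod (y - x)%C <= (1 - Cmod x) / 2 /\
    Cmod (f (phi s x) - f x - RtoC s * (G x * cD f x))%C <= 928 * (eta * eta) * Cmod (f y).
Proof.
  intros Hf Hz Hs He Hsm. assert (Hz' := Hz). unfold inD in Hz'. unfold eta0 in *.
  assert (G0 := Cmod_ge_0 (G x)).
  destruct (near_ex f x ((1 - Cmod x) / 2) (Cmod (f (phi s x) - f x - RtoC s * (G x * cD f x))%C) (464 * (eta * eta))) as [w [W1 W2]]; [lra|nra|apply Cmod_ge_0| |].
  - intros B HB HH.
    assert (Sm : s * Cmod (G x) <= eta0 * (1 - Cmod x)) by (unfold eta0; nra).
    assert (D := displacement x s Hz Hs Sm s ltac:(lra)).
    assert (D2 := second_displacement x s Hz Hs Sm).
    set (d := Cmod (phi s x - x)%C) in *. assert (d0 : 0 <= d) by apply Cmod_ge_0.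
    assert (D' : d <= 2 * eta * (1 - Cmod x)) by lra.
    set (e := 1 - Cmod x) in *.
    assert (C2 := cauchy_second f x (phi s x) (e / 2) B Hf ltac:(unfold e; lra) ltac:(unfold e; lra) HH ltac:(fold d; nra)).
    fold d in C2.
    assert (C1 := cauchy_est f x (e / 2) B Hf ltac:(unfold e; lra) HH).
    replace (f (phi s x) - f x - s * (G x * cD f x))%C with ((f (phi s x) - f x - cD f x * (phi s x - x)) + cD f x * (phi s x - x - RtoC s * G x))%C by ring.
    eapply Rle_trans; [apply Cmod_triangle|]. rewrite Cmod_mult.
    assert (e0 : 0 < e) by (unfold e; lra).
    assert (P1 : 8 * B / (e / 2 * (e / 2)) * (d * d) <= 128 * (eta * eta) * B).
    { apply Rle_trans with (8 * B / (e / 2 * (e / 2)) * ((2 * eta * e) * (2 * eta * e))).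
      - apply Rmult_le_compat_l; [apply Rdiv_le_0_compat; nra|]. apply Rmult_le_compat; assumption.
      - right. field. lra. }
    assert (P2 : Cmod (cD f x) * Cmod (phi s x - x - RtoC s * G x)%C <= 336 * (eta * eta) * B).
    { apply Rle_trans with (B / (e / 2) * (168 * (eta * e) * (eta * e) / e)).
      - apply Rmult_le_compat; [apply Cmod_ge_0|apply Cmod_ge_0|exact C1|].
        eapply Rle_trans; [exact D2|]. apply Rmult_le_compat_r; [left; apply Rinv_0_lt_compat; exact e0|].
        assert (Q : 0 <= s * Cmod (G x)) by (apply Rmult_le_pos; lra).
        rewrite !Rmult_assoc. apply Rmult_le_compat_l; [lra|].
        rewrite <- !Rmult_assoc. rewrite (Rmult_assoc (s * Cmod (G x))), (Rmult_assoc (eta * e)).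
        apply Rmult_le_compat; lra.
      - right. field. lra. }
    lra.
  - exists w. split; [exact W1|]. lra.
Qed.

Definition grad_on_bad (f : C -> C) (t : R) (z : C) : R := if excluded_middle_informative (Bad t z) then Dfn f z else 0.
Local Notation Dbad := grad_on_bad.

Lemma Dbad_ge_0 f t z : 0 <= Dbad f t z.
Proof. unfold grad_on_bad. destruct excluded_middle_informative; [apply Dfn_ge_0|lra]. Qed.
Lemma Dbad_eq f t z : Bad t z -> Dbad f t z = Dfn f z.
Proof. intros H. unfold grad_on_bad. destruct excluded_middle_informative; [reflexivity|contradiction]. Qed.
Lemma Bad_mono t t' z : t <= t' -> Bad t z -> Bad t' z.
Proof. unfold bad_set. intros H B. assert (Q := Cmod_ge_0 (G z)). assert (t * Cmod (G z) <= t' * Cmod (G z)) by (apply Rmult_le_compat_r; lra). lra. Qed.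
Lemma not_Bad t z : ~ Bad t z -> t * Cmod (G z) <= eta0 * (1 - Cmod z).
Proof. unfold bad_set. intros H. lra. Qed.

(** Bad sets shrink with t, so one admissible t for each eps already says that the bad part of D f
    tends to 0. *)
Definition vanishing_grad (f : C -> C) : Prop :=
  analytic_on_D f /\ (exists A, 0 < A /\ bnd (fun z => Cmod (f z)) A) /\
  forall eps, 0 < eps -> exists t, 0 < t <= ts /\ bnd (Dbad f t) eps.

Lemma fsub_analytic f g : analytic_on_D f -> analytic_on_D g -> analytic_on_D (fsub f g).
Proof. apply analytic_minus. Qed.

(** At a bad point 1-|z| <= (t / eta0) |G z|, so for h in E the bad part of D h is at most t / eta0
    times |G h'|, which is bounded in norm. D (f - h) is small everywhere once h is close to f. *)
Lemma closure_vanishing_grad f : Hclosure p alpha (setE p alpha G) f -> vanishing_grad f.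
Proof.
  intros [Hf Hcl]. assert (Hfa := proj1 Hf). split; [exact Hfa|]. split; [apply in_Hinf_bnd; assumption|].
  intros eps He.
  destruct (bnd_of_Hnorm p alpha Hp Ha) as [C1 [P1 H1]]. destruct (bnd_deriv p alpha Hp Ha) as [C2 [P2 H2]].
  destruct (bnd_plus p alpha Hp) as [C3 [P3 H3]].
  set (e1 := eps / (2 * C3 * (C2 * C1))).
  assert (Pe1 : 0 < e1) by (apply Rdiv_lt_0_compat; [lra|]; repeat apply Rmult_lt_0_compat; lra).
  destruct (Hcl e1 Pe1) as [h [[Hh [dh [Hdh HGd]]] HN]].
  assert (Hha := proj1 Hh).
  destruct (in_Hinf_bnd p alpha Hp Ha _ HGd) as [Ag [PAg HAg]].
  set (t := Rmin ts (eta0 * eps / (2 * C3 * Ag))).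
  assert (Pq : 0 < eta0 * eps / (2 * C3 * Ag)).
  { apply Rdiv_lt_0_compat; [unfold eta0; lra|]. repeat apply Rmult_lt_0_compat; lra. }
  assert (Pt : 0 < t) by (apply Rmin_glb_lt; lra).
  exists t. split; [split; [exact Pt|apply Rmin_l]|].
  assert (Fa := fsub_analytic f h Hfa Hha).
  assert (Bd : bnd (Dfn (fsub f h)) (C2 * (C1 * e1))).
  { apply H2; [apply Rmult_lt_0_compat; lra|exact Fa|]. apply H1; [exact Pe1|exact Fa|].
    apply Rbar_lt_le. exact HN. }
  assert (Bg : bnd (fun z => t / eta0 * Cmod (G z * dh z)%C) (t / eta0 * Ag)).
  { apply bnd_scal; auto; [unfold eta0; lra|]. intros z _. apply Cmod_ge_0. }
  assert (Pe0 : 0 < t / eta0) by (unfold eta0; lra).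
  apply (bnd_mono p alpha Hp (Dbad f t) (Dbad f t) (C3 * (C2 * (C1 * e1) + t / eta0 * Ag))).
  - split.
    + apply Rmult_lt_0_compat; [exact P3|]. apply Rplus_lt_0_compat; [apply Rmult_lt_0_compat; [lra|apply Rmult_lt_0_compat; lra]|apply Rmult_lt_0_compat; lra].
    + assert (Q1 : C3 * (C2 * (C1 * e1)) = eps / 2) by (unfold e1; field; lra).
      assert (Q2 : C3 * (t / eta0 * Ag) <= eps / 2).
      { assert (Q : t <= eta0 * eps / (2 * C3 * Ag)) by apply Rmin_r.
        replace (eps / 2) with (C3 * (eta0 * eps / (2 * C3 * Ag) / eta0 * Ag)) by (unfold eta0; field; lra).
        apply Rmult_le_compat_l; [lra|]. apply Rmult_le_compat_r; [lra|]. unfold eta0 in *. lra. }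
      lra.
  - intros z _. split; [apply Dbad_ge_0|lra].
  - apply (H3 _ _ (Dfn (fsub f h)) (fun z => t / eta0 * Cmod (G z * dh z)%C)); auto.
    + apply Rmult_lt_0_compat; [lra|apply Rmult_lt_0_compat; lra].
    + apply Rmult_lt_0_compat; lra.
    + apply Dfn_ge_0.
    + intros z. apply Rmult_le_pos; [lra|apply Cmod_ge_0].
    + intros z Hz. split; [apply Dbad_ge_0|]. unfold grad_on_bad. destruct excluded_middle_informative as [Bz|_].
      2:{ apply Rplus_le_le_0_compat; [apply Dfn_ge_0|]. apply Rmult_le_pos; [lra|apply Cmod_ge_0]. }
      eapply Rle_trans; [apply (Dfn_tri f (fsub f h) h z Hz Fa Hha)|].
      { intros w _. unfold fsub. ring. }
      apply Rplus_le_compat_l. rewrite Dfn_eq by exact Hz.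
      assert (Ed : cD h z = dh z) by (apply cD_eq, is_derive_cderiv, Hdh, Hz).
      rewrite Ed, Cmod_mult. assert (D0 := Cmod_ge_0 (dh z)). unfold bad_set in Bz.
      rewrite <- Rmult_assoc. apply Rmult_le_compat_r; [exact D0|].
      apply Rmult_le_reg_l with eta0; [unfold eta0; lra|].
      replace (eta0 * (t / eta0 * Cmod (G z))) with (t * Cmod (G z)) by (unfold eta0; field). exact Bz.
Qed.

Lemma bnd_plus3 : exists C0, 0 < C0 /\ forall A B D u v w U, 0 < A -> 0 < B -> 0 < D ->
  (forall z, 0 <= u z) -> (forall z, 0 <= v z) -> (forall z, 0 <= w z) -> bnd u A -> bnd v B -> bnd w D ->
  (forall z, inD z -> 0 <= U z <= u z + v z + w z) -> bnd U (C0 * (A + B + D)).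
Proof.
  destruct (bnd_plus p alpha Hp) as [C1 [P1 H1]]. exists (C1 * C1 + C1). split; [nra|].
  intros A B D u v w U HA HB HD Hu Hv Hw Bu Bv Bw HU.
  assert (B1 : bnd (fun z => u z + v z) (C1 * (A + B))).
  { apply (H1 A B u v); auto. intros z _. specialize (Hu z). specialize (Hv z). lra. }
  assert (PAB : 0 < C1 * (A + B)) by (apply Rmult_lt_0_compat; lra).
  apply (bnd_mono p alpha Hp U U (C1 * (C1 * (A + B) + D))).
  - split; [apply Rmult_lt_0_compat; lra|]. nra.
  - intros z Hz. specialize (HU z Hz). lra.
  - apply (H1 (C1 * (A + B)) D (fun z => u z + v z) w); auto.
    intros z. specialize (Hu z). specialize (Hv z). lra.
Qed.

Lemma near_self z : inD z -> Cmod (z - z)%C <= (1 - Cmod z) / 2.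
Proof. intros H. unfold inD in H. replace (z - z)%C with (RtoC 0) by ring. rewrite Cmod_0. lra. Qed.

(** Where z is bad at scale t1/4, [bad_forward] makes phi_s z bad at scale t1, so both terms of D (f
    o phi_s - f) belong to bad parts of D f. Elsewhere the increment is of first order in s / t1. *)
Lemma ee_bnd : exists K, 0 < K /\ forall f A t1 e1 s, analytic_on_D f -> 0 < A -> bnd (fun z => Cmod (f z)) A ->
  0 < t1 <= ts -> 0 < e1 -> bnd (Dbad f t1) e1 -> 0 < s <= t1 / 16 ->
  bnd (Dfn (ee f s)) (K * (e1 + s / t1 * A)).
Proof.
  destruct bnd_plus3 as [C3 [P3 H3]]. destruct (bnd_comp p alpha Hp Ha) as [C4 [P4 H4]].
  destruct (bnd_near p alpha Hp Ha) as [C5 [P5 H5]].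
  set (c := C5 * (21504 * 4 * eta0)). assert (Pc : 0 < c) by (unfold c, eta0; lra).
  exists (C3 * (1 + 2 * C4 + c)). split; [apply Rmult_lt_0_compat; lra|].
  intros f A t1 e1 s Hf HA Hb Ht1 He1 Hbad Hs.
  (* t1/4 compensates the factor 4 of [bad_forward]; together with s <= t1/16 it gives 4 * eta <=
     eta0, as [first_order_deriv] demands. *)
  set (t' := t1 / 4). set (eta := s / t' * eta0).
  assert (Pt' : 0 < t') by (unfold t'; lra).
  assert (Hst : 0 < s / t1 <= 1 / 16).
  { split; [apply Rdiv_lt_0_compat; lra|]. apply Rle_div_l; lra. }
  assert (Est : s / t' = 4 * (s / t1)) by (unfold t'; field; lra).
  assert (Pe : 0 < eta) by (unfold eta; rewrite Est; unfold eta0; lra).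
  assert (Pe4 : 4 * eta <= eta0) by (unfold eta; rewrite Est; unfold eta0; lra).
  assert (Hsts : 0 <= s <= ts) by lra.
  set (N := fun z => if excluded_middle_informative (inD z /\ ~ Bad t' z) then Dfn (ee f s) z else 0).
  assert (N0 : forall z, 0 <= N z) by (intros z; unfold N; destruct excluded_middle_informative; [apply Dfn_ge_0|lra]).
  assert (BN : bnd N (c * (s / t1 * A))).
  { replace (c * (s / t1 * A)) with (C5 * (21504 * eta * A)) by (unfold c, eta; rewrite Est; ring).
    apply (H5 N (fun z => 21504 * eta * Cmod (f z))).
    - apply Rmult_lt_0_compat; lra.
    - apply bnd_scal; auto; [lra|]. intros z _. apply Cmod_ge_0.
    - intros z. assert (Q := Cmod_ge_0 (f z)). apply Rmult_le_pos; lra.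
    - intros z Hz. split; [apply N0|]. unfold N. destruct excluded_middle_informative as [[_ NB]|_].
      + apply not_Bad in NB. apply (first_order_deriv f z s eta); auto.
        unfold eta. replace (s * Cmod (G z)) with (s / t' * (t' * Cmod (G z))) by (field; lra).
        rewrite Rmult_assoc. apply Rmult_le_compat_l; [rewrite Est; lra|exact NB].
      + exists z. split; [apply near_self, Hz|]. apply Rmult_le_pos; [lra|apply Cmod_ge_0]. }
  assert (BC : bnd (fun z => 2 * Dbad f t1 (phi s z)) (2 * (C4 * e1))).
  { apply bnd_scal; auto; [lra|apply Rmult_lt_0_compat; lra|intros z _; apply Dbad_ge_0|].
    apply (H4 (phi s) (fun z => Dbad f t1 (phi s z)) (Dbad f t1)); auto.
    - apply phi_self; lra.
    - apply Dbad_ge_0.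
    - intros z Hz. split; [apply Dbad_ge_0|]. exists (phi s z). split; [|lra].
      apply near_self, phi_inD; [lra|exact Hz]. }
  apply (bnd_mono p alpha Hp _ (Dfn (ee f s)) (C3 * (e1 + 2 * (C4 * e1) + c * (s / t1 * A)))).
  - assert (0 < s / t1 * A) by (apply Rmult_lt_0_compat; lra). split.
    + apply Rmult_lt_0_compat; [exact P3|]. assert (0 < C4 * e1) by (apply Rmult_lt_0_compat; lra).
      assert (0 < c * (s / t1 * A)) by (apply Rmult_lt_0_compat; lra). lra.
    + rewrite Rmult_assoc. apply Rmult_le_compat_l; [lra|].
      set (X := s / t1 * A) in *. assert (0 <= c * e1) by (apply Rmult_le_pos; lra). assert (0 <= C4 * X) by (apply Rmult_le_pos; lra). nra.
  - intros z _. split; [apply Dfn_ge_0|lra].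
  - apply (H3 e1 (2 * (C4 * e1)) (c * (s / t1 * A)) (Dbad f t1) (fun z => 2 * Dbad f t1 (phi s z)) N); auto.
    + assert (0 < C4 * e1) by (apply Rmult_lt_0_compat; lra). lra.
    + apply Rmult_lt_0_compat; [lra|]. apply Rmult_lt_0_compat; lra.
    + apply Dbad_ge_0.
    + intros z. assert (Q := Dbad_ge_0 f t1 (phi s z)). lra.
    + intros z Hz. split; [apply Dfn_ge_0|].
      assert (Q1 := Dbad_ge_0 f t1 z). assert (Q2 := Dbad_ge_0 f t1 (phi s z)).
      destruct (classic (Bad t' z)) as [B|NB].
      * assert (Q3 := N0 z).
        rewrite (Dbad_eq f t1 z) by (apply (Bad_mono t'); [unfold t'; lra|exact B]).
        rewrite (Dbad_eq f t1 (phi s z)).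
        2:{ replace t1 with (4 * t') by (unfold t'; field). apply bad_forward; auto. unfold t'; lra. }
        assert (Cmp := Dfn_comp f (phi s) z Hf (phi_self s ltac:(lra)) Hz).
        assert (T := Dfn_tri (ee f s) (fun w => f (phi s w)) (fun w => (-1) * f w)%C z Hz).
        assert (T' : Dfn (ee f s) z <= Dfn (fun w => f (phi s w)) z + Dfn (fun w => ((-1) * f w)%C) z).
        { apply T.
          - apply analytic_comp; [exact Hf|apply phi_self; lra|apply phi_self; lra].
          - apply analytic_scal, Hf.
          - intros w _. unfold flowdiff, fsub. ring. }
        rewrite (Dfn_scal (fun w => ((-1) * f w)%C) f (-1)%C z Hz Hf) in T' by reflexivity.
        rewrite Cmod_R, Rabs_left in T' by lra. lra.
      * assert (E0 : N z = Dfn (ee f s) z).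
        { unfold N. destruct excluded_middle_informative as [|X]; [reflexivity|]. exfalso. apply X. auto. }
        lra.
Qed.

(** Controls the value at the origin, the one thing that [bnd_of_deriv] asks for besides the
    gradient. *)
Lemma ee_zero f eps : analytic_on_D f -> 0 < eps -> exists d, 0 < d /\ forall s, 0 <= s < d -> s <= ts -> Cmod (ee f s 0%C) <= eps.
Proof.
  intros Hf He. destruct (cderiv_continuous f 0%C _ (analytic_cD f 0%C Hf inD_0) eps He) as [d1 [D1 H1]].
  destruct (flow_unif phi Hsg ts Hts 0%C d1 inD_0 D1) as [d [D Hd]].
  exists d. split; [exact D|]. intros s Hs Hsts. unfold flowdiff, fsub. left. apply H1.
  specialize (Hd s 0 ltac:(lra) ltac:(lra)). rewrite Rminus_0_r in Hd. specialize (Hd ltac:(rewrite Rabs_right; lra)).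
  rewrite phi_0 in Hd by apply inD_0. exact Hd.
Qed.

Lemma vanishing_grad_in_Hinf f : vanishing_grad f -> in_Hinf p alpha f.
Proof. intros [Hf [[A [HA Hb]] _]]. eapply bnd_in_Hinf; eassumption. Qed.

Lemma Rbar_le_lt_fin (x : Rbar) (a c : R) : Rbar_le x a -> a < c -> Rbar_lt x c.
Proof. intros H1 H2. eapply Rbar_le_lt_trans; [exact H1|]. exact H2. Qed.

Lemma vanishing_grad_strong f : vanishing_grad f -> strong_cont p alpha phi f.
Proof.
  intros HL. split; [apply vanishing_grad_in_Hinf, HL|]. destruct HL as [Hf [[A [HA Hb]] Hbad]].
  intros eps He. destruct ee_bnd as [K [PK HK]]. destruct (bnd_of_deriv p alpha Hp Ha) as [C1 [P1 H1]].
  set (e2 := eps / (2 * C1)). assert (Pe2 : 0 < e2) by (apply Rdiv_lt_0_compat; lra).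
  set (e1 := e2 / (2 * K)). assert (Pe1 : 0 < e1) by (apply Rdiv_lt_0_compat; lra).
  destruct (Hbad e1 Pe1) as [t1 [Ht1 Hb1]].
  destruct (ee_zero f e2 Hf Pe2) as [d0 [D0 Hd0]].
  set (d := Rmin d0 (Rmin (t1 / 16) (t1 * e2 / (2 * K * A)))).
  assert (Pq : 0 < t1 * e2 / (2 * K * A)).
  { apply Rdiv_lt_0_compat; [apply Rmult_lt_0_compat; lra|]. apply Rmult_lt_0_compat; [apply Rmult_lt_0_compat|]; lra. }
  exists d. split; [repeat apply Rmin_glb_lt; lra|]. intros s [Hs0 Hs].
  assert (S1 : s < d0) by (eapply Rlt_le_trans; [exact Hs|apply Rmin_l]).
  assert (S2 : s < t1 / 16) by (eapply Rlt_le_trans; [exact Hs|]; eapply Rle_trans; [apply Rmin_r|apply Rmin_l]).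
  assert (S3 : s < t1 * e2 / (2 * K * A)) by (eapply Rlt_le_trans; [exact Hs|]; eapply Rle_trans; [apply Rmin_r|apply Rmin_r]).
  assert (B := HK f A t1 e1 s Hf HA Hb Ht1 Pe1 Hb1 ltac:(lra)).
  assert (Ps : 0 < s / t1 * A) by (apply Rmult_lt_0_compat; [apply Rdiv_lt_0_compat|]; lra).
  assert (B' : bnd (Dfn (ee f s)) e2).
  { apply (bnd_mono p alpha Hp _ (Dfn (ee f s)) (K * (e1 + s / t1 * A))); [|intros z _; split; [apply Dfn_ge_0|lra]|exact B].
    split; [apply Rmult_lt_0_compat; lra|].
    assert (Q1 : K * e1 = e2 / 2) by (unfold e1; field; lra).
    assert (Q2 : K * (s / t1 * A) <= e2 / 2).
    { replace (e2 / 2) with (K * (t1 * e2 / (2 * K * A) / t1 * A)) by (field; lra).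
      apply Rmult_le_compat_l; [lra|]. apply Rmult_le_compat_r; [lra|].
      apply Rmult_le_compat_r; [left; apply Rinv_0_lt_compat; lra|lra]. }
    lra. }
  assert (Ea := ee_analytic f s Hf ltac:(lra)).
  assert (Bf := H1 (ee f s) e2 Pe2 Ea (Hd0 s ltac:(lra) ltac:(lra)) B').
  apply (Rbar_le_lt_fin _ (C1 * e2)).
  - apply Hnorm_of_bnd; auto. apply Rmult_lt_0_compat; lra.
  - unfold e2. replace (C1 * (eps / (2 * C1))) with (eps / 2) by (field; lra). lra.
Qed.

End Main.

(** * Strong continuity forces the gradient to be small on the bad set *)

Section Main.
Variables (p : Rbar) (alpha : R) (phi : R -> C -> C) (G : C -> C) (b : C).
Hypothesis Hp : Rbar_lt 0 p.
Hypothesis Ha : 0 < alpha.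
Hypothesis Hsg : is_semigroup phi.
Hypothesis HG : is_generator phi G.
Hypothesis HDW : boundary_DW_point phi b.
Variable ts : R.
Hypothesis Hts0 : 0 < ts.
Hypothesis Hts : forall t, 0 <= t <= ts -> Cmod (phi t 0%C) <= 1 / 2.

Local Notation dom := (harm_dom p).
Local Notation bnd := (bnd p alpha).
Local Notation phi_self := (phi_self phi Hsg).
Local Notation phi_add := (phi_add phi Hsg).
Local Notation phi_inD := (phi_inD phi Hsg).
Local Notation Bad := (bad_set G).
Local Notation ee := (flowdiff phi).
Local Notation Dbad := (grad_on_bad G).
Local Notation vanishing_grad := (vanishing_grad p alpha G ts).

Definition rem2 (f : C -> C) (s' : R) (w : C) : C := (f (phi s' w) - f w - RtoC s' * (G w * cD f w))%C.

(** phi_s z may be far from z, so smallness of a time step is transported by hyperbolic contraction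
    and not by continuity. *)
Lemma contract_small z s s' k : inD z -> 0 <= s -> 0 <= s' -> 0 < k -> s' * Cmod (G z) <= k * (1 - Cmod z) ->
  s' * Cmod (G (phi s z)) <= 2 * k * (1 - Cmod (phi s z)).
Proof.
  intros Hz Hs Hs' Hk H. assert (F := flow_contract phi G Hsg HG s z Hs Hz).
  assert (Iw := phi_inD s z Hs Hz). set (w := phi s z) in *. unfold inD in Hz, Iw.
  assert (Z0 := Cmod_ge_0 z). assert (W0 := Cmod_ge_0 w). assert (G0 := Cmod_ge_0 (G z)). assert (G1 := Cmod_ge_0 (G w)).
  apply Rmult_le_reg_r with (1 - Cmod z * Cmod z); [nra|].
  apply Rle_trans with (s' * Cmod (G z) * (1 - Cmod w * Cmod w)).
  { rewrite !Rmult_assoc. apply Rmult_le_compat_l; assumption. }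
  apply Rle_trans with (k * (1 - Cmod z) * (1 - Cmod w * Cmod w)).
  { apply Rmult_le_compat_r; [nra|exact H]. }
  replace (k * (1 - Cmod z) * (1 - Cmod w * Cmod w)) with (k * ((1 - Cmod z) * (1 - Cmod w)) * (1 + Cmod w)) by ring.
  replace (2 * k * (1 - Cmod w) * (1 - Cmod z * Cmod z)) with (k * ((1 - Cmod z) * (1 - Cmod w)) * (2 * (1 + Cmod z))) by ring.
  apply Rmult_le_compat_l; [|lra]. apply Rmult_le_pos; [lra|]. apply Rmult_le_pos; lra.
Qed.

(** Differentiating f o phi_s = f + ee f s and multiplying by G gives G(phi_s) f'(phi_s) = G f' + G
    (ee f s)'. So s' G f' at z is the first-order increment of f at phi_s z minus s' G (ee f s)',
    with [rem2] as Taylor error. The freedom in s is what permits averaging. *)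
Lemma grid_ineq f z s s' k : analytic_on_D f -> inD z -> 0 <= s -> 0 <= s' -> 0 < k -> s' * Cmod (G z) <= k * (1 - Cmod z) ->
  s' * Cmod (G z) * Cmod (cD f z) <= Cmod (ee f (s + s') z) + Cmod (ee f s z) + k * Dfn (ee f s) z + Cmod (rem2 f s' (phi s z)).
Proof.
  intros Hf Hz Hs Hs' Hk H. assert (Iw := phi_inD s z Hs Hz).
  assert (De : cD (ee f s) z = (cD f (phi s z) * cD (phi s) z - cD f z)%C).
  { apply cD_eq. unfold flowdiff, fsub. apply cderiv_minus; [|apply analytic_cD; assumption].
    apply cderiv_comp; apply analytic_cD; auto. apply phi_self, Hs. }
  assert (Fc := flow_commute phi G Hsg HG s z Hs Hz).
  assert (E1 : (RtoC s' * (G z * cD f z))%C = ((f (phi s' (phi s z)) - f (phi s z)) + - (rem2 f s' (phi s z)) + - (RtoC s' * G z * cD (ee f s) z))%C).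
  { unfold rem2. rewrite Fc, De. ring. }
  assert (E2 : (f (phi s' (phi s z)) - f (phi s z))%C = (ee f (s + s') z - ee f s z)%C).
  { unfold flowdiff, fsub. rewrite (Rplus_comm s s'), phi_add by assumption. ring. }
  assert (M : Cmod (RtoC s' * (G z * cD f z))%C = s' * Cmod (G z) * Cmod (cD f z)).
  { rewrite !Cmod_mult, Cmod_R, Rabs_right by lra. ring. }
  rewrite <- M, E1, E2.
  eapply Rle_trans; [apply Cmod_triangle|]. rewrite Cmod_opp.
  assert (T1 := Cmod_triangle (ee f (s + s') z - ee f s z)%C (- rem2 f s' (phi s z))%C). rewrite Cmod_opp in T1.
  assert (T2 : Cmod (ee f (s + s') z - ee f s z)%C <= Cmod (ee f (s + s') z) + Cmod (ee f s z)).
  { unfold Cminus. eapply Rle_trans; [apply Cmod_triangle|]. rewrite Cmod_opp. lra. }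
  assert (T3 : Cmod (RtoC s' * G z * cD (ee f s) z)%C <= k * Dfn (ee f s) z).
  { rewrite Dfn_eq by exact Hz. rewrite !Cmod_mult, Cmod_R, Rabs_right by lra.
    rewrite <- Rmult_assoc. apply Rmult_le_compat_r; [apply Cmod_ge_0|exact H]. }
  lra.
Qed.

Lemma floor_grid (x tau : R) : 0 <= x -> 0 < tau -> exists j : nat, INR j * tau <= x < (INR j + 1) * tau.
Proof.
  intros Hx Ht. destruct (archimed (x / tau)) as [A1 A2].
  assert (Q : 0 <= x / tau) by (apply Rdiv_le_0_compat; lra).
  assert (Zp : (0 < up (x / tau))%Z) by (apply lt_IZR; lra).
  exists (Z.to_nat (up (x / tau) - 1)). rewrite INR_IZR_INZ, Z2Nat.id, minus_IZR by lia.
  assert (E0 : x = x / tau * tau) by (field; lra).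
  split; [rewrite E0 at 2|rewrite E0 at 1]; [apply Rmult_le_compat_r|apply Rmult_lt_compat_r]; lra.
Qed.

(** The natural time k (1-|z|) / |G z| depends on z, which no norm estimate with a fixed time can
    handle. Rounded down to j(z) steps of a grid, it turns [grid_ineq] for n values of s into the
    two-term bound required by [dom_avg]. The grid depends on the shell, the constant does not. *)
Lemma Dbad_strong : exists K, 0 < K /\ forall f A k e t0, analytic_on_D f -> 0 < A -> bnd (fun z => Cmod (f z)) A ->
  0 < k <= 1 -> 2 * k <= eta0 -> 0 < e -> 0 < t0 <= ts ->
  (forall s, 0 < s <= t0 -> bnd (fun z => Cmod (ee f s z)) e) ->
  bnd (Dbad f (eta0 * t0 / 2)) (K * (e / k + k * A)).
Proof.
  destruct (bnd_deriv p alpha Hp Ha) as [C2 [P2 H2]]. destruct (dom_transfer p alpha Hp Ha) as [CT [PT HT]].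
  destruct (dom_avg p Hp) as [CA [PA HA]]. destruct (dom_plus p Hp) as [CP [PP HP]].
  destruct (G_growth phi G b Hsg HG HDW) as [CG [PG HGr]].
  set (CR := CT * (3712 * Rpower (1/8) (- alpha))). assert (P8 := Rpower_pos (1/8) (-alpha)).
  assert (PR : 0 < CR) by (unfold CR; apply Rmult_lt_0_compat; lra).
  set (K1 := CP * (1 + C2) + CR).
  assert (PK1 : 0 < CP * (1 + C2)) by (apply Rmult_lt_0_compat; lra).
  exists (2 * CA * (CP * K1)). split.
  { unfold K1. apply Rmult_lt_0_compat; [lra|]. apply Rmult_lt_0_compat; lra. }
  intros f A k e t0 Hf PAA Hb Hk Hk2 He Ht0 Hs.
  (* At this scale a bad point has k (1-|z|) / |G z| <= k t0 / 2, so its rounded time uses at most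
     half of t0. *)
  set (t := eta0 * t0 / 2).
  assert (Hs2 : forall s, 0 < s <= t0 -> bnd (Dfn (ee f s)) (C2 * e)).
  { intros s S. apply H2; auto. apply ee_analytic; auto; lra. }
  intros h Hh. set (H := Rpower h (- alpha)). assert (PH : 0 < H) by apply Rpower_pos.
  (* Lower bound of the natural time on the shell: 1-|z| >= h/2 and |G z| <= 8 CG / h, from the
     growth of G and |b - z| <= 2. *)
  set (s0 := k * (h * h) / (16 * CG)).
  assert (Ps0 : 0 < s0).
  { apply Rdiv_lt_0_compat; [|lra]. apply Rmult_lt_0_compat; [lra|]. apply Rmult_lt_0_compat; lra. }
  destruct (INR_archimed s0 (t0 + s0)) as [n Hn]; [exact Ps0|]. 
  assert (Pn : 1 < INR n) by (apply Rmult_lt_reg_r with s0; lra).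
  (* The choice of n gives tau <= s0 / 2, so rounding down loses at most half of the natural time;
     with i < n and j <= n all times of i + j + 1 steps stay within t0 = 2 n tau. *)
  set (tau := t0 / (2 * INR n)).
  assert (Ptau : 0 < tau) by (apply Rdiv_lt_0_compat; lra).
  assert (Htau : tau <= s0 / 2).
  { unfold tau. apply Rle_div_l; [lra|]. lra. }
  assert (Ent : 2 * INR n * tau = t0) by (unfold tau; field; lra).
  assert (Hn0 : (0 < n)%nat) by (apply INR_lt; simpl; lra).
  assert (Jex : forall z, exists j : nat, inD z -> shell h z -> Bad t z ->
     (j <= n)%nat /\ INR j * tau * Cmod (G z) <= k * (1 - Cmod z) /\ k / 2 * (1 - Cmod z) <= INR j * tau * Cmod (G z)).
  { intros z. destruct (classic (inD z /\ Bad t z /\ shell h z)) as [[Hz [Bz Sz]]|N].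
    2:{ exists 0%nat. intros X1 X2 X3. exfalso. apply N. auto. }
    assert (Hz' := Hz). unfold inD in Hz'. unfold shell in Sz. unfold bad_set in Bz.
    assert (Gz : 0 < Cmod (G z)) by (apply Cmod_gt_0, (G_nz phi G b Hsg HG HDW ts Hts0 Hts z Hz)).
    set (s1 := k * (1 - Cmod z) / Cmod (G z)).
    assert (S1a : s1 * Cmod (G z) = k * (1 - Cmod z)) by (unfold s1; field; lra).
    assert (S1p : 0 < s1) by (apply Rdiv_lt_0_compat; [apply Rmult_lt_0_compat; lra|lra]).
    assert (S1u : s1 <= k * (t0 / 2)).
    { apply Rle_div_l; [lra|]. rewrite Rmult_assoc. apply Rmult_le_compat_l; [lra|]. unfold t, eta0 in Bz. lra. }
    assert (S1l : s0 <= s1).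
    { apply Rmult_le_reg_r with (Cmod (G z)); [exact Gz|]. rewrite S1a. unfold s0.
      assert (Gr := HGr z Hz). assert (Bb : Cmod (bb b z) <= 2).
      { rewrite (bb_mod phi b HDW). unfold Cminus. eapply Rle_trans; [apply Cmod_triangle|]. rewrite Cmod_opp, (proj1 HDW). lra. }
      assert (B0 := Cmod_ge_0 (bb b z)).
      assert (Gr2 : Cmod (G z) * (h / 2) <= CG * 4).
      { apply Rle_trans with (Cmod (G z) * (1 - Cmod z)); [apply Rmult_le_compat_l; lra|]. eapply Rle_trans; [exact Gr|].
        apply Rmult_le_compat_l; [lra|]. nra. }
      replace (k * (h * h) / (16 * CG) * Cmod (G z)) with (k * (h / 2) * ((Cmod (G z) * (h / 2)) / (4 * CG))) by (field; lra).
      apply Rle_trans with (k * (h / 2) * 1); [|rewrite Rmult_1_r; apply Rmult_le_compat_l; lra].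
      apply Rmult_le_compat_l; [apply Rmult_le_pos; lra|]. apply Rle_div_l; lra. }
    destruct (floor_grid s1 tau ltac:(lra) Ptau) as [j [J1 J2]]. exists j. intros _ _ _.
    split; [|split].
    - apply INR_le. apply Rmult_le_reg_r with tau; [exact Ptau|].
      assert (Q : k * (t0 / 2) <= 1 * (t0 / 2)) by (apply Rmult_le_compat_r; lra). lra.
    - rewrite <- S1a. apply Rmult_le_compat_r; lra.
    - replace (k / 2 * (1 - Cmod z)) with (s1 / 2 * Cmod (G z)) by lra. apply Rmult_le_compat_r; lra. }
  apply choice in Jex. destruct Jex as [jf Hjf].
  (* The shift by one avoids the time 0, which the hypothesis on increments does not cover. *)
  set (si := fun i : nat => INR (i + 1) * tau).
  assert (Hsi : forall i, (i < 2 * n)%nat -> 0 < si i <= t0).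
  { intros i Hi. unfold si. split.
    - apply Rmult_lt_0_compat; [apply lt_0_INR; lia|exact Ptau].
    - rewrite <- Ent. apply Rmult_le_compat_r; [lra|]. replace (2 * INR n) with (INR (2 * n)) by (rewrite mult_INR; simpl; ring). apply le_INR. lia. }
  set (Rm := fun (i : nat) z => if excluded_middle_informative (inD z /\ shell h z /\ Bad t z) then Cmod (rem2 f (INR (jf z) * tau) (phi (si i) z)) else 0).
  assert (Rm0 : forall i z, 0 <= Rm i z) by (intros; unfold Rm; destruct excluded_middle_informative; [apply Cmod_ge_0|lra]).
  assert (Hjt : forall j : nat, (j <= n)%nat -> 0 <= INR j * tau <= ts).
  { intros j Hj. assert (Q := pos_INR j). split; [apply Rmult_le_pos; lra|]. apply le_INR in Hj.
    assert (INR j * tau <= INR n * tau) by (apply Rmult_le_compat_r; lra). lra. }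
  assert (DR : forall i, (i < 2 * n)%nat -> dom h (Rm i) (CR * (k * k * A) * H)).
  { intros i Hi. destruct (Hsi i Hi) as [Si1 Si2].
    set (c := 928 * (2 * k * (2 * k))). assert (Pc : 0 < c) by (unfold c; nra).
    assert (X := HT h (h / 8) (phi (si i)) (Rm i) (fun z => c * Cmod (f z)) (c * A)).
    assert (E0 : Rpower (h / 8) (- alpha) = Rpower (1/8) (- alpha) * H).
    { unfold H. rewrite Rpower_mult_distr by lra. f_equal. field. }
    replace (CR * (k * k * A) * H) with (CT * (c * A * Rpower (h / 8) (- alpha))) by (rewrite E0; unfold CR, c; ring).
    apply X; clear X.
    - exact Hh.
    - lra.
    - apply Rmult_lt_0_compat; lra.
    - apply phi_self; lra.
    - apply Hts; lra.
    - intros z Sz. unfold shell in Sz.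
      assert (D := selfmap_dist (phi (si i)) z (phi_self (si i) ltac:(lra)) (Hts (si i) ltac:(lra)) ltac:(unfold inD; lra)). lra.
    - apply bnd_scal; auto. intros z _. apply Cmod_ge_0.
    - intros z. apply Rmult_le_pos; [lra|apply Cmod_ge_0].
    - intros z Sz. split; [apply Rm0|]. assert (Hz : inD z) by (unfold shell in Sz; unfold inD; lra).
      assert (Iw := phi_inD (si i) z ltac:(lra) Hz).
      unfold Rm. destruct excluded_middle_informative as [[_ [_ Bz]]|_].
      + destruct (Hjf z Hz Sz Bz) as [J1 [J2 J3]].
        assert (J0 := Hjt _ J1).
        apply (second_order phi G b Hsg HG HDW ts Hts0 Hts f (phi (si i) z) (INR (jf z) * tau) (2 * k)); auto; [lra|].
        apply contract_small; auto; lra.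
      + exists (phi (si i) z). split; [apply near_self; exact Iw|]. apply Rmult_le_pos; [lra|apply Cmod_ge_0]. }
  set (B1 := CP * (e * H + C2 * e * H)).
  assert (Pe2 : 0 < C2 * e) by (apply Rmult_lt_0_compat; lra).
  assert (PeH : 0 < e * H) by (apply Rmult_lt_0_compat; lra).
  assert (PeH2 : 0 < C2 * e * H) by (apply Rmult_lt_0_compat; lra).
  assert (PB1 : 0 < B1) by (unfold B1; apply Rmult_lt_0_compat; lra).
  assert (PkA : 0 < k * k * A) by (apply Rmult_lt_0_compat; nra).
  assert (PRA : 0 < CR * (k * k * A) * H) by (apply Rmult_lt_0_compat; [apply Rmult_lt_0_compat|]; lra).
  set (B2 := CP * (B1 + CR * (k * k * A) * H)).
  assert (PB2 : 0 < B2) by (unfold B2; apply Rmult_lt_0_compat; lra).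
  set (u := fun i z => (Cmod (ee f (si i) z) + k * Dfn (ee f (si i)) z) + Rm i z).
  assert (u0 : forall i z, 0 <= Cmod (ee f (si i) z) + k * Dfn (ee f (si i)) z).
  { intros i z. assert (Q1 := Cmod_ge_0 (ee f (si i) z)). assert (Q2 := Dfn_ge_0 (ee f (si i)) z). nra. }
  assert (Du : forall i, (i < 2 * n)%nat -> dom h (u i) B2).
  { intros i Hi. assert (Si := Hsi i Hi).
    apply (HP h B1 (CR * (k * k * A) * H) (fun z => Cmod (ee f (si i) z) + k * Dfn (ee f (si i)) z) (Rm i)); auto.
    - apply (HP h (e * H) (C2 * e * H) (fun z => Cmod (ee f (si i) z)) (Dfn (ee f (si i)))); auto.
      + intros z. apply Cmod_ge_0.
      + apply Dfn_ge_0.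
      + apply Hs; auto.
      + apply Hs2; auto.
      + intros z _. split; [apply u0|]. assert (Q2 := Dfn_ge_0 (ee f (si i)) z). nra.
    - intros z _. unfold u. assert (Q1 := u0 i z). assert (Q2 := Rm0 i z). lra. }
  (* The rounded time still satisfies j tau |G z| >= k/2 (1-|z|), hence the factor k / 2. Dividing
     by it turns the errors e and k^2 A into e / k and k A. *)
  assert (DU : dom h (fun z => k / 2 * Dbad f t z) (CA * B2)).
  { apply (HA h B2 n u); auto.
    - intros i z. unfold u. assert (Q1 := u0 i z). assert (Q2 := Rm0 i z). lra.
    - intros z Sz. assert (Hz : inD z) by (unfold shell in Sz; unfold inD; lra).
      split; [apply Rmult_le_pos; [lra|apply Dbad_ge_0]|].
      destruct (classic (Bad t z)) as [Bz|Nz].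
      + destruct (Hjf z Hz Sz Bz) as [J1 [J2 J3]]. exists (jf z). split; [exact J1|]. intros i Hi.
        rewrite Dbad_eq by exact Bz. rewrite Dfn_eq by exact Hz.
        assert (J0 := Hjt _ J1). assert (Si := Hsi i ltac:(lia)).
        assert (GI := grid_ineq f z (si i) (INR (jf z) * tau) k Hf Hz ltac:(lra) ltac:(lra) ltac:(lra) J2).
        assert (Es : si i + INR (jf z) * tau = si (i + jf z)%nat).
        { unfold si. rewrite !plus_INR. simpl. ring. }
        rewrite Es in GI.
        assert (ER : Rm i z = Cmod (rem2 f (INR (jf z) * tau) (phi (si i) z))).
        { unfold Rm. destruct excluded_middle_informative as [|X]; [reflexivity|]. exfalso. apply X. auto. }
        rewrite <- ER in GI.
        assert (F0 := Cmod_ge_0 (cD f z)).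
        assert (L : k / 2 * ((1 - Cmod z) * Cmod (cD f z)) <= INR (jf z) * tau * Cmod (G z) * Cmod (cD f z)).
        { rewrite <- Rmult_assoc. apply Rmult_le_compat_r; assumption. }
        unfold u. assert (Q1 := Rm0 (i + jf z)%nat z). assert (Q2 := Dfn_ge_0 (ee f (si (i + jf z)%nat)) z).
        assert (0 <= k * Dfn (ee f (si (i + jf z)%nat)) z) by (apply Rmult_le_pos; lra). lra.
      + exists 0%nat. split; [lia|]. intros i Hi.
        assert (E0 : Dbad f t z = 0) by (unfold grad_on_bad; destruct excluded_middle_informative; [contradiction|reflexivity]).
        rewrite E0. unfold u. assert (Q1 := u0 i z). assert (Q2 := Rm0 i z). assert (Q1' := u0 (i + 0)%nat z). assert (Q2' := Rm0 (i + 0)%nat z). lra. }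
  assert (DF : dom h (fun z => 2 / k * (k / 2 * Dbad f t z)) (2 / k * (CA * B2))).
  { apply (dom_scal p Hp h (fun z => k / 2 * Dbad f t z)); [apply Rdiv_lt_0_compat; lra|apply Rmult_lt_0_compat; lra| |exact DU].
    intros z _. apply Rmult_le_pos; [lra|apply Dbad_ge_0]. }
  assert (PAB : 0 < 2 / k * (CA * B2)).
  { apply Rmult_lt_0_compat; [apply Rdiv_lt_0_compat; lra|]. apply Rmult_lt_0_compat; lra. }
  apply (dom_mono p Hp h _ (fun z => 2 / k * (k / 2 * Dbad f t z)) (2 / k * (CA * B2))); [|intros z _; split; [apply Dbad_ge_0|right; field; lra]|exact DF].
  split; [exact PAB|]. fold H.
  replace (2 / k * (CA * B2)) with (2 * CA * (CP * (CP * (1 + C2) * (e / k) + CR * (k * A))) * H) by (unfold B2, B1; field; lra).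
  apply Rmult_le_compat_r; [lra|]. rewrite (Rmult_assoc (2 * CA)). apply Rmult_le_compat_l; [lra|].
  rewrite (Rmult_assoc CP K1). apply Rmult_le_compat_l; [lra|]. unfold K1.
  assert (0 < e / k) by (apply Rdiv_lt_0_compat; lra). assert (0 < k * A) by (apply Rmult_lt_0_compat; lra).
  assert (0 <= CP * (1 + C2) * (k * A)) by (apply Rmult_le_pos; lra). assert (0 <= CR * (e / k)) by (apply Rmult_le_pos; lra). nra.
Qed.

Lemma strong_vanishing_grad f : strong_cont p alpha phi f -> vanishing_grad f.
Proof.
  intros [Hf Hst]. assert (Hfa := proj1 Hf). split; [exact Hfa|].
  assert (HA := in_Hinf_bnd p alpha Hp Ha f Hf). split; [exact HA|]. destruct HA as [A [PA HA]].
  intros eps He. destruct Dbad_strong as [K [PK HK]]. destruct (bnd_of_Hnorm p alpha Hp Ha) as [C1 [P1 H1]].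
  assert (PKA : 0 < K * A) by (apply Rmult_lt_0_compat; lra).
  (* k is fixed first, to make k A small; the size e of the increments is chosen afterwards, to make
     e / k small as well. *)
  set (k := Rmin (eta0 / 2) (eps / (2 * (K * A)))).
  assert (Pq : 0 < eps / (2 * (K * A))) by (apply Rdiv_lt_0_compat; lra).
  assert (Pk : 0 < k) by (apply Rmin_glb_lt; [unfold eta0; lra|exact Pq]).
  assert (Lk : k <= eta0 / 2) by apply Rmin_l. assert (Lk2 : k <= eps / (2 * (K * A))) by apply Rmin_r.
  set (e := eps * k / (2 * K)).
  assert (Pe : 0 < e) by (apply Rdiv_lt_0_compat; [apply Rmult_lt_0_compat|]; lra).
  assert (Pe1 : 0 < e / C1) by (apply Rdiv_lt_0_compat; lra).
  destruct (Hst (e / C1) Pe1) as [d [Pd Hd]].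
  set (t0 := Rmin d ts / 2). assert (Pm : 0 < Rmin d ts) by (apply Rmin_glb_lt; lra).
  assert (Lm1 : Rmin d ts <= d) by apply Rmin_l. assert (Lm2 : Rmin d ts <= ts) by apply Rmin_r.
  assert (T0 : 0 < t0 <= ts /\ t0 < d) by (unfold t0; lra).
  exists (eta0 * t0 / 2). split; [unfold eta0; lra|].
  apply (bnd_mono p alpha Hp _ (Dbad f (eta0 * t0 / 2)) (K * (e / k + k * A))).
  - assert (0 < k * A) by (apply Rmult_lt_0_compat; lra). assert (0 < e / k) by (apply Rdiv_lt_0_compat; lra).
    split; [apply Rmult_lt_0_compat; lra|].
    assert (Q1 : K * (e / k) = eps / 2) by (unfold e; field; lra).
    assert (Q2 : K * (k * A) <= eps / 2).
    { replace (K * (k * A)) with (k * (K * A)) by ring. replace (eps / 2) with (eps / (2 * (K * A)) * (K * A)) by (field; lra).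
      apply Rmult_le_compat_r; lra. }
    lra.
  - intros z _. split; [apply Dbad_ge_0|lra].
  - apply HK; auto; [unfold eta0 in Lk; lra|lra|lra|].
    intros s Hs. replace e with (C1 * (e / C1)) by (field; lra).
    apply H1; [exact Pe1|apply ee_analytic; auto; lra|]. apply Rbar_lt_le. apply Hd. lra.
Qed.

End Main.

(** * Time means of an orbit and their derivatives *)

Lemma rderiv_CI g u : (forall s, Ccont g s) -> rderiv (fun s => CI g 0 s) u (g u).
Proof.
  intros Hg eps He. destruct (Hg u eps He) as [d [D Hd]]. exists d. split; [exact D|]. intros s Hs.
  assert (cc : forall a b, ccon g a b) by (intros a b t _; apply Hg).
  assert (cn : forall a b, ccon (fun _ => g u) a b) by (intros a b t _; apply Ccont_const).
  assert (E0 : (CI g 0 s - CI g 0 u - g u * RtoC (s - u))%C = CI (fun t => g t - g u)%C u s).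
  { rewrite <- (CI_Chasles g 0 u s) by apply cc. rewrite CI_minus by (apply cc || apply cn). rewrite CI_const. ring. }
  rewrite E0. apply CI_bound.
  - intros t _. apply Ccont_minus; [apply Hg|apply Ccont_const].
  - intros t Ht. left. apply Hd. eapply Rle_lt_trans; [apply (between_abs2 u s t Ht)|exact Hs].
Qed.

Lemma cD_continuous f z eps : analytic_on_D f -> inD z -> 0 < eps ->
  exists d, 0 < d /\ forall w, Cmod (w - z)%C < d -> Cmod (cD f w - cD f z)%C < eps.
Proof.
  intros Hf Hz He. assert (Hz' := Hz). unfold inD in Hz'.
  destruct (cderiv_continuous f z _ (analytic_cD f z Hf Hz) 1 ltac:(lra)) as [d1 [D1 H1]].
  set (s := Rmin d1 (1 - Cmod z) / 2). assert (Pm : 0 < Rmin d1 (1 - Cmod z)) by (apply Rmin_glb_lt; lra).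
  assert (Ps : 0 < s) by (unfold s; lra).
  assert (L1 := Rmin_l d1 (1 - Cmod z)). assert (L2 := Rmin_r d1 (1 - Cmod z)).
  set (B := Cmod (f z) + 1). assert (PB : 0 < B) by (assert (Q := Cmod_ge_0 (f z)); unfold B; lra).
  set (K := 8 * B / (s * s)). assert (PK : 0 < K) by (apply Rdiv_lt_0_compat; nra).
  exists (Rmin (s / 4) (eps / K)). split; [apply Rmin_glb_lt; [lra|apply Rdiv_lt_0_compat; lra]|].
  intros w Hw. assert (W1 := Rlt_le_trans _ _ _ Hw (Rmin_l _ _)). assert (W2 := Rlt_le_trans _ _ _ Hw (Rmin_r _ _)).
  eapply Rle_lt_trans; [apply (cauchy_lip_deriv f z w s B Hf Ps ltac:(unfold s; lra)); [|lra]|].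
  - intros u Hu. assert (Q := H1 u ltac:(unfold s in Hu; lra)). assert (T := Cmod_le_plus (f u) (f z)). unfold B. lra.
  - fold K. replace eps with (K * (eps / K)) by (field; lra). apply Rmult_lt_compat_l; lra.
Qed.

Lemma Ccont_compF (F : C -> C) (g : R -> C) t :
  (forall eps, 0 < eps -> exists d, 0 < d /\ forall w, Cmod (w - g t)%C < d -> Cmod (F w - F (g t))%C < eps) ->
  Ccont g t -> Ccont (fun s => F (g s)) t.
Proof.
  intros HF Hg eps He. destruct (HF eps He) as [d [D Hd]]. destruct (Hg d D) as [d' [D' Hd']].
  exists d'. split; [exact D'|]. intros s Hs. apply Hd, Hd', Hs.
Qed.

Lemma point_growth p alpha : Rbar_lt 0 p -> 0 < alpha -> exists K, 0 < K /\ forall u A, 0 < A -> bnd p alpha u A -> (forall z, 0 <= u z) ->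
  forall z, inD z -> u z <= K * A * Rpower (1 - Cmod z) (- (alpha + ip p)).
Proof.
  intros Hp Ha. destruct (dom_point p Hp) as [K [PK HK]]. exists K. split; [exact PK|].
  intros u A HA Hb Hu z Hz. unfold inD in Hz. assert (Z0 := Cmod_ge_0 z).
  set (h := 1 - Cmod z).
  assert (Q := HK h u (A * Rpower h (- alpha)) z ltac:(unfold h; lra) ltac:(apply Rmult_lt_0_compat; [lra|apply Rpower_pos]) (Hb h ltac:(unfold h; lra)) ltac:(unfold shell, h; lra) (Hu z)).
  replace (- (alpha + ip p)) with (- alpha + - ip p) by ring. rewrite Rpower_plus.
  eapply Rle_trans; [exact Q|]. right. ring.
Qed.

Lemma ip_ge_0 p : Rbar_lt 0 p -> 0 <= ip p.
Proof. destruct p as [q| |]; simpl; intros H; [|lra|contradiction]. left. apply Rinv_0_lt_compat, H. Qed.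

Section Main.
Variables (p : Rbar) (alpha : R) (phi : R -> C -> C) (G : C -> C) (b : C).
Hypothesis Hp : Rbar_lt 0 p.
Hypothesis Ha : 0 < alpha.
Hypothesis Hsg : is_semigroup phi.
Hypothesis HG : is_generator phi G.
Hypothesis HDW : boundary_DW_point phi b.
Variable ts : R.
Hypothesis Hts0 : 0 < ts.
Hypothesis Hts : forall t, 0 <= t <= ts -> Cmod (phi t 0%C) <= 1 / 2.

Local Notation phi_self := (phi_self phi Hsg).
Local Notation phi_0 := (phi_0 phi Hsg).
Local Notation phi_inD := (phi_inD phi Hsg).
Local Notation ee := (flowdiff phi).
Local Notation traj := (traj phi ts).
Local Notation traj_cont := (traj_cont phi Hsg ts Hts0 Hts).
Local Notation traj_inD := (traj_inD phi Hsg ts Hts0).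
Local Notation G_nz := (G_nz phi G b Hsg HG HDW ts Hts0 Hts).

Lemma G_continuous z eps : inD z -> 0 < eps -> exists d, 0 < d /\ forall w, Cmod (w - z)%C < d -> Cmod (G w - G z)%C < eps.
Proof.
  intros Hz He. assert (Hz' := Hz). unfold inD in Hz'. assert (Gz : 0 < Cmod (G z)) by (apply Cmod_gt_0, G_nz, Hz).
  set (K := 84 * Cmod (G z) / (1 - Cmod z)). assert (PK : 0 < K) by (apply Rdiv_lt_0_compat; lra).
  exists (Rmin ((1 - Cmod z) / 2) (eps / K)). split; [apply Rmin_glb_lt; [lra|apply Rdiv_lt_0_compat; lra]|].
  intros w Hw. assert (W1 := Rlt_le_trans _ _ _ Hw (Rmin_l _ _)). assert (W2 := Rlt_le_trans _ _ _ Hw (Rmin_r _ _)).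
  eapply Rle_lt_trans; [apply (G_lip phi G b Hsg HG HDW z w Hz); lra|].
  replace (84 * Cmod (G z) * Cmod (w - z) / (1 - Cmod z)) with (K * Cmod (w - z)%C) by (unfold K; field; lra).
  replace eps with (K * (eps / K)) by (field; lra). apply Rmult_lt_compat_l; lra.
Qed.

Section OneF.
Variable f : C -> C.
Hypothesis Hf : analytic_on_D f.
Variables (A0 beta : R).
Hypothesis HA0 : 0 < A0.
Hypothesis Hbeta : 0 <= beta.
Hypothesis Hgrow : forall z, inD z -> Cmod (f z) <= A0 * Rpower (1 - Cmod z) (- beta).
Variable t : R.
Hypothesis Ht : 0 < t <= ts.

(** Derivative in time of f (phi_s z). By [flow_commute] it is G z times the derivative in z of f o
    phi_s, so dividing by G z exchanges the two derivatives. *)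
Definition flow_deriv (z : C) (s : R) : C := (cD f (traj z s) * G (traj z s))%C.

Lemma ftraj_cont z s : inD z -> Ccont (fun s => f (traj z s)) s.
Proof.
  intros Hz. apply Ccont_compF; [|apply traj_cont, Hz]. intros eps He.
  apply (cderiv_continuous f _ _ (analytic_cD f _ Hf (traj_inD z s Hz)) eps He).
Qed.

Lemma flow_deriv_cont z s : inD z -> Ccont (flow_deriv z) s.
Proof.
  intros Hz. apply Ccont_mult.
  - apply (Ccont_compF (cD f) (traj z)); [|apply traj_cont, Hz]. intros eps He. apply cD_continuous; auto; apply traj_inD, Hz.
  - apply (Ccont_compF G (traj z)); [|apply traj_cont, Hz]. intros eps He. apply G_continuous; auto; apply traj_inD, Hz.
Qed.

(** The orbit is known to be differentiable only from the right, so the fundamental theorem is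
    derived from [mvt_right] with slope 0. *)
Lemma CI_flow_deriv z : inD z -> CI (flow_deriv z) 0 t = (f (phi t z) - f z)%C.
Proof.
  intros Hz.
  set (y := fun s => (f (traj z s) - CI (flow_deriv z) 0 s)%C).
  assert (M : Cmod (y t - y 0)%C <= 0 * (t - 0)).
  { apply mvt_right; [lra| |].
    - intros s _. apply Ccont_minus; [apply ftraj_cont, Hz|]. eapply rderiv_Ccont, rderiv_CI. intros r. apply flow_deriv_cont, Hz.
    - intros u Hu eps He.
      assert (R1 := rder_comp f _ _ _ _ (traj_rder phi G Hsg HG ts Hts0 z u Hz ltac:(lra)) (analytic_cD f _ Hf (traj_inD z u Hz)) (eps / 2) ltac:(lra)).
      destruct R1 as [d1 [D1 H1]].
      destruct (rderiv_CI (flow_deriv z) u (fun s => flow_deriv_cont z s Hz) (eps / 2) ltac:(lra)) as [d2 [D2 H2]].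
      exists (Rmin d1 d2). split; [apply Rmin_glb_lt; lra|]. intros s Hs.
      assert (L1 := Rmin_l d1 d2). assert (L2 := Rmin_r d1 d2).
      specialize (H1 (s - u) ltac:(lra)). cbv beta in H1. replace (u + (s - u)) with s in H1 by ring.
      specialize (H2 s ltac:(rewrite Rabs_right; lra)). rewrite Rabs_right in H2 by lra.
      replace (y s - y u)%C with ((f (traj z s) - f (traj z u) - (cD f (traj z u) * G (traj z u)) * RtoC (s - u)) - (CI (flow_deriv z) 0 s - CI (flow_deriv z) 0 u - flow_deriv z u * RtoC (s - u)))%C by (unfold y, flow_deriv; ring).
      unfold Cminus at 1. eapply Rle_trans; [apply Cmod_triangle|]. rewrite Cmod_opp. lra. }
  rewrite Rmult_0_l in M. assert (Z : Cmod (y t - y 0)%C = 0) by (apply Rle_antisym; [exact M|apply Cmod_ge_0]).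
  apply Cmod_eq_0 in Z. unfold y in Z. rewrite CI_point in Z.
  rewrite !(traj_eq phi ts) in Z by lra. rewrite phi_0 in Z by exact Hz.
  apply Copp_inj_0. replace (CI (flow_deriv z) 0 t - (f (phi t z) - f z))%C with (- (f (phi t z) - CI (flow_deriv z) 0 t - (f z - 0)))%C by ring.
  rewrite Z. ring.
Qed.

Definition time_mean (z : C) : C := (RtoC (/ t) * CI (fun s => f (traj z s)) 0 t)%C.

Lemma time_mean_cderiv z : inD z -> cderiv time_mean z (RtoC (/ t) * (CI (flow_deriv z) 0 t / G z))%C.
Proof.
  intros Hz. assert (Hz' := Hz). unfold inD in Hz'.
  unfold time_mean. apply cderiv_scal.
  replace (CI (flow_deriv z) 0 t / G z)%C with (CI (fun s => / G z * flow_deriv z s)%C 0 t).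
  2:{ rewrite CI_scal; [|intros s _; apply flow_deriv_cont, Hz]. unfold Cdiv. ring. }
  set (e := (1 - Cmod z) / 2). assert (Pe : 0 < e) by (unfold e; lra).
  (* Uniform in the time: [flow_dist] keeps phi_s u at distance at least e / 4 from the circle for
     every u within e of z. *)
  set (B := A0 * Rpower (e / 4) (- beta)).
  assert (PB : 0 < B) by (apply Rmult_lt_0_compat; [exact HA0|apply Rpower_pos]).
  apply (param_cderiv (fun s w => f (traj w s)) (fun s => (/ G z * flow_deriv z s)%C) 0 t z (8 * B / (e * e)) (e / 4)).
  - lra.
  - lra.
  - intros w Hw s _. apply ftraj_cont. assert (T := Cmod_le_plus w z). unfold inD. unfold e in Hw; lra.
  - intros s _. apply Ccont_mult; [apply Ccont_const|apply flow_deriv_cont, Hz].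
  - apply Rdiv_le_0_compat; nra.
  - intros s w Hs Hw.
    assert (Hst : 0 <= s <= ts) by lra.
    assert (Ed : cD (fun u => f (phi s u)) z = (/ G z * flow_deriv z s)%C).
    { apply cD_eq. assert (D := cderiv_comp f (phi s) z _ _ (analytic_cD (phi s) z (proj1 (phi_self s ltac:(lra))) Hz) (analytic_cD f _ Hf (phi_inD s z ltac:(lra) Hz))).
      unfold flow_deriv. rewrite (traj_eq phi ts) by exact Hst. rewrite (flow_commute phi G Hsg HG) by (lra || exact Hz).
      replace (/ G z * (cD f (phi s z) * (cD (phi s) z * G z)))%C with (cD f (phi s z) * cD (phi s) z)%C; [exact D|].
      field. apply G_nz, Hz. }
    rewrite <- Ed, !(traj_eq phi ts) by exact Hst.
    apply (cauchy_second (fun u => f (phi s u)) z w e B); [|exact Pe|unfold e; lra| |lra].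
    + apply analytic_comp; [exact Hf|apply phi_self; lra|apply phi_self; lra].
    + intros u Hu. assert (T := Cmod_le_plus u z). assert (Iu : inD u) by (unfold inD; unfold e in Hu; lra).
      eapply Rle_trans; [apply Hgrow, phi_inD; [lra|exact Iu]|]. unfold B. apply Rmult_le_compat_l; [lra|].
      apply Rpower_anti; [exact Hbeta|]. assert (Q := flow_dist phi Hsg ts Hts s u Hst Iu). split; [lra|]. unfold e in *; lra.
Qed.

Lemma time_mean_analytic : analytic_on_D time_mean.
Proof. eapply analytic_of. intros z Hz. apply time_mean_cderiv, Hz. Qed.

Lemma time_mean_generator z : inD z -> (G z * cD time_mean z)%C = (RtoC (/ t) * ee f t z)%C.
Proof.
  intros Hz. rewrite (cD_eq _ _ _ (time_mean_cderiv z Hz)), CI_flow_deriv by exact Hz. unfold flowdiff, fsub. field. apply G_nz, Hz.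
Qed.

Lemma mean_error_cD z : inD z -> cD (fsub f time_mean) z = (RtoC (/ t) * CI (fun s => cD f z - / G z * flow_deriv z s) 0 t)%C.
Proof.
  intros Hz. assert (D := cderiv_minus _ _ _ _ _ (analytic_cD f z Hf Hz) (time_mean_cderiv z Hz)).
  change (cderiv (fsub f time_mean) z (cD f z - RtoC (/ t)%R * (CI (flow_deriv z) 0 t / G z))%C) in D. rewrite (cD_eq _ _ _ D). rewrite CI_minus.
  - rewrite CI_const, Rminus_0_r. rewrite (CI_scal (/ G z)%C) by (intros s _; apply flow_deriv_cont, Hz).
    assert (T0 : RtoC t <> 0%C) by (intros X; injection X; lra). rewrite RtoC_inv by lra. field. split; [apply G_nz, Hz|exact T0].
  - intros s _. apply Ccont_const.
  - intros s _. apply Ccont_mult; [apply Ccont_const|apply flow_deriv_cont, Hz].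
Qed.

(** Substitute for Minkowski's integral inequality. If D (f - h_t) exceeded 2 D (ee f s) at z for
    all s, averaging in s would bound it by half of itself. The time found depends on z, and the
    norm estimate that follows has to cope with this. *)
Lemma mean_error_at_time z : inD z -> exists s, 0 <= s <= t /\ Dfn (fsub f time_mean) z <= 2 * Dfn (ee f s) z.
Proof.
  intros Hz. assert (Hz' := Hz). unfold inD in Hz'.
  apply NNPP. intros N.
  set (M := Cmod (cD (fsub f time_mean) z)).
  assert (Q : forall s, 0 <= s <= t -> Cmod (cD f z - / G z * flow_deriv z s)%C <= M / 2).
  { intros s Hs. assert (X : ~ Dfn (fsub f time_mean) z <= 2 * Dfn (ee f s) z) by (intros X; apply N; exists s; auto).
    rewrite !Dfn_eq in X by exact Hz. fold M in X.
    assert (Ed : cD (ee f s) z = (/ G z * flow_deriv z s - cD f z)%C).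
    { apply cD_eq. assert (D := cderiv_comp f (phi s) z _ _ (analytic_cD (phi s) z (proj1 (phi_self s ltac:(lra))) Hz) (analytic_cD f _ Hf (phi_inD s z ltac:(lra) Hz))).
      unfold flowdiff, fsub. apply cderiv_minus; [|apply analytic_cD; assumption].
      unfold flow_deriv. rewrite (traj_eq phi ts) by lra. rewrite (flow_commute phi G Hsg HG) by (lra || exact Hz).
      replace (/ G z * (cD f (phi s z) * (cD (phi s) z * G z)))%C with (cD f (phi s z) * cD (phi s) z)%C; [exact D|].
      field. apply G_nz, Hz. }
    rewrite Ed, Cmod_minus_sym in X. nra. }
  assert (B : M <= M / 2).
  { unfold M at 1. rewrite mean_error_cD by exact Hz. rewrite Cmod_mult, Cmod_R, Rabs_right by (apply Rle_ge; left; apply Rinv_0_lt_compat; lra).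
    apply Rle_trans with (/ t * (M / 2 * Rabs (t - 0))).
    - apply Rmult_le_compat_l; [left; apply Rinv_0_lt_compat; lra|]. apply CI_bound.
      + intros s _. apply Ccont_minus; [apply Ccont_const|]. apply Ccont_mult; [apply Ccont_const|apply flow_deriv_cont, Hz].
      + intros s Hs. apply Q. rewrite Rmin_left, Rmax_right in Hs by lra. exact Hs.
    - rewrite Rminus_0_r, Rabs_right by lra. right. field. lra. }
  apply N. exists 0. split; [lra|]. rewrite Dfn_eq by exact Hz. fold M.
  assert (M0 : 0 <= M) by apply Cmod_ge_0. replace M with 0 by lra. rewrite Rmult_0_r.
  assert (X := Dfn_ge_0 (ee f 0) z). lra.
Qed.

Lemma mean_error_zero eps : (forall s, 0 <= s <= t -> Cmod (ee f s 0%C) <= eps) -> Cmod (fsub f time_mean 0%C) <= eps.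
Proof.
  intros H. assert (E0 : fsub f time_mean 0%C = (RtoC (/ t) * CI (fun s => f 0%C - f (traj 0%C s)) 0 t)%C).
  { unfold fsub, time_mean. rewrite CI_minus.
    - rewrite CI_const, Rminus_0_r, RtoC_inv by lra. assert (T0 : RtoC t <> 0%C) by (intros X; injection X; lra). field. exact T0.
    - intros s _. apply Ccont_const.
    - intros s _. apply ftraj_cont, inD_0. }
  rewrite E0, Cmod_mult, Cmod_R, Rabs_right by (apply Rle_ge; left; apply Rinv_0_lt_compat; lra).
  apply Rle_trans with (/ t * (eps * Rabs (t - 0))).
  - apply Rmult_le_compat_l; [left; apply Rinv_0_lt_compat; lra|]. apply CI_bound.
    + intros s _. apply Ccont_minus; [apply Ccont_const|apply ftraj_cont, inD_0].
    + intros s Hs. rewrite Rmin_left, Rmax_right in Hs by lra. rewrite Cmod_minus_sym, (traj_eq phi ts) by lra. apply H, Hs.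
  - rewrite Rminus_0_r, Rabs_right by lra. right. field. lra.
Qed.

End OneF.
End Main.

(** * From a vanishing gradient back to the closure of E, and the space H(p,0,alpha) *)

Section Main.
Variables (p : Rbar) (alpha : R) (phi : R -> C -> C) (G : C -> C) (b : C).
Hypothesis Hp : Rbar_lt 0 p.
Hypothesis Ha : 0 < alpha.
Hypothesis Hsg : is_semigroup phi.
Hypothesis HG : is_generator phi G.
Hypothesis HDW : boundary_DW_point phi b.
Variable ts : R.
Hypothesis Hts0 : 0 < ts.
Hypothesis Hts : forall t, 0 <= t <= ts -> Cmod (phi t 0%C) <= 1 / 2.

Local Notation dom := (harm_dom p).
Local Notation bnd := (bnd p alpha).
Local Notation phi_self := (phi_self phi Hsg).
Local Notation Bad := (bad_set G).
Local Notation ee := (flowdiff phi).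
Local Notation Dbad := (grad_on_bad G).
Local Notation vanishing_grad := (vanishing_grad p alpha G ts).
Local Notation time_mean := (time_mean phi ts).

Lemma Dfn_ee f s z : analytic_on_D f -> 0 <= s -> inD z -> Dfn (ee f s) z <= Dfn f z + 2 * Dfn f (phi s z).
Proof.
  intros Hf Hs Hz. assert (S := phi_self s Hs).
  assert (Cmp := Dfn_comp f (phi s) z Hf S Hz).
  assert (T : Dfn (ee f s) z <= Dfn (fun w => f (phi s w)) z + Dfn (fun w => ((-1) * f w)%C) z).
  { apply Dfn_tri; [exact Hz|apply analytic_comp; [exact Hf|apply S|apply S]|apply analytic_scal, Hf|].
    intros w _. unfold flowdiff, fsub. ring. }
  rewrite (Dfn_scal (fun w => ((-1) * f w)%C) f (-1)%C z Hz Hf) in T by reflexivity.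
  rewrite Cmod_R, Rabs_left in T by lra. lra.
Qed.

(** Three zones. Not bad at scale t1/16: first order in t / t1 for every s <= t. Bad at scale t: t G
    h_t' = f o phi_t - f bounds D h_t by |f o phi_t - f| / eta0, whence 400. In between, phi_s z is
    bad at scale t1 and, z not being bad at scale t, lies near z; so [bnd_near] applies although s
    depends on z. *)
Lemma mean_error_bnd : exists K, 0 < K /\ forall f A A0 beta t1 e1 e3 t, analytic_on_D f -> 0 < A -> bnd (fun z => Cmod (f z)) A ->
  0 < A0 -> 0 <= beta -> (forall z, inD z -> Cmod (f z) <= A0 * Rpower (1 - Cmod z) (- beta)) ->
  0 < t1 <= ts -> 0 < e1 -> bnd (Dbad f t1) e1 -> 0 < t <= t1 / 64 -> 0 < e3 -> bnd (fun z => Cmod (ee f t z)) e3 ->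
  bnd (Dfn (fsub f (time_mean f t))) (K * (e1 + e3 + t / t1 * A)).
Proof.
  destruct (bnd_plus3 p alpha Hp) as [C3 [P3 H3]]. destruct (bnd_plus p alpha Hp) as [C4 [P4 H4]].
  destruct (bnd_near p alpha Hp Ha) as [C5 [P5 H5]].
  set (c := C5 * (43008 * 16 * eta0)). assert (Pc : 0 < c) by (unfold c, eta0; lra).
  set (c4 := C4 * 400).
  exists (C3 * (c + 6 * C5 + c4)). split; [unfold c4; apply Rmult_lt_0_compat; lra|].
  intros f A A0 beta t1 e1 e3 t Hf HA Hb HA0 Hbeta Hgr Ht1 He1 Hbad Ht He3 Hb3.
  (* With t <= t1/64 this gives 4 * eta <= eta0; and 4 t' <= t1 lets [bad_forward] land in the set
     bad at scale t1. *)
  set (t' := t1 / 16). assert (Pt' : 0 < t') by (unfold t'; lra).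
  set (eta := t / t' * eta0).
  assert (Hst : 0 < t / t1 <= 1 / 64) by (split; [apply Rdiv_lt_0_compat; lra|apply Rle_div_l; lra]).
  assert (Est : t / t' = 16 * (t / t1)) by (unfold t'; field; lra).
  assert (Pe : 0 < eta) by (unfold eta; rewrite Est; unfold eta0; lra).
  assert (Pe4 : 4 * eta <= eta0) by (unfold eta; rewrite Est; unfold eta0; lra).
  assert (Htts : 0 < t <= ts) by lra.
  set (h := time_mean f t).
  assert (hA : analytic_on_D h) by (apply (time_mean_analytic phi G b Hsg HG HDW ts Hts0 Hts f Hf A0 beta); auto).
  assert (FT := mean_error_at_time phi G b Hsg HG HDW ts Hts0 Hts f Hf A0 beta HA0 Hbeta Hgr t Htts). fold h in FT.
  set (N := fun z => if excluded_middle_informative (inD z /\ ~ Bad t' z) then Dfn (fsub f h) z else 0).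
  assert (N0 : forall z, 0 <= N z) by (intros z; unfold N; destruct excluded_middle_informative; [apply Dfn_ge_0|lra]).
  set (N2 := fun z => if excluded_middle_informative (inD z /\ Bad t' z /\ ~ Bad t z) then Dfn (fsub f h) z else 0).
  assert (N20 : forall z, 0 <= N2 z) by (intros z; unfold N2; destruct excluded_middle_informative; [apply Dfn_ge_0|lra]).
  set (V := fun z => Dbad f t1 z + 400 * Cmod (ee f t z)).
  assert (V0 : forall z, 0 <= V z) by (intros z; unfold V; assert (Q1 := Dbad_ge_0 G f t1 z); assert (Q2 := Cmod_ge_0 (ee f t z)); lra).
  assert (Px : 0 < t / t1 * A) by (apply Rmult_lt_0_compat; lra).
  assert (BN : bnd N (c * (t / t1 * A))).
  { replace (c * (t / t1 * A)) with (C5 * (43008 * eta * A)) by (unfold c, eta; rewrite Est; ring).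
    apply (H5 N (fun z => 43008 * eta * Cmod (f z))).
    - apply Rmult_lt_0_compat; lra.
    - apply bnd_scal; auto; [lra|]. intros z _. apply Cmod_ge_0.
    - intros z. assert (Q := Cmod_ge_0 (f z)). apply Rmult_le_pos; lra.
    - intros z Hz. split; [apply N0|]. unfold N. destruct excluded_middle_informative as [[_ NB]|_].
      + apply not_Bad in NB. destruct (FT z Hz) as [s [Hs HD]].
        assert (G0 := Cmod_ge_0 (G z)).
        destruct (first_order_deriv phi G b Hsg HG HDW ts Hts0 Hts f z s eta Hf Hz ltac:(lra) Pe Pe4) as [w [W1 W2]].
        { apply Rle_trans with (t * Cmod (G z)); [apply Rmult_le_compat_r; lra|].
          unfold eta. replace (t * Cmod (G z)) with (t / t' * (t' * Cmod (G z))) by (field; lra).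
          rewrite Rmult_assoc. apply Rmult_le_compat_l; [rewrite Est; lra|exact NB]. }
        exists w. split; [exact W1|]. lra.
      + exists z. split; [apply near_self, Hz|]. apply Rmult_le_pos; [lra|apply Cmod_ge_0]. }
  assert (BN2 : bnd N2 (C5 * (6 * e1))).
  { apply (H5 N2 (fun z => 6 * Dbad f t1 z)).
    - lra.
    - apply bnd_scal; auto; [lra|]. intros z _. apply Dbad_ge_0.
    - intros z. assert (Q := Dbad_ge_0 G f t1 z). lra.
    - intros z Hz. split; [apply N20|]. unfold N2. destruct excluded_middle_informative as [[_ [B' NB]]|_].
      + apply not_Bad in NB. destruct (FT z Hz) as [s [Hs HD]].
        assert (De := Dfn_ee f s z Hf ltac:(lra) Hz).
        assert (D1 : Dbad f t1 z = Dfn f z) by (apply Dbad_eq; apply (Bad_mono G t'); [unfold t'; lra|exact B']).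
        assert (D2 : Dbad f t1 (phi s z) = Dfn f (phi s z)).
        { apply Dbad_eq. apply (Bad_mono G (4 * t')); [unfold t'; lra|].
          apply (bad_forward phi G b Hsg HG HDW ts Hts0 Hts); auto; [lra|unfold t'; lra]. }
        assert (Dp := displacement phi G b Hsg HG HDW ts Hts0 Hts z t Hz ltac:(lra) NB s ltac:(lra)).
        assert (Nr : Cmod (phi s z - z)%C <= (1 - Cmod z) / 2).
        { eapply Rle_trans; [exact Dp|]. assert (G0 := Cmod_ge_0 (G z)).
          assert (s * Cmod (G z) <= t * Cmod (G z)) by (apply Rmult_le_compat_r; lra). unfold inD in Hz. unfold eta0 in NB. lra. }
        destruct (Rle_lt_dec (Dfn f (phi s z)) (Dfn f z)) as [L|L].
        * exists z. split; [apply near_self, Hz|]. rewrite D1. lra.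
        * exists (phi s z). split; [exact Nr|]. rewrite D2. lra.
      + exists z. split; [apply near_self, Hz|]. assert (Q := Dbad_ge_0 G f t1 z). lra. }
  assert (BV : bnd V (C4 * (e1 + 400 * e3))).
  { apply (H4 e1 (400 * e3) (Dbad f t1) (fun z => 400 * Cmod (ee f t z))); auto.
    - lra.
    - apply Dbad_ge_0.
    - intros z. assert (Q2 := Cmod_ge_0 (ee f t z)). lra.
    - apply bnd_scal; auto; [lra|]. intros z _. apply Cmod_ge_0.
    - intros z _. split; [apply V0|]. unfold V. lra. }
  assert (Q1 : 0 < c * (t / t1 * A)) by (apply Rmult_lt_0_compat; lra).
  assert (Q2 : 0 < C5 * (6 * e1)) by (apply Rmult_lt_0_compat; lra).
  assert (Q3 : 0 < C4 * (e1 + 400 * e3)) by (apply Rmult_lt_0_compat; lra).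
  apply (bnd_mono p alpha Hp _ (Dfn (fsub f h)) (C3 * (c * (t / t1 * A) + C5 * (6 * e1) + C4 * (e1 + 400 * e3)))).
  - split; [apply Rmult_lt_0_compat; lra|]. rewrite Rmult_assoc. apply Rmult_le_compat_l; [lra|].
    set (X := t / t1 * A) in *. unfold c4.
    assert (0 <= c * e1) by (apply Rmult_le_pos; lra). assert (0 <= c * e3) by (apply Rmult_le_pos; lra).
    assert (0 <= C5 * X) by (apply Rmult_le_pos; lra). assert (0 <= C5 * e3) by (apply Rmult_le_pos; lra).
    assert (0 <= C4 * X) by (apply Rmult_le_pos; lra). assert (0 <= C4 * e1) by (apply Rmult_le_pos; lra). nra.
  - intros z _. split; [apply Dfn_ge_0|lra].
  - apply (H3 (c * (t / t1 * A)) (C5 * (6 * e1)) (C4 * (e1 + 400 * e3)) N N2 V); auto.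
    intros z Hz. split; [apply Dfn_ge_0|].
    assert (X1 := N0 z). assert (X2 := N20 z). assert (X3 := V0 z).
    destruct (classic (Bad t z)) as [B|NB].
    + enough (Dfn (fsub f h) z <= V z) by lra. unfold V.
      rewrite Dbad_eq by (apply (Bad_mono G t); [lra|exact B]).
      eapply Rle_trans; [apply (Dfn_tri (fsub f h) f (fun w => (-1) * h w)%C z Hz Hf)|].
      { apply analytic_scal, hA. }
      { intros w _. unfold fsub. ring. }
      rewrite (Dfn_scal (fun w => ((-1) * h w)%C) h (-1)%C z Hz hA) by reflexivity.
      rewrite Cmod_R, Rabs_left by lra. apply Rplus_le_compat_l.
      rewrite Dfn_eq by exact Hz.
      assert (Gz : 0 < Cmod (G z)) by (apply Cmod_gt_0, (G_nz phi G b Hsg HG HDW ts Hts0 Hts z Hz)).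
      assert (HE := time_mean_generator phi G b Hsg HG HDW ts Hts0 Hts f Hf A0 beta HA0 Hbeta Hgr t Htts z Hz). fold h in HE.
      apply (f_equal Cmod) in HE. rewrite !Cmod_mult, Cmod_R, Rabs_right in HE by (apply Rle_ge; left; apply Rinv_0_lt_compat; lra).
      unfold bad_set, eta0 in B. 
      assert (HE' : t * Cmod (G z) * Cmod (cD h z) = Cmod (ee f t z)).
      { rewrite Rmult_assoc, HE. field. lra. }
      rewrite <- HE'. assert (C0 := Cmod_ge_0 (cD h z)).
      replace (- (-1) * ((1 - Cmod z) * Cmod (cD h z))) with ((1 - Cmod z) * Cmod (cD h z)) by ring.
      rewrite <- Rmult_assoc. apply Rmult_le_compat_r; lra.
    + destruct (classic (Bad t' z)) as [B'|NB'].
      * assert (E0 : N2 z = Dfn (fsub f h) z).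
        { unfold N2. destruct excluded_middle_informative as [|X]; [reflexivity|]. exfalso. apply X. auto. }
        lra.
      * assert (E0 : N z = Dfn (fsub f h) z).
        { unfold N. destruct excluded_middle_informative as [|X]; [reflexivity|]. exfalso. apply X. auto. }
        lra.
Qed.

Lemma vanishing_grad_closure f : vanishing_grad f -> Hclosure p alpha (setE p alpha G) f.
Proof.
  intros HL. assert (Hst := vanishing_grad_strong p alpha phi G b Hp Ha Hsg HG HDW ts Hts0 Hts f HL).
  split; [apply Hst|]. destruct HL as [Hf [[A [HA Hb]] Hbad]]. destruct Hst as [_ Hst].
  intros eps He. destruct mean_error_bnd as [K [PK HK]]. destruct (bnd_of_deriv p alpha Hp Ha) as [C1 [P1 H1]].
  destruct (bnd_of_Hnorm p alpha Hp Ha) as [CH [PH HH]]. destruct (point_growth p alpha Hp Ha) as [KG [PG HGr]].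
  destruct (bnd_plus p alpha Hp) as [C4 [P4 H4]].
  assert (Ip := ip_ge_0 p Hp). set (A0 := KG * A). set (beta := alpha + ip p).
  assert (HA0 : 0 < A0) by (apply Rmult_lt_0_compat; lra). assert (Hbeta : 0 <= beta) by (unfold beta; lra).
  assert (Hgr : forall z, inD z -> Cmod (f z) <= A0 * Rpower (1 - Cmod z) (- beta)).
  { apply (HGr (fun z => Cmod (f z)) A HA Hb). intros z. apply Cmod_ge_0. }
  set (e2 := eps / (2 * C1)). assert (Pe2 : 0 < e2) by (apply Rdiv_lt_0_compat; lra).
  set (e1 := e2 / (3 * K)). assert (Pe1 : 0 < e1) by (apply Rdiv_lt_0_compat; lra).
  destruct (Hbad e1 Pe1) as [t1 [Ht1 Hb1]].
  destruct (ee_zero phi Hsg ts Hts0 Hts f e2 Hf Pe2) as [d0 [D0 Hd0]].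
  assert (Pe3 : 0 < e1 / CH) by (apply Rdiv_lt_0_compat; lra).
  destruct (Hst (e1 / CH) Pe3) as [d1 [D1 Hd1]].
  set (t := Rmin (Rmin (d0 / 2) (d1 / 2)) (Rmin (t1 / 64) (t1 * e1 / A))).
  assert (Pq : 0 < t1 * e1 / A) by (apply Rdiv_lt_0_compat; [apply Rmult_lt_0_compat; lra|lra]).
  assert (Pt : 0 < t) by (repeat apply Rmin_glb_lt; lra).
  assert (T1 : t <= d0 / 2) by (eapply Rle_trans; [apply Rmin_l|apply Rmin_l]).
  assert (T2 : t <= d1 / 2) by (eapply Rle_trans; [apply Rmin_l|apply Rmin_r]).
  assert (T3 : t <= t1 / 64) by (eapply Rle_trans; [apply Rmin_r|apply Rmin_l]).
  assert (T4 : t <= t1 * e1 / A) by (eapply Rle_trans; [apply Rmin_r|apply Rmin_r]).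
  clearbody t.
  assert (Ea := ee_analytic phi Hsg f t Hf ltac:(lra)).
  assert (Be : bnd (fun z => Cmod (ee f t z)) e1).
  { replace e1 with (CH * (e1 / CH)) by (field; lra). apply HH; auto. apply Rbar_lt_le, Hd1. lra. }
  assert (Bd := HK f A A0 beta t1 e1 e1 t Hf HA Hb HA0 Hbeta Hgr Ht1 Pe1 Hb1 ltac:(lra) Pe1 Be).
  assert (hA : analytic_on_D (time_mean f t)) by (apply (time_mean_analytic phi G b Hsg HG HDW ts Hts0 Hts f Hf A0 beta); auto; lra).
  assert (Px : 0 < t / t1 * A) by (apply Rmult_lt_0_compat; [apply Rdiv_lt_0_compat|]; lra).
  assert (Bd' : bnd (Dfn (fsub f (time_mean f t))) e2).
  { apply (bnd_mono p alpha Hp _ (Dfn (fsub f (time_mean f t))) (K * (e1 + e1 + t / t1 * A))); [|intros z _; split; [apply Dfn_ge_0|lra]|exact Bd].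
    split; [apply Rmult_lt_0_compat; lra|].
    assert (Q : t / t1 * A <= e1).
    { replace e1 with (t1 * e1 / A / t1 * A) by (field; lra). apply Rmult_le_compat_r; [lra|].
      apply Rmult_le_compat_r; [left; apply Rinv_0_lt_compat; lra|exact T4]. }
    replace e2 with (K * (3 * e1)) by (unfold e1; field; lra). apply Rmult_le_compat_l; lra. }
  assert (Fa := fsub_analytic f (time_mean f t) Hf hA).
  assert (Z0 : Cmod (fsub f (time_mean f t) 0%C) <= e2).
  { apply (mean_error_zero phi Hsg ts Hts0 Hts f Hf t); [lra|]. intros s Hs. apply Hd0; lra. }
  assert (Pce : 0 < C1 * e2) by (apply Rmult_lt_0_compat; lra).
  assert (Bf := H1 _ _ Pe2 Fa Z0 Bd').
  exists (time_mean f t). split.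
  - split.
    + apply (bnd_in_Hinf p alpha Hp _ (C4 * (A + C1 * e2))); [apply Rmult_lt_0_compat; lra|exact hA|].
      apply (H4 A (C1 * e2) (fun z => Cmod (f z)) (fun z => Cmod (fsub f (time_mean f t) z))); auto; try (intros z; apply Cmod_ge_0).
      intros z _. split; [apply Cmod_ge_0|]. unfold fsub. rewrite Cmod_minus_sym. apply Cmod_le_plus.
    + exists (cD (time_mean f t)). split.
      * intros z Hz. apply is_derive_cderiv, analytic_cD; assumption.
      * assert (HE := time_mean_generator phi G b Hsg HG HDW ts Hts0 Hts f Hf A0 beta HA0 Hbeta Hgr t ltac:(lra)).
        assert (Pit : 0 < / t) by (apply Rinv_0_lt_compat; lra).
        apply (bnd_in_Hinf p alpha Hp _ (/ t * e1)); [apply Rmult_lt_0_compat; lra| |].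
        -- apply (analytic_ext (fun z => RtoC (/ t) * ee f t z)%C); [intros z Hz; symmetry; apply HE, Hz|]. apply analytic_scal, Ea.
        -- apply (bnd_mono p alpha Hp _ (fun z => / t * Cmod (ee f t z)) (/ t * e1)).
           ++ split; [apply Rmult_lt_0_compat; lra|lra].
           ++ intros z Hz. split; [apply Cmod_ge_0|]. rewrite HE by exact Hz. rewrite Cmod_mult, Cmod_R, Rabs_right by lra. lra.
           ++ apply bnd_scal; auto. intros z _. apply Cmod_ge_0.
  - apply (Rbar_le_lt_fin _ (C1 * e2)).
    + apply Hnorm_of_bnd; auto.
    + unfold e2. replace (C1 * (eps / (2 * C1))) with (eps / 2) by (field; lra). lra.
Qed.

Lemma H0_dom f eps : in_H0 p alpha f -> 0 < eps ->
  exists h1, 0 < h1 <= 1 /\ forall h, 0 < h <= h1 -> dom h (fun z => Cmod (f z)) (eps * Rpower h (- alpha)).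
Proof.
  intros [Hf Hl] He. assert (Hfa := proj1 Hf). destruct (dom_of_wMp p alpha Hp Ha) as [C1 [P1 H1]].
  set (e := eps / C1). assert (Pe : 0 < e) by (apply Rdiv_lt_0_compat; lra).
  destruct (Hl (fun y => Rabs y < e)) as [[d Pd] Hd].
  { exists (mkposreal e Pe). intros y Hy. unfold ball in Hy; simpl in Hy. unfold AbsRing_ball, abs, minus, plus, opp in Hy; simpl in Hy.
    rewrite Ropp_0, Rplus_0_r in Hy. exact Hy. }
  set (h1 := Rmin (d / 2) 1). assert (Ph1 : 0 < h1) by (apply Rmin_glb_lt; lra).
  assert (L1 : h1 <= d / 2) by apply Rmin_l. assert (L2 : h1 <= 1) by apply Rmin_r.
  exists h1. split; [lra|]. intros h Hh. replace eps with (C1 * e) by (unfold e; field; lra).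
  apply H1; auto; [lra|]. intros r Hr. assert (Q : Rabs (wMp p alpha r f) < e).
  { apply Hd; [|lra]. unfold ball; simpl. unfold AbsRing_ball, abs, minus, plus, opp; simpl.
    rewrite Rabs_left1 by lra. lra. }
  assert (X := Rle_abs (wMp p alpha r f)). lra.
Qed.

(** Since |G z| (1-|z|) <= 4 CG, a point bad at a small scale is close to the circle, and there f
    itself is small in the sense of the majorants, hence so is D f. *)
Lemma H0_vanishing_grad f : in_H0 p alpha f -> vanishing_grad f.
Proof.
  intros H0. destruct (proj1 H0) as [Hfa _]. split; [exact Hfa|]. split; [apply in_Hinf_bnd; auto; apply H0|].
  intros eps He. destruct (bnd_near p alpha Hp Ha) as [C5 [P5 H5]].
  destruct (G_growth phi G b Hsg HG HDW) as [CG [PG HGr]].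
  set (e := eps / (4 * C5)).
  assert (Pe : 0 < e) by (apply Rdiv_lt_0_compat; lra).
  destruct (H0_dom f e H0 Pe) as [h1 [[Ph1 L2] Hw]].
  (* Cut at h1/2 while bad points will satisfy 1-|z| <= h1/4: the witness of Cauchy's estimate may
     be half as far again from the circle. *)
  set (v := fun z => if Rle_dec (1 - Cmod z) (h1 / 2) then Cmod (f z) else 0).
  assert (v0 : forall z, 0 <= v z) by (intros z; unfold v; destruct Rle_dec; [apply Cmod_ge_0|lra]).
  assert (Bv : bnd v e).
  { intros h Hh. assert (PH := Rpower_pos h (- alpha)). assert (PX : 0 < e * Rpower h (- alpha)) by (apply Rmult_lt_0_compat; lra).
    destruct (Rle_lt_dec h h1) as [L|L].
    - apply (dom_mono p Hp h v (fun z => Cmod (f z)) (e * Rpower h (- alpha))).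
      + split; [exact PX|lra].
      + intros z _. split; [apply v0|]. unfold v. destruct Rle_dec; [lra|apply Cmod_ge_0].
      + apply Hw. lra.
    - apply (dom_mono p Hp h v (fun _ => 0) (e * Rpower h (- alpha))).
      + split; [exact PX|lra].
      + intros z Sz. unfold shell in Sz. split; [apply v0|]. unfold v. destruct Rle_dec; lra.
      + apply dom_const; auto. lra. }
  (* Badness gives eta0 (1-|z|)^2 <= 4 CG t <= eta0 h1^2 / 16, hence 1-|z| <= h1/4. *)
  set (t := Rmin ts (eta0 * (h1 * h1) / (64 * CG))).
  assert (Ptq : 0 < eta0 * (h1 * h1) / (64 * CG)) by (apply Rdiv_lt_0_compat; [unfold eta0; nra|lra]).
  assert (Pt : 0 < t) by (apply Rmin_glb_lt; lra).
  exists t. split; [split; [exact Pt|apply Rmin_l]|].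
  assert (Hbd : forall z, inD z -> Bad t z -> 1 - Cmod z <= h1 / 4).
  { intros z Hz B. unfold bad_set in B. assert (Gr := HGr z Hz). assert (Hz' := Hz). unfold inD in Hz'.
    assert (Bb : Cmod (bb b z) <= 2).
    { rewrite (bb_mod phi b HDW). unfold Cminus. eapply Rle_trans; [apply Cmod_triangle|]. rewrite Cmod_opp, (proj1 HDW). lra. }
    assert (B0 := Cmod_ge_0 (bb b z)).
    assert (Gr2 : Cmod (G z) * (1 - Cmod z) <= CG * 4).
    { eapply Rle_trans; [exact Gr|]. apply Rmult_le_compat_l; [lra|]. nra. }
    assert (Tq : t * (64 * CG) <= eta0 * (h1 * h1)).
    { replace (eta0 * (h1 * h1)) with (eta0 * (h1 * h1) / (64 * CG) * (64 * CG)) by (field; lra).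
      apply Rmult_le_compat_r; [lra|apply Rmin_r]. }
    destruct (Rle_lt_dec (1 - Cmod z) (h1 / 4)) as [L|L]; [exact L|exfalso].
    assert (X : eta0 * (1 - Cmod z) * (1 - Cmod z) <= t * (CG * 4)).
    { apply Rle_trans with (t * Cmod (G z) * (1 - Cmod z)); [apply Rmult_le_compat_r; lra|].
      rewrite Rmult_assoc. apply Rmult_le_compat_l; lra. }
    assert (Y : h1 / 4 * (h1 / 4) < (1 - Cmod z) * (1 - Cmod z)) by (apply Rmult_le_0_lt_compat; lra).
    unfold eta0 in *. lra. }
  replace eps with (C5 * (4 * e)) by (unfold e; field; lra).
  apply (H5 (Dbad f t) (fun z => 4 * v z)).
  - lra.
  - apply bnd_scal; auto; lra.
  - intros z. assert (Q := v0 z). lra.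
  - intros z Hz. split; [apply Dbad_ge_0|]. unfold grad_on_bad. destruct excluded_middle_informative as [B|_].
    + specialize (Hbd z Hz B). assert (Hz' := Hz). unfold inD in Hz'.
      destruct (near_ex f z ((1 - Cmod z) / 2) (Dfn f z) 2) as [w [W1 W2]]; [lra|lra|apply Dfn_ge_0| |].
      * intros M HM HH. rewrite Dfn_eq by exact Hz.
        assert (K := cauchy_est f z ((1 - Cmod z) / 2) M Hfa ltac:(lra) HH).
        apply Rmult_le_compat_l with (r := 1 - Cmod z) in K; [|lra].
        replace ((1 - Cmod z) * (M / ((1 - Cmod z) / 2))) with (2 * M) in K by (field; lra). exact K.
      * exists w. split; [exact W1|]. unfold v. destruct Rle_dec as [|X]; [lra|].
        assert (T := Cmod_le_plus z w). rewrite Cmod_minus_sym in T. lra.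
    + exists z. split; [apply near_self, Hz|]. assert (Q := v0 z). lra.
Qed.

End Main.

(** * The copy of l_infty *)

Fixpoint csum (u : nat -> C) (n : nat) : C := match n with O => 0%C | S m => (csum u m + u m)%C end.
Definition cseries (u : nat -> C) : C := (Series (fun n => Re (u n)), Series (fun n => Im (u n))).
Definition abs_bounded (u : nat -> C) (B : R) : Prop := forall N, rsum (fun n => Cmod (u n)) N <= B.
Definition clim (u : nat -> C) (l : C) : Prop := forall eps, 0 < eps -> exists N0, forall N, (N0 <= N)%nat -> Cmod (l - csum u N)%C < eps.

Lemma sum_n_rsum (a : nat -> R) N : sum_n a N = rsum a (S N).
Proof. induction N; [rewrite sum_O; simpl; ring|]. rewrite sum_Sn, IHN. reflexivity. Qed.

Lemma ex_series_bounded (a : nat -> R) B : (forall n, 0 <= a n) -> (forall N, rsum a N <= B) -> ex_series a.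
Proof.
  intros Ha Hb. apply ex_series_ext with (a := a); [reflexivity|].
  destruct (ex_finite_lim_seq_incr (sum_n a) B) as [l Hl].
  - intros n. rewrite sum_Sn. unfold plus; simpl. specialize (Ha (S n)). lra.
  - intros n. rewrite sum_n_rsum. apply Hb.
  - exists l. exact Hl.
Qed.

Lemma series_eps (a : nat -> R) eps : ex_series a -> 0 < eps -> exists N0, forall N, (N0 <= N)%nat -> Rabs (Series a - rsum a N) < eps.
Proof.
  intros He Hp. assert (L := Series_correct a He). change (is_lim_seq (sum_n a) (Series a)) in L.
  apply is_lim_seq_spec in L. destruct (L (mkposreal eps Hp)) as [N0 H]. simpl in H.
  exists (S N0). intros N HN. destruct N; [lia|]. rewrite <- sum_n_rsum, Rabs_minus_sym. apply H. lia.
Qed.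

Lemma csum_Re u N : Re (csum u N) = rsum (fun n => Re (u n)) N.
Proof. induction N; simpl; [reflexivity|]. rewrite <- IHN. reflexivity. Qed.
Lemma csum_Im u N : Im (csum u N) = rsum (fun n => Im (u n)) N.
Proof. induction N; simpl; [reflexivity|]. rewrite <- IHN. reflexivity. Qed.
Lemma csum_mod u N : Cmod (csum u N) <= rsum (fun n => Cmod (u n)) N.
Proof. induction N; simpl; [rewrite Cmod_0; lra|]. eapply Rle_trans; [apply Cmod_triangle|]. lra. Qed.

Lemma cseries_lim u B : abs_bounded u B -> clim u (cseries u).
Proof.
  intros Hb. assert (E : ex_series (fun n => Cmod (u n))) by (apply (ex_series_bounded _ B); [intros; apply Cmod_ge_0|exact Hb]).
  assert (E1 : ex_series (fun n => Re (u n))).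
  { apply (ex_series_le (fun n => Re (u n)) (fun n => Cmod (u n))); [|exact E]. intros n. apply re_le_Cmod. }
  assert (E2 : ex_series (fun n => Im (u n))).
  { apply (ex_series_le (fun n => Im (u n)) (fun n => Cmod (u n))); [|exact E]. intros n. apply im_le_Cmod. }
  intros eps He. destruct (series_eps _ (eps / 2) E1 ltac:(lra)) as [N1 H1]. destruct (series_eps _ (eps / 2) E2 ltac:(lra)) as [N2 H2].
  exists (max N1 N2). intros N HN. specialize (H1 N ltac:(lia)). specialize (H2 N ltac:(lia)).
  eapply Rle_lt_trans; [apply Cmod_le_sum|]. rewrite Re_minus, Im_minus, csum_Re, csum_Im. simpl. lra.
Qed.

Lemma clim_unique u l l' : clim u l -> clim u l' -> l = l'.
Proof.
  intros H H'. apply Copp_inj_0, Cmod_eq_0. apply Rle_antisym; [|apply Cmod_ge_0]. apply Rnot_lt_le. intros P.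
  destruct (H (Cmod (l - l')%C / 2) ltac:(lra)) as [N Q]. destruct (H' (Cmod (l - l')%C / 2) ltac:(lra)) as [N' Q'].
  specialize (Q (max N N') ltac:(lia)). specialize (Q' (max N N') ltac:(lia)). rewrite Cmod_minus_sym in Q'.
  assert (T := Cmod_tri_sub l (csum u (max N N')) l'). lra.
Qed.

Lemma clim_le u l B : clim u l -> (forall N, Cmod (csum u N) <= B) -> Cmod l <= B.
Proof.
  intros H Hb. apply Rnot_lt_le. intros P. destruct (H (Cmod l - B) ltac:(lra)) as [N Q].
  specialize (Q N (le_n N)). specialize (Hb N). assert (T := Cmod_le_plus l (csum u N)). lra.
Qed.

Lemma csum_lin a x y N : csum (fun n => a * x n + y n)%C N = (a * csum x N + csum y N)%C.
Proof. induction N; simpl; [ring|]. rewrite IHN. ring. Qed.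

Lemma clim_lin a x y l m : clim x l -> clim y m -> clim (fun n => a * x n + y n)%C (a * l + m)%C.
Proof.
  intros Hx Hy eps He. assert (A0 := Cmod_ge_0 a).
  destruct (Hx (eps / 2 / (Cmod a + 1))) as [N1 H1]; [apply Rdiv_lt_0_compat; lra|]. destruct (Hy (eps / 2) ltac:(lra)) as [N2 H2].
  exists (max N1 N2). intros N HN. specialize (H1 N ltac:(lia)). specialize (H2 N ltac:(lia)).
  rewrite csum_lin. replace (a * l + m - (a * csum x N + csum y N))%C with (a * (l - csum x N) + (m - csum y N))%C by ring.
  eapply Rle_lt_trans; [apply Cmod_triangle|]. rewrite Cmod_mult.
  assert (K : Cmod a * Cmod (l - csum x N)%C <= eps / 2).
  { apply Rle_trans with ((Cmod a + 1) * (eps / 2 / (Cmod a + 1))); [apply Rmult_le_compat; try lra; apply Cmod_ge_0|right; field; lra]. }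
  lra.
Qed.

Lemma cseries_bound u B : abs_bounded u B -> Cmod (cseries u) <= B.
Proof. intros H. eapply clim_le; [eapply cseries_lim, H|]. intros N. eapply Rle_trans; [apply csum_mod|apply H]. Qed.

Lemma abs_bounded_lin a x y A B : abs_bounded x A -> abs_bounded y B -> abs_bounded (fun n => a * x n + y n)%C (Cmod a * A + B).
Proof.
  intros Hx Hy N. eapply Rle_trans; [apply (rsum_le _ (fun n => Cmod a * Cmod (x n) + Cmod (y n)))|].
  - intros i _. rewrite <- Cmod_mult. apply Cmod_triangle.
  - rewrite rsum_plus, rsum_scal. assert (A0 := Cmod_ge_0 a). specialize (Hx N). specialize (Hy N). nra.
Qed.

Lemma cseries_lin a x y A B : abs_bounded x A -> abs_bounded y B -> cseries (fun n => a * x n + y n)%C = (a * cseries x + cseries y)%C.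
Proof.
  intros Hx Hy. eapply clim_unique; [eapply cseries_lim, abs_bounded_lin; eassumption|]. apply clim_lin; eapply cseries_lim; eassumption.
Qed.

Lemma cseries_ext u v : (forall n, u n = v n) -> cseries u = cseries v.
Proof. intros H. replace v with u; [reflexivity|]. apply functional_extensionality, H. Qed.

Definition drop1 (n : nat) (u : nat -> C) (m : nat) : C := if Nat.eq_dec m n then 0%C else u m.

Lemma cseries_drop n u B : abs_bounded (drop1 n u) B -> cseries u = (u n + cseries (drop1 n u))%C.
Proof.
  intros Hb. assert (L := cseries_lim _ _ Hb).
  assert (Es : forall N, (n < N)%nat -> csum u N = (u n + csum (drop1 n u) N)%C).
  { intros N HN. assert (X : forall N, csum u N = ((if le_lt_dec N n then 0 else u n) + csum (drop1 n u) N)%C).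
    { clear. induction N; cbn [csum].
      - destruct (le_lt_dec 0 n); [ring|lia].
      - rewrite IHN. generalize (csum (drop1 n u) N). intros c. unfold drop1.
        destruct (Nat.eq_dec N n) as [->|Ne].
        + destruct (le_lt_dec n n), (le_lt_dec (S n) n); try (exfalso; lia). ring.
        + destruct (le_lt_dec N n), (le_lt_dec (S N) n); try (exfalso; lia); ring. }
    rewrite X. destruct (le_lt_dec N n); [lia|reflexivity]. }
  assert (L' : clim u (u n + cseries (drop1 n u))%C).
  { intros eps He. destruct (L eps He) as [N0 H0]. exists (max N0 (S n)). intros N HN. rewrite Es by lia.
    replace (u n + cseries (drop1 n u) - (u n + csum (drop1 n u) N))%C with (cseries (drop1 n u) - csum (drop1 n u) N)%C by ring.
    apply H0. lia. }
  eapply clim_unique; [|exact L'].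
  apply (cseries_lim u (Cmod (u n) + B)). intros N.
  assert (X : forall N, rsum (fun n => Cmod (u n)) N <= Cmod (u n) + rsum (fun m => Cmod (drop1 n u m)) N /\ ((N <= n)%nat -> rsum (fun n => Cmod (u n)) N <= rsum (fun m => Cmod (drop1 n u m)) N)).
  { clear. assert (Q := Cmod_ge_0 (u n)). induction N; simpl; [split; lra|]. destruct IHN as [I1 I2].
    unfold drop1 in *. destruct (Nat.eq_dec N n) as [->|Ne].
    - rewrite Cmod_0. split; [|lia]. specialize (I2 (le_n n)). lra.
    - split; [lra|]. intros. specialize (I2 ltac:(lia)). lra. }
  eapply Rle_trans; [apply (proj1 (X N))|]. apply Rplus_le_compat_l, Hb.
Qed.

(** Two geometric series of ratio q, one ascending and one descending, meet where y q^i crosses 1,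
    and neither has a term above 1. The induction keeps track of the side of the crossing that has
    been reached. *)
Lemma geo_min q y N : 0 < q < 1 -> 0 < y -> rsum (fun i => Rmin (y * q ^ i) (/ (y * q ^ i))) N <= 2 / (1 - q).
Proof.
  intros Hq Hy.
  assert (Inv : let T := rsum (fun i => Rmin (y * q ^ i) (/ (y * q ^ i))) N in let z := y * q ^ N in
    (q <= z /\ (1 - q) * T <= q / z) \/ (z < q /\ (1 - q) * T <= 2 - z)).
  { cbv zeta. induction N.
    - simpl. rewrite Rmult_1_r, Rmult_0_r. destruct (Rle_lt_dec q y); [left|right]; split; try lra. apply Rdiv_le_0_compat; lra.
    - simpl rsum. set (T := rsum _ N) in *. set (z := y * q ^ N) in *.
      replace (y * q ^ S N) with (q * z) by (unfold z; simpl; ring).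
      assert (Pz : 0 < z) by (apply Rmult_lt_0_compat; [exact Hy|apply pow_lt; lra]).
      assert (M1 := Rmin_l z (/ z)). assert (M2 := Rmin_r z (/ z)).
      set (m := Rmin z (/ z)) in *.
      assert (Mm : (1 - q) * m <= (1 - q) * z) by (apply Rmult_le_compat_l; lra).
      assert (Mm2 : (1 - q) * m <= (1 - q) * / z) by (apply Rmult_le_compat_l; lra).
      destruct IHN as [[Z1 I]|[Z1 I]].
      + destruct (Rle_lt_dec 1 z) as [L|L].
        * left. split; [nra|]. replace (q / (q * z)) with (/ z) by (field; lra). unfold Rdiv in I. nra.
        * right. split; [nra|]. assert (q / z <= 1) by (apply Rle_div_l; lra). nra.
      + right. split; nra. }
  cbv zeta in Inv. set (T := rsum _ N) in *. assert (Pz : 0 < y * q ^ N) by (apply Rmult_lt_0_compat; [exact Hy|apply pow_lt; lra]).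
  apply Rmult_le_reg_l with (1 - q); [lra|]. replace ((1 - q) * (2 / (1 - q))) with 2 by (field; lra).
  destruct Inv as [[Z1 I]|[Z1 I]]; [|lra]. assert (q / (y * q ^ N) <= 1) by (apply Rle_div_l; lra). lra.
Qed.

(** Without the peak at i = n both series start with q instead of 1. This gain is what makes the
    other summands negligible when one coefficient is recovered. *)
Lemma geo_min_drop q n N : 0 < q < 1 ->
  rsum (fun i => if Nat.eq_dec i n then 0 else Rmin (q ^ i / q ^ n) (q ^ n / q ^ i)) N <= 2 * q / (1 - q).
Proof.
  intros Hq. assert (Pn : 0 < q ^ n) by (apply pow_lt; lra).
  assert (Inv : let T := rsum (fun i => if Nat.eq_dec i n then 0 else Rmin (q ^ i / q ^ n) (q ^ n / q ^ i)) N in let z := q ^ N / q ^ n in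
    ((N <= n)%nat /\ (1 - q) * T <= q / z) \/ ((n < N)%nat /\ (1 - q) * T <= 2 * q - z)).
  { cbv zeta. induction N.
    - left. split; [lia|]. simpl. rewrite Rmult_0_r. apply Rdiv_le_0_compat; [lra|]. apply Rdiv_lt_0_compat; lra.
    - simpl rsum. set (T := rsum _ N) in *. set (z := q ^ N / q ^ n) in *.
      assert (PN : 0 < q ^ N) by (apply pow_lt; lra).
      replace (q ^ S N / q ^ n) with (q * z) by (unfold z; simpl; field; lra).
      assert (Pz : 0 < z) by (apply Rdiv_lt_0_compat; lra).
      replace (q ^ n / q ^ N) with (/ z) by (unfold z; field; lra).
      destruct (Nat.eq_dec N n) as [->|Ne].
      + right. split; [lia|]. destruct IHN as [[_ I]|[X _]]; [|lia].
        replace z with 1 in I |- * by (unfold z; field; lra). lra.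
      + assert (M1 := Rmin_l z (/ z)). assert (M2 := Rmin_r z (/ z)). set (m := Rmin z (/ z)) in *.
        assert (Mm : (1 - q) * m <= (1 - q) * z) by (apply Rmult_le_compat_l; lra).
        assert (Mm2 : (1 - q) * m <= (1 - q) * / z) by (apply Rmult_le_compat_l; lra).
        destruct IHN as [[Z1 I]|[Z1 I]].
        * left. split; [lia|]. replace (q / (q * z)) with (/ z) by (field; lra). unfold Rdiv in I. nra.
        * right. split; [lia|]. nra. }
  cbv zeta in Inv. set (T := rsum _ N) in *. assert (PN : 0 < q ^ N) by (apply pow_lt; lra).
  assert (Pz : 0 < q ^ N / q ^ n) by (apply Rdiv_lt_0_compat; lra).
  apply Rmult_le_reg_l with (1 - q); [lra|]. replace ((1 - q) * (2 * q / (1 - q))) with (2 * q) by (field; lra).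
  destruct Inv as [[Z1 I]|[Z1 I]]; [|lra].
  assert (L : 1 <= q ^ N / q ^ n).
  { apply Rle_div_r; [exact Pn|]. rewrite Rmult_1_l. replace n with (N + (n - N))%nat by lia. rewrite pow_add.
    assert (q ^ (n - N) <= 1) by (rewrite <- (pow1 (n - N)); apply pow_incr; lra). nra. }
  assert (q / (q ^ N / q ^ n) <= q).
  { apply Rle_div_l; [exact Pz|]. nra. }
  lra.
Qed.

(** m >= h alone gives h^(-beta); m >= h and m >= d with M >= 2 beta give h^beta d^(-2 beta). The
    smaller of the two is d^(-beta) with decay on both sides of h = d. *)
Lemma kernel_min (h d m beta : R) (M : nat) : 0 < h <= m -> 0 < d <= m -> 0 < beta -> 2 * beta <= INR M ->
  Rpower h (INR M - beta) * / m ^ M <= Rpower d (- beta) * Rmin (Rpower h beta / Rpower d beta) (/ (Rpower h beta / Rpower d beta)).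
Proof.
  intros Hh Hd Hb HM. assert (Ph := Rpower_pos h beta). assert (Pd := Rpower_pos d beta).
  assert (Em : / m ^ M = Rpower m (- INR M)) by (rewrite Rpower_Ropp, Rpower_pow by lra; reflexivity).
  rewrite Em.
  assert (A1 : Rpower h (INR M - beta) * Rpower m (- INR M) <= Rpower h (- beta)).
  { apply Rle_trans with (Rpower h (INR M - beta) * Rpower h (- INR M)).
    - apply Rmult_le_compat_l; [left; apply Rpower_pos|]. apply Rpower_anti; lra.
    - rewrite <- Rpower_plus. right. f_equal. ring. }
  assert (A2 : Rpower h (INR M - beta) * Rpower m (- INR M) <= Rpower h beta * Rpower d (- (2 * beta))).
  { replace (- INR M) with (- (INR M - 2 * beta) + - (2 * beta)) by ring. rewrite Rpower_plus.
    apply Rle_trans with (Rpower h (INR M - beta) * (Rpower h (- (INR M - 2 * beta)) * Rpower d (- (2 * beta)))).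
    - apply Rmult_le_compat_l; [left; apply Rpower_pos|]. apply Rmult_le_compat; try (left; apply Rpower_pos); apply Rpower_anti; lra.
    - rewrite <- Rmult_assoc, <- Rpower_plus. right. f_equal. f_equal. ring. }
  assert (Q1 : Rpower d (- beta) = / Rpower d beta) by apply Rpower_Ropp.
  assert (Q2 : Rpower h (- beta) = / Rpower h beta) by apply Rpower_Ropp.
  assert (Q3 : Rpower d (- (2 * beta)) = / Rpower d beta * / Rpower d beta).
  { rewrite Rpower_Ropp. replace (2 * beta) with (beta + beta) by ring. rewrite Rpower_plus. field. lra. }
  rewrite Q1. rewrite Q2 in A1. rewrite Q3 in A2. unfold Rmin. destruct Rle_dec.
  - eapply Rle_trans; [exact A2|]. right. field. lra.
  - eapply Rle_trans; [exact A1|]. right. field. lra.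
Qed.

(** * The weight |b - z|^(-beta) has finite norm *)

Section Boundary.
Variable b : C.
Hypothesis Hb : Cmod b = 1.

Lemma conj_b_mod z : Cmod (Cconj b * z)%C = Cmod z.
Proof. rewrite Cmod_mult, Cmod_conj, Hb. ring. Qed.

Lemma bb_bounds z : inD z -> 1 - Cmod z <= Cmod (bb b z) <= 2.
Proof.
  intros Hz. unfold inD in Hz. unfold bb. assert (T := Cmod_rev_tri 1%C (Cconj b * z)%C). rewrite Cmod_1, conj_b_mod in T.
  split; [exact T|]. unfold Cminus. eapply Rle_trans; [apply Cmod_triangle|]. rewrite Cmod_opp, Cmod_1, conj_b_mod. lra.
Qed.

Lemma bb_shift g z : 0 <= g <= 1 -> inD z -> Cmod (1 - RtoC (1 - g) * Cconj b * z)%C <= Cmod (bb b z) + g.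
Proof.
  intros Hg Hz. unfold inD in Hz. assert (Z0 := Cmod_ge_0 z).
  replace (1 - RtoC (1 - g) * Cconj b * z)%C with (bb b z + RtoC g * (Cconj b * z))%C by (unfold bb; rewrite RtoC_minus; ring).
  eapply Rle_trans; [apply Cmod_triangle|]. rewrite (Cmod_mult (RtoC g)), conj_b_mod, Cmod_R, Rabs_right by lra. nra.
Qed.

Lemma bb_unshift g z : 0 <= g <= 1 -> inD z -> Cmod (bb b z) <= Cmod (1 - RtoC (1 - g) * Cconj b * z)%C + g.
Proof.
  intros Hg Hz. unfold inD in Hz. assert (Z0 := Cmod_ge_0 z).
  replace (bb b z) with ((1 - RtoC (1 - g) * Cconj b * z) + - (RtoC g * (Cconj b * z)))%C by (unfold bb; rewrite RtoC_minus; ring).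
  eapply Rle_trans; [apply Cmod_triangle|]. rewrite Cmod_opp, (Cmod_mult (RtoC g)), conj_b_mod, Cmod_R, Rabs_right by lra. nra.
Qed.

Lemma shift_mod g z : 0 <= g <= 1 -> Cmod (RtoC (1 - g) * Cconj b * z)%C = (1 - g) * Cmod z.
Proof. intros Hg. rewrite <- Cmult_assoc, Cmod_mult, conj_b_mod, Cmod_R, Rabs_right by lra. reflexivity. Qed.

Lemma shift_ge g z : 0 <= g <= 1 -> inD z -> g <= Cmod (1 - RtoC (1 - g) * Cconj b * z)%C.
Proof.
  intros Hg Hz. unfold inD in Hz. assert (Z0 := Cmod_ge_0 z).
  assert (T := Cmod_rev_tri 1%C (RtoC (1 - g) * Cconj b * z)%C). rewrite Cmod_1, shift_mod in T by exact Hg. nra.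
Qed.

Definition piece (p : Rbar) (alpha g : R) (z : C) : R :=
  if Rle_dec (Cmod (bb b z) / 4) g then if Rle_dec g (4 * Cmod (bb b z)) then Rpower (Cmod (bb b z)) (- (alpha + ip p)) else 0 else 0.

Lemma piece_ge_0 p alpha g z : 0 <= piece p alpha g z.
Proof. unfold piece. destruct Rle_dec; [|lra]. destruct Rle_dec; [|lra]. left; apply Rpower_pos. Qed.

(* the Cayley kernel with pole at distance g outside the disk is comparable to 1/|b - z| where |b - z| is of order g *)
Lemma piece_dom p alpha : Rbar_lt 0 p -> 0 < alpha -> exists C0, 0 < C0 /\ forall g h, 0 < g <= 1 -> 0 < h ->
  harm_dom p h (piece p alpha g) (C0 * Rpower g (- alpha)).
Proof.
  intros Hp Ha. exists (Rpower 100 (ip p) * Rpower 4 alpha).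
  assert (P1 := Rpower_pos 100 (ip p)). assert (P2 := Rpower_pos 4 alpha).
  split; [apply Rmult_lt_0_compat; lra|]. intros g h Hg Hh.
  assert (Rg : forall D a, 0 < D -> 0 < a -> g <= 4 * D -> Rpower D (- a) <= Rpower 4 a * Rpower g (- a)).
  { intros D a HD Haa HgD. apply Rle_trans with (Rpower 4 a * Rpower (4 * D) (- a)).
    - rewrite <- Rpower_mult_distr by lra. rewrite <- Rmult_assoc, Rpower_inv_r. lra.
    - apply Rmult_le_compat_l; [left; apply Rpower_pos|]. apply Rpower_anti; lra. }
  destruct p as [q| |]; simpl in Hp; [| |contradiction].
  - exists (fun z => RtoC (Rpower (Rpower 100 (/ q) * Rpower 4 alpha * Rpower g (- alpha)) q) * ((1 + (RtoC (1 - g) * Cconj b) * z) / (1 - (RtoC (1 - g) * Cconj b) * z)))%C.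
    set (c := Rpower (Rpower 100 (/ q) * Rpower 4 alpha * Rpower g (- alpha)) q).
    assert (Pc : 0 < c) by apply Rpower_pos.
    assert (Ec : c = 100 * (Rpower 4 (alpha * q) * Rpower g (- (alpha * q)))).
    { unfold c. rewrite <- !Rpower_mult_distr by (try apply Rpower_pos; apply Rmult_lt_0_compat; apply Rpower_pos).
      rewrite Rpower_root, !Rpower_mult by lra. rewrite <- Ropp_mult_distr_l. ring. }
    assert (Mw : Cmod (RtoC (1 - g) * Cconj b)%C <= 1).
    { assert (X := shift_mod g 1%C ltac:(lra)). rewrite Cmult_1_r, Cmod_1 in X. rewrite X. lra. }
    split; [|split].
    + apply pos_scal; [lra|]. apply (cayley_pos (fun z => z) _ selfmap_id Mw).
    + right. fold c. replace ((1 + RtoC (1 - g) * Cconj b * 0) / (1 - RtoC (1 - g) * Cconj b * 0))%C with (RtoC 1).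
      * simpl. unfold c. simpl. ring.
      * rewrite Cmult_0_r. unfold Cdiv, Cminus. rewrite Copp_0, !Cplus_0_r, Cinv_r, ?Cmult_1_l; [reflexivity|]. intros X. injection X. lra.
    + intros z Sz. unfold shell in Sz. assert (Hz : inD z) by (unfold inD; lra).
      assert (PK := proj2 (pos_scal c _ ltac:(lra) (cayley_pos (fun z => z) _ selfmap_id Mw)) z Hz). cbv beta in PK.
      unfold piece. destruct Rle_dec as [L1|_]; [|rewrite powp_0; exact PK]. destruct Rle_dec as [L2|_]; [|rewrite powp_0; exact PK].
      clear PK. set (D := Cmod (bb b z)) in *. assert (PD : 0 < D) by (assert (X := bb_bounds z Hz); unfold inD in Hz; unfold D; lra).
      rewrite powp_pos_eq by apply Rpower_pos. rewrite Rpower_mult. simpl ip.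
      replace (- (alpha + / q) * q) with (- (alpha * q) + - (1)) by (field; lra). rewrite Rpower_plus, (Rpower_Ropp D 1), Rpower_1 by exact PD.
      assert (Zm := Cmod_ge_0 z).
      assert (Lt1 : Cmod (RtoC (1 - g) * Cconj b * z)%C < 1) by (rewrite shift_mod by lra; unfold inD in Hz; nra).
      replace (Re (RtoC c * ((1 + RtoC (1 - g) * Cconj b * z) / (1 - RtoC (1 - g) * Cconj b * z)))%C) with (c * Re ((1 + RtoC (1 - g) * Cconj b * z) / (1 - RtoC (1 - g) * Cconj b * z))%C) by (unfold Re; simpl; ring).
      rewrite cayley_Re by exact Lt1.
      assert (S1 := bb_shift g z ltac:(lra) Hz). fold D in S1. assert (S2 := shift_ge g z ltac:(lra) Hz).
      set (m := Cmod (1 - RtoC (1 - g) * Cconj b * z)%C) in *. rewrite shift_mod by lra.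
      (* From D/4 <= g <= 4 D: the numerator is at least g >= D/4 and m <= D + g <= 5 D, so 100 = 4
         * 25. *)
      assert (X1 : / (100 * D) <= (1 - (1 - g) * Cmod z * ((1 - g) * Cmod z)) / (m * m)).
      { apply Rle_trans with ((D / 4) / ((5 * D) * (5 * D))); [right; field; lra|].
        apply Rmult_le_compat; [lra|left; apply Rinv_0_lt_compat; nra| |].
        - assert ((1 - g) * Cmod z <= 1 - g) by (unfold inD in Hz; nra). assert (0 <= (1 - g) * Cmod z) by nra. nra.
        - apply Rinv_le_contravar; nra. }
      rewrite Ec. assert (R0 := Rg D (alpha * q) PD ltac:(nra) L2).
      set (X := (1 - (1 - g) * Cmod z * ((1 - g) * Cmod z)) / (m * m)) in *. set (Y := Rpower 4 (alpha * q) * Rpower g (- (alpha * q))) in *.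
      replace (Rpower D (- (alpha * q)) * / D) with (100 * (Rpower D (- (alpha * q)) * / (100 * D))) by (field; lra).
      rewrite Rmult_assoc. apply Rmult_le_compat_l; [lra|]. apply Rmult_le_compat; auto; [left; apply Rpower_pos|left; apply Rinv_0_lt_compat; lra].
  - intros z Sz. unfold shell in Sz. assert (Hz : inD z) by (unfold inD; lra). simpl ip.
    rewrite Rpower_O by lra. rewrite Rmult_1_l. assert (Y := Rmult_lt_0_compat _ _ P2 (Rpower_pos g (- alpha))).
    unfold piece. simpl ip. rewrite Rplus_0_r. destruct Rle_dec as [L1|_]; [|lra]. destruct Rle_dec as [L2|_]; [|lra].
    apply Rg; [|exact Ha|exact L2]. assert (X := bb_bounds z Hz). unfold inD in Hz. lra.
Qed.

(** Cut by the dyadic size g of |b - z|. A piece costs g^(-alpha), and since |b - z| >= 1-|z| the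
    sizes start near h; alpha > 0 makes the sum geometric and comparable to h^(-alpha). *)
Lemma bb_bnd p alpha : Rbar_lt 0 p -> 0 < alpha -> exists C0, 0 < C0 /\ bnd p alpha (fun z => Rpower (Cmod (bb b z)) (- (alpha + ip p))) C0.
Proof.
  intros Hp Ha. destruct (piece_dom p alpha Hp Ha) as [C1 [P1 H1]].
  set (k := Rpower 2 (- alpha)).
  assert (Hk : 0 < k < 1).
  { unfold k. split; [apply Rpower_pos|]. rewrite Rpower_Ropp, <- Rinv_1. apply Rinv_lt_contravar; [rewrite Rmult_1_l; apply Rpower_pos|].
    rewrite <- (Rpower_O 2) by lra. apply Rpower_lt; lra. }
  destruct (dom_geo p Hp k Hk) as [C2 [P2 H2]].
  assert (P3 := Rpower_pos 2 alpha).
  assert (P4 : 0 < C1 * Rpower 2 alpha) by (apply Rmult_lt_0_compat; lra).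
  exists (C2 * (C1 * Rpower 2 alpha)). split; [apply Rmult_lt_0_compat; lra|].
  intros h Hh. assert (PH := Rpower_pos h (- alpha)).
  destruct (level_exists 2 h ltac:(lra) Hh) as [N HN].
  set (g := fun i : nat => Rmin 1 (2 ^ i * h)).
  assert (P2i : forall i, 0 < 2 ^ i) by (intros i; apply pow_lt; lra).
  assert (Hg : forall i, (i <= N)%nat -> 0 < g i <= 1 /\ 2 ^ i * h / 2 <= g i).
  { intros i Hi. unfold g. assert (Q := P2i i). assert (0 < 2 ^ i * h) by (apply Rmult_lt_0_compat; lra).
    assert (Le : 2 ^ i * h <= 2 ^ N * h) by (apply Rmult_le_compat_r; [lra|]; apply Rle_pow; [lra|exact Hi]).
    split; [split; [apply Rmin_glb_lt; lra|apply Rmin_l]|]. apply Rmin_glb; lra. }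
  rewrite Rmult_assoc.
  apply (H2 h (C1 * Rpower 2 alpha * Rpower h (- alpha)) (S N) (fun i => piece p alpha (g i))).
  - apply Rmult_lt_0_compat; lra.
  - intros i z. apply piece_ge_0.
  - intros i Hi. destruct (Hg i ltac:(lia)) as [G1 G2]. assert (Q := P2i i).
    apply (dom_mono p Hp h _ (piece p alpha (g i)) (C1 * Rpower (g i) (- alpha))).
    + split; [apply Rmult_lt_0_compat; [lra|apply Rpower_pos]|].
      replace (C1 * Rpower 2 alpha * Rpower h (- alpha) * k ^ i) with (C1 * (Rpower 2 alpha * Rpower h (- alpha) * k ^ i)) by ring.
      apply Rmult_le_compat_l; [lra|]. unfold k. rewrite <- Rpower_pow_comm by lra.
      replace (Rpower 2 alpha) with (Rpower (1/2) (- alpha)).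
      2:{ replace (1 / 2) with (Rpower 2 (- (1))). rewrite Rpower_mult. f_equal. ring. rewrite Rpower_Ropp, Rpower_1; lra. }
      rewrite !Rpower_mult_distr by lra. apply Rpower_anti; [lra|]. split; [nra|]. lra.
    + intros z _. split; [apply piece_ge_0|lra].
    + apply H1; lra.
  - intros z Sz. split; [left; apply Rpower_pos|]. unfold shell in Sz. assert (Hz : inD z) by (unfold inD; lra).
    assert (B := bb_bounds z Hz). set (D := Cmod (bb b z)) in *.
    (* D can be as small as h/2, below the first level, and as large as 2, above the last; this x
       stays between h and 1 and is comparable to D within the tolerance 4 of [piece]. *)
    set (x := Rmax h (D / 2)). assert (X1 := Rmax_l h (D / 2)). assert (X2 := Rmax_r h (D / 2)).
    assert (X3 : x <= 1) by (apply Rmax_lub; lra).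
    assert (X4 : x <= 2 * D) by (apply Rmax_lub; lra).
    destruct (level_find h x N ltac:(unfold x; lra) ltac:(lra)) as [i [Hi Hl]].
    assert (E0 : piece p alpha (g i) z = Rpower D (- (alpha + ip p))).
    { unfold piece. fold D. fold x in X1, X2. assert (G1 : g i <= 2 ^ i * h) by apply Rmin_r.
      assert (G2 : x <= g i) by (apply Rmin_glb; lra).
      destruct Rle_dec as [_|Y]; [|exfalso; apply Y; lra]. destruct Rle_dec as [_|Y]; [reflexivity|exfalso; apply Y; lra]. }
    rewrite <- E0. apply (rsum_elem (fun i => piece p alpha (g i) z)); [intros; apply piece_ge_0|lia].
Qed.

End Boundary.

Lemma pow_le_one x n : 0 <= x <= 1 -> x ^ n <= 1.
Proof. intros H. assert (X := pow_incr x 1 n H). rewrite pow1 in X. exact X. Qed.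

(** * Lacunary sums of boundary kernels with bounded coefficients *)

Section Operator.
Variable b : C.
Hypothesis Hb : Cmod b = 1.
Variables (beta : R) (M : nat).
Hypothesis Hbeta : 0 < beta.
Hypothesis HM : 2 * beta <= INR M.

(* hn n ^ beta = qq ^ (n + 1); any ratio with 2 qq / (1 - qq) <= 2^(-M) / 2 would do. *)
Definition qq : R := (1 / 2) ^ M / 8.
Definition hn (n : nat) : R := Rpower (qq ^ S n) (/ beta).
Definition aa (n : nat) (z : C) : C := (1 - RtoC (1 - hn n) * Cconj b * z)%C.
Definition fn (n : nat) (z : C) : C := (RtoC (Rpower (hn n) (INR M - beta)) * (/ aa n z) ^ M)%C.
Definition dfn (n : nat) (z : C) : C := (RtoC (INR M) * (RtoC (1 - hn n) * Cconj b) * / aa n z * fn n z)%C.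
Definition linf_map (x : nat -> C) (z : C) : C := cseries (fun n => x n * fn n z)%C.

Lemma qq_bd : 0 < qq <= 1 / 8.
Proof.
  unfold qq. assert (0 < (1 / 2) ^ M) by (apply pow_lt; lra).
  assert ((1 / 2) ^ M <= 1) by (apply pow_le_one; lra). lra.
Qed.

Lemma qn_bd n : 0 < qq ^ S n < 1.
Proof.
  assert (Q := qq_bd). split; [apply pow_lt; lra|]. simpl. assert (0 < qq ^ n) by (apply pow_lt; lra).
  assert (qq ^ n <= 1) by (apply pow_le_one; lra). nra.
Qed.

Lemma hn_beta n : Rpower (hn n) beta = qq ^ S n.
Proof. unfold hn. apply Rpower_root; [apply qn_bd|exact Hbeta]. Qed.

Lemma hn_bd n : 0 < hn n < 1.
Proof. split; [apply Rpower_pos|]. unfold hn. apply Rpower_lt_1; [apply qn_bd|]. apply Rinv_0_lt_compat, Hbeta. Qed.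

Lemma aa_ge n z : inD z -> hn n <= Cmod (aa n z) /\ Cmod (bb b z) / 2 <= Cmod (aa n z).
Proof.
  intros Hz. assert (H := hn_bd n). assert (S1 := shift_ge b Hb (hn n) z ltac:(lra) Hz).
  assert (S2 := bb_unshift b Hb (hn n) z ltac:(lra) Hz). unfold aa. split; [exact S1|]. lra.
Qed.

Lemma aa_nz n z : inD z -> aa n z <> 0%C.
Proof. intros Hz. apply Cmod_gt_0. assert (A := aa_ge n z Hz). assert (H := hn_bd n). lra. Qed.

Lemma fn_mod n z : inD z -> Cmod (fn n z) = Rpower (hn n) (INR M - beta) * / Cmod (aa n z) ^ M.
Proof.
  intros Hz. unfold fn. rewrite Cmod_mult, Cmod_R, Rabs_right by (apply Rle_ge; left; apply Rpower_pos).
  rewrite Cmod_pow, Cmod_inv by (apply aa_nz, Hz). rewrite pow_inv. reflexivity.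
Qed.

Lemma bbp z : inD z -> 0 < Cmod (bb b z).
Proof. intros Hz. assert (X := bb_bounds b Hb z Hz). unfold inD in Hz. lra. Qed.

(** The factor 2^beta is the price of [aa_ge], which provides only half of |b - z|; the other factor
    is the sum in [geo_min]. *)
Definition KT : R := Rpower 2 beta * (2 / (1 - qq)).
Lemma KT_pos : 0 < KT.
Proof. assert (Q := qq_bd). unfold KT. apply Rmult_lt_0_compat; [apply Rpower_pos|]. apply Rdiv_lt_0_compat; lra. Qed.

Lemma fn_sum z N : inD z -> rsum (fun n => Cmod (fn n z)) N <= KT * Rpower (Cmod (bb b z)) (- beta).
Proof.
  intros Hz. assert (Q := qq_bd). assert (D0 := bbp z Hz). set (D := Cmod (bb b z)) in *.
  assert (Pd : 0 < Rpower (D / 2) beta) by apply Rpower_pos.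
  set (y := qq / Rpower (D / 2) beta). assert (Py : 0 < y) by (apply Rdiv_lt_0_compat; lra).
  apply Rle_trans with (rsum (fun n => Rpower (D / 2) (- beta) * Rmin (y * qq ^ n) (/ (y * qq ^ n))) N).
  - apply rsum_le. intros i _. rewrite fn_mod by exact Hz. destruct (aa_ge i z Hz) as [A1 A2]. fold D in A2. assert (Hi := hn_bd i).
    eapply Rle_trans; [apply (kernel_min (hn i) (D / 2) (Cmod (aa i z)) beta M); lra|].
    rewrite hn_beta. right. f_equal. replace (qq ^ S i / Rpower (D / 2) beta) with (y * qq ^ i) by (unfold y; simpl; field; lra). reflexivity.
  - rewrite rsum_scal. apply Rle_trans with (Rpower (D / 2) (- beta) * (2 / (1 - qq))).
    + apply Rmult_le_compat_l; [left; apply Rpower_pos|]. apply geo_min; [lra|exact Py].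
    + right. unfold KT. replace (D / 2) with (D * / 2) by reflexivity. rewrite <- Rpower_mult_distr by lra.
      replace (Rpower (/ 2) (- beta)) with (Rpower 2 beta); [ring|].
      rewrite <- (Rpower_1 2) at 2 by lra. rewrite <- Rpower_Ropp, Rpower_mult. f_equal. ring.
Qed.

Lemma dfn_mod n z : inD z -> Cmod (dfn n z) <= 2 * INR M / Cmod (bb b z) * Cmod (fn n z).
Proof.
  intros Hz. assert (D0 := bbp z Hz). assert (H := hn_bd n). destruct (aa_ge n z Hz) as [A1 A2].
  unfold dfn. rewrite !Cmod_mult, Cmod_inv by (apply aa_nz, Hz). rewrite Cmod_conj, Hb, !Cmod_R.
  assert (M0 := pos_INR M). rewrite !Rabs_right by lra. apply Rmult_le_compat_r; [apply Cmod_ge_0|].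
  apply Rle_trans with (INR M * (1 * 1) * / (Cmod (bb b z) / 2)).
  - apply Rmult_le_compat; [|left; apply Rinv_0_lt_compat; lra| |apply Rinv_le_contravar; lra].
    + apply Rmult_le_pos; [lra|]. nra.
    + apply Rmult_le_compat_l; lra.
  - right. field. lra.
Qed.

Lemma Tx_abs_bounded x S z : (forall n, Cmod (x n) <= S) -> inD z -> abs_bounded (fun n => x n * fn n z)%C (S * (KT * Rpower (Cmod (bb b z)) (- beta))).
Proof.
  intros Hx Hz N. assert (S0 : 0 <= S) by (eapply Rle_trans; [apply (Cmod_ge_0 (x 0%nat))|apply Hx]).
  apply Rle_trans with (rsum (fun n => S * Cmod (fn n z)) N).
  - apply rsum_le. intros i _. rewrite Cmod_mult. apply Rmult_le_compat_r; [apply Cmod_ge_0|apply Hx].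
  - rewrite rsum_scal. apply Rmult_le_compat_l; [exact S0|apply fn_sum, Hz].
Qed.

Lemma dTx_abs_bounded x S z : (forall n, Cmod (x n) <= S) -> inD z ->
  abs_bounded (fun n => x n * dfn n z)%C (2 * INR M / Cmod (bb b z) * (S * (KT * Rpower (Cmod (bb b z)) (- beta)))).
Proof.
  intros Hx Hz N. assert (D0 := bbp z Hz). assert (M0 := pos_INR M).
  apply Rle_trans with (rsum (fun n => 2 * INR M / Cmod (bb b z) * Cmod (x n * fn n z)%C) N).
  - apply rsum_le. intros i _. rewrite !Cmod_mult. assert (Q := dfn_mod i z Hz). assert (X := Cmod_ge_0 (x i)).
    replace (2 * INR M / Cmod (bb b z) * (Cmod (x i) * Cmod (fn i z))) with (Cmod (x i) * (2 * INR M / Cmod (bb b z) * Cmod (fn i z))) by ring.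
    apply Rmult_le_compat_l; assumption.
  - rewrite rsum_scal. apply Rmult_le_compat_l; [|apply Tx_abs_bounded; assumption]. apply Rdiv_le_0_compat; lra.
Qed.

Lemma moeb_circle_mod x S z : (forall n, Cmod (x n) <= S) -> inD z -> Cmod (linf_map x z) <= S * (KT * Rpower (Cmod (bb b z)) (- beta)).
Proof. intros Hx Hz. apply cseries_bound, Tx_abs_bounded; assumption. Qed.

Lemma fn_cderiv n z : inD z -> cderiv (fn n) z (dfn n z).
Proof.
  intros Hz. set (k := (RtoC (1 - hn n) * Cconj b)%C).
  assert (Da : cderiv (aa n) z (- k)%C).
  { unfold aa. fold k. replace (- k)%C with (0 - k * 1)%C by ring. apply cderiv_minus; [apply cderiv_const|]. apply cderiv_scal, cderiv_id. }
  assert (Di := cderiv_inv _ _ _ Da (aa_nz n z Hz)).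
  assert (Dp : forall m : nat, cderiv (fun w => ((/ aa n w) ^ m)%C) z (RtoC (INR m) * k * / aa n z * (/ aa n z) ^ m)%C).
  { induction m.
    - simpl. apply (cderiv_eq _ _ 0%C); [|ring]. apply cderiv_const.
    - assert (D := cderiv_mult _ _ _ _ _ Di IHm). 
      apply (cderiv_eq _ _ _ _ D). rewrite S_INR, RtoC_plus. simpl Cpow. field. apply aa_nz, Hz. }
  unfold fn. apply (cderiv_eq _ _ (RtoC (Rpower (hn n) (INR M - beta)) * (RtoC (INR M) * k * / aa n z * (/ aa n z) ^ M))%C).
  - apply cderiv_scal, Dp.
  - unfold dfn, fn. fold k. ring.
Qed.

Lemma partial_cderiv x N z : inD z -> cderiv (fun w => csum (fun n => x n * fn n w)%C N) z (csum (fun n => x n * dfn n z)%C N).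
Proof.
  intros Hz. induction N; simpl; [apply cderiv_const|]. apply cderiv_plus; [exact IHN|]. apply cderiv_scal, fn_cderiv, Hz.
Qed.

(** Termwise differentiation of the lacunary sum: the partial sums share one bound near z, hence one
    second-order Cauchy estimate, and this inequality passes to the limit. *)
Lemma moeb_circle_cderiv x S z : (forall n, Cmod (x n) <= S) -> inD z -> cderiv (linf_map x) z (cseries (fun n => x n * dfn n z)%C).
Proof.
  intros Hx Hz. assert (Hz' := Hz). unfold inD in Hz'. assert (Z0 := Cmod_ge_0 z).
  assert (S0 : 0 <= S) by (eapply Rle_trans; [apply (Cmod_ge_0 (x 0%nat))|apply Hx]). assert (PK := KT_pos).
  set (s := (1 - Cmod z) / 2). assert (Ps : 0 < s) by (unfold s; lra).
  set (B := S * (KT * Rpower s (- beta))).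
  assert (B0 : 0 <= B) by (apply Rmult_le_pos; [exact S0|]; apply Rmult_le_pos; [lra|left; apply Rpower_pos]).
  set (K := 8 * B / (s * s)). assert (K0 : 0 <= K) by (apply Rdiv_le_0_compat; nra).
  assert (Q : forall w, Cmod (w - z)%C <= s / 4 -> Cmod (linf_map x w - linf_map x z - cseries (fun n => x n * dfn n z)%C * (w - z))%C <= K * (Cmod (w - z)%C * Cmod (w - z)%C)).
  { intros w Hw. assert (Iw : inD w) by (assert (T := Cmod_le_plus w z); unfold inD; unfold s in Hw; lra).
    set (e := fun n => ((- (w - z)) * (x n * dfn n z) + ((-1) * (x n * fn n z) + x n * fn n w))%C).
    assert (L : clim e (linf_map x w - linf_map x z - cseries (fun n => x n * dfn n z)%C * (w - z))%C).
    { replace (linf_map x w - linf_map x z - cseries (fun n => x n * dfn n z)%C * (w - z))%C with ((- (w - z)) * cseries (fun n => x n * dfn n z)%C + ((-1) * linf_map x z + linf_map x w))%C by ring.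
      apply clim_lin; [eapply cseries_lim, dTx_abs_bounded; eassumption|]. apply clim_lin; eapply cseries_lim, Tx_abs_bounded; eassumption. }
    apply (clim_le e _ _ L). intros N.
    set (P := fun w => csum (fun n => x n * fn n w)%C N).
    assert (PA : analytic_on_D P) by (eapply analytic_of; intros u Hu; apply partial_cderiv, Hu).
    assert (Ee : csum e N = (P w - P z - cD P z * (w - z))%C).
    { unfold e. rewrite csum_lin, csum_lin. rewrite (cD_eq P z _ (partial_cderiv x N z Hz)). unfold P. ring. }
    rewrite Ee. apply (cauchy_second P z w s B); auto; [unfold s; lra|].
    intros u Hu. assert (T := Cmod_le_plus u z). assert (Iu : inD u) by (unfold inD; unfold s in Hu; lra).
    eapply Rle_trans; [apply csum_mod|]. eapply Rle_trans; [apply (Tx_abs_bounded x S u Hx Iu)|].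
    unfold B. apply Rmult_le_compat_l; [exact S0|]. apply Rmult_le_compat_l; [lra|]. apply Rpower_anti; [lra|].
    assert (X := bb_bounds b Hb u Iu). split; [exact Ps|]. unfold s in *; lra. }
  intros eps He. exists (Rmin (s / 4) (eps / (K + 1))). split; [apply Rmin_glb_lt; [lra|apply Rdiv_lt_0_compat; lra]|].
  intros w Hw. assert (W1 := Rlt_le_trans _ _ _ Hw (Rmin_l _ _)). assert (W2 := Rlt_le_trans _ _ _ Hw (Rmin_r _ _)).
  eapply Rle_trans; [apply Q; lra|]. assert (W0 := Cmod_ge_0 (w - z)%C). rewrite <- Rmult_assoc. apply Rmult_le_compat_r; [exact W0|].
  apply Rle_trans with ((K + 1) * (eps / (K + 1))); [apply Rmult_le_compat; lra|right; field; lra].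
Qed.

Lemma moeb_circle_analytic x S : (forall n, Cmod (x n) <= S) -> analytic_on_D (linf_map x).
Proof. intros Hx. eapply analytic_of. intros z Hz. eapply moeb_circle_cderiv; eassumption. Qed.

Lemma moeb_circle_deriv_mod x S z : (forall n, Cmod (x n) <= S) -> inD z ->
  Cmod (cD (linf_map x) z) <= 2 * INR M / Cmod (bb b z) * (S * (KT * Rpower (Cmod (bb b z)) (- beta))).
Proof. intros Hx Hz. rewrite (cD_eq _ _ _ (moeb_circle_cderiv x S z Hx Hz)). apply cseries_bound, dTx_abs_bounded; assumption. Qed.

Lemma moeb_circle_linear x y a S S' z : (forall n, Cmod (x n) <= S) -> (forall n, Cmod (y n) <= S') -> inD z ->
  linf_map (fun n => a * x n + y n)%C z = (a * linf_map x z + linf_map y z)%C.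
Proof.
  intros Hx Hy Hz. unfold linf_map. rewrite <- (cseries_lin a _ _ _ _ (Tx_abs_bounded x S z Hx Hz) (Tx_abs_bounded y S' z Hy Hz)).
  apply cseries_ext. intros n. ring.
Qed.

Definition zn (n : nat) : C := (RtoC (1 - hn n) * b)%C.

Lemma zn_mod n : Cmod (zn n) = 1 - hn n.
Proof. assert (H := hn_bd n). unfold zn. rewrite Cmod_mult, Hb, Cmod_R, Rabs_right by lra. ring. Qed.
Lemma zn_inD n : inD (zn n).
Proof. unfold inD. rewrite zn_mod. assert (H := hn_bd n). lra. Qed.

Lemma aa_zn m n : Cmod (aa m (zn n)) = 1 - (1 - hn m) * (1 - hn n).
Proof.
  assert (H := hn_bd n). assert (H' := hn_bd m).
  assert (E0 : (Cconj b * b)%C = 1%C) by (rewrite Cmult_comm, <- Cmod2_conj, Hb; f_equal; ring).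
  unfold aa, zn. replace (RtoC (1 - hn m) * Cconj b * (RtoC (1 - hn n) * b))%C with (RtoC (1 - hn m) * RtoC (1 - hn n) * (Cconj b * b))%C by ring.
  rewrite E0, Cmult_1_r, <- RtoC_mult, <- RtoC_minus, Cmod_R, Rabs_right by nra. reflexivity.
Qed.

(* the choice of the ratio qq makes the n-th summand dominate at zn n *)
Lemma moeb_circle_lower x Sx n : (forall n, Cmod (x n) <= Sx) ->
  (1 / 2) ^ M * Cmod (x n) <= Cmod (linf_map x (zn n)) * Rpower (hn n) beta + (1 / 2) ^ M / 2 * Sx.
Proof.
  intros Hx. assert (S0 : 0 <= Sx) by (eapply Rle_trans; [apply (Cmod_ge_0 (x 0%nat))|apply Hx]).
  assert (Q := qq_bd). assert (Hn := hn_bd n). assert (Iz := zn_inD n).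
  set (H := Rpower (hn n) beta). assert (PH : 0 < H) by apply Rpower_pos.
  assert (EH : Rpower (hn n) (- beta) = / H) by apply Rpower_Ropp.
  set (u := fun m => (x m * fn m (zn n))%C).
  assert (Ab : abs_bounded (drop1 n u) (Sx * (/ H * (2 * qq / (1 - qq))))).
  { intros N. apply Rle_trans with (rsum (fun i => Sx * (/ H * (if Nat.eq_dec i n then 0 else Rmin (qq ^ i / qq ^ n) (qq ^ n / qq ^ i)))) N).
    - apply rsum_le. intros i _. unfold drop1. destruct (Nat.eq_dec i n) as [->|Ne]; [rewrite Cmod_0; lra|].
      unfold u. rewrite Cmod_mult. apply Rmult_le_compat; try apply Cmod_ge_0; [apply Hx|].
      rewrite fn_mod by exact Iz. assert (Hi := hn_bd i).
      eapply Rle_trans; [apply (kernel_min (hn i) (hn n) (Cmod (aa i (zn n))) beta M); try lra; rewrite aa_zn; nra|].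
      rewrite !hn_beta, EH. right. f_equal.
      assert (0 < qq ^ i) by (apply pow_lt; lra). assert (0 < qq ^ n) by (apply pow_lt; lra).
      replace (qq ^ S i / qq ^ S n) with (qq ^ i / qq ^ n) by (simpl; field; lra).
      replace (/ (qq ^ i / qq ^ n)) with (qq ^ n / qq ^ i) by (field; lra). reflexivity.
    - rewrite !rsum_scal. apply Rmult_le_compat_l; [exact S0|]. apply Rmult_le_compat_l; [left; apply Rinv_0_lt_compat, PH|].
      apply geo_min_drop. lra. }
  assert (E0 := cseries_drop n u _ Ab). assert (Bd := cseries_bound _ _ Ab). change (cseries u) with (linf_map x (zn n)) in E0.
  set (r := cseries (drop1 n u)) in *.
  assert (T : Cmod (u n) <= Cmod (linf_map x (zn n)) + Cmod r).
  { replace (u n) with (linf_map x (zn n) + - r)%C by (rewrite E0; ring). eapply Rle_trans; [apply Cmod_triangle|]. rewrite Cmod_opp. lra. }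
  (* At [zn n] the denominator of the n-th kernel is 1 - (1-h)^2 <= 2 h, which costs the factor
     (1/2)^M. *)
  assert (F : (1 / 2) ^ M * / H <= Cmod (fn n (zn n))).
  { rewrite fn_mod by exact Iz. rewrite aa_zn. rewrite <- EH.
    apply Rle_trans with (Rpower (hn n) (INR M - beta) * / (2 * hn n) ^ M).
    - rewrite Rpow_mult_distr, Rinv_mult. replace (INR M - beta) with (INR M + - beta) by ring. rewrite Rpower_plus, Rpower_pow by lra.
      replace (/ 2 ^ M) with ((1 / 2) ^ M) by (rewrite <- pow_inv; f_equal; lra).
      assert (0 < hn n ^ M) by (apply pow_lt; lra). right. field. lra.
    - apply Rmult_le_compat_l; [left; apply Rpower_pos|]. apply Rinv_le_contravar; [apply pow_lt; nra|]. apply pow_incr. nra. }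
  unfold u in T. rewrite Cmod_mult in T. assert (X0 := Cmod_ge_0 (x n)).
  assert (T2 : Cmod (x n) * ((1 / 2) ^ M * / H) <= Cmod (linf_map x (zn n)) + Sx * (/ H * (2 * qq / (1 - qq)))).
  { apply Rle_trans with (Cmod (x n) * Cmod (fn n (zn n))); [apply Rmult_le_compat_l; assumption|]. lra. }
  apply Rmult_le_compat_r with (r := H) in T2; [|lra].
  replace (Cmod (x n) * ((1 / 2) ^ M * / H) * H) with ((1 / 2) ^ M * Cmod (x n)) in T2 by (field; lra).
  replace ((Cmod (linf_map x (zn n)) + Sx * (/ H * (2 * qq / (1 - qq)))) * H) with (Cmod (linf_map x (zn n)) * H + 2 * qq / (1 - qq) * Sx) in T2 by (field; lra).
  (* 2 q / (1 - q) <= 4 q for q <= 1/2, and 4 [qq] is exactly half of (1/2)^M. *)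
  assert (Fq : 2 * qq / (1 - qq) <= (1 / 2) ^ M / 2).
  { apply Rle_trans with (4 * qq); [apply Rle_div_l; [lra|nra]|]. unfold qq. lra. }
  assert (2 * qq / (1 - qq) * Sx <= (1 / 2) ^ M / 2 * Sx) by (apply Rmult_le_compat_r; lra). lra.
Qed.

End Operator.

Lemma supnorm_spec x : bounded_seq x -> (forall n, Cmod (x n) <= supnorm x) /\ (forall B, (forall n, Cmod (x n) <= B) -> supnorm x <= B).
Proof.
  intros [B0 H0]. unfold supnorm. set (E := fun y => exists n, y = Cmod (x n)).
  assert (Q : forall B, (forall n, Cmod (x n) <= B) -> forall n, Cmod (x n) <= Lub_Rbar E <= B).
  { intros B HB n. apply Lub_real_ub; [|exists n; reflexivity]. intros y [m ->]. apply HB. }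
  split; [intros n; apply (Q B0 H0)|]. intros B HB. apply (Q B HB 0%nat).
Qed.

Lemma half_pow_small eps : 0 < eps -> exists N : nat, forall n, (N <= n)%nat -> (1 / 2) ^ n < eps.
Proof.
  intros He. destruct (pow_lt_1_zero (1 / 2) ltac:(rewrite Rabs_right; lra) eps He) as [N H]. exists N. intros n Hn.
  specialize (H n Hn). rewrite Rabs_right in H; [exact H|]. apply Rle_ge, pow_le. lra.
Qed.

Lemma le_half_pow a K : (forall k : nat, a <= K * (1 / 2) ^ k) -> a <= 0.
Proof.
  intros H. apply Rnot_lt_le. intros P. assert (H0 := H 0%nat). simpl in H0.
  destruct (half_pow_small (a / (K + 1))) as [N HN]; [apply Rdiv_lt_0_compat; lra|].
  specialize (HN N (le_n N)). specialize (H N).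
  assert (K * (1 / 2) ^ N < K * (a / (K + 1))) by (apply Rmult_lt_compat_l; lra).
  assert (K * (a / (K + 1)) <= (K + 1) * (a / (K + 1))).
  { apply Rmult_le_compat_r; [|lra]. left. apply Rdiv_lt_0_compat; lra. }
  replace ((K + 1) * (a / (K + 1))) with a in H2 by (field; lra). lra.
Qed.

Lemma C_cauchy_lim (v : nat -> C) K : (forall j k, Cmod (v j - v k)%C <= K * ((1 / 2) ^ j + (1 / 2) ^ k)) ->
  exists l, forall k, Cmod (v k - l)%C <= K * (1 / 2) ^ k.
Proof.
  intros H.
  assert (K0 : 0 <= K) by (assert (X := H 0%nat 0%nat); assert (Y := Cmod_ge_0 (v 0%nat - v 0%nat)%C); simpl in X; lra).
  assert (Q : forall eps, 0 < eps -> exists N, forall j k, (N <= j)%nat -> (N <= k)%nat -> Cmod (v j - v k)%C < eps).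
  { intros eps He. destruct (half_pow_small (eps / (2 * (K + 1)))) as [N HN]; [apply Rdiv_lt_0_compat; lra|].
    exists N. intros j k Hj Hk. eapply Rle_lt_trans; [apply H|]. specialize (HN j Hj) as Hj'. specialize (HN k Hk) as Hk'.
    apply Rlt_le_trans with ((K + 1) * (eps / (2 * (K + 1)) + eps / (2 * (K + 1)))); [|right; field; lra].
    assert (0 < (1 / 2) ^ j) by (apply pow_lt; lra). assert (0 < (1 / 2) ^ k) by (apply pow_lt; lra). nra. }
  assert (L1 : ex_finite_lim_seq (fun k => Re (v k))).
  { apply ex_lim_seq_cauchy_corr. intros eps. destruct (Q eps (cond_pos eps)) as [N HN]. exists N. intros j k Hj Hk.
    rewrite <- Re_minus. eapply Rle_lt_trans; [apply re_le_Cmod|]. apply HN; assumption. }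
  assert (L2 : ex_finite_lim_seq (fun k => Im (v k))).
  { apply ex_lim_seq_cauchy_corr. intros eps. destruct (Q eps (cond_pos eps)) as [N HN]. exists N. intros j k Hj Hk.
    rewrite <- Im_minus. eapply Rle_lt_trans; [apply im_le_Cmod|]. apply HN; assumption. }
  destruct L1 as [l1 L1]. destruct L2 as [l2 L2]. exists (l1, l2). intros k.
  apply Rnot_lt_le. intros P. set (d := Cmod (v k - (l1, l2))%C - K * (1 / 2) ^ k) in *.
  assert (Pd : 0 < d / 4) by (unfold d; lra).
  apply is_lim_seq_spec in L1. apply is_lim_seq_spec in L2.
  destruct (L1 (mkposreal _ Pd)) as [N1 H1]. destruct (L2 (mkposreal _ Pd)) as [N2 H2]. simpl in H1, H2.
  destruct (half_pow_small (d / 4 / (K + 1))) as [N3 H3]; [apply Rdiv_lt_0_compat; lra|].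
  set (j := max N1 (max N2 N3)). specialize (H1 j ltac:(lia)). specialize (H2 j ltac:(lia)). specialize (H3 j ltac:(lia)).
  assert (T := Cmod_tri_sub (v k) (v j) (l1, l2)). assert (T2 := Cmod_le_sum (v j - (l1, l2))%C). rewrite Re_minus, Im_minus in T2. simpl in T2.
  unfold Re, Im in H1, H2. assert (T3 := H k j).
  assert (T4 : K * (1 / 2) ^ j <= d / 4).
  { apply Rle_trans with ((K + 1) * (d / 4 / (K + 1))); [|right; field; lra]. apply Rmult_le_compat; try lra. apply pow_le. lra. }
  unfold Re, Im in T2. unfold d in *. lra.
Qed.

(** * The copy of l_infty inside the closure of E *)

Section Main.
Variables (p : Rbar) (alpha : R) (phi : R -> C -> C) (G : C -> C) (b : C).
Hypothesis Hp : Rbar_lt 0 p.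
Hypothesis Ha : 0 < alpha.
Hypothesis Hsg : is_semigroup phi.
Hypothesis HG : is_generator phi G.
Hypothesis HDW : boundary_DW_point phi b.
Variable ts : R.
Hypothesis Hts0 : 0 < ts.
Hypothesis Hts : forall t, 0 <= t <= ts -> Cmod (phi t 0%C) <= 1 / 2.

Local Notation bnd := (bnd p alpha).
Local Notation vanishing_grad := (vanishing_grad p alpha G ts).
Local Notation beta := (alpha + ip p).
Variable M : nat.
Hypothesis HM : 2 * beta <= INR M.
Local Notation T := (linf_map b beta M).

Lemma b_mod : Cmod b = 1.
Proof. apply HDW. Qed.

Lemma Hbeta0 : 0 < beta.
Proof. assert (X := ip_ge_0 p Hp). lra. Qed.

Lemma T_bnd : exists K, 0 < K /\ forall x S, 0 < S -> (forall n, Cmod (x n) <= S) -> bnd (fun z => Cmod (T x z)) (K * S).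
Proof.
  destruct (bb_bnd b b_mod p alpha Hp Ha) as [C0 [P0 H0]]. assert (PK := KT_pos beta M).
  exists (KT beta M * C0). split; [apply Rmult_lt_0_compat; lra|]. intros x S HS Hx.
  assert (PS : 0 < S * KT beta M) by (apply Rmult_lt_0_compat; lra).
  apply (bnd_mono p alpha Hp _ (fun z => S * KT beta M * Rpower (Cmod (bb b z)) (- beta)) (S * KT beta M * C0)).
  - split; [apply Rmult_lt_0_compat; lra|]. right. ring.
  - intros z Hz. split; [apply Cmod_ge_0|]. rewrite Rmult_assoc. apply (moeb_circle_mod b b_mod beta M Hbeta0 HM); assumption.
  - apply bnd_scal; auto. intros z _. left. apply Rpower_pos.
Qed.

Lemma T_vanishing_grad x : bounded_seq x -> vanishing_grad (T x).
Proof.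
  intros [S0 Hx0]. set (S := Rabs S0 + 1). assert (HS : 0 < S) by (assert (X := Rabs_pos S0); unfold S; lra).
  assert (Hx : forall n, Cmod (x n) <= S) by (intros n; eapply Rle_trans; [apply Hx0|]; assert (X := Rle_abs S0); unfold S; lra).
  clearbody S. clear S0 Hx0.
  assert (TA := moeb_circle_analytic b b_mod beta M Hbeta0 HM x S Hx).
  split; [exact TA|]. destruct T_bnd as [K [PK HK]]. split; [exists (K * S); split; [apply Rmult_lt_0_compat; lra|apply HK; assumption]|].
  intros eps He. destruct (bb_bnd b b_mod p alpha Hp Ha) as [C0 [P0 H0]]. assert (PKT := KT_pos beta M).
  destruct (G_growth phi G b Hsg HG HDW) as [CG [PG HGr]].
  assert (M0 : 0 < INR M) by (assert (X := Hbeta0); lra).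
  set (W := 2 * INR M * (S * KT beta M)).
  assert (PW : 0 < W) by (apply Rmult_lt_0_compat; [lra|apply Rmult_lt_0_compat; lra]).
  set (e := eps / (W * C0)). assert (PWC : 0 < W * C0) by (apply Rmult_lt_0_compat; lra).
  assert (Pe : 0 < e) by (apply Rdiv_lt_0_compat; lra).
  (* Badness and the growth of G give eta0 (1-|z|)^2 <= t CG |b-z|^2; this t makes the ratio (1-|z|)
     / |b-z| at most e on the bad set. *)
  set (t := Rmin ts (eta0 * (e * e) / CG)).
  assert (Pq : 0 < eta0 * (e * e) / CG) by (apply Rdiv_lt_0_compat; [unfold eta0; nra|lra]).
  exists t. split; [split; [apply Rmin_glb_lt; lra|apply Rmin_l]|].
  assert (Pt : 0 < t) by (apply Rmin_glb_lt; lra).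
  assert (Tq : t * CG <= eta0 * (e * e)).
  { replace (eta0 * (e * e)) with (eta0 * (e * e) / CG * CG) by (field; lra). apply Rmult_le_compat_r; [lra|apply Rmin_r]. }
  assert (PeW : 0 < e * W) by (apply Rmult_lt_0_compat; lra).
  apply (bnd_mono p alpha Hp _ (fun z => e * W * Rpower (Cmod (bb b z)) (- beta)) (e * W * C0)).
  - split; [apply Rmult_lt_0_compat; lra|]. right. unfold e. field. lra.
  - intros z Hz. split; [apply Dbad_ge_0|]. unfold grad_on_bad. destruct excluded_middle_informative as [Bz|_].
    2:{ apply Rmult_le_pos; [lra|left; apply Rpower_pos]. }
    assert (D0 := bbp b b_mod z Hz). set (D := Cmod (bb b z)) in *.
    rewrite Dfn_eq by exact Hz. assert (X := moeb_circle_deriv_mod b b_mod beta M Hbeta0 HM x S z Hx Hz). fold D in X.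
    assert (Small : 1 - Cmod z <= e * D).
    { unfold bad_set in Bz. assert (Gr := HGr z Hz). fold D in Gr. unfold inD in Hz.
      apply Rnot_lt_le. intros Lt.
      assert (Y1 : eta0 * (1 - Cmod z) * (1 - Cmod z) <= t * (CG * (D * D))).
      { apply Rle_trans with (t * Cmod (G z) * (1 - Cmod z)); [apply Rmult_le_compat_r; lra|]. rewrite Rmult_assoc. apply Rmult_le_compat_l; lra. }
      assert (PeD : 0 <= e * D) by (apply Rmult_le_pos; lra).
      assert (Y2 : e * D * (e * D) < (1 - Cmod z) * (1 - Cmod z)) by (apply Rmult_le_0_lt_compat; lra).
      assert (Y3 : t * CG * (D * D) <= eta0 * (e * e) * (D * D)) by (apply Rmult_le_compat_r; [apply Rmult_le_pos; lra|exact Tq]).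
      unfold eta0 in *. nra. }
    apply Rle_trans with (e * D * (2 * INR M / D * (S * (KT beta M * Rpower D (- beta))))).
    + apply Rmult_le_compat; [unfold inD in Hz; lra|apply Cmod_ge_0|exact Small|exact X].
    + right. unfold W. field. lra.
  - apply bnd_scal; auto. intros z _. left. apply Rpower_pos.
Qed.

(** The estimate at [zn m] has an error of half the supremum norm of x; taking the supremum over m
    absorbs it, which is legitimate because x is bounded. *)
Lemma T_lower_bnd : exists K, 0 < K /\ forall x A, bounded_seq x -> 0 < A -> bnd (fun z => Cmod (T x z)) A -> forall n, Cmod (x n) <= K * A.
Proof.
  destruct (point_growth p alpha Hp Ha) as [KG [PG HGr]].
  assert (P2 : 0 < (1 / 2) ^ M) by (apply pow_lt; lra). set (c := (1 / 2) ^ M) in *.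
  exists (2 * (KG / c)). split; [apply Rmult_lt_0_compat; [lra|apply Rdiv_lt_0_compat; lra]|].
  intros x A Hx HA HB n. destruct (supnorm_spec x Hx) as [S1 S2]. set (s := supnorm x) in *.
  assert (Q : forall n, Cmod (x n) <= KG / c * A + s / 2).
  { intros m. assert (L := moeb_circle_lower b b_mod beta M Hbeta0 HM x s m S1). fold c in L.
    assert (Gr := HGr _ A HA HB (fun z => Cmod_ge_0 _) (zn b beta M m) (zn_inD b b_mod beta M Hbeta0 m)).
    rewrite (zn_mod b b_mod beta M Hbeta0) in Gr. replace (1 - (1 - hn beta M m)) with (hn beta M m) in Gr by ring.
    apply Rmult_le_compat_r with (r := Rpower (hn beta M m) beta) in Gr; [|left; apply Rpower_pos].
    rewrite Rmult_assoc, (Rmult_comm (Rpower _ (- beta))), Rpower_inv_r in Gr.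
    apply Rmult_le_reg_l with c; [exact P2|]. replace (c * (KG / c * A + s / 2)) with (KG * A * 1 + c / 2 * s) by (field; lra). lra. }
  assert (S3 := S2 _ Q). specialize (S1 n). lra.
Qed.

Lemma Hnorm_nonneg f (A : R) : analytic_on_D f -> Rbar_le (Hnorm p alpha f) A -> 0 <= A.
Proof.
  intros Hf H. assert (X := Hnorm_wMp p alpha f A 0 H ltac:(lra)). assert (Y := Mp_ge_0 p Hp f 0 Hf ltac:(lra)).
  unfold wMp in X. assert (Z := Rpower_pos (1 - 0) alpha). eapply Rle_trans; [|exact X]. apply Rmult_le_pos; lra.
Qed.

Lemma le_of_forall_gt x y : (forall A, y < A -> x <= A) -> x <= y.
Proof. intros H. apply Rnot_lt_le. intros L. specialize (H ((x + y) / 2) ltac:(lra)). lra. Qed.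

(** The lower bound, applied to differences of approximants, makes their coefficients Cauchy
    uniformly in the index. The limit sequence is bounded, and both g - T (X k) and T (X k) - T x
    tend to 0 at each point. *)
Lemma T_closed g : in_Hinf p alpha g ->
  (forall eps, 0 < eps -> exists x, bounded_seq x /\ Rbar_lt (Hnorm p alpha (fsub g (T x))) eps) ->
  exists x, bounded_seq x /\ forall z, inD z -> g z = T x z.
Proof.
  intros Hg Hap. assert (Hga := proj1 Hg).
  destruct (bnd_of_Hnorm p alpha Hp Ha) as [C1 [P1 H1]]. destruct (bnd_plus p alpha Hp) as [C4 [P4 H4]].
  destruct T_lower_bnd as [K [PK HK]]. destruct (point_growth p alpha Hp Ha) as [KG [PG HGr]].
  assert (Pp : forall k : nat, 0 < (1 / 2) ^ k) by (intros k; apply pow_lt; lra).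
  assert (Ch : forall k : nat, exists x, bounded_seq x /\ Rbar_lt (Hnorm p alpha (fsub g (T x))) ((1 / 2) ^ k)) by (intros k; apply Hap, Pp).
  apply choice in Ch. destruct Ch as [X HX].
  assert (An : forall x, bounded_seq x -> analytic_on_D (T x)) by (intros x [S HS]; apply (moeb_circle_analytic b b_mod beta M Hbeta0 HM x S HS)).
  assert (Bd : forall k, bnd (fun z => Cmod (fsub g (T (X k)) z)) (C1 * (1 / 2) ^ k)).
  { intros k. destruct (HX k) as [X1 X2]. apply H1; [apply Pp|apply fsub_analytic; auto|]. apply Rbar_lt_le, X2. }
  set (KK := K * (C4 * C1)). assert (PKK : 0 < KK) by (apply Rmult_lt_0_compat; [lra|apply Rmult_lt_0_compat; lra]).
  assert (Dj : forall n j k, Cmod (X j n - X k n)%C <= KK * ((1 / 2) ^ j + (1 / 2) ^ k)).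
  { intros n j k. destruct (HX j) as [[Sj Bj] _]. destruct (HX k) as [[Sk Bk] _].
    set (y := fun n => ((-1) * X k n + X j n)%C).
    assert (By : bounded_seq y).
    { exists (Sk + Sj). intros m. unfold y. eapply Rle_trans; [apply Cmod_triangle|]. rewrite Cmod_mult, Cmod_R, Rabs_left by lra.
      specialize (Bj m). specialize (Bk m). lra. }
    replace (X j n - X k n)%C with (y n) by (unfold y; ring).
    assert (Q1 := Pp j). assert (Q2 := Pp k).
    assert (Q3 : 0 < C1 * (1 / 2) ^ j) by (apply Rmult_lt_0_compat; lra). assert (Q4 : 0 < C1 * (1 / 2) ^ k) by (apply Rmult_lt_0_compat; lra).
    replace (KK * ((1 / 2) ^ j + (1 / 2) ^ k)) with (K * (C4 * (C1 * (1 / 2) ^ j + C1 * (1 / 2) ^ k))) by (unfold KK; ring).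
    apply (HK y); [exact By|apply Rmult_lt_0_compat; lra|].
    apply (H4 _ _ (fun z => Cmod (fsub g (T (X j)) z)) (fun z => Cmod (fsub g (T (X k)) z))); auto; try (intros z; apply Cmod_ge_0).
    intros z Hz. split; [apply Cmod_ge_0|].
    unfold y. rewrite (moeb_circle_linear b b_mod beta M Hbeta0 HM (X k) (X j) (-1)%C Sk Sj z Bk Bj Hz).
    replace ((-1) * T (X k) z + T (X j) z)%C with (fsub g (T (X k)) z + - fsub g (T (X j)) z)%C by (unfold fsub; ring).
    eapply Rle_trans; [apply Cmod_triangle|]. rewrite Cmod_opp. lra. }
  assert (Lm : forall n, exists l, forall k, Cmod (X k n - l)%C <= KK * (1 / 2) ^ k) by (intros n; apply (C_cauchy_lim (fun k => X k n)); intros j k; apply Dj).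
  apply choice in Lm. destruct Lm as [x Hx]. exists x.
  assert (Bx : exists S, forall n, Cmod (x n) <= S).
  { destruct (HX 0%nat) as [[S0 B0] _]. exists (S0 + KK). intros n. specialize (B0 n). specialize (Hx n 0%nat). simpl in Hx.
    assert (Q := Cmod_le_plus (x n) (X 0%nat n)). rewrite Cmod_minus_sym in Q. lra. }
  split; [exact Bx|]. destruct Bx as [Sx Bx]. intros z Hz.
  apply Copp_inj_0, Cmod_eq_0. apply Rle_antisym; [|apply Cmod_ge_0].
  set (U := KG * C1 * Rpower (1 - Cmod z) (- beta)). set (V := KK * (KT beta M * Rpower (Cmod (bb b z)) (- beta))).
  apply (le_half_pow _ (U + V)). intros k. destruct (HX k) as [[Sk Bk] _].
  set (y := fun n => ((-1) * x n + X k n)%C).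
  assert (Ey : T y z = ((-1) * T x z + T (X k) z)%C) by (apply (moeb_circle_linear b b_mod beta M Hbeta0 HM x (X k) (-1)%C Sx Sk z Bx Bk Hz)).
  assert (Ty := moeb_circle_mod b b_mod beta M Hbeta0 HM y (KK * (1 / 2) ^ k) z ltac:(intros n; replace (y n) with (X k n - x n)%C by (unfold y; ring); apply Hx) Hz).
  assert (Gz := HGr _ (C1 * (1 / 2) ^ k) ltac:(apply Rmult_lt_0_compat; [lra|apply Pp]) (Bd k) (fun z => Cmod_ge_0 _) z Hz).
  replace (g z - T x z)%C with (fsub g (T (X k)) z + T y z)%C by (rewrite Ey; unfold fsub; ring).
  eapply Rle_trans; [apply Cmod_triangle|]. unfold U, V.
  eapply Rle_trans; [apply Rplus_le_compat; [exact Gz|exact Ty]|]. right. ring.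
Qed.

Lemma linf_copy : contains_linf_copy p alpha (Hclosure p alpha (setE p alpha G)).
Proof.
  destruct T_bnd as [K2 [P2 H2]]. destruct T_lower_bnd as [K [PK HK]]. destruct (bnd_of_Hnorm p alpha Hp Ha) as [C1 [P1 H1]].
  assert (PKC : 0 < K * C1) by (apply Rmult_lt_0_compat; lra).
  exists T, (/ (K * C1)), K2. split; [apply Rinv_0_lt_compat; lra|]. split; [exact P2|]. split; [|split; [|split]].
  - intros x y a [Sx Bx] [Sy By] z Hz. apply (moeb_circle_linear b b_mod beta M Hbeta0 HM x y a Sx Sy z Bx By Hz).
  - intros x Hx. apply (vanishing_grad_closure p alpha phi G b Hp Ha Hsg HG HDW ts Hts0 Hts). apply T_vanishing_grad, Hx.
  - intros x Hx. destruct (supnorm_spec x Hx) as [S1 S2]. set (s := supnorm x) in *.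
    assert (TA : analytic_on_D (T x)) by apply (T_vanishing_grad x Hx).
    assert (s0 : 0 <= s) by (eapply Rle_trans; [apply (Cmod_ge_0 (x 0%nat))|apply S1]).
    assert (Fin : is_finite (Hnorm p alpha (T x))) by apply (vanishing_grad_in_Hinf p alpha G Hp ts _ (T_vanishing_grad x Hx)).
    rewrite <- Fin. simpl. set (H := real (Hnorm p alpha (T x))) in *.
    assert (Hn0 : 0 <= H) by (apply (Hnorm_nonneg (T x)); [exact TA|unfold H; rewrite Fin; apply Rbar_le_refl]).
    split.
    (* [bnd] is handled with positive constants only, while the norm may be 0; so every A above the
       norm is used instead of the norm. *)
    + apply le_of_forall_gt. intros A HA.
      assert (X : forall n, Cmod (x n) <= K * (C1 * A)).
      { apply HK; [exact Hx|apply Rmult_lt_0_compat; lra|]. apply H1; [lra|exact TA|]. rewrite <- Fin. simpl. fold H. lra. }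
      apply S2 in X. fold s in X. replace A with (/ (K * C1) * (K * (C1 * A))) by (field; lra).
      apply Rmult_le_compat_l; [left; apply Rinv_0_lt_compat; lra|exact X].
    + apply le_of_forall_gt. intros A HA.
      set (A' := A / K2). assert (PA : s < A').
      { unfold A'. apply Rmult_lt_reg_l with K2; [exact P2|]. replace (K2 * (A / K2)) with A by (field; lra). exact HA. }
      assert (X : Rbar_le (Hnorm p alpha (T x)) (K2 * A')).
      { apply Hnorm_of_bnd; auto; [apply Rmult_lt_0_compat; lra|]. apply H2; [lra|]. intros n. specialize (S1 n). lra. }
      rewrite <- Fin in X. simpl in X. fold H in X. replace (K2 * A') with A in X by (unfold A'; field; lra). exact X.
  - apply T_closed.
Qed.

(** With c = (1/2)^M and all coefficients 1, |T| h^beta is at least c/2 at the points [zn n], where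
    h tends to 0; membership in H(p,0,alpha) would make it at most c/4 for large n. *)
Lemma T_one_not_H0 : ~ in_H0 p alpha (T (fun _ => 1%C)).
Proof.
  intros H0. destruct (dom_point p Hp) as [K [PK HK]].
  assert (Pc : 0 < (1 / 2) ^ M) by (apply pow_lt; lra). set (c := (1 / 2) ^ M) in *.
  assert (Pe : 0 < c / (4 * K)) by (apply Rdiv_lt_0_compat; lra).
  destruct (H0_dom p alpha Hp Ha _ _ H0 Pe) as [h1 [Hh1 Hd]].
  assert (Q := qq_bd M). assert (B := Hbeta0).
  destruct (pow_lt_1_zero (qq M) ltac:(rewrite Rabs_right; lra) (Rpower h1 beta) (Rpower_pos _ _)) as [n Hn].
  specialize (Hn (S n) ltac:(lia)). rewrite Rabs_right in Hn by (apply Rle_ge, pow_le; lra).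
  assert (Hh := hn_bd beta M B n). set (h := hn beta M n) in *.
  assert (Lh : h <= h1).
  { unfold h, hn. rewrite <- (Rpower_1 h1) by lra. replace 1 with (beta * / beta) by (field; lra). rewrite <- Rpower_mult.
    apply Rpower_incr; [apply Rinv_0_lt_compat, B|]. split; [apply pow_lt; lra|lra]. }
  assert (L := moeb_circle_lower b b_mod beta M B HM (fun _ => 1%C) 1 n ltac:(intros; cbv beta; rewrite Cmod_1; lra)). fold c in L. fold h in L. cbv beta in L. rewrite Cmod_1 in L.
  set (z := zn b beta M n) in *.
  assert (Ez : Cmod z = 1 - h) by apply (zn_mod b b_mod beta M B).
  assert (X := HK h _ _ z ltac:(lra) ltac:(apply Rmult_lt_0_compat; [exact Pe|apply Rpower_pos]) (Hd h ltac:(lra)) ltac:(unfold shell; lra) (Cmod_ge_0 _)).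
  apply Rmult_le_compat_r with (r := Rpower h beta) in X; [|left; apply Rpower_pos].
  replace (K * (c / (4 * K) * Rpower h (- alpha)) * Rpower h (- ip p) * Rpower h beta) with (c / 4 * (Rpower h beta * (Rpower h (- alpha) * Rpower h (- ip p)))) in X by (field; lra).
  rewrite <- Rpower_plus in X. replace (- alpha + - ip p) with (- beta) in X by ring. rewrite Rpower_inv_r in X. lra.
Qed.

End Main.

Theorem theorem6p5 (p : Rbar) (alpha : R) (phi : R -> C -> C) (G : C -> C) (b : C) :
  Rbar_lt 0 p -> 0 < alpha ->
  is_semigroup phi -> is_generator phi G -> boundary_DW_point phi b ->
  (forall f, Hclosure p alpha (setE p alpha G) f <-> strong_cont p alpha phi f) /\
  contains_linf_copy p alpha (Hclosure p alpha (setE p alpha G)) /\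
  (forall f, in_H0 p alpha f -> strong_cont p alpha phi f) /\
  (exists f, strong_cont p alpha phi f /\ ~ in_H0 p alpha f).
Proof.
  intros Hp Ha Hsg HG HDW. destruct (ts_exists phi Hsg) as [ts [Hts0 Hts]].
  (* An integer exponent M >= 2 beta, as the two-sided decay in [kernel_min] demands. *)
  destruct (INR_archimed 1 (2 * (alpha + ip p)) ltac:(lra)) as [M HM]. rewrite Rmult_1_r in HM. apply Rgt_lt, Rlt_le in HM.
  assert (LS := vanishing_grad_strong p alpha phi G b Hp Ha Hsg HG HDW ts Hts0 Hts).
  split; [|split; [|split]].
  (* Both implications pass through [vanishing_grad], the common description of the closure of E and
     of the strongly continuous functions. *)
  - intros f. split; intros H.
    + apply LS, closure_vanishing_grad; assumption.
    + apply (vanishing_grad_closure p alpha phi G b Hp Ha Hsg HG HDW ts Hts0 Hts), (strong_vanishing_grad p alpha phi G b Hp Ha Hsg HG HDW ts Hts0 Hts), H.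
  - exact (linf_copy p alpha phi G b Hp Ha Hsg HG HDW ts Hts0 Hts M HM).
  - intros f H. apply LS, (H0_vanishing_grad p alpha phi G b Hp Ha Hsg HG HDW ts Hts0), H.
  - exists (linf_map b (alpha + ip p) M (fun _ => 1%C)). split.
    + apply LS, (T_vanishing_grad p alpha phi G b Hp Ha Hsg HG HDW ts Hts0 M HM). exists 1. intros n. cbv beta. rewrite Cmod_1. lra.
    + apply (T_one_not_H0 p alpha phi b Hp Ha HDW M HM).
Qed.
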